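(* Fix $0 < c < 1$, and let $\beta_c$ be the function on $[c,1]$ defined in the context. Suppose that there is a (Borel) probability measure $\mu$ on $[c^2, 1]$, with $\mu(\{1\}) = 0$, such that $$\int_{c^2}^1 t^k\,d\mu(t) \geq \frac{1}{k+1} \quad \text{for all } k = 0, 1, 2, \ldots,$$ $$\int_{c^2}^1 \beta_c(\sqrt{t})\, t^k\,d\mu(t) \leq \frac{1}{k+1} \quad \text{for all } k = 1, 2, \ldots,$$ where the integrals are over the closed interval $[c^2,1]$ (so a possible atom of $\mu$ at $c^2$ is included). Then $c$ is admissible in Korenblum's maximum principle; that is, for all $f, g \in A^2(\mathbb{D})$ with $|f(z)| \leq |g(z)|$ for $c < |z| < 1$, one has $\|f\|_{A^2} \leq \|g\|_{A^2}$.
   Context: $\mathbb{D}$ is the open unit disk in $\mathbb{C}$, and $dA(z) = \pi^{-1}\,dx\,dy$ is normalized area measure. The Bergman space $A^2(\mathbb{D})$ consists of all holomorphic functions $f$ on $\mathbb{D}$ such that $\|f\|_{A^2}^2 = \int_{\mathbb{D}} |f(z)|^2\,dA(z) < \infty$. For $0 < c < 1$ and $c < r < 1$ define $$K_c(r) = 2r\left(1 + \frac{c}{r^2}\right) \prod_{n=1}^{\infty} \frac{(1 + r^2 c^{2n-1})(1 + r^{-2} c^{2n+1})(1 + c^{2n})^2}{(1 + r^2 c^{2n-2})(1 + r^{-2} c^{2n})(1 + c^{2n-1})^2},$$ $$G_c(r) = \frac{1}{2}\left(1 + \sqrt{\frac{1 + 3K_c(r)^2}{1 - K_c(r)^2}}\right),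 \qquad \beta_c(r) = 1 - \frac{1}{G_c(r)}.$$ At the endpoints the limiting convention $\beta_c(c) = \beta_c(1) = 1$ is used. *)

(* Defs.v *)
From HB Require Import structures.
From mathcomp Require Import all_boot all_order all_algebra.
From mathcomp Require Import all_classical all_reals all_analysis.
From mathcomp.real_closed Require Import complex.
Import Order.TTheory GRing.Theory Num.Theory.
Import numFieldNormedType.Exports.
Import ComplexField.Normc.

Set Implicit Arguments.
Unset Strict Implicit.
Unset Printing Implicit Defensive.

Local Open Scope classical_set_scope.
Local Open Scope ring_scope.
Local Open Scope complex_scope.

Definition unit_disk (R : realType) : set R[i] := [set z | normc z < 1].

(* [R[i]^o] is R[i] as a normed module over itself, so the difference quotient
   below has complex increments: this is complex differentiability. *)
Definition holomorphic_on (R : realType) (D : set R[i]) (f : R[i] -> R[i]) : Prop :=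
  forall z : R[i], D z -> derivable (f : R[i]^o -> R[i]^o) z 1.

(* Integral over D with respect to dA = dx dy / pi. *)
Definition area_integral (R : realType) (D : set R[i]) (h : R[i] -> \bar R) : \bar R :=
  ((pi^-1)%:E *
    \int[lebesgue_measure \x lebesgue_measure]_(p in [set p : R * R | D (p.1 +i* p.2)])
      h (p.1 +i* p.2))%E.

Definition bergman_sqnorm (R : realType) (f : R[i] -> R[i]) : \bar R :=
  area_integral (@unit_disk R) (fun z => ((normc (f z)) ^+ 2)%:E).

(* Elements of A^2 are represented by total functions; their values off the
   disk are irrelevant. *)
Definition bergman (R : realType) (f : R[i] -> R[i]) : Prop :=
  holomorphic_on (@unit_disk R) f /\ (bergman_sqnorm f < +oo)%E.

Definition bergman_norm (R : realType) (f : R[i] -> R[i]) : R :=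
  Num.sqrt (fine (bergman_sqnorm f)).

Definition korenblum_admissible (R : realType) (c : R) : Prop :=
  forall f g : R[i] -> R[i], bergman f -> bergman g ->
    (forall z : R[i], c < normc z < 1 -> normc (f z) <= normc (g z)) ->
    bergman_norm f <= bergman_norm g.

Definition Kfactor (R : realType) (c r : R) (n : nat) : R :=
  ((1 + r ^+ 2 * c ^+ (2 * n - 1)) * (1 + r ^- 2 * c ^+ (2 * n + 1))
     * (1 + c ^+ (2 * n)) ^+ 2) /
  ((1 + r ^+ 2 * c ^+ (2 * n - 2)) * (1 + r ^- 2 * c ^+ (2 * n))
     * (1 + c ^+ (2 * n - 1)) ^+ 2).

Definition Kfun (R : realType) (c r : R) : R :=
  2 * r * (1 + c / r ^+ 2) *
  lim ((fun N : nat => \prod_(1 <= n < N.+1) Kfactor c r n) @ \oo).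

Definition Gfun (R : realType) (c r : R) : R :=
  2^-1 * (1 + Num.sqrt ((1 + 3 * Kfun c r ^+ 2) / (1 - Kfun c r ^+ 2))).

(* The default value 1 is the convention beta_c(c) = beta_c(1) = 1. *)
Definition beta (R : realType) (c r : R) : R :=
  if c < r < 1 then 1 - (Gfun c r)^-1 else 1.

(* Main.v *)
(* Put om = f / g, which is analytic and bounded by 1 on c < |z| < 1. Pick's inequality for the
   Szego kernel of the annulus at two points of the circle |z| = r reads
     X^2 |1 - om(z) om(w)^*|^2 <= (1 - |om(z)|^2) (1 - |om(w)|^2),
   where X is a quotient of theta functions, and Jacobi's identity (the residue sum of an
   elliptic function) gives X^2 = 1 - K_c(r)^2. Hence, with phi = |g|^2 - |f|^2,
     |g(z) f(w) - f(z) g(w)|^2 <= K_c(r)^2 / (1 - K_c(r)^2) phi(z) phi(w).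
   Let p_n be the difference of the squared moduli of the n-th Taylor coefficients of g and f.
   Averaging over z and w and splitting a 2 x 2 Gram determinant along S = {n | p_n > 0} bounds
   the sum of p_n t^n over S, t = r^2, by G_c(r) times the full sum; in other words the negative
   part of the series is at most beta_c(sqrt t) times the positive part. Integrating in t against
   mu, the two families of moment inequalities turn this into the comparison of the sums of
   |p_n| / (n + 1) over the two signs, that is ||f|| <= ||g||.
   Contour integrals are replaced throughout by means over roots of unity, and theta functions
   by finite products. *)
Require Import Defs.
From mathcomp Require Import all_boot all_order all_algebra.
From mathcomp Require Import all_classical all_reals all_analysis.
From mathcomp Require Import measurable_realfun.
From mathcomp.real_closed Require Import complex.
From mathcomp Require Import ring lra zify.
Import Order.TTheory GRing.Theory Num.Theory.
Import numFieldNormedType.Exports.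
Import ComplexField.Normc.

Set Implicit Arguments.
Unset Strict Implicit.
Unset Printing Implicit Defensive.

Local Open Scope classical_set_scope.
Local Open Scope ring_scope.
Local Open Scope complex_scope.

Local Notation Re := complex.Re.
Local Notation Im := complex.Im.

Local Notation "z ^*" := (conjc z) : ring_scope.

(** * Complex analysis on disks and annuli *)

(** The quotient om lives on the open annulus and has no boundary values, whereas the kernel method
    takes means over both boundary circles. So Pick's inequality is proved for functions holomorphic
    across the closed annulus and applied to the dilates om(s z), with an inner radius slightly
    above c; then s tends to 1 and the radius returns to c. Monotonicity of the theta quotients,
    with tails uniform in the radius, justifies the second limit. The Hardy norm carries the weight
    c / r^2 on its inner circle. This places the argument of the numerator of the kernel on the
    circle of radius c = sqrt q, the one preserved by the symmetry x -> q / x of the theta function.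
    On |z| = r the kernel is then constant on the diagonal and smallest in modulus at antipodal
    points; X is the ratio of these two values. No Hardy space is formed: kernels are truncated and
    means are discrete, so the reproducing property and the positivity hold up to errors that are
    carried along and vanish in the limit. The number G_c(r) enters as the larger root of G (G - 1)
    = K^2 / (1 - K^2), where K = K_c(r). *)

Section ComplexModulus.
Variable R : realType.
Implicit Types (x y z w : R[i]) (a b c : R).

Lemma normc_ge0 x : 0 <= normc x.
Proof. by case: x => a b; rewrite sqrtr_ge0. Qed.

Lemma normc_gt0 x : (0 < normc x) = (x != 0).
Proof.
rewrite lt_neqAle normc_ge0 andbT eq_sym; congr (~~ _).
by apply/eqP/eqP => [/eq0_normc//|->]; rewrite normc0.
Qed.

Lemma normc_eq0 x : (normc x == 0) = (x == 0).
Proof. by apply/eqP/eqP => [/eq0_normc//|->]; rewrite normc0. Qed.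

Lemma le_normcB x y : normc (x - y) <= normc x + normc y.
Proof. by rewrite (le_trans (le_normcD _ _))// normcN. Qed.

Lemma normcC x y : normc (x - y) = normc (y - x).
Proof. by rewrite -normcN opprB. Qed.

Lemma normc_dist x y z : normc (x - z) <= normc (x - y) + normc (y - z).
Proof. by rewrite -[x - z](subrKA y) le_normcD. Qed.

Lemma le_normc_sub x y : normc x - normc y <= normc (x - y).
Proof. by rewrite lerBlDr -{1}(subrK y x) le_normcD. Qed.

Lemma normc_real a : normc (a%:C) = `|a|.
Proof. by rewrite /= expr0n addr0 sqrtr_sqr. Qed.

Lemma normc_pos a : 0 <= a -> normc (a%:C) = a.
Proof. by move=> a0; rewrite normc_real ger0_norm. Qed.

Lemma normc_conj x : normc (x^*) = normc x.
Proof. by case: x => a b /=; rewrite sqrrN. Qed.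

Lemma normc_sum (I : Type) (s : seq I) (P : pred I) (F : I -> R[i]) :
  normc (\sum_(i <- s | P i) F i) <= \sum_(i <- s | P i) normc (F i).
Proof. exact: (@ler_norm_sum _ (Rcomplex R)). Qed.

Lemma normc_prod (I : Type) (s : seq I) (P : pred I) (F : I -> R[i]) :
  normc (\prod_(i <- s | P i) F i) = \prod_(i <- s | P i) normc (F i).
Proof.
by apply: (big_morph (@normc R)) => [x y|]; rewrite ?normcM// normc1.
Qed.

Lemma normcX x n : normc (x ^+ n) = normc x ^+ n.
Proof. by elim: n => [|n ih]; rewrite ?expr0 ?normc1// !exprS normcM ih. Qed.

Lemma normc_nat n : normc (n%:R : R[i]) = n%:R.
Proof. by rewrite -(rmorph_nat (@real_complex R)) normc_pos. Qed.

Lemma sqr_normc_conj x : (normc x ^+ 2)%:C = x * x^*.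
Proof.
case: x => a b; rewrite sqr_sqrtr ?addr_ge0 ?sqr_ge0//.
by apply/eqP; rewrite eq_complex /=; apply/andP; split; apply/eqP; ring.
Qed.

Lemma sqr_normcE x : normc x ^+ 2 = Re x ^+ 2 + Im x ^+ 2.
Proof. by case: x => a b /=; rewrite sqr_sqrtr// addr_ge0 ?sqr_ge0. Qed.

Lemma normr_Re_le x : `|Re x| <= normc x.
Proof.
rewrite -(ler_pXn2r (n := 2)) ?nnegrE ?normc_ge0// sqr_normcE real_normK ?num_real//.
by rewrite lerDl sqr_ge0.
Qed.

Lemma normr_Im_le x : `|Im x| <= normc x.
Proof.
rewrite -(ler_pXn2r (n := 2)) ?nnegrE ?normc_ge0// sqr_normcE real_normK ?num_real//.
by rewrite lerDr sqr_ge0.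
Qed.

Lemma normc_le_ReIm x : normc x <= `|Re x| + `|Im x|.
Proof.
rewrite -(ler_pXn2r (n := 2)) ?nnegrE ?normc_ge0 ?addr_ge0// sqr_normcE sqrrD.
rewrite !real_normK ?num_real// lerD2r lerDl mulrn_wge0// mulr_ge0//.
Qed.

Definition cis a : R[i] := cos a +i* sin a.

Lemma normc_cis a : normc (cis a) = 1.
Proof. by rewrite /= cos2Dsin2 sqrtr1. Qed.

Lemma cisD a b : cis (a + b) = cis a * cis b.
Proof. by rewrite /cis cosD sinD; simpc; rewrite [sin a * _ + _]addrC. Qed.

Lemma cis0 : cis 0 = 1.
Proof. by rewrite /cis cos0 sin0. Qed.

Lemma cisX a n : cis a ^+ n = cis (a *+ n).
Proof. by elim: n => [|n ih]; rewrite ?expr0 ?mulr0n ?cis0// exprS ih mulrS cisD. Qed.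

Lemma cis_2pi : cis (pi *+ 2) = 1.
Proof. by rewrite /cis cos2pi sin2pi. Qed.

Lemma cis_neq1 a : 0 < a < pi *+ 2 -> cis a != 1.
Proof.
move=> /andP[a0 a2]; rewrite eq_complex negb_and; apply/orP; left => /=.
have -> : a = (a / 2) *+ 2 by rewrite -mulr_natr -mulrA mulVf ?mulr1.
have s0 : 0 < sin (a / 2).
  apply: sin_gt0_pi; rewrite divr_gt0//= ltr_pdivrMr// mulr_natr//.
rewrite cos_mulr2n cos2sin2 -mulr_natr.
apply/eqP => h; have : sin (a/2) ^+ 2 = 0 by lra.
by move/eqP; rewrite sqrf_eq0 gt_eqF.
Qed.

Lemma polarP z : exists2 a, - pi <= a <= pi & z = (normc z)%:C * cis a.
Proof.
have [->|z0] := eqVneq z 0.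
  by exists 0; rewrite ?normc0 ?mul0r// oppr_le0 pi_ge0.
have n0 : normc z != 0 by rewrite normc_eq0.
have : (Re z / normc z) ^+ 2 + (Im z / normc z) ^+ 2 = 1.
  by rewrite !expr_div_n -mulrDl -sqr_normcE divff// expf_neq0.
set x := Re z / _; set y := Im z / _ => xy1.
have x1 : -1 <= x <= 1.
  rewrite -ler_norml -(ler_pXn2r (n := 2)) ?nnegrE//.
  rewrite real_normK ?num_real// expr1n; have := sqr_ge0 y; lra.
have zE t : cos t = x -> sin t = y -> z = (normc z)%:C * cis t.
  move=> hc hs; rewrite /cis hc hs; simpc.
  by rewrite /x /y mulrCA divff// mulrCA divff// !mulr1; case: (z).
have cE : cos (acos x) = x by rewrite acosK// in_itv.
have sE : sin (acos x) = `|y|.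
  rewrite sin_acos//; apply/eqP; rewrite -(eqrXn2 (n := 2))// ?sqrtr_ge0//.
  rewrite sqr_sqrtr ?real_normK ?num_real//; first by apply/eqP; lra.
  have := sqr_ge0 y; lra.
have a0 := acos_ge0 x1; have api := acos_lepi x1.
(* Since [sin (acos x)] is the modulus of [y], the sign of [y] decides between the angle and its
   opposite. *)
have [y0|y0] := lerP 0 y.
  exists (acos x); last by apply: zE => //; rewrite sE ger0_norm.
  by rewrite api (le_trans _ a0)// oppr_le0 pi_ge0.
exists (- acos x); last by apply: zE; rewrite ?cosN ?sinN// sE ltr0_norm// opprK.
by rewrite lerN2 api (le_trans _ (pi_ge0 R))// oppr_le0.
Qed.

End ComplexModulus.

#[global] Arguments normc : simpl never.
#[global] Arguments cis : simpl never.

(** * Continuity, complex differentiability and sequential limits *)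

Section ComplexLimits.
Variable R : realType.
Implicit Types (x y z w l m : R[i]) (f g : R[i] -> R[i]) (u v : nat -> R[i]).

(** Distances are measured by the real-valued [normc], so that continuity arguments reduce to real
    linear arithmetic. *)
Definition ccont f z := forall e : R, 0 < e -> exists2 d : R, 0 < d &
  forall w, normc (w - z) < d -> normc (f w - f z) < e.

Lemma ccont_cst c z : ccont (fun=> c) z.
Proof. by move=> e e0; exists 1 => // w _; rewrite subrr normc0. Qed.

Lemma ccont_id z : ccont id z.
Proof. by move=> e e0; exists e. Qed.

Lemma ccontD f g z : ccont f z -> ccont g z -> ccont (fun w => f w + g w) z.
Proof.
move=> cf cg e e0; have e2 : 0 < e / 2 by rewrite divr_gt0.
have [d d0 hd] := cf _ e2; have [d' d0' hd'] := cg _ e2.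
exists (Num.min d d'); first by rewrite lt_min d0.
move=> w; rewrite lt_min => /andP[/hd h /hd' h'].
rewrite opprD addrACA (le_lt_trans (le_normcD _ _))//; lra.
Qed.

Lemma ccontM f g z : ccont f z -> ccont g z -> ccont (fun w => f w * g w) z.
Proof.
move=> cf cg e e0.
have F0 := normc_ge0 (f z); have G0 := normc_ge0 (g z).
pose K := 1 + normc (f z) + normc (g z).
have K0 : 0 < K by rewrite /K; lra.
pose e' := Num.min 1 (e / (2 * K)).
have e'0 : 0 < e' by rewrite lt_min ltr01 divr_gt0// mulr_gt0.
have [d d0 hd] := cf _ e'0; have [d' d0' hd'] := cg _ e'0.
exists (Num.min d d'); first by rewrite lt_min d0.
move=> w; rewrite lt_min => /andP[/hd h /hd' h'].
have -> : f w * g w - f z * g z =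
  (f w - f z) * (g w - g z) + f z * (g w - g z) + g z * (f w - f z) by ring.
apply: (le_lt_trans (le_normcD _ _)).
apply: (le_lt_trans (lerD (le_normcD _ _) (lexx _))); rewrite !normcM.
have e'1 : e' <= 1 by rewrite ge_min lexx.
have e'2 : e' * (2 * K) <= e by rewrite -ler_pdivlMr ?mulr_gt0// ge_min lexx orbT.
have p1 := normc_ge0 (f w - f z); have p2 := normc_ge0 (g w - g z).
have q1 : normc (f w - f z) * normc (g w - g z) <= e' * 1 by apply: ler_pM => //; lra.
have q2 : normc (f z) * normc (g w - g z) <= normc (f z) * e' by apply: ler_wpM2l => //; lra.
have q3 : normc (g z) * normc (f w - f z) <= normc (g z) * e' by apply: ler_wpM2l => //; lra.
have : K * e' = e' + normc (f z) * e' + normc (g z) * e' by rewrite /K; ring.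
have : 0 < K * e' by rewrite mulr_gt0.
lra.
Qed.

Lemma ccontN f z : ccont f z -> ccont (fun w => - f w) z.
Proof.
move=> cf e e0; have [d d0 h] := cf _ e0; exists d => // w /h hw.
by rewrite opprK addrC normcC.
Qed.

Lemma ccontB f g z : ccont f z -> ccont g z -> ccont (fun w => f w - g w) z.
Proof. by move=> cf cg; apply: ccontD => //; exact: ccontN. Qed.

Lemma ccontV f z : f z != 0 -> ccont f z -> ccont (fun w => (f w)^-1) z.
Proof.
move=> fz0 cf e e0.
have n0 : 0 < normc (f z) by rewrite normc_gt0.
pose e' := Num.min (normc (f z) / 2) (e * (normc (f z)) ^+ 2 / 2).
have e'0 : 0 < e'.
  rewrite lt_min !divr_gt0 ?mulr_gt0 ?exprn_gt0//.
have [d d0 h] := cf _ e'0; exists d => // w /h hw.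
have h1 : normc (f w - f z) < normc (f z) / 2.
  by apply: (lt_le_trans hw); rewrite ge_min lexx.
have h2 : normc (f w - f z) < e * normc (f z) ^+ 2 / 2.
  by apply: (lt_le_trans hw); rewrite ge_min lexx orbT.
have h3 : normc (f z) / 2 < normc (f w).
  have := le_normc_sub (f z) (f w); rewrite normcC; lra.
have fw0 : f w != 0 by rewrite -normc_gt0; lra.
have -> : (f w)^-1 - (f z)^-1 = (f z - f w) / (f w * f z).
  by field; rewrite fz0.
rewrite normcM normcV normcM normcC ltr_pdivrMr ?mulr_gt0//; last lra.
apply: (lt_le_trans h2).
rewrite expr2 -!mulrA ler_wpM2l ?(ltW e0)// mulrC -mulrA.
by rewrite [X in _ <= X]mulrC ler_wpM2l// ?normc_ge0// mulrC ltW.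
Qed.

Lemma ccont_comp f g z : ccont f z -> ccont g (f z) -> ccont (fun w => g (f w)) z.
Proof.
move=> cf cg e e0; have [d d0 h] := cg _ e0; have [d' d0' h'] := cf _ d0.
by exists d' => // w /h'/h.
Qed.

Lemma ccont_near f g z d : 0 < d -> (forall w, normc (w - z) < d -> f w = g w) ->
  ccont f z -> ccont g z.
Proof.
move=> d0 fg cf e e0; have [d' d0' h'] := cf _ e0.
exists (Num.min d d'); first by rewrite lt_min d0.
move=> w; rewrite lt_min => /andP[wd /h' hh].
by rewrite -(fg w wd) -(fg z)// subrr normc0.
Qed.

(* Caratheodory's form of complex differentiability, which avoids difference quotients. *)
Definition cdiff f z := exists2 psi, ccont psi z &
  forall w, f w - f z = psi w * (w - z).

Lemma cdiff_cont f z : cdiff f z -> ccont f z.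
Proof.
move=> [psi cpsi fE].
have -> : f = (fun w => f z + psi w * (w - z)).
  by apply/funext => w; rewrite -fE addrC subrK.
apply: ccontD; first exact: ccont_cst.
apply: ccontM => //; apply: ccontB; [exact: ccont_id|exact: ccont_cst].
Qed.

Lemma cdiff_cst c z : cdiff (fun=> c) z.
Proof.
by exists (fun=> 0); [exact: ccont_cst | move=> w; rewrite subrr mul0r].
Qed.

Lemma cdiff_id z : cdiff id z.
Proof.
by exists (fun=> 1); [exact: ccont_cst | move=> w; rewrite mul1r].
Qed.

Lemma cdiffD f g z : cdiff f z -> cdiff g z -> cdiff (fun w => f w + g w) z.
Proof.
move=> [p cp fE] [q cq gE]; exists (fun w => p w + q w); first exact: ccontD.
by move=> w; rewrite mulrDl -fE -gE; ring.
Qed.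

Lemma cdiffM f g z : cdiff f z -> cdiff g z -> cdiff (fun w => f w * g w) z.
Proof.
move=> cf [q cq gE]; have cf' := cdiff_cont cf; case: cf => [p cp fE].
exists (fun w => p w * g z + f w * q w).
  by apply: ccontD; apply: ccontM => //; exact: ccont_cst.
move=> w; rewrite mulrDl mulrAC -fE -mulrA -gE; ring.
Qed.

Lemma cdiffB f g z : cdiff f z -> cdiff g z -> cdiff (fun w => f w - g w) z.
Proof.
move=> cf cg; apply: cdiffD => //.
have -> : (fun w => - g w) = (fun w => -1 * g w) by apply/funext => w; rewrite mulN1r.
by apply: cdiffM => //; exact: cdiff_cst.
Qed.

(** A slope has to satisfy its identity at every [w], so the given one is kept near [z] and replaced
    by the difference quotient elsewhere; continuity is asked at [z] only. *)
Lemma cdiff_near f g z d : 0 < d -> (forall w, normc (w - z) < d -> f w = g w) ->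
  cdiff f z -> cdiff g z.
Proof.
move=> d0 fg [p cp fE].
have fgz : f z = g z by apply: fg; rewrite subrr normc0.
exists (fun w => if normc (w - z) < d then p w else (g w - g z) / (w - z)).
  by apply: ccont_near cp; first exact: d0; move=> w /= ->.
move=> w /=; case: ifPn => [wd|]; first by rewrite -fE fg// fgz.
rewrite -leNgt => dw; rewrite divfK// -normc_gt0; exact: (lt_le_trans d0).
Qed.

Lemma cdiffV f z : f z != 0 -> cdiff f z -> cdiff (fun w => (f w)^-1) z.
Proof.
move=> fz0 cf; have cf' := cdiff_cont cf; case: cf => [p cp fE].
have n0 : 0 < normc (f z) by rewrite normc_gt0.
have [d d0 hd] := cf' _ n0.
exists (fun w => if normc (w - z) < d then - p w / (f w * f z)
                 else ((f w)^-1 - (f z)^-1) / (w - z)).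
  apply: (@ccont_near (fun w => - p w / (f w * f z)) _ _ d) => //.
    by move=> w ->.
  apply: ccontM; first exact: ccontN.
  apply: ccontV; first by rewrite mulf_neq0.
  by apply: ccontM => //; exact: ccont_cst.
move=> w; case: ifPn => [/hd wd|]; last first.
  rewrite -leNgt => dw; rewrite divfK// -normc_gt0; exact: (lt_le_trans d0).
have fw0 : f w != 0.
  by rewrite -normc_gt0; have := le_normc_sub (f z) (f w); rewrite normcC; lra.
have -> : - p w / (f w * f z) * (w - z) = - (p w * (w - z)) / (f w * f z) by ring.
by rewrite -fE; field; rewrite fz0.
Qed.

Lemma cdiff_div f g z : g z != 0 -> cdiff f z -> cdiff g z ->
  cdiff (fun w => f w / g w) z.
Proof. by move=> gz cf cg; apply: cdiffM => //; exact: cdiffV. Qed.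

Lemma cdiff_prod (I : Type) (s : seq I) (F : I -> R[i] -> R[i]) z :
  (forall i, cdiff (F i) z) -> cdiff (fun w => \prod_(i <- s) F i w) z.
Proof.
move=> h; elim: s => [|i s ih].
  have -> : (fun w => \prod_(i <- [::]) F i w) = (fun=> 1).
    by apply/funext => w; rewrite big_nil.
  exact: cdiff_cst.
have -> : (fun w => \prod_(j <- i :: s) F j w) = (fun w => F i w * \prod_(j <- s) F j w).
  by apply/funext => w; rewrite big_cons.
exact: cdiffM.
Qed.

Lemma cdiffX f z n : cdiff f z -> cdiff (fun w => f w ^+ n) z.
Proof.
move=> cf; elim: n => [|n ih].
  have -> : (fun w => f w ^+ 0) = (fun=> 1) by apply/funext => w; rewrite expr0.
  exact: cdiff_cst.
have -> : (fun w => f w ^+ n.+1) = (fun w => f w * f w ^+ n).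
  by apply/funext => w; rewrite exprS.
exact: cdiffM.
Qed.

Lemma derivable_cdiff f z : derivable (f : R[i]^o -> R[i]^o) z 1 -> cdiff f z.
Proof.
move=> /cvg_ex[/= l hl].
exists (fun w => if w == z then l else (f w - f z) / (w - z)); last first.
  move=> w; case: eqP => [->|/eqP wz]; first by rewrite !subrr mulr0.
  by rewrite divfK// subr_eq0.
move=> e e0; rewrite eqxx.
have e0c : 0 < e%:C by rewrite ltcR.
move/cvgrPdist_lt : hl => /(_ _ e0c) [/= d d0 hd].
(* A positive element of [R[i]] in its partial order is real, so the radius can be read as a real
   number. *)
have dE : d = (normc d)%:C.
  by apply/eqP; rewrite eq_sym; apply/eqP; rewrite -[LHS]/(`|d|) ger0_norm// ltW.
have d0' : 0 < normc d by rewrite normc_gt0 gt_eqF.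
exists (normc d) => // w wd; case: eqP => [_|/eqP wz].
  by rewrite subrr normc0.
rewrite normcC -ltcR.
have := hd (w - z); rewrite /= sub0r normrN dE ltcR => /(_ wd).
rewrite subr_eq0 => /(_ wz).
by rewrite /GRing.scale /= !mulr1 subrK [X in l - X]mulrC.
Qed.

Definition climit u l := (fun n => normc (u n - l)) @ \oo --> (0 : R).

Lemma climit_squeeze u l (e : nat -> R) :
  (forall n, normc (u n - l) <= e n) -> e @ \oo --> (0 : R) -> climit u l.
Proof.
move=> h he; apply: (squeeze_cvgr _ (cvg_cst 0) he).
by near=> n; rewrite normc_ge0 h.
Unshelve. all: by end_near. Qed.

Lemma climit_cst l : climit (fun=> l) l.
Proof. by apply: (climit_squeeze (e := fun=> 0)) => [n|]; [rewrite subrr normc0|exact: cvg_cst]. Qed.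

Lemma climitD u v l m : climit u l -> climit v m -> climit (fun n => u n + v n) (l + m).
Proof.
move=> hu hv.
have h : (normc (u n - l) + normc (v n - m)) @[n --> \oo] --> (0 : R).
  by rewrite -[X in _ --> X]addr0; exact: cvgD.
apply: (climit_squeeze _ h) => n /=.
by rewrite opprD addrACA le_normcD.
Qed.

Lemma climitM u v l m : climit u l -> climit v m -> climit (fun n => u n * v n) (l * m).
Proof.
move=> hu hv.
have h : (normc (u n - l) * normc (v n - m) + normc l * normc (v n - m)
    + normc m * normc (u n - l)) @[n --> \oo] --> (0 : R).
  rewrite [X in _ --> X](_ : _ = 0 * 0 + normc l * 0 + normc m * 0); last by ring.
  by apply: cvgD; [apply: cvgD|]; apply: cvgM => //; exact: cvg_cst.
apply: (climit_squeeze _ h) => n /=.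
have -> : u n * v n - l * m = (u n - l) * (v n - m) + l * (v n - m) + m * (u n - l) by ring.
by rewrite -!normcM; apply: (le_trans (le_normcD _ _)); rewrite lerD2r le_normcD.
Qed.

Lemma climitZ c u l : climit u l -> climit (fun n => c * u n) (c * l).
Proof. exact: climitM (climit_cst c). Qed.

Lemma climitB u v l m : climit u l -> climit v m -> climit (fun n => u n - v n) (l - m).
Proof.
move=> hu hv; apply: climitD => //.
rewrite /climit (_ : (fun _ => _) = (fun n => normc (v n - m)))//.
by apply/funext => n; rewrite -opprD normcN.
Qed.

Lemma climit_normc u l : climit u l -> normc (u n) @[n --> \oo] --> normc l.
Proof.
move=> h; apply/cvgrPdist_le => e e0; move/cvgrPdist_le : h => /(_ _ e0).
apply: filterS => n; rewrite sub0r normrN ger0_norm ?normc_ge0// => h.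
have h1 := le_normc_sub (u n) l; have := le_normc_sub l (u n); rewrite normcC => h2.
by rewrite ler_norml; lra.
Qed.

Lemma climit_eq u v l : (forall n, u n = v n) -> climit u l -> climit v l.
Proof. by move=> /funext ->. Qed.

Lemma climit_shift_eq (N : nat) u v l : (forall n, (N <= n)%N -> u n = v n) ->
  climit u l -> climit v l.
Proof.
move=> uv hu; rewrite /climit; apply: (cvg_trans _ hu); apply: near_eq_cvg.
by exists N => //= n /uv ->.
Qed.

Lemma climit_epsP u l : climit u l <->
  (forall e, 0 < e -> exists N, forall n, (N <= n)%N -> normc (u n - l) <= e).
Proof.
split=> [h e e0|h].
  move/cvgrPdist_le : h => /(_ _ e0)[N _ hN]; exists N => n Nn.
  by have := hN n Nn; rewrite /= sub0r normrN ger0_norm ?normc_ge0.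
apply/cvgrPdist_le => e e0; have [N hN] := h _ e0; exists N => // n Nn /=.
by rewrite sub0r normrN ger0_norm ?normc_ge0// hN.
Qed.

Lemma climit_conj u l : climit u l -> climit (fun n => (u n)^*) (l^*).
Proof.
rewrite /climit (_ : (fun n => normc ((u n)^* - l^*)) = (fun n => normc (u n - l)))//.
by apply/funext => n; rewrite -rmorphB normc_conj.
Qed.

Lemma climit_geom x : normc x < 1 -> climit (fun n => x ^+ n) 0.
Proof.
move=> x1; rewrite /climit (_ : (fun _ => _) = (fun n => normc x ^+ n)).
  by apply: cvg_expr; rewrite ger0_norm ?normc_ge0.
by apply/funext => n; rewrite subr0 normcX.
Qed.

Lemma climitV u l : l != 0 -> climit u l -> climit (fun n => (u n)^-1) l^-1.
Proof.
move=> l0 /climit_epsP h; apply/climit_epsP => e e0.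
have [d d0 hd] := ccontV l0 (@ccont_id l) e0.
have [N hN] := h (d / 2) (divr_gt0 d0 (ltr0n _ 2)).
exists N => n Nn; apply/ltW/hd; apply: (le_lt_trans (hN _ Nn)); lra.
Qed.

End ComplexLimits.

(** * Means over scaled roots of unity *)

Section CircleAverages.
Variable R : realType.
Implicit Types (x y z w : R[i]) (u v : R[i] -> R[i]) (M n m : nat) (r : R).

Lemma pi2_gt0 : 0 < pi *+ 2 :> R.
Proof. by rewrite mulr2n addr_gt0 ?pi_gt0. Qed.

Definition circle_pt M r (j : nat) : R[i] := r%:C * cis (j%:R * (pi *+ 2 / M%:R)).

Definition avgc M r u : R[i] := M%:R^-1 * \sum_(j < M) u (circle_pt M r j).

Definition ravg M r (h : R[i] -> R) : R := M%:R^-1 * \sum_(j < M) h (circle_pt M r j).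

Lemma normc_circle_pt M r j : 0 <= r -> normc (circle_pt M r j) = r.
Proof. by move=> r0; rewrite normcM normc_cis mulr1 normc_pos. Qed.

Lemma eq_avgc M r u v : 0 <= r -> (forall z, normc z = r -> u z = v z) ->
  avgc M r u = avgc M r v.
Proof.
move=> r0 uv; congr (_ * _); apply: eq_bigr => j _.
by rewrite uv// normc_circle_pt.
Qed.

Lemma avgcD M r u v : avgc M r (fun z => u z + v z) = avgc M r u + avgc M r v.
Proof. by rewrite /avgc big_split mulrDr. Qed.

Lemma avgcZ M r c u : avgc M r (fun z => c * u z) = c * avgc M r u.
Proof. by rewrite /avgc -mulr_sumr mulrCA. Qed.

Lemma avgcB M r u v : avgc M r (fun z => u z - v z) = avgc M r u - avgc M r v.
Proof. by rewrite /avgc sumrB mulrBr. Qed.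

Lemma avgc_sum M r (I : Type) (s : seq I) (F : I -> R[i] -> R[i]) :
  avgc M r (fun z => \sum_(i <- s) F i z) = \sum_(i <- s) avgc M r (F i).
Proof. by rewrite /avgc exchange_big mulr_sumr. Qed.

Lemma normc_natV M : normc (M%:R^-1 : R[i]) = M%:R^-1.
Proof. by rewrite normcV normc_nat. Qed.

Lemma normc_avgc_le M r u : normc (avgc M r u) <= ravg M r (fun z => normc (u z)).
Proof.
rewrite /avgc /ravg normcM normc_natV ler_wpM2l ?invr_ge0//.
exact: normc_sum.
Qed.

Lemma ravg_le M r h h' : 0 <= r -> (forall z, normc z = r -> h z <= h' z) ->
  ravg M r h <= ravg M r h'.
Proof.
move=> r0 hh; rewrite ler_wpM2l ?invr_ge0// ler_sum// => j _.
by rewrite hh// normc_circle_pt.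
Qed.

Lemma ravg_ge0 M r h : 0 <= r -> (forall z, normc z = r -> 0 <= h z) -> 0 <= ravg M r h.
Proof.
move=> r0 hh; rewrite mulr_ge0 ?invr_ge0// sumr_ge0// => j _.
by rewrite hh// normc_circle_pt.
Qed.

Lemma ravg_cst_le M r (K : R) : 0 <= K -> ravg M r (fun=> K) <= K.
Proof.
move=> K0; rewrite /ravg sumr_const card_ord -[K *+ M]mulr_natl mulrA.
by have [->|M0] := eqVneq M 0%N; rewrite ?mulr0 ?mul0r// mulVf ?pnatr_eq0// mul1r.
Qed.

Lemma normc_avgc_le_cst M r u (K : R) : 0 <= r -> 0 <= K ->
  (forall z, normc z = r -> normc (u z) <= K) -> normc (avgc M r u) <= K.
Proof.
move=> r0 K0 uK; apply: (le_trans (normc_avgc_le _ _ _)).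
apply: (le_trans _ (ravg_cst_le M r K0)); exact: ravg_le.
Qed.

Lemma ravgD M r h h' : ravg M r (fun z => h z + h' z) = ravg M r h + ravg M r h'.
Proof. by rewrite /ravg big_split mulrDr. Qed.

Lemma ravgB M r h h' : ravg M r (fun z => h z - h' z) = ravg M r h - ravg M r h'.
Proof. by rewrite /ravg sumrB mulrBr. Qed.

Lemma ravgZ M r c h : ravg M r (fun z => c * h z) = c * ravg M r h.
Proof. by rewrite /ravg -mulr_sumr mulrCA. Qed.

Lemma ravgC M r h : (ravg M r h)%:C = avgc M r (fun z => (h z)%:C).
Proof.
by rewrite /ravg /avgc rmorphM fmorphV rmorph_nat rmorph_sum.
Qed.

Lemma avgc_conj M r u : (avgc M r u)^* = avgc M r (fun z => (u z)^*).
Proof.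
rewrite /avgc rmorphM rmorph_sum; congr (_ * _).
by rewrite -[M%:R](rmorph_nat (@real_complex R)) -fmorphV /= oppr0.
Qed.

Lemma avgc_cst M r c : (0 < M)%N -> avgc M r (fun=> c) = c.
Proof.
move=> M0; rewrite /avgc sumr_const card_ord -[c *+ M]mulr_natl mulrA mulVf ?mul1r//.
by rewrite pnatr_eq0 -lt0n.
Qed.

Lemma circle_ptX M r j : (0 < M)%N -> circle_pt M r j ^+ M = (r ^+ M)%:C.
Proof.
move=> M0; rewrite exprMn -rmorphXn cisX [X in cis X](_ : _ = (pi *+ 2) *+ j).
  by rewrite -cisX cis_2pi expr1n mulr1.
rewrite -[LHS]mulr_natr -[RHS]mulr_natr mulrC mulrA mulrCA -mulrA mulrC.
have M0' : M%:R != 0 :> R by rewrite pnatr_eq0 -lt0n.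
by field.
Qed.

Lemma avgcX M r n : (0 < n < M)%N -> avgc M r (fun z => z ^+ n) = 0.
Proof.
move=> /andP[n0 nM].
have M0 : (0 < M)%N by exact: ltn_trans nM.
have M0' : M%:R != 0 :> R by rewrite pnatr_eq0 -lt0n.
pose zt := cis (n%:R * (pi *+ 2 / M%:R)) : R[i].
have -> : avgc M r (fun z => z ^+ n) = M%:R^-1 * ((r ^+ n)%:C * \sum_(j < M) zt ^+ j).
  rewrite /avgc; congr (_ * _); rewrite mulr_sumr; apply: eq_bigr => j _.
  rewrite /circle_pt exprMn -rmorphXn; congr (_ * _).
  rewrite /zt !cisX; congr cis; rewrite -[LHS]mulr_natl -[RHS]mulr_natl.
  by rewrite mulrCA.
have zt1 : zt != 1.
  apply: cis_neq1; apply/andP; split.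
    by rewrite mulr_gt0 ?ltr0n// divr_gt0 ?ltr0n// pi2_gt0.
  rewrite mulrCA -[ltRHS]mulr1 ltr_pM2l ?pi2_gt0//.
  by rewrite ltr_pdivrMr ?ltr0n// mul1r ltr_nat.
have : (zt - 1) * \sum_(j < M) zt ^+ j = 0.
  rewrite -subrX1 /zt cisX [X in cis X](_ : _ = (pi *+ 2) *+ n).
    by rewrite -cisX cis_2pi expr1n subrr.
  by rewrite -[LHS]mulr_natr -[RHS]mulr_natr; field; exact: M0'.
by move/eqP; rewrite mulf_eq0 subr_eq0 (negbTE zt1) => /eqP ->; rewrite !mulr0.
Qed.

(** There is no aliasing below [M]: powers with exponents smaller than the number of sample points
    are orthogonal exactly, not only in the limit. *)
Lemma avgc_monomials M r n m : 0 <= r -> (n < M)%N -> (m < M)%N ->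
  avgc M r (fun z => z ^+ n * (z ^* ) ^+ m) = if n == m then (r ^+ n.*2)%:C else 0.
Proof.
move=> r0.
wlog mn : n m / (m <= n)%N => [hw nM mM|nM mM].
  have [mn|/ltnW nm] := leqP m n; first exact: hw.
  rewrite eq_sym; case: eqP => [->|/eqP mn].
    by rewrite hw// eqxx.
  have := hw _ _ nm mM nM; rewrite (negbTE mn) => /(congr1 (@conjc R)).
  rewrite conjc0 avgc_conj => h; rewrite -[RHS]h; apply: eq_avgc => // z _.
  by rewrite rmorphM !rmorphXn /= conjcK mulrC.
have zE z : normc z = r -> z ^+ n * (z^*) ^+ m = (r ^+ m.*2)%:C * z ^+ (n - m).
  move=> zr; rewrite -{1}(subnK mn) exprD -mulrA -exprMn -sqr_normc_conj zr.
  by rewrite mulrC -rmorphXn -exprM mul2n.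
rewrite (eq_avgc _ r0 zE) avgcZ.
have [->|nm] := eqVneq n m.
  rewrite subnn; have -> : avgc M r (fun z => z ^+ 0) = 1.
    by apply: avgc_cst; case: (M) nM.
  by rewrite mulr1.
rewrite avgcX ?mulr0//; apply/andP; split; first by rewrite subn_gt0 ltn_neqAle mn eq_sym nm.
by rewrite (leq_ltn_trans _ nM)// leq_subr.
Qed.

Lemma avgcXV M r n : 0 < r -> (0 < n < M)%N -> avgc M r (fun z => z ^- n) = 0.
Proof.
move=> r0 nM; have zE z : normc z = r -> z ^- n = (r ^- n.*2)%:C * (z ^+ n)^*.
  move=> zr; have z0 : z != 0 by rewrite -normc_gt0 zr.
  apply: (@mulfI _ (z ^+ n)); first by rewrite expf_neq0.
  rewrite divff ?expf_neq0// mulrCA -sqr_normc_conj normcX zr -rmorphM.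
  by rewrite -exprM muln2 mulVf// expf_neq0// gt_eqF.
rewrite (eq_avgc _ (ltW r0) zE) avgcZ -avgc_conj avgcX//.
by rewrite conjc0 mulr0.
Qed.

(** At the sample points [z ^+ M] equals [r ^+ M], so [1 - (w / r) ^+ M] times the kernel is the
    finite geometric sum of the [(w / z) ^+ n], of which only the constant term has nonzero mean.
    One formula covers both positions of [w]: it tends to 1 when [w] is inside the circle and to 0
    when it is outside. *)
Lemma avgc_cauchy_kernel M r w : 0 < r -> normc w != r -> (0 < M)%N ->
  avgc M r (fun z => z / (z - w)) = (1 - (w / r%:C) ^+ M)^-1.
Proof.
move=> r0 wr M0.
have rC : r%:C != 0 :> R[i] by rewrite -normc_gt0 normc_pos// ltW.
have nw1 : 1 - (w / r%:C) ^+ M != 0.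
  rewrite subr_eq0 eq_sym; apply/eqP => h.
  have : normc (w / r%:C) ^+ M = 1 by rewrite -normcX h normc1.
  rewrite normcM normcV normc_pos ?ltW// => /eqP.
  rewrite -{1}(expr1n _ M) eqrXn2 ?M0//; last by rewrite divr_ge0 ?normc_ge0 ?ltW.
  move=> /eqP h1; move/eqP : wr; apply.
  by rewrite -[LHS](divfK (lt0r_neq0 r0)) h1 mul1r.
apply: (mulfI nw1); rewrite divff// -avgcZ.
have -> : avgc M r (fun z => (1 - (w / r%:C) ^+ M) * (z / (z - w))) =
   avgc M r (fun z => \sum_(n <- index_iota 0 M) w ^+ n * z ^- n).
  rewrite /avgc; congr (_ * _); apply: eq_bigr => j _; set z := circle_pt _ _ _.
  have zr : normc z = r by rewrite normc_circle_pt// ltW.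
  have z0 : z != 0 by rewrite -normc_gt0 zr.
  have zw : z - w != 0.
    by rewrite subr_eq0; apply: contra_neq wr => <-.
  apply: (mulIf zw).
  rewrite -mulrA divfK//.
  have -> : (w / r%:C) ^+ M = (w / z) ^+ M.
    by rewrite !exprMn !exprVn (circle_ptX r j M0) rmorphXn.
  rewrite big_mkord.
  have -> : \sum_(i < M) w ^+ i * z ^- i = \sum_(i < M) (w / z) ^+ i.
    by apply: eq_bigr => i _; rewrite expr_div_n.
  rewrite -opprB (subrX1 (w / z) M) -[z - w]opprB.
  have -> : w - z = (w / z - 1) * z by field.
  ring.
rewrite avgc_sum; case: M M0 {nw1} => // M _.
rewrite big_nat_recl// big1_seq ?addr0 => [|n /=].
  rewrite (_ : (fun z => w ^+ 0 * z ^- 0) = (fun=> 1)) ?avgc_cst//.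
  by apply/funext => z; rewrite !expr0 invr1 mulr1.
rewrite mem_index_iota => /= nM.
by rewrite avgcZ avgcXV ?mulr0.
Qed.

End CircleAverages.

(** * Goursat's theorem on rectangles *)

Section Goursat.
Variable R : realType.
Implicit Types (a b c d t : R).

Definition rint a b (u : R -> R) : R := \int[@lebesgue_measure R]_(t in `[a, b]) u t.

Lemma rint_integrable a b (u : R -> R) : continuous u ->
  (@lebesgue_measure R).-integrable `[a, b] (EFin \o u).
Proof.
move=> cu; apply: continuous_compact_integrable; first exact: segment_compact.
exact: continuous_subspaceT.
Qed.

Lemma rintB a b (u v : R -> R) : continuous u -> continuous v ->
  rint a b (fun t => u t - v t) = rint a b u - rint a b v.
Proof. by move=> cu cv; rewrite /rint RintegralB//; exact: rint_integrable. Qed.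

Lemma rint_chasles a b c (u : R -> R) : continuous u -> a <= b -> b <= c ->
  rint a c u = rint a b u + rint b c u.
Proof.
move=> cu ab bc; apply/eqP; rewrite addrC -subr_eq; apply/eqP; rewrite /rint Rintegral_itvB.
- rewrite Rintegral_itv_obnd_cbnd//.
  apply: (integrableS _ _ _ (rint_integrable b c cu)) => //.
  by apply: subset_itvr; rewrite bnd_simp.
- exact: rint_integrable.
- by rewrite bnd_simp.
- by rewrite bnd_simp.
Qed.

Lemma rint_bound a b (u : R -> R) (K : R) : continuous u -> a <= b ->
  (forall t, a <= t <= b -> `|u t| <= K) -> `|rint a b u| <= K * (b - a).
Proof.
move=> cu ab uK; apply: (le_trans (le_normr_Rintegral _ _)) => //.
  exact: rint_integrable.
have cn : continuous (fun t => `|u t|).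
  by move=> x; apply: continuous_comp; [exact: cu|exact: norm_continuous].
apply: (@le_trans _ _ (\int[@lebesgue_measure R]_(t in `[a, b]) (fun=> K) t)).
  apply: le_Rintegral => //; first exact: rint_integrable.
  by apply: rint_integrable => x; exact: cvg_cst.
rewrite Rintegral_cst//.
rewrite (_ : fine _ = b - a) ?lexx//. 
rewrite [X in fine X](_ : _ = lebesgue_measure (`[a, b]%classic : set R))//.
rewrite lebesgue_measure_itv /= lte_fin.
by case: ltgtP ab => // -> _ /=; rewrite subrr.
Qed.

Lemma rint_affine a b p q : a <= b ->
  rint a b (fun t : R => p + q * t) = p * (b - a) + q * ((b ^+ 2 - a ^+ 2) / 2).
Proof.
rewrite le_eqVlt => /orP[/eqP <-|ab].
  by rewrite /rint set_itv1 Rintegral_set1 !subrr mul0r !mulr0 addr0.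
have dF (x : R) : is_derive x 1 (fun t : R => p * t + q * (t ^+ 2 / 2)) (p + q * x).
  by apply: is_derive_eq; rewrite /GRing.scale /=; field.
have cont : continuous (fun t : R => p + q * t).
  by move=> t; apply: cvgD; [exact: cvg_cst|apply: cvgM; [exact: cvg_cst|exact: cvg_id]].
pose G (t : R) : R^o := p * t + q * (t ^+ 2 / 2).
have cG x : {for x, continuous G}.
  by apply/differentiable_continuous/derivable1_diffP; case: (dF x).
have H : (\int[@lebesgue_measure R]_(t in `[a, b]) (p + q * t)%:E = (G b)%:E - (G a)%:E)%E.
  apply: continuous_FTC2 => //.
  - exact: continuous_subspaceT.
  - split=> [x _||]; first by case: (dF x).
      by apply: cvg_at_right_filter; exact: cG.
    by apply: cvg_at_left_filter; exact: cG.
  - by move=> x _; rewrite derive1E; have [_ ->] := dF x.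
by rewrite /rint /Rintegral H /G /=; field.
Qed.

Implicit Types (u v : R -> R[i]).

Definition rcont u := continuous (fun t => Re (u t)) /\ continuous (fun t => Im (u t)).

Definition cint a b u : R[i] :=
  rint a b (fun t => Re (u t)) +i* rint a b (fun t => Im (u t)).

Lemma rcontB u v : rcont u -> rcont v -> rcont (fun t => u t - v t).
Proof.
move=> [u1 u2] [v1 v2]; split.
  rewrite (_ : (fun t => _) = (fun t => Re (u t) - Re (v t))).
    by move=> x; apply: cvgB; [exact: u1|exact: v1].
  by apply/funext => t; case: (u t) (v t) => ? ? [].
rewrite (_ : (fun t => _) = (fun t => Im (u t) - Im (v t))).
  by move=> x; apply: cvgB; [exact: u2|exact: v2].
by apply/funext => t; case: (u t) (v t) => ? ? [].
Qed.

Lemma cintB a b u v : rcont u -> rcont v ->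
  cint a b (fun t => u t - v t) = cint a b u - cint a b v.
Proof.
move=> [u1 u2] [v1 v2]; rewrite /cint.
rewrite (_ : (fun t => Re (u t - v t)) = (fun t => Re (u t) - Re (v t))); last first.
  by apply/funext => t; case: (u t) (v t) => ? ? [].
rewrite (_ : (fun t => Im (u t - v t)) = (fun t => Im (u t) - Im (v t))); last first.
  by apply/funext => t; case: (u t) (v t) => ? ? [].
by rewrite !rintB.
Qed.

Lemma cint_chasles a b c u : rcont u -> a <= b -> b <= c ->
  cint a c u = cint a b u + cint b c u.
Proof.
by move=> [u1 u2] ab bc; rewrite /cint (rint_chasles u1 ab bc) (rint_chasles u2 ab bc).
Qed.

(** Bounding the real and the imaginary part separately costs the factor 2, which every application
    absorbs. *)
Lemma cint_bound a b u (K : R) : rcont u -> a <= b ->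
  (forall t, a <= t <= b -> normc (u t) <= K) -> normc (cint a b u) <= 2 * K * (b - a).
Proof.
move=> [u1 u2] ab uK; apply: (le_trans (normc_le_ReIm _)) => /=.
have h1 := rint_bound u1 ab (fun t ht => le_trans (normr_Re_le _) (uK t ht)).
have h2 := rint_bound u2 ab (fun t ht => le_trans (normr_Im_le _) (uK t ht)).
lra.
Qed.

Lemma Re_affine (p q : R[i]) t : Re (p + q * t%:C) = Re p + Re q * t.
Proof. by case: p q => ? ? [? ?] /=; ring. Qed.

Lemma Im_affine (p q : R[i]) t : Im (p + q * t%:C) = Im p + Im q * t.
Proof. by case: p q => ? ? [? ?] /=; ring. Qed.

Lemma rcont_affine (p q : R[i]) : rcont (fun t => p + q * t%:C).
Proof.
split.
  rewrite (_ : (fun _ => _) = (fun t => Re p + Re q * t)).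
    by move=> x; apply: cvgD; [exact: cvg_cst|apply: cvgM; [exact: cvg_cst|exact: cvg_id]].
  by apply/funext => t; rewrite Re_affine.
rewrite (_ : (fun _ => _) = (fun t => Im p + Im q * t)).
  by move=> x; apply: cvgD; [exact: cvg_cst|apply: cvgM; [exact: cvg_cst|exact: cvg_id]].
by apply/funext => t; rewrite Im_affine.
Qed.

Lemma cint_affine a b (p q : R[i]) : a <= b ->
  cint a b (fun t => p + q * t%:C) = p * (b - a)%:C + q * ((b ^+ 2 - a ^+ 2) / 2)%:C.
Proof.
move=> ab; rewrite /cint.
rewrite (_ : (fun t => Re _) = (fun t => Re p + Re q * t)); last first.
  by apply/funext => t; rewrite Re_affine.
rewrite (_ : (fun t => Im _) = (fun t => Im p + Im q * t)); last first.
  by apply/funext => t; rewrite Im_affine.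
rewrite !rint_affine//; case: p q => ? ? [? ?].
by apply/eqP; rewrite eq_complex /=; apply/andP; split; apply/eqP; ring.
Qed.

Implicit Type F : R -> R -> R[i].

(* The integral of F dw along the boundary of [a, b] x [c, d], where [F x y] is the value at
   w = x + i y. *)
Definition rect_int F a b c d : R[i] :=
  cint a b (F ^~ c) + 'i * cint c d (F b) - cint a b (F ^~ d) - 'i * cint c d (F a).

(** Continuity along every horizontal and vertical line of the plane, rather than on one rectangle,
    serves all the rectangles of a subdivision at once. *)
Definition sep_cont F := (forall y, rcont (F ^~ y)) /\ (forall x, rcont (F x)).

Lemma rect_int_split F a b c d m n : sep_cont F ->
  a <= m -> m <= b -> c <= n -> n <= d ->
  rect_int F a b c d = rect_int F a m c n + rect_int F m b c n +
    (rect_int F a m n d + rect_int F m b n d).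
Proof.
move=> [F1 F2] am mb cn nd; rewrite /rect_int.
rewrite (cint_chasles (F1 c) am mb) (cint_chasles (F1 d) am mb).
rewrite (cint_chasles (F2 a) cn nd) (cint_chasles (F2 b) cn nd).
ring.
Qed.

Lemma rect_int_affine (p q : R[i]) a b c d : a <= b -> c <= d ->
  rect_int (fun x y => p + q * (x +i* y)) a b c d = 0.
Proof.
move=> ab cd; rewrite /rect_int.
have E x y : p + q * (x +i* y) = p + q * (x%:C + 'i * y%:C).
  by rewrite [x +i* y]complexE.
have hx y : (fun x => p + q * (x +i* y)) = (fun x => (p + q * ('i * y%:C)) + q * x%:C).
  by apply/funext => x; rewrite E; ring.
have hy x : (fun y => p + q * (x +i* y)) = (fun y => (p + q * x%:C) + (q * 'i) * y%:C).
  by apply/funext => y; rewrite E; ring.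
rewrite !hx !hy !cint_affine// !rmorphB /=.
ring.
Qed.

Lemma sep_cont_affine (p q : R[i]) : sep_cont (fun x y => p + q * (x +i* y)).
Proof.
have E x y : p + q * (x +i* y) = p + q * (x%:C + 'i * y%:C).
  by rewrite [x +i* y]complexE.
split=> [y|x].
  rewrite (_ : (fun x => _) = (fun x => (p + q * ('i * y%:C)) + q * x%:C)).
    exact: rcont_affine.
  by apply/funext => x; rewrite E; ring.
rewrite (_ : (fun y => _) = (fun y => (p + q * x%:C) + (q * 'i) * y%:C)).
  exact: rcont_affine.
by apply/funext => y; rewrite E; ring.
Qed.

(** An affine function has zero boundary integral, so only the deviation contributes, over a
    perimeter of twice [(b - a) + (d - c)]. *)
Lemma rect_int_near_affine F (p q : R[i]) a b c d (K : R) : sep_cont F -> a <= b -> c <= d ->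
  (forall x y, a <= x <= b -> c <= y <= d ->
     normc (F x y - (p + q * (x +i* y))) <= K) ->
  normc (rect_int F a b c d) <= 4 * K * ((b - a) + (d - c)).
Proof.
move=> cF ab cd FK.
rewrite -[rect_int F a b c d]subr0 -(rect_int_affine p q ab cd).
set L := fun x y : R => _.
have cL : sep_cont L by exact: sep_cont_affine.
have [F1 F2] := cF; have [L1 L2] := cL.
have -> : rect_int F a b c d - rect_int L a b c d =
   cint a b (fun x => F x c - L x c) + 'i * cint c d (fun y => F b y - L b y)
   - cint a b (fun x => F x d - L x d) - 'i * cint c d (fun y => F a y - L a y).
  by rewrite !cintB// /rect_int; ring.
have n1 : normc ('i : R[i]) = 1 by rewrite /normc /= expr0n expr1n add0r sqrtr1.
have b1 : normc (cint a b (fun x => F x c - L x c)) <= 2 * K * (b - a).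
  by apply: cint_bound => //; [exact: rcontB|move=> t ht; apply: FK; rewrite ?lexx].
have b2 : normc (cint a b (fun x => F x d - L x d)) <= 2 * K * (b - a).
  by apply: cint_bound => //; [exact: rcontB|move=> t ht; apply: FK; rewrite ?lexx ?andbT].
have b3 : normc (cint c d (fun y => F a y - L a y)) <= 2 * K * (d - c).
  by apply: cint_bound => //; [exact: rcontB|move=> t ht; apply: FK; rewrite ?lexx].
have b4 : normc (cint c d (fun y => F b y - L b y)) <= 2 * K * (d - c).
  by apply: cint_bound => //; [exact: rcontB|move=> t ht; apply: FK; rewrite ?lexx ?andbT].
apply: (le_trans (le_normcB _ _)).
apply: (le_trans (lerD (le_normcB _ _) (lexx _))).
apply: (le_trans (lerD (lerD (le_normcD _ _) (lexx _)) (lexx _))).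
rewrite !normcM n1 !mul1r; lra.
Qed.

(** The increments stay in the closed rectangle, so the notion makes sense on its sides and at its
    corners, where the limit point of a bisection may fall. *)
Definition diff_within F a b c d x y := exists D : R[i], forall e, 0 < e ->
  exists2 dl, 0 < dl & forall x' y', a <= x' <= b -> c <= y' <= d ->
    `|x' - x| < dl -> `|y' - y| < dl ->
    normc (F x' y' - F x y - D * ((x' - x) +i* (y' - y))) <= e * (`|x' - x| + `|y' - y|).

Lemma nested_limit (x : nat -> R) h :
  (forall n, x n <= x n.+1) -> (forall n, x n.+1 + h / 2 ^+ n.+1 <= x n + h / 2 ^+ n) ->
  0 <= h -> exists X, forall n, x n <= X <= x n + h / 2 ^+ n.
Proof.
move=> nd ni h0.
have mono := homo_leq (@lexx _ R) (@le_trans _ R) nd.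
have mono' n m : (n <= m)%N -> x m + h / 2 ^+ m <= x n + h / 2 ^+ n.
  move=> /subnKC <-; elim: (m - n)%N => [|k ih]; first by rewrite addn0.
  by rewrite addnS; exact: le_trans (ni _) ih.
have xy n m : x m <= x n + h / 2 ^+ n.
  have hm k : x k <= x k + h / 2 ^+ k by rewrite lerDl divr_ge0// exprn_ge0.
  have [nm|/ltnW mn] := leqP n m.
    exact: (le_trans (hm m)) (mono' _ _ nm).
  exact: (le_trans (mono _ _ mn)) (hm n).
exists (sup (range x)) => n; apply/andP; split.
  apply: ub_le_sup; last by exists n.
  by exists (x 0%N + h / 2 ^+ 0) => _ [m _ <-].
apply: ge_sup; first by exists (x 0%N); exists 0%N.
by move=> _ [m _ <-].
Qed.

Lemma goursat F a b c d : a <= b -> c <= d -> sep_cont F ->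
  (forall x y, a <= x <= b -> c <= y <= d -> diff_within F a b c d x y) ->
  rect_int F a b c d = 0.
Proof.
move=> ab cd cF dF.
pose h := b - a; pose k := d - c.
have h0 : 0 <= h by rewrite subr_ge0.
have k0 : 0 <= k by rewrite subr_ge0.
apply: contrapT => /eqP; rewrite -normc_gt0 => I0.
(* Chosen so that the whole rectangle is bad at stage 0; the summand 1 keeps the denominator
   positive for a degenerate rectangle. *)
pose e := normc (rect_int F a b c d) / (8 * (1 + (h + k) ^+ 2)).
have den0 : 0 < 8 * (1 + (h + k) ^+ 2) by have := sqr_ge0 (h + k); lra.
have e0 : 0 < e by rewrite divr_gt0.
(* The threshold is quadratic in the half-perimeter, which halves at each stage: four quarters below
   their threshold would put the whole rectangle below its own. *)
pose bad (p : R * R) (n : nat) :=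
  4 * e * (h / 2 ^+ n + k / 2 ^+ n) ^+ 2 <
  normc (rect_int F p.1 (p.1 + h / 2 ^+ n) p.2 (p.2 + k / 2 ^+ n)).
have bad0 : bad (a, c) 0%N.
  rewrite /bad /= expr0 !divr1 /h /k !subrKC -/h -/k.
  have : e * (8 * (1 + (h + k) ^+ 2)) = normc (rect_int F a b c d).
    by rewrite /e divfK// gt_eqF.
  have : 0 <= e * (h + k) ^+ 2 by rewrite mulr_ge0 ?sqr_ge0// ltW.
  lra.
have next p n : exists p' : R * R, bad p n -> [/\ bad p' n.+1,
    p'.1 = p.1 \/ p'.1 = p.1 + h / 2 ^+ n.+1 &
    p'.2 = p.2 \/ p'.2 = p.2 + k / 2 ^+ n.+1].
  have [bp|] := pselect (bad p n); last by exists p.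
  set h' := h / 2 ^+ n.+1; set k' := k / 2 ^+ n.+1.
  have hE : h / 2 ^+ n = h' + h'.
    by rewrite /h' exprS; field; rewrite expf_neq0.
  have kE : k / 2 ^+ n = k' + k'.
    by rewrite /k' exprS; field; rewrite expf_neq0.
  have h'0 : 0 <= h' by rewrite divr_ge0// exprn_ge0.
  have k'0 : 0 <= k' by rewrite divr_ge0// exprn_ge0.
  apply: contrapT => hno.
  have good (p' : R * R) : p'.1 = p.1 \/ p'.1 = p.1 + h' ->
     p'.2 = p.2 \/ p'.2 = p.2 + k' ->
     normc (rect_int F p'.1 (p'.1 + h') p'.2 (p'.2 + k')) <= 4 * e * (h' + k') ^+ 2.
    move=> p1 p2; rewrite leNgt; apply/negP => hb; apply: hno; exists p' => _.
    by split.
  move: bp; rewrite /bad hE kE; apply/negP; rewrite -leNgt.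
  rewrite (rect_int_split (m := p.1 + h') (n := p.2 + k')) //; try lra.
  rewrite [p.1 + (h' + h')]addrA [p.2 + (k' + k')]addrA.
  have g1 := good p (or_introl erefl) (or_introl erefl).
  have g2 := good (p.1 + h', p.2) (or_intror erefl) (or_introl erefl).
  have g3 := good (p.1, p.2 + k') (or_introl erefl) (or_intror erefl).
  have g4 := good (p.1 + h', p.2 + k') (or_intror erefl) (or_intror erefl).
  move: g1 g2 g3 g4 => /= g1 g2 g3 g4.
  apply: (le_trans (le_normcD (_ + _) (_ + _))).
  apply: (le_trans (lerD (le_normcD (rect_int _ _ _ _ _) (rect_int _ _ _ _ _))
    (le_normcD (rect_int _ _ _ _ _) (rect_int _ _ _ _ _)))).
  have -> : h' + h' + (k' + k') = 2 * (h' + k') by ring.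
  have -> : (2 * (h' + k')) ^+ 2 = 4 * (h' + k') ^+ 2 by ring.
  lra.
pose g p n := projT1 (cid (next p n)).
have gP p n := projT2 (cid (next p n)).
pose s := fix s n := if n is m.+1 then g (s m) m else (a, c).
have sbad n : bad (s n) n.
  by elim: n => [//|n ih]; have [] := gP (s n) n ih.
have s1 n : (s n.+1).1 = (s n).1 \/ (s n.+1).1 = (s n).1 + h / 2 ^+ n.+1.
  by have [] := gP (s n) n (sbad n).
have s2 n : (s n.+1).2 = (s n).2 \/ (s n.+1).2 = (s n).2 + k / 2 ^+ n.+1.
  by have [] := gP (s n) n (sbad n).
have halfE (l : R) n : l / 2 ^+ n = l / 2 ^+ n.+1 + l / 2 ^+ n.+1.
  by rewrite exprS; field; rewrite expf_neq0.
have halfge (l : R) n : 0 <= l -> 0 <= l / 2 ^+ n by move=> l0; rewrite divr_ge0// exprn_ge0.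
have [X XP] : exists X, forall n, (s n).1 <= X <= (s n).1 + h / 2 ^+ n.
  apply: (@nested_limit (fun n => (s n).1)) => // n.
    by have := halfge h n.+1 h0; case: (s1 n) => ->; lra.
  by rewrite (halfE h n); have := halfge h n.+1 h0; case: (s1 n) => ->; lra.
have [Y YP] : exists Y, forall n, (s n).2 <= Y <= (s n).2 + k / 2 ^+ n.
  apply: (@nested_limit (fun n => (s n).2)) => // n.
    by have := halfge k n.+1 k0; case: (s2 n) => ->; lra.
  by rewrite (halfE k n); have := halfge k n.+1 k0; case: (s2 n) => ->; lra.
have in1 n : a <= (s n).1 /\ (s n).1 + h / 2 ^+ n <= b.
  elim: n => [|n [i1 i2]]; first by rewrite /= expr0 divr1 /h; lra.
  rewrite (halfE h n) in i2; have := halfge h n.+1 h0; case: (s1 n) => ->; lra.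
have in2 n : c <= (s n).2 /\ (s n).2 + k / 2 ^+ n <= d.
  elim: n => [|n [i1 i2]]; first by rewrite /= expr0 divr1 /k; lra.
  rewrite (halfE k n) in i2; have := halfge k n.+1 k0; case: (s2 n) => ->; lra.
have Xab : a <= X <= b by have := XP 0%N; have := in1 0%N; lra.
have Ycd : c <= Y <= d by have := YP 0%N; have := in2 0%N; lra.
have [D /(_ _ e0)[dl dl0 hD]] := dF X Y Xab Ycd.
have [n hn] : exists n, h / 2 ^+ n + k / 2 ^+ n < dl.
  have : (fun n => (h + k) * (2^-1) ^+ n) @ \oo --> (h + k) * 0.
    have h1 : `|2^-1 : R| < 1 by rewrite ger0_norm ?invr_ge0// invf_lt1// ltr1n.
    by apply: cvgM; [exact: cvg_cst|exact: cvg_expr].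
  rewrite mulr0 => /cvgrPdist_lt/(_ _ dl0)[N _ /(_ N (leqnn N))] /=.
  rewrite sub0r normrN => hN; exists N.
  by apply: le_lt_trans hN; rewrite -mulrDl exprVn; exact: ler_norm.
(* Near the limit point [F] is affine up to [e] times the distance, and the resulting bound on the
   boundary integral is exactly the threshold in [bad]. *)
have := sbad n; rewrite /bad; apply/negP; rewrite -leNgt.
move: (in1 n) (in2 n) (XP n) (YP n) hn (halfge h n h0) (halfge k n k0).
set hn := h / 2 ^+ n; set kn := k / 2 ^+ n; set x := (s n).1; set y := (s n).2.
move=> [i1 i2] [j1 j2] Xn Yn hk hn0 kn0.
have -> : 4 * e * (hn + kn) ^+ 2 = 4 * (e * (hn + kn)) * ((x + hn - x) + (y + kn - y)) by ring.
apply: (@rect_int_near_affine F (F X Y - D * (X +i* Y)) D) => //; try lra.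
move=> x' y' xx yy.
have -> : F x' y' - (F X Y - D * (X +i* Y) + D * (x' +i* y')) =
    F x' y' - F X Y - D * ((x' - X) +i* (y' - Y)).
  have -> : (x' - X) +i* (y' - Y) = (x' +i* y') - (X +i* Y) by [].
  ring.
have d1 : `|x' - X| <= hn by rewrite ler_norml; lra.
have d2 : `|y' - Y| <= kn by rewrite ler_norml; lra.
apply: (le_trans (hD _ _ _ _ _ _)); try lra.
by rewrite ler_wpM2l ?(ltW e0)//; lra.
Qed.

End Goursat.

(** * Exponential coordinates and circle integrals *)

Section LogCoordinates.
Variable R : realType.
Implicit Types (v q : R[i] -> R[i]) (z w : R[i]) (a b r s t : R).

Lemma derive_eps (f : R -> R) (x d : R) : is_derive x 1 f d -> forall e, 0 < e ->
  exists2 dl : R, 0 < dl & forall h : R, `|h| < dl -> `|f (x + h) - f x - d * h| <= e * `|h|.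
Proof.
move=> [/cvg_ex[/= l hl] dE] e e0.
have ld : l = d by rewrite -dE; apply/esym/cvg_lim.
move/cvgrPdist_lt : hl => /(_ _ e0)[/= dl dl0 hd].
exists dl => // h hh; have [->|h0] := eqVneq h 0.
  by rewrite addr0 subrr mulr0 subr0 normr0 mulr0.
have := hd h; rewrite /= sub0r normrN ld => /(_ hh h0) /ltW.
rewrite /GRing.scale /= mulr1 [h + x]addrC => hle.
have -> : f (x + h) - f x - d * h = - (d - h^-1 * (f (x + h) - f x)) * h by field.
by rewrite normrM normrN ler_wpM2r.
Qed.

(* In the coordinate s + i t of z = exp (s + i t), rectangles are sectors of annuli, so that
   Goursat's lemma yields Cauchy's theorem on annuli. *)
Definition ecis s t : R[i] := (expR s)%:C * cis t.

Lemma ecisD s t s' t' : ecis (s + s') (t + t') = ecis s t * ecis s' t'.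
Proof. by rewrite /ecis expRD cisD rmorphM; ring. Qed.

Lemma normc_ecis s t : normc (ecis s t) = expR s.
Proof. by rewrite normcM normc_cis mulr1 normc_pos ?expR_ge0. Qed.

Lemma cis_diff0 e : 0 < e -> exists2 dl : R, 0 < dl & forall k : R, `|k| < dl ->
  normc (cis k - 1 - 'i%C * k%:C) <= e * `|k|.
Proof.
move=> e0; have e2 : 0 < e / 2 by rewrite divr_gt0.
have [d1 d10 h1] := derive_eps (is_derive_cos 0) e2.
have [d2 d20 h2] := derive_eps (is_derive_sin 0) e2.
exists (Num.min d1 d2); first by rewrite lt_min d10.
move=> k; rewrite lt_min => /andP[/h1 {}h1 /h2 {}h2].
apply: (le_trans (normc_le_ReIm _)).
have -> : Re (cis k - 1 - 'i%C * k%:C) = cos (0 + k) - cos 0 - - sin 0 * k.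
  by rewrite add0r cos0 sin0 /cis /=; ring.
have -> : Im (cis k - 1 - 'i%C * k%:C) = sin (0 + k) - sin 0 - cos 0 * k.
  by rewrite add0r cos0 sin0 /cis /=; ring.
by apply: (le_trans (lerD h1 h2)); rewrite -mulrDl -splitr.
Qed.

Lemma ecis_diff0 e : 0 < e -> exists2 dl : R, 0 < dl & forall h k : R, `|h| < dl -> `|k| < dl ->
  normc (ecis h k - 1 - (h +i* k)) <= e * (`|h| + `|k|).
Proof.
move=> e0; pose e' := Num.min (e / 4) 1.
have e'0 : 0 < e' by rewrite lt_min divr_gt0//=.
have e'1 : e' <= 1 by rewrite ge_min lexx orbT.
have e'e : e' <= e / 4 by rewrite ge_min lexx.
have [d1 d10 h1] := derive_eps (is_derive_expR 0) e'0.
have [d2 d20 h2] := cis_diff0 e'0.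
exists (Num.min (Num.min d1 d2) (e' / 2)); first by rewrite !lt_min d10 d20 divr_gt0.
move=> h k; rewrite !lt_min => /andP[/andP[hd1 _] he] /andP[/andP[_ kd2] _].
have {h1} := h1 _ hd1; rewrite add0r expR0 mul1r => h1.
have {}h2 := h2 _ kd2.
have ch : normc (cis k - 1) <= 2 * `|k|.
  have := le_normcD (cis k - 1 - 'i%C * k%:C) ('i%C * k%:C).
  rewrite subrK normcM normc_real (_ : normc ('i%C : R[i]) = 1); last first.
    by rewrite /normc /= expr0n expr1n add0r sqrtr1.
  have : e' * `|k| <= 1 * `|k| by rewrite ler_wpM2r.
  by move: h2; clear; lra.
have eh : `|expR h - 1| <= e'.
  have := ler_normD (expR h - 1 - h) h; rewrite subrK.
  have : e' * `|h| <= 1 * `|h| by rewrite ler_wpM2r.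
  by move: h1 he; clear; lra.
have -> : ecis h k - 1 - (h +i* k) = (expR h - 1 - h)%:C + (expR h - 1)%:C * (cis k - 1)
   + (cis k - 1 - 'i%C * k%:C).
  rewrite [h +i* k]complexE /= /ecis !rmorphB /= rmorph1; ring.
apply: (le_trans (le_normcD _ _)).
apply: (le_trans (lerD (le_normcD _ _) (lexx _))).
rewrite normcM !normc_real.
have p : `|expR h - 1| * normc (cis k - 1) <= e' * (2 * `|k|).
  by apply: ler_pM => //; exact: normc_ge0.
have q1 : e' * `|h| <= e / 4 * `|h| by rewrite ler_wpM2r.
have q2 : e' * `|k| <= e / 4 * `|k| by rewrite ler_wpM2r.
have q3 : 0 <= e * `|h| by rewrite mulr_ge0 ?(ltW e0).
have q4 : 0 <= e * `|k| by rewrite mulr_ge0 ?(ltW e0).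
by move: h1 h2 p q1 q2 q3 q4; clear; lra.
Qed.

Lemma rcont_eps (g : R -> R[i]) :
  (forall x e, 0 < e -> \forall y \near x, normc (g y - g x) < e) -> rcont g.
Proof.
move=> h; split=> x; apply/cvgrPdist_lt => e e0; have := h x _ e0; apply: filterS => y.
  apply: le_lt_trans; rewrite normcC.
  have -> : Re (g x) - Re (g y) = Re (g x - g y) by case: (g x) (g y) => ? ? [].
  exact: normr_Re_le.
apply: le_lt_trans; rewrite normcC.
have -> : Im (g x) - Im (g y) = Im (g x - g y) by case: (g x) (g y) => ? ? [].
exact: normr_Im_le.
Qed.

Lemma eps_rcont (g : R -> R[i]) x e : rcont g -> 0 < e ->
  \forall y \near x, normc (g y - g x) < e.
Proof.
move=> [g1 g2] e0; have e2 : 0 < e / 2 by rewrite divr_gt0.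
have /cvgrPdist_lt/(_ _ e2) h1 := g1 x.
have /cvgrPdist_lt/(_ _ e2) h2 := g2 x.
near=> y; apply: (le_lt_trans (normc_le_ReIm _)).
have -> : Re (g y - g x) = - (Re (g x) - Re (g y)) by case: (g x) (g y) => ? ? [? ?] /=; ring.
have -> : Im (g y - g x) = - (Im (g x) - Im (g y)) by case: (g x) (g y) => ? ? [? ?] /=; ring.
rewrite !normrN [e]splitr ltrD//; [near: y; exact: h1|near: y; exact: h2].
Unshelve. all: by end_near. Qed.

Lemma rcont_comp v (g : R -> R[i]) : rcont g -> (forall x, ccont v (g x)) ->
  rcont (fun x => v (g x)).
Proof.
move=> cg cv; apply: rcont_eps => x e e0; have [d d0 hd] := cv x _ e0.
by have := eps_rcont x cg d0; apply: filterS => y /hd.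
Qed.

Lemma rcont_polar (f h : R -> R) : continuous f -> continuous h ->
  rcont (fun x => (f x)%:C * cis (h x)).
Proof.
move=> cf ch; split.
  rewrite (_ : (fun _ => _) = (fun x => f x * cos (h x))).
    move=> x; apply: cvgM; first exact: cf.
    by apply: continuous_comp; [exact: ch|exact: continuous_cos].
  by apply/funext => x; rewrite /cis /=; ring.
rewrite (_ : (fun _ => _) = (fun x => f x * sin (h x))).
  move=> x; apply: cvgM; first exact: cf.
  by apply: continuous_comp; [exact: ch|exact: continuous_sin].
by apply/funext => x; rewrite /cis /=; ring.
Qed.

(** Integration is against the angle, that is against dz / (i z); in this normalization the integral
    of a holomorphic function does not depend on the radius. *)
Definition circle_int r v : R[i] := cint 0 (pi *+ 2) (fun t => v (r%:C * cis t)).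

Lemma rcont_circle r v : 0 <= r -> (forall z, normc z = r -> ccont v z) ->
  rcont (fun t => v (r%:C * cis t)).
Proof.
move=> r0 cv; apply: (@rcont_comp v (fun t => r%:C * cis t)).
  by apply: (rcont_polar (f := fun=> r) (h := id)) => x; [exact: cvg_cst|exact: cvg_id].
by move=> t; apply: cv; rewrite normcM normc_cis mulr1 normc_pos.
Qed.

(** Goursat's theorem for [v] composed with exp on [[ln r1, ln r2] x [0, 2 pi]]: the horizontal
    sides cancel by periodicity, and the vertical ones are the two circle integrals times i. *)
Lemma circle_int_const v r1 r2 : 0 < r1 -> r1 <= r2 ->
  (forall z, r1 <= normc z <= r2 -> cdiff v z) -> circle_int r1 v = circle_int r2 v.
Proof.
move=> r10 r12 dv; have r20 : 0 < r2 := lt_le_trans r10 r12.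
pose s1 := ln r1; pose s2 := ln r2.
have s12 : s1 <= s2 by rewrite ler_ln ?posrE.
(* The logarithm of the radius is clamped because [sep_cont] asks for continuity on the whole plane,
   while [v] is regular only between the two circles. *)
pose cl s := Num.max s1 (Num.min s s2).
have clI s : s1 <= s <= s2 -> cl s = s.
  by move=> /andP[h1 h2]; rewrite /cl (min_idPl h2) (max_idPr h1).
have cl1 s : s1 <= cl s by rewrite le_max lexx.
have cl2 s : cl s <= s2 by rewrite ge_max s12 ge_min lexx orbT.
have ccl : continuous cl.
  move=> s; apply: (@continuous_max _ _ (fun=> s1) (fun s => Num.min s s2)).
    exact: cvg_cst.
  apply: (@continuous_min _ _ id (fun=> s2)); [exact: cvg_id|exact: cvg_cst].
pose F s t := v (ecis (cl s) t).
have inA s t : r1 <= normc (ecis (cl s) t) <= r2.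
  by rewrite normc_ecis -[X in X <= _ <= _](lnK r10) -[X in _ <= _ <= X](lnK r20) !ler_expR cl1 cl2.
have cF : sep_cont F.
  split=> [t|s].
    apply: (rcont_comp (g := fun s => ecis (cl s) t)); last by move=> s; apply/cdiff_cont/dv.
    apply: (rcont_polar (f := fun s => expR (cl s)) (h := fun=> t)) => s; last exact: cvg_cst.
    by apply: continuous_comp; [exact: ccl|exact: continuous_expR].
  apply: (rcont_comp (g := fun t => ecis (cl s) t)); last by move=> t; apply/cdiff_cont/dv.
  by apply: (rcont_polar (f := fun=> expR (cl s)) (h := id)) => t; [exact: cvg_cst|exact: cvg_id].
have dF s t : s1 <= s <= s2 -> 0 <= t <= pi *+ 2 -> diff_within F s1 s2 0 (pi *+ 2) s t.
  move=> hs ht; have [p cp vE] := dv _ (inA s t).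
  move: cp vE; set z := ecis _ _ => cp vE.
  exists (p z * z) => e e0.
  have n0 := normc_ge0 z; have np := normc_ge0 (p z).
  pose A := normc z + 1; pose B := normc (p z) + 1.
  have A0 : 0 < A by rewrite ltr_wpDl.
  have B0 : 0 < B by rewrite ltr_wpDl.
  have [d1 d10 h1] := cp _ (divr_gt0 e0 (mulr_gt0 (ltr0n _ 4) A0)).
  pose e' := Num.min 1 (e / (2 * (B * A))).
  have e'0 : 0 < e' by rewrite lt_min ltr01 divr_gt0// mulr_gt0// mulr_gt0.
  have [d2 d20 h2] := ecis_diff0 e'0.
  pose d3 := d1 / (2 * A) / 2.
  have d30 : 0 < d3 by rewrite !divr_gt0// mulr_gt0.
  exists (Num.min d2 d3); first by rewrite lt_min d20.
  move=> s' t' hs' ht'; rewrite !lt_min => /andP[a1 a2] /andP[b1 b2].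
  have zE : ecis (cl s') t' - z = z * (ecis (s' - s) (t' - t) - 1).
    by rewrite mulrBr mulr1 {2}/z (clI _ hs) (clI _ hs') -ecisD !subrKC.
  set h := s' - s in a1 a2 zE *; set k := t' - t in b1 b2 zE *.
  have {}h2 := h2 h k a1 b1.
  pose D := `|h| + `|k|; have D0 : 0 <= D by rewrite addr_ge0.
  have hkD : normc (h +i* k) <= D by exact: normc_le_ReIm.
  have e'1 : e' <= 1 by rewrite ge_min lexx.
  have b3 : normc (ecis h k - 1) <= 2 * D.
    have := le_normcD (ecis h k - 1 - (h +i* k)) (h +i* k); rewrite subrK.
    have : e' * D <= 1 * D by rewrite ler_wpM2r.
    by move: h2 hkD; rewrite -/D; clear; lra.
  have b4 : normc z * normc (ecis h k - 1) <= A * (2 * D).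
    by apply: ler_pM => //; [exact: normc_ge0|rewrite lerDl].
  have near1 : normc (p (ecis (cl s') t') - p z) < e / (4 * A).
    apply: h1; rewrite zE (normcM z); apply: (le_lt_trans b4).
    have D3 : D < d3 + d3 by rewrite ltrD.
    rewrite mulrCA mulrA mulrC -ltr_pdivlMr ?mulr_gt0//; apply: (lt_le_trans D3).
    by rewrite /d3 -splitr.
  rewrite /F vE zE.
  have -> : p (ecis (cl s') t') * (z * (ecis h k - 1)) - p z * z * (h +i* k) =
     (p (ecis (cl s') t') - p z) * (z * (ecis h k - 1)) +
     p z * (z * (ecis h k - 1 - (h +i* k))) by ring.
  apply: (le_trans (le_normcD _ _)); rewrite (normcM (p _ - p z)) (normcM (p z)) !(normcM z) -/D [e * D]mulrC [e]splitr mulrDr.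
  apply: lerD.
    have -> : D * (e / 2) = e / (4 * A) * (A * (2 * D)) by field; exact: lt0r_neq0.
    apply: ler_pM; [exact: normc_ge0|by rewrite mulr_ge0 ?normc_ge0|exact: ltW|exact: b4].
  have -> : D * (e / 2) = B * (A * (e / (2 * (B * A)) * D)).
    by field; rewrite !lt0r_neq0.
  apply: ler_pM; [exact: normc_ge0|by rewrite mulr_ge0 ?normc_ge0|by rewrite lerDl|].
  apply: ler_pM; [exact: normc_ge0|exact: normc_ge0|by rewrite lerDl|].
  apply: (le_trans h2); rewrite ler_wpM2r//.
  by rewrite ge_min lexx orbT.
have := goursat s12 (ltW (pi2_gt0 R)) cF dF.
rewrite /rect_int.
have -> : F ^~ (pi *+ 2) = F ^~ 0.
  by apply/funext => s; rewrite /F /ecis cis_2pi cis0.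
have E r s : 0 < r -> s = ln r -> s1 <= s <= s2 -> F s = (fun t => v (r%:C * cis t)).
  by move=> r0 sE hs; apply/funext => t; rewrite /F /ecis clI// sE lnK.
rewrite (E r1 s1)// ?lexx// (E r2 s2)// ?lexx ?andbT//.
rewrite -/(circle_int r1 v) -/(circle_int r2 v).
set X := cint _ _ _.
have -> : X + 'i%C * circle_int r2 v - X - 'i%C * circle_int r1 v =
  'i%C * (circle_int r2 v - circle_int r1 v) by ring.
move/eqP; rewrite mulf_eq0 subr_eq0 => /orP[|/eqP//].
by rewrite eq_complex /= oner_eq0 andbF.
Qed.

End LogCoordinates.

(** * Exceptional circles and convergence of discrete means *)

Section CircleMeans.
Variable R : realType.
Implicit Types (v q : R[i] -> R[i]) (z w : R[i]) (a b r s t : R).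

(** Compactness in its covering form turns a local threshold into a uniform one; it serves both
    continuity in the radius and Riemann sums. *)
Lemma compact_uniform (P : nat -> R -> Prop) a b :
  (forall t, a <= t <= b -> \forall t' \near t & n \near \oo, P n t') ->
  exists N, forall n, (N <= n)%N -> forall t, a <= t <= b -> P n t.
Proof.
move=> h; have /compact_near_coveringP cov := @segment_compact R a b.
have [|N _ hN] := cov nat \oo P _.
  by move=> t; rewrite /= in_itv /=; exact: h.
by exists N => n Nn t ht; apply: (hN n Nn); rewrite /= in_itv.
Qed.

Lemma circle_int_cont v r0 e : 0 < r0 -> 0 < e ->
  (forall z, normc z = r0 -> ccont v z) ->
  exists2 d, 0 < d & forall r t, `|r - r0| < d -> 0 <= t <= pi *+ 2 ->
    normc (v (r%:C * cis t) - v (r0%:C * cis t)) < e.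
Proof.
move=> r00 e0 cv.
pose P n t := forall r, `|r - r0| < n.+1%:R^-1 ->
  normc (v (r%:C * cis t) - v (r0%:C * cis t)) < e.
have [|N hN] := @compact_uniform P 0 (pi *+ 2); last first.
  exists N.+1%:R^-1 => [|r t rd ht]; first by rewrite invr_gt0.
  exact: (hN N (leqnn N) t ht).
move=> t ht; have e2 : 0 < e / 2 by rewrite divr_gt0.
have n0 : normc (r0%:C * cis t) = r0 by rewrite normcM normc_cis mulr1 normc_pos// ltW.
have [d d0 hd] := cv _ n0 _ e2.
have d2 : 0 < d / 2 by rewrite divr_gt0.
have ct : rcont (fun t => r0%:C * cis t).
  by apply: (rcont_polar (f := fun=> r0) (h := id)) => x; [exact: cvg_cst|exact: cvg_id].
near=> t' n => r rn.
have h1 : normc (r0%:C * cis t' - r0%:C * cis t) < d / 2.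
  by near: t'; exact: (eps_rcont t ct d2).
have h2 : n.+1%:R^-1 < d / 2.
  near: n; exact: (near_infty_natSinv_lt (PosNum d2)).
have h3 : normc (r%:C * cis t' - r0%:C * cis t') < d / 2.
  by rewrite -mulrBl normcM normc_cis mulr1 -rmorphB normc_real (lt_trans rn).
rewrite [e]splitr; apply: (le_lt_trans (normc_dist _ (v (r0%:C * cis t)) _)).
apply: ltrD; last by rewrite normcC; apply: hd; apply: (lt_trans h1); rewrite ltr_pdivrMr// ltr_pMr// ltr1n.
apply: hd; rewrite [d]splitr.
by apply: (le_lt_trans (normc_dist _ (r0%:C * cis t') _)); exact: ltrD.
Unshelve. all: by end_near. Qed.

Lemma circle_int_close v r r0 e : 0 <= r -> 0 <= r0 ->
  (forall z, normc z = r -> ccont v z) -> (forall z, normc z = r0 -> ccont v z) ->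
  (forall t, 0 <= t <= pi *+ 2 -> normc (v (r%:C * cis t) - v (r0%:C * cis t)) <= e) ->
  normc (circle_int r v - circle_int r0 v) <= 2 * e * (pi *+ 2).
Proof.
move=> r_ge0 r0_ge0 c1 c2 h; rewrite /circle_int -cintB; try exact: rcont_circle.
rewrite -[X in _ <= _ * X]subr0; apply: cint_bound => //.
  by apply: rcontB; exact: rcont_circle.
exact/ltW/pi2_gt0.
Qed.

(** One circle on which [v] is merely continuous does no harm: the integral is constant on either
    side of it and continuous at [r0]. The case in view is a difference quotient, whose holomorphy
    at its base point is not yet known. *)
Lemma circle_int_const_exc v a b r0 r1 r2 : 0 <= a ->
  (forall z, a < normc z < b -> ccont v z) ->
  (forall z, a < normc z < b -> normc z != r0 -> cdiff v z) ->
  a < r1 -> r1 <= r2 -> r2 < b -> circle_int r1 v = circle_int r2 v.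
Proof.
move=> a0 cv dv ar1 r12 r2b.
have step s1 s2 : a < s1 -> s1 <= s2 -> s2 < b -> ~~ (s1 <= r0 <= s2) ->
   circle_int s1 v = circle_int s2 v.
  move=> as1 s12 s2b nr; apply: circle_int_const => //; first exact: le_lt_trans as1.
  move=> z /andP[z1 z2]; apply: dv; first by rewrite (lt_le_trans as1)// (le_lt_trans z2).
  by apply: contra nr => /eqP <-; rewrite z1.
have [hr|] := boolP (r1 <= r0 <= r2); last exact: step.
have /andP[h1 h2] := hr.
have r00 : 0 < r0 by apply: (le_lt_trans a0); exact: lt_le_trans h1.
have ar0 : a < r0 by exact: lt_le_trans h1.
have r0b : r0 < b by exact: le_lt_trans r2b.
have cr s : a < s -> s < b -> forall z, normc z = s -> ccont v z.
  by move=> as_ sb z zs; apply: cv; rewrite zs as_.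
have close e : 0 < e -> exists2 d, 0 < d & forall r, a < r -> r < b -> `|r - r0| < d ->
    normc (circle_int r v - circle_int r0 v) <= e.
  move=> e0; have p2 := pi2_gt0 R; have e'0 : 0 < e / (2 * (pi *+ 2)).
    by rewrite divr_gt0// mulr_gt0.
  have [d d0 hd] := circle_int_cont r00 e'0 (cr _ ar0 r0b).
  exists d => // r ar rb rd.
  have -> : e = 2 * (e / (2 * (pi *+ 2))) * (pi *+ 2) 
    by move: (pi *+ 2) (lt0r_neq0 p2) => x x0; field.
  apply: circle_int_close; [|exact: ltW|exact: cr|exact: cr|].
    by apply: ltW; exact: le_lt_trans ar.
  by move=> t ht; apply/ltW/hd.
have eq0 s : a < s -> s < b -> circle_int s v = circle_int r0 v.
  move=> as_ sb; apply/eqP; rewrite -subr_eq0 -normc_eq0; apply/negPn/negP => n0.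
  have {}n0 : 0 < normc (circle_int s v - circle_int r0 v).
    by rewrite lt_neqAle eq_sym n0 normc_ge0.
  have n2 : 0 < normc (circle_int s v - circle_int r0 v) / 2 by rewrite divr_gt0.
  have [d d0 hd] := close _ n2.
  have [sr|rs|sE] := ltgtP s r0; last by move: n0; rewrite sE subrr normc0 ltxx.
    (* The radius [m] lies on the side of [s] and close to [r0]: the integral is unchanged from [s]
       to [m], and at [m] it is close to the one at [r0]. *)
    pose m := Num.max s (r0 - d / 2).
    have m1 : s <= m by rewrite le_max lexx.
    have m2 : m < r0 by rewrite gt_max sr; lra.
    have m3 : `|m - r0| < d.
      rewrite ltr0_norm; last lra.
      have : r0 - d / 2 <= m by rewrite le_max lexx orbT.
      lra.
    have st : circle_int s v = circle_int m v.
      by apply: step => //; [exact: lt_trans r0b|rewrite negb_and -!ltNge m2 orbT].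
    by have := hd m (lt_le_trans as_ m1) (lt_trans m2 r0b) m3; rewrite -st; move: n0; clear; lra.
  pose m := Num.min s (r0 + d / 2).
  have m1 : m <= s by rewrite ge_min lexx.
  have m2 : r0 < m by rewrite lt_min rs; lra.
  have m3 : `|m - r0| < d.
    rewrite gtr0_norm; last lra.
    have : m <= r0 + d / 2 by rewrite ge_min lexx orbT.
    lra.
  have st : circle_int m v = circle_int s v.
    by apply: step => //; [exact: lt_trans m2|rewrite negb_and -!ltNge m2].
  by have := hd m (lt_trans ar0 m2) (le_lt_trans m1 sb) m3; rewrite st; move: n0; clear; lra.
rewrite (eq0 r1)//; last exact: le_lt_trans r2b.
by rewrite (eq0 r2)//; exact: lt_le_trans r12.
Qed.

Lemma cint_riemann (g : R -> R[i]) a h n e : rcont g -> 0 <= h ->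
  (forall t t', a <= t <= a + h *+ n -> t <= t' <= t + h -> normc (g t' - g t) <= e) ->
  normc (cint a (a + h *+ n) g - h%:C * \sum_(j < n) g (a + h *+ j)) <= 2 * e * (h *+ n).
Proof.
move=> cg h0; elim: n => [|n ih] hu.
  rewrite big_ord0 mulr0 subr0 mulr0n addr0 mulr0.
  have := cint_bound cg (lexx a) (K := normc (g a)).
  rewrite subrr mulr0; apply => t /le_anti ->; exact: lexx.
rewrite big_ord_recr /= (cint_chasles cg (b := a + h *+ n)); first last.
- by rewrite lerD2l mulrSr lerDl.
- by rewrite lerDl mulrn_wge0.
have -> : cint a (a + h *+ n) g + cint (a + h *+ n) (a + h *+ n.+1) g -
   h%:C * (\sum_(i < n) g (a + h *+ i) + g (a + h *+ n)) =
   (cint a (a + h *+ n) g - h%:C * \sum_(i < n) g (a + h *+ i)) +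
   (cint (a + h *+ n) (a + h *+ n.+1) g - h%:C * g (a + h *+ n)) by ring.
apply: (le_trans (le_normcD _ _)); rewrite mulrSr mulrDr; apply: lerD.
  apply: ih => t t' /andP[t1 t2]; apply: hu; rewrite t1/= (le_trans t2)//.
  by rewrite lerD2l mulrSr lerDl.
set c := a + h *+ n; have -> : a + (h *+ n + h) = c + h by rewrite addrA.
have ch : c <= c + h by rewrite lerDl.
have -> : h%:C * g c = cint c (c + h) (fun t => g c + 0 * t%:C).
  by rewrite cint_affine// mul0r addr0 addrAC subrr add0r mulrC.
rewrite -cintB//; last exact: rcont_affine.
have -> : 2 * e * h = 2 * e * (c + h - c) by ring.
apply: cint_bound => //; first by apply: rcontB => //; exact: rcont_affine.
move=> t tc; rewrite mul0r addr0; apply: hu => //.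
by rewrite /c lerD2l lerDl mulrn_wge0//= mulrSr lerDl.
Qed.

(** This is how the discrete means inherit convergence, and independence of the radius, from circle
    integrals. *)
Lemma avgc_circle_int v r : 0 < r -> (forall z, normc z = r -> ccont v z) ->
  climit (fun M => avgc M r v) (((pi *+ 2)^-1)%:C * circle_int r v).
Proof.
move=> r0 cv; have p2 := pi2_gt0 R.
apply/climit_epsP => e e0.
have cg := rcont_circle (ltW r0) cv.
set g := fun t => _ in cg.
have e2 : 0 < e / 4 by rewrite divr_gt0.
pose P n t := forall t', t <= t' <= t + (pi *+ 2) / n.+1%:R -> normc (g t' - g t) <= e / 2.
have [|N hN] := @compact_uniform P 0 (pi *+ 2).
  move=> t ht.
  have /nbhs_ballP[d /= d0 hd] := eps_rcont t cg e2.
  have d2 : 0 < d / 2 by rewrite divr_gt0.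
  have d2p : 0 < d / 2 / (pi *+ 2) by rewrite divr_gt0.
  near=> t0 n => t' /andP[t1 t2].
  have h1 : `|t - t0| < d / 2 by near: t0; exact: (nbhsx_ballx t (d/2)).
  have h2 : n.+1%:R^-1 < d / 2 / (pi *+ 2).
    by near: n; exact: (near_infty_natSinv_lt (PosNum d2p)).
  have h3 : (pi *+ 2) / n.+1%:R < d / 2 by rewrite mulrC -ltr_pdivlMr.
  have h4 : normc (g t0 - g t) < e / 4.
    by apply: hd; rewrite /ball /= (lt_trans h1)// ltr_pdivrMr// ltr_pMr// ltr1n.
  have h5 : normc (g t' - g t) < e / 4.
    apply: hd; rewrite /ball /= -(subrKA t0) (le_lt_trans (ler_normD _ _))//.
    rewrite [d]splitr ltrD// ler0_norm ?subr_le0// opprB ltrBlDl.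
    by rewrite (le_lt_trans t2)// ltrD2l.
  apply: (le_trans (normc_dist _ (g t) _)); rewrite (normcC (g t)).
  by move: h4 h5; clear; lra.
exists N.+1 => M NM.
have M0 : (0 < M)%N by exact: leq_trans NM.
have M0R : 0 < M%:R :> R by rewrite ltr0n.
have := @cint_riemann g 0 ((pi *+ 2) / M%:R) M (e / 2) cg (ltW (divr_gt0 p2 M0R)).
have -> : (pi *+ 2) / M%:R *+ M = pi *+ 2 :> R.
  by rewrite -(mulr_natr (pi *+ 2 / M%:R)) divfK// lt0r_neq0.
rewrite add0r => h.
have {}h := h _.
have {}h : normc (circle_int r v - ((pi *+ 2) / M%:R)%:C * (\sum_(j < M) v (circle_pt M r j))) <= 2 * (e / 2) * (pi *+ 2).
  have := h _; rewrite (_ : \sum_(j < M) g _ = \sum_(j < M) v (circle_pt M r j)).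
    apply => t t' ht htt; apply: (hN M.-1) => //; first by rewrite -ltnS prednK.
    by rewrite prednK.
  by apply: eq_bigr => j _; rewrite /g /circle_pt add0r -[_ *+ j]mulr_natl.
have -> : avgc M r v - ((pi *+ 2)^-1)%:C * circle_int r v =
   - ((pi *+ 2)^-1)%:C * (circle_int r v - ((pi *+ 2) / M%:R)%:C * (\sum_(j < M) v (circle_pt M r j))).
  rewrite mulrBr !mulNr opprK mulrA -rmorphM mulKf ?lt0r_neq0//=.
  have -> : (M%:R^-1 : R)%:C = M%:R^-1 by rewrite fmorphV rmorph_nat.
  by rewrite /avgc; ring.
have na : normc (- ((pi *+ 2)^-1)%:C : R[i]) = (pi *+ 2)^-1.
  by rewrite normcN normc_pos// invr_ge0 ltW.
rewrite normcM na.
rewrite ler_pdivrMl//; apply: (le_trans h).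
by rewrite [2 * _]mulrC divfK// mulrC.
Unshelve. all: by end_near. Qed.

End CircleMeans.

(** * Cauchy's formula on annuli and disks *)

Section CauchyFormula.
Variable R : realType.
Implicit Types (v q : R[i] -> R[i]) (z w : R[i]) (a b r s t : R).

Lemma slope_off psi v w z : (forall z, v z - v w = psi z * (z - w)) -> z != w ->
  cdiff v z -> cdiff psi z.
Proof.
move=> vE zw cv.
have d0 : 0 < normc (z - w) by rewrite normc_gt0 subr_eq0.
apply: (@cdiff_near _ (fun x => (v x - v w) / (x - w)) _ _ _ d0).
  move=> x xz; rewrite vE mulfK// subr_eq0; apply/eqP => xw.
  by move: xz; rewrite xw normcC ltxx.
apply: cdiff_div; first by rewrite subr_eq0.
  by apply: cdiffB => //; exact: cdiff_cst.
by apply: cdiffB; [exact: cdiff_id|exact: cdiff_cst].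
Qed.

Lemma avgc_slope psi v w M r : 0 <= r -> normc w != r ->
  (forall z, v z - v w = psi z * (z - w)) ->
  avgc M r (fun z => z * psi z) =
  avgc M r (fun z => v z * (z / (z - w))) - v w * avgc M r (fun z => z / (z - w)).
Proof.
move=> r0 wr vE; rewrite -avgcZ -avgcB; apply: eq_avgc => // z zr.
have zw : z - w != 0 by rewrite subr_eq0; apply: contra_neq wr => <-.
by rewrite -mulrBl vE; field.
Qed.

Lemma climit_kernel_out r w : 0 < r -> normc w < r ->
  climit (fun M => avgc M r (fun z => z / (z - w))) 1.
Proof.
move=> r0 wr; have rC : normc r%:C = r by rewrite normc_pos ?ltW.
apply: (@climit_shift_eq _ 1 (fun M => (1 - (w / r%:C) ^+ M)^-1)).
  by move=> M M1; rewrite avgc_cauchy_kernel// lt_eqF.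
rewrite -[X in climit _ X]invr1; apply: climitV; first exact: oner_neq0.
rewrite -[X in climit _ X]subr0; apply: climitB; first exact: climit_cst.
by apply: climit_geom; rewrite normcM normcV rC ltr_pdivrMr// mul1r.
Qed.

Lemma climit_kernel_in r w : 0 < r -> r < normc w ->
  climit (fun M => avgc M r (fun z => z / (z - w))) 0.
Proof.
move=> r0 wr; have rC : normc r%:C = r by rewrite normc_pos ?ltW.
have w0 : w != 0 by rewrite -normc_gt0 (lt_trans r0).
have rC0 : r%:C != 0 :> R[i] by rewrite -normc_gt0 rC.
set y := r%:C / w; have y1 : normc y < 1.
  by rewrite normcM normcV rC ltr_pdivrMr ?mul1r// (lt_trans r0).
apply: (@climit_shift_eq _ 1 (fun M => y ^+ M * (y ^+ M - 1)^-1)).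
  move=> M M1; rewrite avgc_cauchy_kernel// ?gt_eqF//.
  have -> : w / r%:C = y^-1 by rewrite invf_div.
  have y0 : y ^+ M != 0 by rewrite expf_neq0// mulf_neq0 ?invr_eq0.
  have yM : y ^+ M - 1 != 0.
    rewrite subr_eq0; apply/eqP => /(congr1 (@normc R)); rewrite normcX normc1.
    by apply/eqP; rewrite lt_eqF// exprn_ilt1 ?normc_ge0// -lt0n.
  have -> : 1 - y^-1 ^+ M = (y ^+ M - 1) / y ^+ M by rewrite exprVn; field.
  by rewrite invf_div.
rewrite -[X in climit _ X](mul0r (0 - 1)^-1); apply: climitM; first exact: climit_geom.
apply: climitV; first by rewrite sub0r oppr_eq0 oner_neq0.
by apply: climitB; [exact: climit_geom|exact: climit_cst].
Qed.

(** With [psi] the slope of [v] at [w], the function [z * psi z] is continuous and is holomorphic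
    off the circle through [w], so its means on the two circles have the same limit. The remaining
    term is [v w] times the means of the kernel, which tend to 1 on the outer circle and to 0 on the
    inner one. *)
Lemma cauchy_annulus v a b r1 r2 w : 0 <= a ->
  (forall z, a < normc z < b -> cdiff v z) ->
  a < r1 -> r1 < normc w -> normc w < r2 -> r2 < b ->
  climit (fun M => avgc M r2 (fun z => v z * (z / (z - w))) -
                   avgc M r1 (fun z => v z * (z / (z - w)))) (v w).
Proof.
move=> a0 dv ar1 r1w wr2 r2b.
have r10 : 0 < r1 by exact: le_lt_trans ar1.
have r20 : 0 < r2 by rewrite (lt_trans r10)// (lt_trans r1w).
have wab : a < normc w < b by rewrite (lt_trans ar1)// (lt_trans wr2).
have [psi cpsi vE] := dv _ wab.
pose q z := z * psi z.
have cq z : a < normc z < b -> ccont q z.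
  move=> zab; apply: ccontM; first exact: ccont_id.
  have [->//|zw] := eqVneq z w.
  by apply/cdiff_cont/(slope_off vE zw)/dv.
have dq z : a < normc z < b -> normc z != normc w -> cdiff q z.
  move=> zab zw; apply: cdiffM; first exact: cdiff_id.
  by apply: (slope_off vE _ (dv _ zab)); apply: contra_neq zw => ->.
have I12 : circle_int r1 q = circle_int r2 q.
  by apply: (circle_int_const_exc a0 cq dq) => //; apply: ltW; exact: lt_trans wr2.
have l1 := @avgc_circle_int _ q r1 r10 _; have l2 := @avgc_circle_int _ q r2 r20 _.
have {}l1 : climit (fun M => avgc M r1 q) (((pi *+ 2)^-1)%:C * circle_int r1 q).
  by apply: l1 => z zr; apply: cq; rewrite zr ar1 (lt_trans r1w)// (lt_trans wr2).
have {}l2 : climit (fun M => avgc M r2 q) (((pi *+ 2)^-1)%:C * circle_int r2 q).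
  by apply: l2 => z zr; apply: cq; rewrite zr r2b (lt_trans ar1)// (lt_trans r1w).
have := climitB l2 l1; rewrite I12 subrr => l.
have k2 := climitZ (v w) (climit_kernel_out r20 wr2).
have k1 := climitZ (v w) (climit_kernel_in r10 r1w).
have := climitD l (climitB k2 k1).
rewrite mulr1 mulr0 subr0 add0r; apply: climit_eq => M.
rewrite (avgc_slope _ (ltW r10) _ vE) ?gt_eqF// (avgc_slope _ (ltW r20) _ vE) ?lt_eqF//.
ring.
Qed.

Lemma cauchy_disk v r w : (forall z, normc z < 1 -> cdiff v z) ->
  normc w < r -> r < 1 ->
  climit (fun M => avgc M r (fun z => v z * (z / (z - w)))) (v w).
Proof.
move=> dv wr r1; have r0 : 0 < r by rewrite (le_lt_trans _ wr)// normc_ge0.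
have [psi cpsi vE] := dv _ (lt_trans wr r1).
pose q z := z * psi z.
have cq z : normc z < 1 -> ccont q z.
  move=> z1; apply: ccontM; first exact: ccont_id.
  have [->//|zw] := eqVneq z w.
  by apply/cdiff_cont/(slope_off vE zw)/dv.
have dq z : normc z < 1 -> normc z != normc w -> cdiff q z.
  move=> z1 zw; apply: cdiffM; first exact: cdiff_id.
  by apply: (slope_off vE _ (dv _ z1)); apply: contra_neq zw => ->.
(* The integrand [q] vanishes at 0, so on a small enough circle the integral, which is the same for
   all radii, is at most half of its own modulus. *)
have I0 : circle_int r q = 0.
  apply/eqP; rewrite -normc_eq0; apply/negPn/negP => n0.
  have {}n0 : 0 < normc (circle_int r q) by rewrite lt_neqAle eq_sym n0 normc_ge0.
  have p2 := pi2_gt0 R.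
  have e0 : 0 < normc (circle_int r q) / (4 * (pi *+ 2)) by rewrite divr_gt0// mulr_gt0.
  have z01 : normc (0 : R[i]) < 1 by rewrite normc0.
  have [d d0 hd] := cq 0 z01 _ e0.
  pose s := Num.min (r / 2) (d / 2).
  have s0 : 0 < s by rewrite lt_min !divr_gt0.
  have sr : s < r.
    by rewrite (@le_lt_trans _ _ (r / 2)) ?ge_min ?lexx// ltr_pdivrMr// ltr_pMr// ltr1n.
  have sd : s < d.
    by rewrite (@le_lt_trans _ _ (d / 2)) ?ge_min ?lexx ?orbT// ltr_pdivrMr// ltr_pMr// ltr1n.
  have Ers : circle_int s q = circle_int r q.
    apply: (@circle_int_const_exc _ q 0 1 (normc w)) => //.
    - by move=> z /andP[_]; exact: cq.
    - by move=> z /andP[_]; exact: dq.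
    - exact: ltW.
  have : normc (circle_int s q) <= 2 * (normc (circle_int r q) / (4 * (pi *+ 2))) * (pi *+ 2 - 0).
    apply: cint_bound; last first.
    - move=> t _; apply: ltW; have := hd (s%:C * cis t).
      rewrite /q mul0r !subr0 normcM normc_cis mulr1 normc_pos ?(ltW s0)//.
      exact.
    - exact: ltW.
    apply: (rcont_circle (ltW s0)).
    by move=> z zs; apply: cq; rewrite zs (lt_trans sr).
  rewrite Ers subr0.
  have -> : 2 * (normc (circle_int r q) / (4 * (pi *+ 2))) * (pi *+ 2) = normc (circle_int r q) / 2.
    by move: (pi *+ 2) (lt0r_neq0 p2) => x x0; field.
  by move: n0; clear; lra.
have l := @avgc_circle_int _ q r r0 _.
have {}l : climit (fun M => avgc M r q) 0.
  rewrite -(mulr0 (((pi *+ 2)^-1)%:C)) -I0; apply: l => z zr; apply: cq; by rewrite zr.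
have k2 := climitZ (v w) (climit_kernel_out r0 wr).
have := climitD l k2.
rewrite mulr1 add0r; apply: climit_eq => M.
rewrite (avgc_slope _ (ltW r0) _ vE) ?lt_eqF//.
ring.
Qed.

End CauchyFormula.

(** * Taylor expansion and removable singularities *)

Section Holomorphic.
Variable R : realType.
Implicit Types (v f g h : R[i] -> R[i]) (z w : R[i]) (a b r s t K : R) (n m N : nat).

Definition holo v := forall z, normc z < 1 -> cdiff v z.

Lemma climit_le u (l : R[i]) K : climit u l -> (\forall n \near \oo, normc (u n) <= K) ->
  normc l <= K.
Proof. by move=> /climit_normc/cvgr_to_le; exact. Qed.

Lemma circle_bounded v r : 0 <= r -> (forall z, normc z = r -> ccont v z) ->
  exists2 K, 0 <= K & forall z, normc z = r -> normc (v z) <= K.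
Proof.
move=> r0 cv; have [c1 c2] := rcont_circle r0 cv.
set g := fun t => _ in c1 c2.
have cn : continuous (fun t => `|Re (v (r%:C * cis t))| + `|Im (v (r%:C * cis t))|).
  by move=> t; apply: cvgD; apply: cvg_norm; [exact: c1|exact: c2].
have pp : - pi <= pi :> R by rewrite (le_trans _ (pi_ge0 R))// oppr_le0 pi_ge0.
have [c _ hc] := EVT_max pp (continuous_subspaceT cn).
exists (`|Re (v (r%:C * cis c))| + `|Im (v (r%:C * cis c))|); first by rewrite addr_ge0.
move=> z zr; have [t ht zE] := polarP z.
apply: (le_trans (normc_le_ReIm _)); rewrite {1 2}zE zr.
by apply: hc; rewrite in_itv.
Qed.

Lemma holo_bounded v r : holo v -> 0 <= r -> r < 1 ->
  exists2 K, 0 <= K & forall z, normc z = r -> normc (v z) <= K.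
Proof.
by move=> hv r0 r1; apply: circle_bounded => // z zr; apply/cdiff_cont/hv; rewrite zr.
Qed.

(* The radius 1/2 is irrelevant, see [climit_coef]. *)
Definition coef v n : R[i] :=
  ((pi *+ 2)^-1)%:C * circle_int 2^-1 (fun z => v z * z ^- n).

Lemma cdiff_expV n z : z != 0 -> cdiff (fun z => z ^- n) z.
Proof. by move=> z0; apply: cdiffV; [rewrite expf_neq0|apply/cdiffX/cdiff_id]. Qed.

Lemma climit_coef v r n : holo v -> 0 < r -> r < 1 ->
  climit (fun M => avgc M r (fun z => v z * z ^- n)) (coef v n).
Proof.
move=> hv r0 r1.
have dv s1 s2 : 0 < s1 -> s2 < 1 -> forall z, s1 <= normc z <= s2 -> cdiff (fun z => v z * z ^- n) z.
  move=> s10 s21 z /andP[z1 z2]; apply: cdiffM; first by apply: hv; exact: le_lt_trans z2 _.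
  by apply: cdiff_expV; rewrite -normc_gt0 (lt_le_trans s10).
have h1 : 2^-1 < 1 :> R by rewrite invf_lt1// ltr1n.
pose F z := v z * z ^- n.
have E : circle_int 2^-1 F = circle_int r F.
  have h0 : 0 < 2^-1 :> R by rewrite invr_gt0.
  have [rh|/ltW rh] := leP r 2^-1.
    by apply/esym; apply: (circle_int_const r0 rh); exact: dv r0 h1.
  by apply: (circle_int_const h0 rh); exact: dv h0 r1.
rewrite /coef -/F E.
apply: (@avgc_circle_int R F r r0) => z zr; apply: cdiff_cont; apply: (dv r r r0 r1).
by rewrite zr lexx.
Qed.

(** Subtracting the first [N] terms of its expansion from the Cauchy kernel leaves the kernel times
    [(w / z) ^+ N]. Every discrete mean therefore obeys the bound already, and the bound passes to
    the limit. *)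
Lemma taylor_bound v w r s K N : holo v -> normc w <= r -> r < s -> s < 1 ->
  (forall z, normc z = s -> normc (v z) <= K) ->
  normc (v w - \sum_(n <- iota 0 N) coef v n * w ^+ n) <= K * (s / (s - r)) * (r / s) ^+ N.
Proof.
move=> hv wr rs s1 vK.
have r0 : 0 <= r := le_trans (normc_ge0 w) wr.
have s0 : 0 < s := le_lt_trans r0 rs.
have K0 : 0 <= K by have := vK s%:C (normc_pos (ltW s0)); exact/le_trans/normc_ge0.
have ws : normc w < s := le_lt_trans wr rs.
have l1 := cauchy_disk hv ws s1.
have l2 : climit (fun M => \sum_(n <- iota 0 N) w ^+ n * avgc M s (fun z => v z * z ^- n))
    (\sum_(n <- iota 0 N) coef v n * w ^+ n).
  elim: (iota 0 N) => [|n l ih].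
    rewrite big_nil; apply: climit_eq (climit_cst 0) => M; by rewrite big_nil.
  rewrite big_cons mulrC.
  by apply: climit_eq (climitD (climitZ (w ^+ n) (climit_coef n hv s0 s1)) ih) => M; rewrite big_cons.
apply: climit_le (climitB l1 l2) _; apply: nearW => M.
under eq_bigr do rewrite -avgcZ.
rewrite -avgc_sum -avgcB.
have B0 : 0 <= K * (s / (s - r)) * (r / s) ^+ N.
  have sr0 : 0 <= s - r by rewrite subr_ge0 ltW.
  by rewrite !mulr_ge0 ?exprn_ge0 ?mulr_ge0 ?invr_ge0 ?subr_ge0 ?(ltW s0) ?(ltW rs).
apply: normc_avgc_le_cst => //; first exact: ltW.
move=> z zs.
have z0 : z != 0 by rewrite -normc_gt0 zs.
have zw : z - w != 0 by rewrite subr_eq0; apply: contra_neq (negbT (lt_eqF ws)) => <-.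
have -> : v z * (z / (z - w)) - \sum_(n <- iota 0 N) w ^+ n * (v z * z ^- n) =
  v z * (z / (z - w)) * (w / z) ^+ N.
  elim: N {l2 B0} => [|N ih]; first by rewrite big_nil expr0 subr0 mulr1.
  rewrite -addn1 iotaD big_cat /= big_seq1 add0n opprD addrA ih addn1 exprS.
  have -> : w ^+ N * (v z * z ^- N) = v z * (w / z) ^+ N by rewrite expr_div_n; ring.
  by field; rewrite z0 zw.
rewrite !normcM normcX !normcM !normcV zs.
apply: ler_pM; rewrite ?exprn_ge0 ?mulr_ge0 ?invr_ge0 ?normc_ge0 ?(ltW s0)//.
  apply: ler_pM; rewrite ?mulr_ge0 ?invr_ge0 ?normc_ge0 ?(ltW s0)//; first exact: vK.
  rewrite ler_wpM2l ?(ltW s0)// lef_pV2 ?posrE ?normc_gt0// ?subr_gt0//.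
  by have := le_normc_sub z w; rewrite zs; move: wr; clear; lra.
rewrite lerXn2r ?nnegrE ?mulr_ge0 ?invr_ge0 ?normc_ge0 ?(ltW s0)//.
by rewrite ler_wpM2r// invr_ge0 ltW.
Qed.

Lemma cdiff_quadratic f z0 (A B : R[i]) d K : 0 < d ->
  (forall z, normc (z - z0) < d -> normc (f z - A - B * (z - z0)) <= K * normc (z - z0) ^+ 2) ->
  cdiff f z0.
Proof.
move=> d0 hf.
have fA : f z0 = A.
  have := hf z0; rewrite subrr normc0 expr0n mulr0 => /(_ d0); rewrite mulr0 subr0 => h.
  by apply/eqP; rewrite -subr_eq0 -normc_eq0 eq_le h normc_ge0.
exists (fun z => if z == z0 then B else (f z - f z0) / (z - z0)); last first.
  by move=> z; case: eqP => [->|/eqP zz]; rewrite ?subrr ?mulr0// divfK// subr_eq0.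
have K1 : 0 < `|K| + 1 by rewrite ltr_wpDl.
move=> e e0; exists (Num.min d (e / (`|K| + 1))); first by rewrite lt_min d0 divr_gt0.
move=> z; rewrite lt_min eqxx => /andP[zd ze].
case: eqP => [_|/eqP zz]; first by rewrite subrr normc0.
have n0 : 0 < normc (z - z0) by rewrite normc_gt0 subr_eq0.
have zz0 : z - z0 != 0 by rewrite subr_eq0.
have -> : (f z - f z0) / (z - z0) - B = (f z - A - B * (z - z0)) / (z - z0).
  by rewrite fA; field.
rewrite normcM normcV ltr_pdivrMr//.
apply: (le_lt_trans (hf z zd)); rewrite expr2 mulrA ltr_pM2r//.
apply: (@le_lt_trans _ _ (`|K| * normc (z - z0))); first by rewrite ler_wpM2r ?normc_ge0// ler_norm.
apply: (@le_lt_trans _ _ ((`|K| + 1) * normc (z - z0))).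
  by rewrite ler_wpM2r ?normc_ge0// lerDl.
by rewrite mulrC -ltr_pdivlMr.
Qed.

Lemma ccont_close f z (l : R[i]) K d : 0 < d -> ccont f z ->
  (forall w, normc (w - z) < d -> w != z -> normc (f w - l) <= K * normc (w - z)) ->
  f z = l.
Proof.
move=> d0 cf hf; apply/eqP; rewrite -subr_eq0 -normc_eq0; apply/negPn/negP => n0.
have {}n0 : 0 < normc (f z - l) by rewrite lt_neqAle eq_sym n0 normc_ge0.
have n2 : 0 < normc (f z - l) / 2 by rewrite divr_gt0.
have [d' d'0 hd] := cf _ n2.
have K1 : 0 < `|K| + 1 by rewrite ltr_wpDl.
have e0 : 0 < normc (f z - l) / 2 / (`|K| + 1) by rewrite divr_gt0.
pose x := Num.min (d / 2) (Num.min (d' / 2) (normc (f z - l) / 2 / (`|K| + 1))).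
have x0 : 0 < x by rewrite !lt_min !divr_gt0.
have xd : x < d by rewrite (@le_lt_trans _ _ (d / 2)) ?ge_min ?lexx//; lra.
have xd' : x < d' by rewrite (@le_lt_trans _ _ (d' / 2)) ?ge_min ?lexx ?orbT//; lra.
have xe : x <= normc (f z - l) / 2 / (`|K| + 1) by rewrite !ge_min lexx !orbT.
have wz : z + x%:C - z = x%:C by rewrite addrC addKr.
have nw : normc (z + x%:C - z) = x by rewrite wz normc_pos// ltW.
have h1 : normc (f (z + x%:C) - f z) < normc (f z - l) / 2 by apply: hd; rewrite nw.
have h2 : normc (f (z + x%:C) - l) <= normc (f z - l) / 2.
  apply: (le_trans (hf _ _ _)); rewrite ?nw//.
    by rewrite -subr_eq0 wz -normc_gt0 normc_pos// ltW.
  apply: (@le_trans _ _ ((`|K| + 1) * x)).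
    by rewrite ler_wpM2r ?(ltW x0)// (le_trans (ler_norm _))// lerDl.
  by rewrite mulrC -ler_pdivlMr.
have := normc_dist (f z) (f (z + x%:C)) l; rewrite normcC in h1.
by move: h1 h2; clear; lra.
Qed.

(** This is the removability of a singularity. Away from [z0] the slope is a quotient; at [z0]
    Cauchy's formula on a larger circle gives it a second-order expansion, from which
    [cdiff_quadratic] yields differentiability. *)
Lemma holo_slope v psi z0 : holo v -> normc z0 < 1 -> ccont psi z0 ->
  (forall z, v z - v z0 = psi z * (z - z0)) -> holo psi.
Proof.
move=> hv z01 cpsi vE z z1.
have [->|zz0] := eqVneq z z0; last exact: (slope_off vE zz0 (hv _ z1)).
clear z z1.
pose r := (1 + normc z0) / 2.
have r1 : r < 1 by rewrite /r; lra.
have rz : normc z0 < r by rewrite /r; lra.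
have r0 : 0 < r := le_lt_trans (normc_ge0 _) rz.
have [K K0 vK] := holo_bounded hv (ltW r0) r1.
pose d := (r - normc z0) / 2.
have d0 : 0 < d by rewrite /d; lra.
have far z : normc z = r -> normc (z - z0) >= d + d.
  by move=> zr; have := le_normc_sub z z0; rewrite zr /d; lra.
have far' z w : normc z = r -> normc (w - z0) < d -> normc (z - w) >= d.
  move=> zr wd; have := far z zr; have := normc_dist z w z0; lra.
have neq0 z : normc z = r -> z - z0 != 0.
  by move=> zr; rewrite -normc_gt0; have := far z zr; lra.
have neq0' z w : normc z = r -> normc (w - z0) < d -> z - w != 0.
  by move=> zr wd; rewrite -normc_gt0; have := far' z w zr wd; lra.
pose G z := v z * z / (z - z0).
have cont m z : normc z = r -> ccont (fun z => G z / (z - z0) ^+ m) z.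
  move=> zr; apply: ccontM.
    apply: ccontM; first by apply: ccontM; [apply/cdiff_cont/hv; rewrite zr|exact: ccont_id].
    by apply: ccontV; [exact: neq0|apply: ccontB; [exact: ccont_id|exact: ccont_cst]].
  apply: cdiff_cont; apply: cdiffV; first by rewrite expf_neq0// neq0.
  by apply: cdiffX; apply: cdiffB; [exact: cdiff_id|exact: cdiff_cst].
(* The limits [L1] and [L2] represent v'(z0) and v''(z0) / 2. *)
have [L1 l1] : exists L, climit (fun M => avgc M r (fun z => G z / (z - z0) ^+ 1)) L.
  by eexists; apply: (@avgc_circle_int R _ r r0) => z zr; exact: cont.
have [L2 l2] : exists L, climit (fun M => avgc M r (fun z => G z / (z - z0) ^+ 2)) L.
  by eexists; apply: (@avgc_circle_int R _ r r0) => z zr; exact: cont.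
pose C := K * r / (d + d) / d / (d + d) ^+ 2.
have C0 : 0 <= C.
  have r0' := ltW r0; have d0' := ltW d0.
  have dd0 : 0 <= d + d by rewrite addr_ge0.
  apply: mulr_ge0; last by rewrite invr_ge0 exprn_ge0.
  apply: mulr_ge0; last by rewrite invr_ge0.
  by apply: mulr_ge0; [exact: mulr_ge0|rewrite invr_ge0].
have key w : normc (w - z0) < d -> w != z0 ->
    normc (psi w - L1 - L2 * (w - z0)) <= C * normc (w - z0) ^+ 2.
  move=> wd wz.
  have wr : normc w < r.
    by have := normc_dist w z0 0; rewrite !subr0; move: wd; rewrite /d; lra.
  have wz' : w - z0 != 0 by rewrite subr_eq0.
  have lw := climitB (cauchy_disk hv wr r1) (cauchy_disk hv rz r1).
  have {}lw := climitZ (w - z0)^-1 lw.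
  have := climitB (climitB lw l1) (climitZ (w - z0) l2).
  rewrite vE mulrC mulfK// [(w - z0) * L2]mulrC => /climit_le; apply.
  apply: nearW => M; rewrite -avgcB -!avgcZ -!avgcB.
  apply: normc_avgc_le_cst; first exact: ltW.
    by rewrite mulr_ge0 ?exprn_ge0 ?normc_ge0.
  move=> z zr; have n1 := neq0 z zr; have n2 := neq0' z w zr wd.
  have -> : (w - z0)^-1 * (v z * (z / (z - w)) - v z * (z / (z - z0))) -
     G z / (z - z0) ^+ 1 - (w - z0) * (G z / (z - z0) ^+ 2) =
     v z * z / (z - z0) / (z - w) / (z - z0) ^+ 2 * (w - z0) ^+ 2.
    have -> : z - w = (z - z0) - (w - z0) by ring.
    have n3 : (z - z0) - (w - z0) != 0 by rewrite opprB addrA subrK.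
    rewrite /G !(mulrA (v z)); move: (v z * z) (z - z0) (w - z0) n1 n3 wz' => x p q p0 pq q0.
    by rewrite expr1; field; rewrite p0 q0 pq.
  rewrite (normcM _ ((w - z0) ^+ 2)) normcX ler_wpM2r ?exprn_ge0 ?normc_ge0//.
  rewrite !normcM !normcV !normcX zr /C.
  have V1 : (normc (z - z0))^-1 <= (d + d)^-1.
    by rewrite lef_pV2 ?posrE ?addr_gt0 ?normc_gt0// far.
  have V2 : (normc (z - w))^-1 <= d^-1 by rewrite lef_pV2 ?posrE ?normc_gt0// far'.
  have V3 : (normc (z - z0) ^+ 2)^-1 <= ((d + d) ^+ 2)^-1.
    by rewrite -!exprVn lerXn2r ?nnegrE ?invr_ge0 ?normc_ge0 ?addr_ge0 ?(ltW d0).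
  have iv (x : R[i]) : 0 <= (normc x)^-1 by rewrite invr_ge0 normc_ge0.
  have P0 : 0 <= normc (v z) * r by apply: mulr_ge0; [exact: normc_ge0|exact: ltW].
  have P1 : normc (v z) * r <= K * r by rewrite ler_wpM2r ?(ltW r0)// vK.
  have P2 := ler_pM P0 (iv _) P1 V1.
  have P3 := ler_pM (mulr_ge0 P0 (iv _)) (iv _) P2 V2.
  apply: (ler_pM _ _ P3 V3); first by apply: mulr_ge0 => //; exact: mulr_ge0.
  by rewrite invr_ge0 exprn_ge0 ?normc_ge0.
(* The expansion [key] is available off [z0] only; continuity of [psi] supplies the value at
   [z0]. *)
have psiL : psi z0 = L1.
  apply: (@ccont_close _ _ _ (normc L2 + C * d) d) => // w wd wz.
  have -> : psi w - L1 = (psi w - L1 - L2 * (w - z0)) + L2 * (w - z0) by ring.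
  apply: (le_trans (le_normcD _ _)); rewrite normcM addrC mulrDl lerD2l.
  apply: (le_trans (key w wd wz)); rewrite expr2 mulrA ler_wpM2r ?normc_ge0//.
  by rewrite ler_wpM2l ?(ltW wd).
apply: (@cdiff_quadratic _ _ L1 L2 d C) => // w wd.
have [->|wz] := eqVneq w z0; last exact: key.
by rewrite psiL !subrr mulr0 subr0 normc0 expr0n mulr0.
Qed.

Lemma holo_factor v z0 : holo v -> normc z0 < 1 -> v z0 = 0 ->
  exists2 h, holo h & forall z, v z = (z - z0) * h z.
Proof.
move=> hv z01 v0; have [psi cpsi vE] := hv _ z01.
exists psi; first exact: holo_slope vE.
by move=> z; rewrite mulrC -vE v0 subr0.
Qed.

End Holomorphic.

(** * Zeros of holomorphic functions and the quotient f / g *)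

Section Quotient.
Variable R : realType.
Implicit Types (v f g h p : R[i] -> R[i]) (z w : R[i]) (c r s K : R) (n m : nat).

Lemma blaschke_lt1 z0 w r : normc z0 < r -> normc w < r ->
  normc (r%:C * (w - z0)) < normc ((r ^+ 2)%:C - z0^* * w).
Proof.
move=> z0r wr; have r0 : 0 < r := le_lt_trans (normc_ge0 _) wr.
rewrite -(ltr_pXn2r (n := 2)) ?nnegrE ?normc_ge0// !sqr_normcE.
have h1 : normc z0 ^+ 2 < r ^+ 2 by rewrite ltrXn2r ?nnegrE ?normc_ge0 ?(ltW r0).
have h2 : normc w ^+ 2 < r ^+ 2 by rewrite ltrXn2r ?nnegrE ?normc_ge0 ?(ltW r0).
rewrite !sqr_normcE in h1 h2; rewrite -subr_gt0.
have := mulr_gt0 (etrans (subr_gt0 _ _) h1) (etrans (subr_gt0 _ _) h2).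
congr (0 < _); case: z0 w {z0r wr h1 h2} => a b [x y] /=; ring.
Qed.

Lemma blaschke_circle z0 z r : 0 < r -> normc z = r ->
  normc (((r ^+ 2)%:C - z0^* * z) / r%:C) = normc (z - z0).
Proof.
move=> r0 zr; rewrite -zr sqr_normc_conj mulrC [z0^* * z]mulrC -mulrBr.
rewrite mulrA normcM -rmorphB normc_conj normcM normcV (normc_pos (normc_ge0 z)) mulVf ?mul1r//.
by rewrite zr lt0r_neq0.
Qed.

(** Divide [g] by the [m]-th power of the Blaschke factor of the disk of radius [r] vanishing at
    [z0]. That factor is unimodular on the circle, so the bound [K] there persists, and inside it
    has modulus [q < 1] at [w]; hence [normc (g w) <= q ^+ m * C] for all [m]. *)
Lemma flat_zero g z0 : holo g -> normc z0 < 1 ->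
  (forall m, exists2 h, holo h & forall z, g z = (z - z0) ^+ m * h z) ->
  forall w, normc w < 1 -> g w = 0.
Proof.
move=> hg z01 flat w w1.
pose r := (1 + Num.max (normc z0) (normc w)) / 2.
have m1 : Num.max (normc z0) (normc w) < 1 by rewrite gt_max z01.
have mz : normc z0 <= Num.max (normc z0) (normc w) by rewrite le_max lexx.
have mw : normc w <= Num.max (normc z0) (normc w) by rewrite le_max lexx orbT.
have r1 : r < 1 by rewrite /r; lra.
have zr : normc z0 < r by rewrite /r; lra.
have wr : normc w < r by rewrite /r; lra.
clearbody r; clear m1 mz mw.
have r0 : 0 < r := le_lt_trans (normc_ge0 _) wr.
have rC : r%:C != 0 :> R[i] by rewrite -normc_gt0 normc_pos// ltW.
have [K K0 gK] := holo_bounded hg (ltW r0) r1.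
pose den z := (r ^+ 2)%:C - z0^* * z.
pose q := normc (r%:C * (w - z0)) / normc (den w).
have lt := blaschke_lt1 zr wr; rewrite -/(den w) in lt.
have dw0 : 0 < normc (den w) := le_lt_trans (normc_ge0 _) lt.
have q1 : q < 1 by rewrite /q ltr_pdivrMr// mul1r.
have q0 : 0 <= q by rewrite /q mulr_ge0 ?invr_ge0 ?normc_ge0.
pose C := K * (r / (r - normc w)).
have bound m : normc (g w) <= q ^+ m * C.
  have [h hh gE] := flat m.
  pose H z := h z * (den z / r%:C) ^+ m.
  have hH : holo H.
    move=> z z1; apply: cdiffM; first exact: hh.
    apply: cdiffX; apply: cdiffM; last exact: cdiff_cst.
    by apply: cdiffB; [exact: cdiff_cst|apply: cdiffM; [exact: cdiff_cst|exact: cdiff_id]].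
  have HK z : normc z = r -> normc (H z) <= K.
    move=> zr'; rewrite normcM normcX blaschke_circle// -normcX -normcM mulrC -gE.
    exact: gK.
  have : normc (H w) <= C.
    have cw := cauchy_disk hH wr r1.
    apply: (climit_le cw); apply: nearW => M.
    apply: normc_avgc_le_cst; first exact: ltW.
      by rewrite /C mulr_ge0// divr_ge0 ?subr_ge0 ?(ltW r0) ?(ltW wr).
    move=> z zr'; rewrite (normcM (H z)) (normcM z) normcV zr'.
    apply: ler_pM; [exact: normc_ge0| |exact: HK|].
      by rewrite mulr_ge0 ?invr_ge0 ?normc_ge0 ?(ltW r0).
    rewrite ler_wpM2l ?(ltW r0)// lef_pV2 ?posrE ?subr_gt0//.
      by have := le_normc_sub z w; rewrite zr'.
    by have := le_normc_sub z w; rewrite zr'; apply: lt_le_trans; rewrite subr_gt0.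
  have -> : g w = (r%:C * (w - z0) / den w) ^+ m * H w.
    have dw : den w != 0 by rewrite -normc_gt0.
    rewrite gE /H mulrCA -exprMn [LHS]mulrC; congr (_ * _ ^+ _).
    by field; rewrite dw rC.
  move=> hC; rewrite normcM normcX ler_pM ?exprn_ge0 ?normc_ge0//.
  by rewrite lerXn2r ?nnegrE ?normc_ge0 ?q0// normcM normcV.
have l0 : (fun m => q ^+ m * C) @ \oo --> (0 : R).
  rewrite -[X in _ --> X](mul0r C); apply: cvgM; last exact: cvg_cst.
  by apply: cvg_expr; rewrite ger0_norm.
apply/eqP; rewrite -normc_eq0 eq_le normc_ge0 andbT.
apply: (@cvgr_to_ge _ _ _ _ _ _ _ l0); apply: nearW => m; exact: bound.
Qed.

(** Removing factors [z - z0] one at a time either stops at a function that does not vanish at [z0],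
    or never stops, and then [flat_zero] applies. *)
Lemma holo_order g z0 : holo g -> normc z0 < 1 ->
  (forall w, normc w < 1 -> g w = 0) \/
  exists m h, [/\ holo h, h z0 != 0 & forall z, g z = (z - z0) ^+ m * h z].
Proof.
move=> hg z01; have [ex|nex] := pselect (exists m h, [/\ holo h, h z0 != 0 &
   forall z, g z = (z - z0) ^+ m * h z]); [by right|left].
apply: (flat_zero hg z01); elim=> [|m [h hh gE]].
  by exists g => // z; rewrite expr0 mul1r.
have h0 : h z0 = 0.
  by apply: contrapT => /eqP h0; apply: nex; exists m, h.
have [h' hh' hE] := holo_factor hh z01 h0.
by exists h' => // z; rewrite gE hE mulrA -exprSr.
Qed.

(** As long as fewer than [m] factors have been removed from [f], domination by [g] forces the
    remaining one to vanish at [z0], so another factor comes out. *)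
Lemma holo_factor_dom f g h z0 m d : holo f -> normc z0 < 1 -> ccont h z0 -> 0 < d ->
  (forall z, normc (z - z0) < d -> normc (f z) <= normc (g z)) ->
  (forall z, g z = (z - z0) ^+ m * h z) ->
  exists2 p, holo p & forall z, f z = (z - z0) ^+ m * p z.
Proof.
move=> hf z01 ch d0 fg gE.
suff H j : (j <= m)%N -> exists2 p, holo p & forall z, f z = (z - z0) ^+ j * p z by exact: H.
elim: j => [_|j ih jm].
  by exists f => // z; rewrite expr0 mul1r.
have [p hp fE] := ih (ltnW jm).
have [d1 d10 hd1] := ch 1 ltr01.
pose K := normc (h z0) + 1.
have p0 : p z0 = 0.
  pose d2 := Num.min (Num.min d d1) 1.
  have d20 : 0 < d2 by rewrite !lt_min d0 d10 ltr01.
  apply: (@ccont_close _ _ _ _ K d2 d20); first exact/cdiff_cont/hp.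
  move=> w; rewrite !lt_min => /andP[/andP[wd wd1] w1] wz; rewrite subr0.
  have n0 : 0 < normc (w - z0) by rewrite normc_gt0 subr_eq0.
  have nj : 0 < normc (w - z0) ^+ j by rewrite exprn_gt0.
  rewrite -(ler_pM2l nj) -normcX -normcM -fE.
  apply: (le_trans (fg _ wd)); rewrite gE normcM normcX mulrCA mulrC.
  rewrite normcX -exprSr; apply: ler_pM; rewrite ?exprn_ge0 ?normc_ge0//.
    have := le_normcD (h w - h z0) (h z0); rewrite subrK => /le_trans; apply.
    by rewrite /K addrC lerD2l ltW// hd1.
  by rewrite -(subnKC jm) exprD ler_piMr ?exprn_ge0 ?normc_ge0// exprn_ile1 ?normc_ge0// ltW.
have [p' hp' pE] := holo_factor hp z01 p0.
by exists p' => // z; rewrite fE pE mulrA -exprSr.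
Qed.

Lemma quotient_holomorphic f g c : 0 < c -> holo f -> holo g ->
  (forall z, c < normc z < 1 -> normc (f z) <= normc (g z)) ->
  (forall w, normc w < 1 -> g w = 0) \/
  exists om : R[i] -> R[i], forall z, c < normc z < 1 ->
    [/\ cdiff om z, normc (om z) <= 1 & f z = om z * g z].
Proof.
move=> c0 hf hg fg.
have [zero|nz] := pselect (forall w, normc w < 1 -> g w = 0); [by left|right].
have loc z0 : c < normc z0 < 1 -> exists p, [/\ cdiff p z0, f z0 = p z0 * g z0 &
   exists2 d, 0 < d & forall z, normc (z - z0) < d -> z != z0 ->
     g z != 0 /\ f z = p z * g z].
  move=> /andP[cz0 z01].
  have [//|[m [h [hh h0 gE]]]] := holo_order hg z01.
  have ch := cdiff_cont (hh _ z01).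
  have [d1 d10 hd1] : exists2 d, 0 < d & forall z, normc (z - z0) < d -> c < normc z < 1.
    exists (Num.min (normc z0 - c) (1 - normc z0)); first by rewrite lt_min !subr_gt0 cz0.
    move=> z; rewrite lt_min => /andP[h1 h2].
    have := le_normc_sub z z0; have := le_normc_sub z0 z; rewrite normcC.
    by move: h1 h2; clear; lra.
  have [p hp fE] := holo_factor_dom hf z01 ch d10 (fun z hz => fg z (hd1 z hz)) gE.
  exists (fun z => p z / h z); split.
  - by apply: cdiff_div => //; [exact: hp|exact: hh].
  - by rewrite fE gE; field.
  have n0 : 0 < normc (h z0) by rewrite normc_gt0.
  have [d2 d20 hd2] := ch _ n0.
  exists d2 => // z zd zz0.
  have hz : h z != 0.
    rewrite -normc_gt0; have := le_normc_sub (h z0) (h z); rewrite normcC.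
    by have := hd2 z zd; lra.
  split; first by rewrite gE mulf_neq0// expf_neq0// subr_eq0.
  by rewrite fE gE; field.
have [P PP] : exists P : R[i] -> R[i] -> R[i], forall z0, c < normc z0 < 1 ->
  [/\ cdiff (P z0) z0, f z0 = P z0 z0 * g z0 &
   exists2 d, 0 < d & forall z, normc (z - z0) < d -> z != z0 ->
     g z != 0 /\ f z = P z0 z * g z].
  have /choice[P PP] : forall z0, exists p, c < normc z0 < 1 -> [/\ cdiff p z0, f z0 = p z0 * g z0 &
   exists2 d, 0 < d & forall z, normc (z - z0) < d -> z != z0 ->
     g z != 0 /\ f z = p z * g z].
    move=> z0; have [hz|hz] := pselect (c < normc z0 < 1); last by exists f.
    by have [p hp] := loc z0 hz; exists p.
  by exists P.
(* Each point takes its value from its own local quotient. Near [z0] this agrees with [P z0]: at the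
   other points [g] does not vanish and the value of the quotient is forced. *)
exists (fun z => P z z) => z0 hz0.
have [dP f0 [d d0 hd]] := PP _ hz0.
have [d1 d10 hd1] : exists2 d, 0 < d & forall z, normc (z - z0) < d -> c < normc z < 1.
  have /andP[cz0 z01] := hz0.
  exists (Num.min (normc z0 - c) (1 - normc z0)); first by rewrite lt_min !subr_gt0 cz0.
  move=> z; rewrite lt_min => /andP[h1 h2].
  have := le_normc_sub z z0; have := le_normc_sub z0 z; rewrite normcC.
  by move: h1 h2; clear; lra.
pose d2 := Num.min d d1.
have d20 : 0 < d2 by rewrite lt_min d0.
split=> //.
  apply: (@cdiff_near _ (P z0) _ _ d2) => // z; rewrite lt_min => /andP[zd zd1].
  have [->//|zz0] := eqVneq z z0.
  have [gz fz] := hd z zd zz0; have [_ fz' _] := PP z (hd1 _ zd1).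
  by apply: (mulIf gz); rewrite -fz -fz'.
(* At a zero of [g] the bound comes by continuity from nearby points, where [g] does not vanish. *)
rewrite leNgt; apply/negP => n1.
have [d3 d30 hd3] := cdiff_cont dP (etrans (subr_gt0 _ _) n1).
pose x := Num.min d2 d3 / 2.
have x0 : 0 < x by rewrite divr_gt0// lt_min d20.
have xlt : x < Num.min d2 d3 by rewrite ltr_pdivrMr// ltr_pMr ?ltr1n// lt_min d20.
have wz : z0 + x%:C - z0 = x%:C by rewrite addrC addKr.
have nw : normc (z0 + x%:C - z0) = x by rewrite wz normc_pos// ltW.
move: xlt; rewrite !lt_min -nw => /andP[/andP[w1 w2] w3].
have wz0 : z0 + x%:C != z0 by rewrite -subr_eq0 -normc_gt0 nw.
have [gz fz] := hd _ w1 wz0.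
have := fg _ (hd1 _ w2); rewrite fz normcM -[X in _ <= X]mul1r ler_pM2r ?normc_gt0//.
have := hd3 _ w3; have := le_normc_sub (P z0 z0) (P z0 (z0 + x%:C)); rewrite normcC.
by clear; lra.
Qed.

End Quotient.

(** * Pick's inequality on an annulus *)

Section TruncatedTheta.
Variable F : fieldType.
Implicit Types (q x : F) (N : nat).

(* [thp q N x] is the product of (1 - q^j x)(1 - q^j / x) over 1 <= j <= N, so that [th q N x]
   tends to the theta function (x; q)_oo (q / x; q)_oo. *)
Definition thp q N x : F := \prod_(j < N) ((1 - q ^+ j.+1 * x) * (1 - q ^+ j.+1 / x)).

Definition th q N x : F := (1 - x) * thp q N x.

Lemma thpS q N x : thp q N.+1 x = thp q N x * ((1 - q ^+ N.+1 * x) * (1 - q ^+ N.+1 / x)).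
Proof. by rewrite /thp big_ord_recr. Qed.

(** Replacing [x] by [q * x] moves both products by one index. They telescope up to one factor at
    each end, and for [q] of modulus below 1 these two factors tend to 1. *)
Lemma th_shift q N x : q != 0 -> x != 0 ->
  th q N (q * x) * (1 - q ^+ N / x) = - x^-1 * th q N x * (1 - q ^+ N.+1 * x).
Proof.
move=> q0 x0; elim: N => [|N ih].
  by rewrite /th /thp !big_ord0 expr0 expr1; field.
have E z : th q N.+1 z = th q N z * ((1 - q ^+ N.+1 * z) * (1 - q ^+ N.+1 / z)).
  by rewrite /th thpS mulrA.
rewrite !E.
have -> : q ^+ N.+1 / (q * x) = q ^+ N / x by rewrite exprS; field; rewrite q0 x0.
have -> : q ^+ N.+1 * (q * x) = q ^+ N.+2 * x by rewrite mulrA -exprSr.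
move: ih; set A := th q N (q * x); set B := th q N x => ih.
have -> : A * ((1 - q ^+ N.+2 * x) * (1 - q ^+ N / x)) * (1 - q ^+ N.+1 / x) =
  A * (1 - q ^+ N / x) * (1 - q ^+ N.+2 * x) * (1 - q ^+ N.+1 / x) by ring.
rewrite ih; ring.
Qed.

End TruncatedTheta.

(** * Bounds for theta products, uniform in the truncation *)

Section ThetaBounds.
Variable R : realType.
Implicit Types (x : R[i]) (q s a : R) (N : nat).

Lemma thpC q N s : (thp q N s)%:C = thp q%:C N s%:C.
Proof.
rewrite /thp rmorph_prod; apply: eq_bigr => j _.
by rewrite rmorphM !rmorphB rmorph1 !rmorphM fmorphV rmorphXn.
Qed.

Lemma thC q N s : (th q N s)%:C = th q%:C N s%:C.
Proof. by rewrite /th rmorphM rmorphB rmorph1 -thpC. Qed.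

(** Factor by factor, the modulus on a circle is largest at its negative point. Its counterpart
    [normc_thp_ge] puts the minimum at the positive point, where the conditions on [q] keep all
    factors positive. *)
Lemma normc_thp_le q N x : 0 <= q -> normc (thp q%:C N x) <= thp q N (- normc x).
Proof.
move=> q0; rewrite normc_prod; apply: ler_prod => j _; rewrite normc_ge0/= normcM.
have n1 : normc (q%:C ^+ j.+1 : R[i]) = q ^+ j.+1 by rewrite normcX normc_pos.
apply: ler_pM; rewrite ?normc_ge0//; apply: (le_trans (le_normcB _ _)).
  by rewrite normcM n1 normc1 mulrN opprK.
by rewrite normcM normcV n1 normc1 invrN mulrN opprK.
Qed.

Lemma thp_factor_bounds q s j : 0 < q -> q < 1 -> q < s -> q * s < 1 ->
  (0 < 1 - q ^+ j.+1 * s) /\ (0 < 1 - q ^+ j.+1 / s).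
Proof.
move=> q0 q1 qs qs1; have s0 : 0 < s := lt_trans q0 qs.
have qj : q ^+ j <= 1 by rewrite exprn_ile1// ltW.
split.
  rewrite subr_gt0 exprSr -mulrA (le_lt_trans _ qs1)//.
  by rewrite ler_piMl// mulr_ge0// ltW.
rewrite subr_gt0 ltr_pdivrMr// mul1r exprSr (le_lt_trans _ qs)//.
by rewrite ler_piMl// ltW.
Qed.

Lemma normc_thp_ge q N x : 0 < q -> q < 1 -> q < normc x -> q * normc x < 1 ->
  thp q N (normc x) <= normc (thp q%:C N x).
Proof.
move=> q0 q1 h1 h2; rewrite normc_prod; apply: ler_prod => j _.
have [p1 p2] := thp_factor_bounds j q0 q1 h1 h2.
rewrite mulr_ge0 ?(ltW p1) ?(ltW p2)//= normcM.
have n1 : normc (q%:C ^+ j.+1 : R[i]) = q ^+ j.+1 by rewrite normcX normc_pos// ltW.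
apply: ler_pM; [exact: ltW|exact: ltW| |].
  by have := le_normc_sub 1 (q%:C ^+ j.+1 * x); rewrite normcM n1 normc1.
by have := le_normc_sub 1 (q%:C ^+ j.+1 / x); rewrite normcM normcV n1 normc1.
Qed.

Lemma thp_gt0 q N s : 0 < q -> q < 1 -> q < s -> q * s < 1 -> 0 < thp q N s.
Proof.
move=> q0 q1 h1 h2; apply: prodr_gt0 => j _.
by have [p1 p2] := thp_factor_bounds j q0 q1 h1 h2; rewrite mulr_gt0.
Qed.

Lemma thp_le1 q N s : 0 < q -> q < 1 -> q < s -> q * s < 1 -> thp q N s <= 1.
Proof.
move=> q0 q1 h1 h2; apply: prodr_ile1 => j _.
have [p1 p2] := thp_factor_bounds j q0 q1 h1 h2; rewrite mulr_ge0 ?(ltW p1) ?(ltW p2)//=.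
have s0 : 0 < s := lt_trans q0 h1; have qj : 0 <= q ^+ j.+1 by rewrite exprn_ge0 ?ltW.
rewrite -[X in _ <= X]mulr1 ler_pM ?(ltW p1) ?(ltW p2)// lerBlDr lerDl.
  by rewrite mulr_ge0// ltW.
by rewrite mulr_ge0// invr_ge0 ltW.
Qed.

Lemma thpN_ge1 q N s : 0 < q -> 0 < s -> 1 <= thp q N (- s).
Proof.
move=> q0 s0; elim: N => [|N ih]; first by rewrite /thp big_ord0.
rewrite thpS mulr_ege1// invrN !mulrN !opprK mulr_ege1// lerDl.
  by rewrite mulr_ge0 ?exprn_ge0 ?ltW.
by rewrite mulr_ge0 ?invr_ge0 ?exprn_ge0 ?ltW.
Qed.

Lemma prod_1D_le (a : R) q N : 0 <= a -> 0 < q -> q < 1 ->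
  \prod_(j < N) (1 + a * q ^+ j.+1) <= expR (a / (1 - q)).
Proof.
move=> a0 q0 q1; have q1' : 0 < 1 - q by rewrite subr_gt0.
apply: (@le_trans _ _ (\prod_(j < N) expR (a * q ^+ j.+1))).
  apply: ler_prod => j _; rewrite expR_ge1Dx andbT addr_ge0// mulr_ge0// exprn_ge0 ?ltW//.
rewrite -expR_sum ler_expR -mulr_sumr ler_wpM2l// -[X in _ <= X]mul1r ler_pdivlMr//.
have -> : \sum_(i < N) q ^+ i.+1 = q * \sum_(i < N) q ^+ i.
  by rewrite mulr_sumr; apply: eq_bigr => i _; rewrite exprS.
rewrite -mulrA [_ * (1 - q)]mulrC -opprB mulNr -subrX1 opprB.
rewrite -[X in _ <= X]mulr1 ler_pM ?subr_ge0 ?exprn_ile1 ?(ltW q0) ?(ltW q1)//.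
by rewrite gerBl exprn_ge0 ?ltW.
Qed.

Lemma thpN_bounded q s : 0 < q -> q < 1 -> 0 < s ->
  exists2 U, 0 < U & forall N, thp q N (- s) <= U.
Proof.
move=> q0 q1 s0; exists (expR (s / (1 - q)) * expR (s^-1 / (1 - q))).
  by rewrite mulr_gt0 ?expR_gt0.
move=> N; rewrite /thp big_split /=; apply: ler_pM.
- apply: prodr_ge0 => j _; rewrite mulrN opprK addr_ge0// mulr_ge0 ?exprn_ge0 ?ltW//.
- apply: prodr_ge0 => j _; rewrite invrN mulrN opprK addr_ge0// mulr_ge0 ?invr_ge0 ?exprn_ge0 ?ltW//.
- rewrite (eq_bigr (fun j : 'I_N => 1 + s * q ^+ j.+1)) => [|j _]; last by rewrite mulrN opprK mulrC.
  by apply: prod_1D_le => //; exact: ltW.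
rewrite (eq_bigr (fun j : 'I_N => 1 + s^-1 * q ^+ j.+1)) => [|j _].
  by apply: prod_1D_le; rewrite ?invr_ge0 ?ltW.
by rewrite invrN mulrN opprK mulrC.
Qed.

(** For [0 <= y <= b < 1] the inverse of [1 - y] is at most [1 + y / (1 - b)], which reduces the
    lower bound to the upper bound of [prod_1D_le]. *)
Lemma prod_1B_ge (a b : R) q N : 0 <= a -> 0 < q -> q < 1 -> b < 1 ->
  (forall j : nat, a * q ^+ j.+1 <= b) ->
  (expR (a / (1 - b) / (1 - q)))^-1 <= \prod_(j < N) (1 - a * q ^+ j.+1).
Proof.
move=> a0 q0 q1 b1 hb; have b1' : 0 < 1 - b by rewrite subr_gt0.
have P0 : 0 < \prod_(j < N) (1 - a * q ^+ j.+1).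
  by apply: prodr_gt0 => j _; rewrite subr_gt0 (le_lt_trans (hb j)).
rewrite invf_ple ?posrE ?expR_gt0//.
apply: le_trans (prod_1D_le N (divr_ge0 a0 (ltW b1')) q0 q1).
rewrite -prodfV; apply: ler_prod => j _.
have y0 : 0 <= a * q ^+ j.+1 by rewrite mulr_ge0// exprn_ge0 ?ltW.
have y1 : 0 < 1 - a * q ^+ j.+1 by rewrite subr_gt0 (le_lt_trans (hb j)).
rewrite invr_ge0 (ltW y1)/= -[X in X <= _]mul1r ler_pdivrMr// mulrAC.
move: (hb j) y0 y1; set y := a * q ^+ j.+1 => yb y0 y1.
have -> : (1 + y / (1 - b)) * (1 - y) = 1 + (y / (1 - b)) * (b - y) by field; rewrite lt0r_neq0.
by rewrite lerDl mulr_ge0 ?subr_ge0// divr_ge0// ltW.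
Qed.

Lemma thp_bounded_below q s : 0 < q -> q < 1 -> q < s -> q * s < 1 ->
  exists2 L, 0 < L & forall N, L <= thp q N s.
Proof.
move=> q0 q1 h1 h2; have s0 : 0 < s := lt_trans q0 h1.
have qj j : q ^+ j <= 1 by rewrite exprn_ile1// ltW.
have b1 : q / s < 1 by rewrite ltr_pdivrMr// mul1r.
pose L1 := (expR (s / (1 - q * s) / (1 - q)))^-1.
pose L2 := (expR (s^-1 / (1 - q / s) / (1 - q)))^-1.
exists (L1 * L2); first by rewrite mulr_gt0 ?invr_gt0 ?expR_gt0.
move=> N; rewrite /thp big_split /=; apply: ler_pM; rewrite ?invr_ge0 ?expR_ge0//.
  rewrite (eq_bigr (fun j : 'I_N => 1 - s * q ^+ j.+1)) => [|j _]; last by rewrite mulrC.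
  apply: prod_1B_ge => // [|j]; first exact: ltW.
  by rewrite exprS mulrA [s * q]mulrC ler_piMr// mulr_ge0 ?ltW.
rewrite (eq_bigr (fun j : 'I_N => 1 - s^-1 * q ^+ j.+1)) => [|j _]; last by rewrite mulrC.
apply: prod_1B_ge => // [|j]; first by rewrite invr_ge0 ltW.
by rewrite exprS mulrA [s^-1 * q]mulrC ler_piMr// divr_ge0 ?ltW.
Qed.

End ThetaBounds.

(** * The kernel of the annulus and its reproducing property *)

Section SzegoKernel.
Variable R : realType.
Implicit Types (u v : R[i] -> R[i]) (x z w : R[i]) (a b c q s r al e : R) (N M n : nat).

Lemma conj_real a : (a%:C)^* = a%:C :> R[i].
Proof. by rewrite /= oppr0. Qed.

Lemma avgcN M r u : avgc M r (fun z => - u z) = - avgc M r u.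
Proof. by rewrite /avgc sumrN mulrN. Qed.

Lemma conj_circle z r : z != 0 -> normc z = r -> z^* = (r ^+ 2)%:C / z.
Proof. by move=> z0 <-; rewrite sqr_normc_conj mulrC mulKf. Qed.

Lemma thp_conj q N x : (thp q%:C N x)^* = thp q%:C N x^*.
Proof.
rewrite /thp rmorph_prod; apply: eq_bigr => j _.
rewrite rmorphM !rmorphB !rmorphM !fmorphV !rmorphXn /=.
by rewrite oppr0.
Qed.

Lemma th_conj q N x : (th q%:C N x)^* = th q%:C N x^*.
Proof. by rewrite /th rmorphM rmorphB rmorph1 /= thp_conj. Qed.

(* As N tends to infinity, [szego q al N (z * w^* )] tends to a multiple of the reproducing
   kernel of the Hardy space of the annulus sqrt q < |z| < 1 with the norm
   mean_{|z|=1} |u|^2 + al mean_{|z|=sqrt q} |u|^2. *)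
Definition szego q al N x : R[i] := th q%:C N (- al%:C * x) / th q%:C N x.

Lemma szego_conj q al N x : (szego q al N x)^* = szego q al N x^*.
Proof.
have E : (- al%:C * x)^* = - al%:C * x^*.
  case: x => a b; apply/eqP; rewrite eq_complex /=.
  by apply/andP; split; apply/eqP; ring.
rewrite /szego rmorphM fmorphV; congr (_ / _); last exact: th_conj.
by rewrite -E; exact: th_conj.
Qed.

(* The relative error made by the truncation in the quasi-periodicity of the kernel. *)
Definition szego_err q al N x : R[i] :=
  ((1 + al%:C * q%:C ^+ N.+1 * x) * (1 - q%:C ^+ N / x)) /
  ((1 + q%:C ^+ N / (al%:C * x)) * (1 - q%:C ^+ N.+1 * x)) - 1.

Lemma th_neq0 q N x : 0 < q -> q < 1 -> q < normc x -> q * normc x < 1 -> normc x != 1 ->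
  th q%:C N x != 0.
Proof.
move=> q0 q1 h1 h2 n1; rewrite mulf_neq0//.
  by rewrite subr_eq0 eq_sym; apply: contra_neq n1 => ->; rewrite normc1.
rewrite -normc_gt0; apply: lt_le_trans (normc_thp_ge N q0 q1 h1 h2).
exact: thp_gt0.
Qed.

Lemma normc_1B_neq0 x : normc x < 1 -> 1 - x != 0.
Proof.
by move=> x1; rewrite subr_eq0; apply/eqP => e; move: x1; rewrite -e normc1 ltxx.
Qed.

(** In the quotient of the quasi-periodicity relations at [- al * x] and at [x] the variable
    cancels, and the constant multiplier -1 / [al] remains. The bounds on the moduli keep the
    truncation factors from vanishing. *)
Lemma szego_shift q al N x : 0 < q -> q < 1 -> al != 0 -> 1 < normc x -> q * normc x < 1 ->
  1 < `|al| * normc x -> al%:C * szego q al N (q%:C * x) = - szego q al N x * (1 + szego_err q al N x).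
Proof.
move=> q0 q1 al0 x1 qx alx.
have qC : q%:C != 0 :> R[i] by rewrite -normc_gt0 normc_pos// ltW.
have alC : al%:C != 0 :> R[i] by rewrite -normc_gt0 normc_real normr_gt0.
have x0 : x != 0 by rewrite -normc_gt0 (lt_trans ltr01).
have qn n : normc (q%:C ^+ n : R[i]) <= 1.
  by rewrite normcX (normc_pos (ltW q0)) exprn_ile1 ?(ltW q0) ?(ltW q1).
have y0 : - al%:C * x != 0 by rewrite mulNr oppr_eq0 mulf_neq0.
have e1 := th_shift N qC y0; have e2 := th_shift N qC x0.
have inv1 z : 1 < normc z -> 1 - q%:C ^+ N / z != 0.
  move=> z1; apply: normc_1B_neq0; rewrite normcM normcV ltr_pdivrMr; last exact: lt_trans z1.
  by rewrite mul1r (le_lt_trans _ z1).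
have n1 := inv1 _ x1.
have n2 : 1 + q%:C ^+ N / (al%:C * x) != 0.
  have := inv1 (- al%:C * x); rewrite normcM normcN normc_real => /(_ alx).
  by rewrite mulNr invrN mulrN opprK.
have n3 : 1 - q%:C ^+ N.+1 * x != 0.
  apply: normc_1B_neq0; rewrite exprSr -mulrA normcM normcM (normc_pos (ltW q0)).
  by rewrite (le_lt_trans _ qx)// ler_piMl// mulr_ge0 ?normc_ge0// ltW.
have t0 : th q%:C N x != 0 by apply: th_neq0; rewrite ?gt_eqF// (lt_trans q1).
have E1 : th q%:C N (- al%:C * (q%:C * x)) =
   (al%:C * x)^-1 * th q%:C N (- al%:C * x) * (1 + al%:C * q%:C ^+ N.+1 * x) / (1 + q%:C ^+ N / (al%:C * x)).
  apply: (mulIf n2); rewrite divfK//.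
  have -> : - al%:C * (q%:C * x) = q%:C * (- al%:C * x) by ring.
  move: e1; rewrite mulNr invrN !mulrN !opprK => ->; ring.
have E2 : th q%:C N (q%:C * x) = - x^-1 * th q%:C N x * (1 - q%:C ^+ N.+1 * x) / (1 - q%:C ^+ N / x).
  by apply: (mulIf n1); rewrite divfK.
rewrite /szego /szego_err E1 E2.
move: (th _ _ _) (th _ _ _) (1 + al%:C * _ * _) (1 - q%:C ^+ N / x) (1 + q%:C ^+ N / _) (1 - _ * x) t0 n1 n2 n3.
move=> A B C1 C2 C3 C4 B0 c2 c3 c4.
by field; rewrite B0 c2 c3 c4 x0 alC.
Qed.

Definition aip c al M u v : R[i] :=
  avgc M 1 (fun z => u z * (v z)^*) + al%:C * avgc M c (fun z => u z * (v z)^*).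

Definition anorm2 c al M u : R :=
  ravg M 1 (fun z => normc (u z) ^+ 2) + al * ravg M c (fun z => normc (u z) ^+ 2).

Lemma aip_sumr c al M u n (A : 'I_n -> R[i]) (k : 'I_n -> R[i] -> R[i]) :
  aip c al M u (fun z => \sum_i A i * k i z) = \sum_i (A i)^* * aip c al M u (k i).
Proof.
rewrite /aip.
have E s : avgc M s (fun z => u z * (\sum_i A i * k i z)^*) =
    \sum_i (A i)^* * avgc M s (fun z => u z * (k i z)^*).
  have -> : (fun z => u z * (\sum_i A i * k i z)^*) =
     (fun z => \sum_i (A i)^* * (u z * (k i z)^*)).
    apply/funext => z; rewrite rmorph_sum mulr_sumr; apply: eq_bigr => i _.
    by rewrite rmorphM /= mulrCA.
  by rewrite avgc_sum; apply: eq_bigr => i _; rewrite avgcZ.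
rewrite !E mulr_sumr -big_split; apply: eq_bigr => i _ /=; ring.
Qed.

Lemma aip_self c al M u : aip c al M u u = (anorm2 c al M u)%:C.
Proof.
have E s : avgc M s (fun z => u z * (u z)^*) = (ravg M s (fun z => normc (u z) ^+ 2))%:C.
  by rewrite ravgC; congr (avgc _ _ _); apply/funext => z; rewrite sqr_normc_conj.
by rewrite /aip !E -rmorphM -rmorphD.
Qed.

(** The arithmetic-geometric mean takes the place of Cauchy-Schwarz: the bound is linear in the
    squared norms, as are the approximation errors later added to them. *)
Lemma normc_aip_le c al M u v : 0 <= al ->
  normc (aip c al M u v) <= (anorm2 c al M u + anorm2 c al M v) / 2.
Proof.
move=> al0.
have E s : normc (avgc M s (fun z => u z * (v z)^*)) <=
   (ravg M s (fun z => normc (u z) ^+ 2) + ravg M s (fun z => normc (v z) ^+ 2)) / 2.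
  apply: (le_trans (normc_avgc_le _ _ _)).
  rewrite -ravgD mulrC -ravgZ /ravg ler_wpM2l ?invr_ge0// ler_sum// => j _.
  rewrite normcM normc_conj.
  have := sqr_ge0 (normc (u (circle_pt M s j)) - normc (v (circle_pt M s j))).
  by rewrite sqrrB; lra.
apply: (le_trans (le_normcD _ _)); rewrite (normcM al%:C) normc_pos//.
have h1 := E 1; have h2 := ler_wpM2l al0 (E c); rewrite /anorm2.
by move: h1 h2; lra.
Qed.

Lemma anorm2_le c al M u v : 0 <= al -> 0 <= c ->
  (forall z, normc z = 1 \/ normc z = c -> normc (u z) <= normc (v z)) ->
  anorm2 c al M u <= anorm2 c al M v.
Proof.
move=> al0 c0 uv.
have E s : 0 <= s -> (forall z, normc z = s -> normc (u z) <= normc (v z)) ->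
    ravg M s (fun z => normc (u z) ^+ 2) <= ravg M s (fun z => normc (v z) ^+ 2).
  move=> s0 h; apply: ravg_le => // z zs.
  by rewrite lerXn2r ?nnegrE ?normc_ge0// h.
apply: lerD; first by apply: E => // z z1; apply: uv; left.
by apply: ler_wpM2l => //; apply: E => // z zc; apply: uv; right.
Qed.

Lemma cdiff_thp_div q N w z (l : R[i]) : z != 0 -> w != 0 ->
  cdiff (fun z => thp q%:C N (l * (w / z))) z.
Proof.
move=> z0 w0; apply: cdiff_prod => j.
have dV : cdiff (fun z => l * (w / z)) z.
  by apply: cdiffM; [exact: cdiff_cst|apply: cdiff_div => //; [exact: cdiff_cst|exact: cdiff_id]].
apply: cdiffM; apply: cdiffB; try exact: cdiff_cst.
  by apply: cdiffM => //; exact: cdiff_cst.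
have -> : (fun z => q%:C ^+ j.+1 / (l * (w / z))) = (fun z => q%:C ^+ j.+1 / (l * w) * z).
  by apply/funext => x; rewrite !invfM invrK; ring.
by apply: cdiffM; [exact: cdiff_cst|exact: cdiff_id].
Qed.

(** On the unit circle the conjugate kernel is the kernel at [w / z]. On the inner circle
    conjugation produces the argument [q * (w / z)], and the quasi-period turns [al] times that
    kernel into minus the kernel at [w / z], up to [szego_err]. The inner product thus becomes a
    difference of means over the two circles, to which Cauchy's formula applies; [E] bounds the
    truncation error. *)
Lemma szego_reproducing a b c r u w E N : 0 < a -> a < c -> c < r -> r < 1 -> 1 < b -> 0 <= E ->
  let q := c ^+ 2 in let al := c / r ^+ 2 in
  (forall z, a < normc z < b -> cdiff u z) -> normc w = r ->
  (forall z, normc z = c -> normc (u z * szego q al N (w / z) * szego_err q al N (w / z)) <= E) ->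
  forall dl, 0 < dl -> exists M0, forall M, (M0 <= M)%N ->
    normc (aip c al M u (fun z => szego q al N (z * w^*)) -
           u w * (th q N (- al) / thp q N 1)%:C) <= E + dl.
Proof.
move=> a0 ac cr r1 b1 E0 q al du wr uE dl dl0.
have c0 : 0 < c := lt_trans a0 ac; have r0 : 0 < r := lt_trans c0 cr.
have c1 : c < 1 := lt_trans cr r1.
have q0 : 0 < q by rewrite exprn_gt0.
have q1 : q < 1 by rewrite exprn_ilt1// ltW.
have al0 : 0 < al by rewrite divr_gt0// exprn_gt0.
have w0 : w != 0 by rewrite -normc_gt0 wr.
pose kp z := szego q al N (w / z).
(* The kernel without its simple pole at [w]: the factor [1 - w / z] of the denominator is left to
   the Cauchy kernel. *)
pose g z := th q%:C N (- al%:C * (w / z)) / thp q%:C N (w / z).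
have qr : q * r < c.
  by rewrite /q expr2 -mulrA -[X in _ < X]mulr1 ltr_pM2l// mulr_ilt1// ltW.
have rq : 1 < r / q.
  by rewrite ltr_pdivlMr// mul1r /q expr2 (lt_trans _ cr)// -[X in _ < X]mulr1 ltr_pM2l.
(* Between these radii [q < normc (w / z)] and [q * normc (w / z) < 1], so the denominator of [g]
   has no zero. *)
pose a' := Num.max a (q * r); pose b' := Num.min b (r / q).
have a'0 : 0 <= a' by rewrite le_max (ltW a0).
have a'c : a' < c by rewrite gt_max ac.
have b'1 : 1 < b' by rewrite lt_min b1.
have dv z : a' < normc z < b' -> cdiff (fun z => u z * g z) z.
  rewrite gt_max lt_min => /andP[/andP[za zq] /andP[zb zr]].
  have z0 : z != 0 by rewrite -normc_gt0 (lt_trans a0).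
  have nz : 0 < normc z by rewrite normc_gt0.
  apply: cdiffM; first by apply: du; rewrite za.
  apply: cdiff_div; last first.
  - have -> : (fun z => thp q%:C N (w / z)) = (fun z => thp q%:C N (1 * (w / z))).
      by apply/funext => x; rewrite mul1r.
    exact: cdiff_thp_div.
  - apply: cdiffM; last exact: cdiff_thp_div.
    apply: cdiffB; first exact: cdiff_cst.
    apply: cdiffM; first exact: cdiff_cst.
    by apply: cdiff_div => //; [exact: cdiff_cst|exact: cdiff_id].
  rewrite -normc_gt0; have nwz : normc (w / z) = r / normc z by rewrite normcM normcV wr.
  have h1 : q < normc (w / z) by rewrite nwz ltr_pdivlMr// mulrC -ltr_pdivlMr.
  have h2 : q * normc (w / z) < 1 by rewrite nwz mulrA ltr_pdivrMr// mul1r.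
  exact: lt_le_trans (thp_gt0 N q0 q1 h1 h2) (normc_thp_ge N q0 q1 h1 h2).
have cw : c < normc w by rewrite wr.
have w1 : normc w < 1 by rewrite wr.
have cau := cauchy_annulus a'0 dv a'c cw w1 b'1.
have kpE z : normc z != r -> z != 0 -> g z * (z / (z - w)) = kp z.
  move=> zr z0; have zw : z - w != 0 by rewrite subr_eq0; apply: contra_neq zr => ->.
  rewrite /kp /szego {2}/th.
  have -> : 1 - w / z = (z - w) / z by field.
  rewrite /g invfM invf_div; ring.
have sc z : (szego q al N (z * w^*))^* = szego q al N (z^* * w).
  rewrite szego_conj; congr szego; rewrite rmorphM; congr (_ * _); exact: conjcK.
have outer z : normc z = 1 -> u z * (szego q al N (z * w^*))^* = u z * g z * (z / (z - w)).
  move=> z1; have z0 : z != 0 by rewrite -normc_gt0 z1.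
  have zr : normc z != r by rewrite z1 gt_eqF.
  rewrite -mulrA (kpE _ zr z0) sc; congr (_ * szego _ _ _ _).
  by rewrite (conj_circle z0 z1) expr1n mul1r mulrC.
have inner z : normc z = c -> al%:C * (u z * (szego q al N (z * w^*))^*) =
    - (u z * g z * (z / (z - w))) - u z * kp z * szego_err q al N (w / z).
  move=> zc; have z0 : z != 0 by rewrite -normc_gt0 zc.
  have zr : normc z != r by rewrite zc lt_eqF.
  rewrite -mulrA (kpE _ zr z0) sc.
  have -> : z^* * w = q%:C * (w / z) by rewrite (conj_circle z0 zc) mulrAC mulrA.
  have nx : normc (w / z) = r / c by rewrite normcM normcV wr zc.
  rewrite mulrCA szego_shift ?gt_eqF//; first by rewrite -/(kp z); ring.
  - by rewrite nx ltr_pdivlMr// mul1r.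
  - rewrite nx; have -> : q * (r / c) = c * r by rewrite /q; field; rewrite gt_eqF.
    by rewrite mulr_ilt1// ltW.
  rewrite nx gtr0_norm// /al; have -> : c / r ^+ 2 * (r / c) = r^-1 by field; rewrite !gt_eqF.
  by rewrite invf_gt1.
have gw : u w * g w = u w * (th q N (- al) / thp q N 1)%:C.
  congr (_ * _); rewrite rmorphM fmorphV /= thC thpC /g divff// mulr1.
  by congr (th _ _ _ / _); rewrite ?rmorphN ?rmorph1.
have /climit_epsP/(_ _ dl0)[M0 hM0] := cau.
exists M0 => M MM.
rewrite -gw.
have -> : aip c al M u (fun z => szego q al N (z * w^*)) =
  (avgc M 1 (fun z => u z * g z * (z / (z - w))) - avgc M c (fun z => u z * g z * (z / (z - w))))
  - avgc M c (fun z => u z * kp z * szego_err q al N (w / z)).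
  rewrite /aip -(avgcZ _ _ al%:C) (eq_avgc _ ler01 outer) (eq_avgc _ (ltW c0) inner).
  by rewrite avgcB avgcN addrA.
rewrite addrAC [E + dl]addrC; apply: (le_trans (le_normcB _ _)); apply: lerD.
  exact: hM0.
by apply: normc_avgc_le_cst => //; exact: ltW.
Qed.

End SzegoKernel.

(** * Approximate positivity of the Pick form *)

Section PickInequality.
Variable R : realType.
Implicit Types (u v om : R[i] -> R[i]) (x z w : R[i]) (a b c q s r al e : R) (N M n : nat).

Lemma szego_err_small q al s : 0 < q -> q < 1 -> al != 0 -> 1 < s -> q * s < 1 -> 1 < `|al| * s ->
  forall e, 0 < e -> exists N0, forall N, (N0 <= N)%N -> forall x, normc x = s ->
    normc (szego_err q al N x) <= e.
Proof.
move=> q0 q1 al0 s1 qs als e e0.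
have al0' : 0 < `|al| by rewrite normr_gt0.
pose K := 1 + `|al|; have K0 : 0 < K by rewrite /K addr_gt0.
(* The four perturbations [A], [B], [C], [D] below are at most [t], and [t <= 1 / 2] makes the
   denominator at least 1 / 4. The numerator is at most [5 * t], whence the 20. *)
pose d := Num.min (1 / 2) (e / 20) / K.
have d0 : 0 < d by rewrite divr_gt0// lt_min !divr_gt0.
have /cvgrPdist_lt/(_ _ d0)[N0 _ hN] : (fun n => q ^+ n) @ \oo --> (0 : R).
  by apply: cvg_expr; rewrite ger0_norm ?ltW.
exists N0 => N NN x xs.
have qN0 : 0 <= q ^+ N by rewrite exprn_ge0 ?ltW.
have := hN N NN; rewrite /= sub0r normrN ger0_norm// ltr_pdivlMr// => ht.
pose t := K * q ^+ N; have t0 : 0 <= t by rewrite /t mulr_ge0// ltW.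
have t1 : t <= 1 / 2 by move: ht; rewrite lt_min mulrC -/t => /andP[/ltW].
have te : t <= e / 20 by move: ht; rewrite lt_min mulrC -/t => /andP[_ /ltW].
have nq n : normc (q%:C ^+ n : R[i]) = q ^+ n by rewrite normcX normc_pos// ltW.
have s0 : 0 < s := lt_trans ltr01 s1.
rewrite /szego_err; set A := al%:C * q%:C ^+ N.+1 * x; set B := q%:C ^+ N / x.
set C := q%:C ^+ N / (al%:C * x); set D := q%:C ^+ N.+1 * x.
have nA : normc A <= t.
  rewrite /A !normcM nq normc_real xs exprSr /t /K.
  have -> : `|al| * (q ^+ N * q) * s = (`|al| * (q * s)) * q ^+ N by ring.
  rewrite ler_wpM2r//; have : `|al| * (q * s) <= `|al| * 1 by rewrite ler_wpM2l ?(ltW qs).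
  lra.
have nB : normc B <= t.
  rewrite /B normcM normcV nq xs /t mulrC ler_wpM2r//.
  have : s^-1 < 1 by rewrite invf_lt1.
  by rewrite /K; lra.
have nC : normc C <= t.
  rewrite /C normcM normcV nq normcM normc_real xs /t mulrC ler_wpM2r//.
  have : (`|al| * s)^-1 < 1 by rewrite invf_lt1// (lt_trans ltr01).
  by rewrite /K; lra.
have nD : normc D <= t.
  rewrite /D normcM nq xs exprSr /t /K.
  have -> : q ^+ N * q * s = (q * s) * q ^+ N by ring.
  by rewrite ler_wpM2r//; lra.
have low z : normc z <= t -> 1 / 2 <= normc (1 + z).
  by move=> zt; have := le_normc_sub 1 (- z); rewrite opprK normcN normc1; lra.
have C1 := low C nC; have D1 := low (- D); rewrite normcN in D1; have {}D1 := D1 nD.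
have c0 : 1 + C != 0 by rewrite -normc_gt0; lra.
have d1 : 1 - D != 0 by rewrite -normc_gt0; lra.
have -> : (1 + A) * (1 - B) / ((1 + C) * (1 - D)) - 1 =
   (A - B - A * B - C + D + C * D) / ((1 + C) * (1 - D)) by field; rewrite c0 d1.
rewrite normcM normcV (normcM (1 + C)) ler_pdivrMr; last by rewrite mulr_gt0//; lra.
apply: (@le_trans _ _ (5 * t)).
  apply: (le_trans (le_normcD _ _)); apply: (le_trans (lerD (le_normcD _ _) (lexx _))).
  apply: (le_trans (lerD (lerD (le_normcB _ _) (lexx _)) (lexx _))).
  apply: (le_trans (lerD (lerD (lerD (le_normcB _ _) (lexx _)) (lexx _)) (lexx _))).
  apply: (le_trans (lerD (lerD (lerD (lerD (le_normcB _ _) (lexx _)) (lexx _)) (lexx _)) (lexx _))).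
  rewrite (normcM A) (normcM C).
  have p1 : normc A * normc B <= t * (1 / 2) by apply: ler_pM; rewrite ?normc_ge0// (le_trans nB).
  have p2 : normc C * normc D <= t * (1 / 2) by apply: ler_pM; rewrite ?normc_ge0// (le_trans nD).
  by move: nA nB nC nD p1 p2; clear; lra.
have p : 1 / 2 * (1 / 2) <= normc (1 + C) * normc (1 - D) by apply: ler_pM => //; lra.
have : e * (1 / 2 * (1 / 2)) <= e * (normc (1 + C) * normc (1 - D)) by rewrite ler_wpM2l// ltW.
by move: te; clear; lra.
Qed.

Lemma szego_bounded q al s : 0 < q -> q < 1 -> al != 0 -> q < s -> q * s < 1 -> s != 1 ->
  exists2 K, 0 < K & forall N x, normc x = s -> normc (szego q al N x) <= K.
Proof.
move=> q0 q1 al0 qs qs1 s1.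
have s0 : 0 < s := lt_trans q0 qs.
have als0 : 0 < `|al| * s by rewrite mulr_gt0 ?normr_gt0.
have [U U0 hU] := thpN_bounded q0 q1 als0.
have [L L0 hL] := thp_bounded_below q0 q1 qs qs1.
have d0 : 0 < `|1 - s| by rewrite normr_gt0 subr_eq0 eq_sym.
have A0 : 0 < 1 + `|al| * s by rewrite addr_gt0.
exists ((1 + `|al| * s) * U / (`|1 - s| * L)); first by rewrite divr_gt0 ?mulr_gt0.
move=> N x xs; rewrite /szego normcM normcV.
have ny : normc (- al%:C * x) = `|al| * s by rewrite mulNr normcN normcM normc_real xs.
apply: ler_pM; rewrite ?normc_ge0 ?invr_ge0 ?normc_ge0//.
  rewrite /th normcM; apply: ler_pM; rewrite ?normc_ge0//.
    by rewrite (le_trans (le_normcB _ _))// normc1 ny.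
  by apply: (le_trans (normc_thp_le _ _ (ltW q0))); rewrite ny.
have lb : `|1 - s| * L <= normc (th q%:C N x).
  rewrite /th normcM; apply: ler_pM; rewrite ?normr_ge0 ?(ltW L0)//.
    have h1 := le_normc_sub 1 x; have h2 := le_normc_sub x 1.
    by rewrite normcC in h2; rewrite normc1 xs in h1 h2; rewrite ler_norml; lra.
  apply: (le_trans (hL N)); rewrite -xs; apply: normc_thp_ge => //; by rewrite xs.
by rewrite lef_pV2 ?posrE ?mulr_gt0// (lt_le_trans _ lb)// mulr_gt0.
Qed.

Lemma cdiff_thp q N (l : R[i]) z : z != 0 -> cdiff (fun z => thp q%:C N (l * z)) z.
Proof.
move=> z0; have dl : cdiff (fun z => l * z) z.
  by apply: cdiffM; [exact: cdiff_cst|exact: cdiff_id].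
apply: cdiff_prod => j; apply: cdiffM; apply: cdiffB; try exact: cdiff_cst.
  by apply: cdiffM => //; exact: cdiff_cst.
have -> : (fun z => q%:C ^+ j.+1 / (l * z)) = (fun z => q%:C ^+ j.+1 / l / z).
  by apply/funext => x; rewrite invfM; ring.
by apply: cdiff_div => //; [exact: cdiff_cst|exact: cdiff_id].
Qed.

Lemma cdiff_th q N (l : R[i]) z : z != 0 -> cdiff (fun z => th q%:C N (l * z)) z.
Proof.
move=> z0; apply: cdiffM; last exact: cdiff_thp.
apply: cdiffB; first exact: cdiff_cst.
by apply: cdiffM; [exact: cdiff_cst|exact: cdiff_id].
Qed.

Lemma cdiff_szego q al N (l : R[i]) z : 0 < q -> q < 1 -> z != 0 -> q < normc (l * z) ->
  normc (l * z) < 1 -> cdiff (fun z => szego q al N (z * l)) z.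
Proof.
move=> q0 q1 z0 h1 h2.
have -> : (fun z => szego q al N (z * l)) =
   (fun z => th q%:C N ((- al%:C * l) * z) / th q%:C N (l * z)).
  by apply/funext => x; rewrite /szego (mulrC x l) mulrA.
apply: cdiff_div; [|exact: cdiff_th|exact: cdiff_th].
apply: th_neq0 => //; last by rewrite lt_eqF.
by apply: (lt_trans _ h2); rewrite gtr_pMl// (lt_trans q0).
Qed.

Lemma sum_close n (A X Y : 'I_n -> R[i]) (D : R) : 0 <= D ->
  (forall i, normc (A i) <= 1) -> (forall i, normc (X i - Y i) <= D) ->
  normc (\sum_i A i * X i - \sum_i A i * Y i) <= n%:R * D.
Proof.
move=> D0 hA hXY; rewrite -sumrB; apply: (le_trans (normc_sum _ _ _)).
rewrite -[n in n%:R]card_ord mulr_natl -sumr_const; apply: ler_sum => i _.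
rewrite -mulrBr normcM -[X in _ <= X]mul1r; apply: ler_pM; rewrite ?normc_ge0//.
Qed.

(** Multiplication by [om] is a contraction whose adjoint multiplies the kernel at [p i] by the
    conjugate of [om (p i)]. With [y] and [h] as in the proof, the product of [om * h] and [y] is
    nearly the squared norm [T] of [h]. It is also at most half the sum of the squared norms of [h]
    and [y], so [T] is at most the squared norm [Y] of [y], up to errors. The constant [C] depends
    neither on [N] nor on [eta], which is what the later limits require. *)
Lemma pick_form om a b c r n (p : 'I_n -> R[i]) : 0 < a -> a < c -> c < r -> r < 1 -> 1 < b ->
  let q := c ^+ 2 in let al := c / r ^+ 2 in
  (forall z, a < normc z < b -> cdiff om z) ->
  (forall z, a < normc z < b -> normc (om z) <= 1) ->
  (forall i, normc (p i) = r) ->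
  exists2 C, 0 <= C & forall N e, 0 <= e ->
    (forall x, normc x = r / c -> normc (szego_err q al N x) <= e) ->
    forall eta : 'I_n -> R[i], (forall i, normc (eta i) <= 1) ->
    - C * e <= Re (\sum_i \sum_j eta i * (eta j)^* * (1 - om (p i) * (om (p j))^*) *
                     szego q al N (p i * (p j)^*)).
Proof.
move=> a0 ac cr r1 b1 q al dom om1 pr.
have c0 : 0 < c := lt_trans a0 ac; have r0 : 0 < r := lt_trans c0 cr.
have c1 : c < 1 := lt_trans cr r1.
have q0 : 0 < q by rewrite exprn_gt0.
have q1 : q < 1 by rewrite exprn_ilt1// ltW.
have al0 : 0 < al by rewrite divr_gt0// exprn_gt0.
have q_cr : q < c * r by rewrite /q expr2 ltr_pM2l.
have cr_1 : c * r < 1 by rewrite mulr_ilt1// ltW.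
have qcr1 : q * (c * r) < 1 by rewrite mulr_ilt1 ?(ltW q0) ?mulr_ge0 ?(ltW c0) ?(ltW r0).
have rc1 : 1 < r / c by rewrite ltr_pdivlMr// mul1r.
have qrc : q * (r / c) < 1.
  by have -> : q * (r / c) = c * r by rewrite /q; field; rewrite gt_eqF.
have cr_n1 : c * r != 1 by rewrite lt_eqF.
have rc_n1 : r / c != 1 by rewrite gt_eqF.
have [K1 K10 hK1] := szego_bounded q0 q1 (lt0r_neq0 al0) q_cr qcr1 cr_n1.
have [K2 K20 hK2] := szego_bounded q0 q1 (lt0r_neq0 al0) (lt_trans q1 rc1) qrc rc_n1.
pose B := n%:R * K1 * K2.
have B0 : 0 <= B by rewrite /B !mulr_ge0 ?(ltW K10) ?(ltW K20).
have C0 : 0 <= 6 * n%:R * B by apply: mulr_ge0 => //; apply: mulr_ge0.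
exists (6 * n%:R * B) => //.
move=> N e e0 he eta eta1.
pose k i z := szego q al N (z * (p i)^*).
(* The function [h] is the image of [y] under the adjoint of multiplication by [om]. *)
pose y z := \sum_i (eta i)^* * k i z.
pose h z := \sum_i (eta i * om (p i))^* * k i z.
(* The constant of the reproducing formula; being at least 1, it can be divided out at the end
   without enlarging the error. *)
pose kap := th q N (- al) / thp q N 1.
have q11 : q * 1 < 1 by rewrite mulr1.
have kap1 : 1 <= kap.
  have t0 := thp_gt0 N q0 q1 q1 q11.
  rewrite /kap ler_pdivlMr// mul1r (le_trans (thp_le1 N q0 q1 q1 q11))//.
  rewrite /th opprK mulr_ege1// ?lerDl ?(ltW al0)//; exact: thpN_ge1.
pose a' := Num.max a (q / r); pose b' := Num.min b r^-1.
have a'0 : 0 < a' by rewrite lt_max a0.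
have a'c : a' < c by rewrite gt_max ac/= ltr_pdivrMr.
have b'1 : 1 < b' by rewrite lt_min b1/= invf_gt1.
have sub z : a' < normc z < b' -> a < normc z < b.
  by rewrite gt_max lt_min => /andP[/andP[-> _] /andP[-> _]].
have pab i : a < normc (p i) < b by rewrite pr (lt_trans ac)//= (lt_trans r1).
have ompi i : normc (om (p i)) <= 1 by apply: om1.
have A1 i : normc (eta i * om (p i)) <= 1.
  by rewrite normcM -[X in _ <= X]mulr1 ler_pM ?normc_ge0.
have dk i z : a' < normc z < b' -> cdiff (k i) z.
  rewrite gt_max lt_min => /andP[/andP[z1 z2] /andP[z3 z4]].
  have n0 : 0 < normc z := lt_trans a0 z1.
  apply: cdiff_szego => //; first by rewrite -normc_gt0.
    by rewrite normcM normc_conj pr mulrC -ltr_pdivrMr.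
  by rewrite normcM normc_conj pr mulrC -ltr_pdivlMr// mul1r.
have dsum (A : 'I_n -> R[i]) z : a' < normc z < b' -> cdiff (fun z => \sum_i A i * k i z) z.
  move=> hz; elim: (index_enum 'I_n) => [|i l ih].
    have -> : (fun z => \sum_(i <- [::]) A i * k i z) = (fun=> 0).
      by apply/funext => x; rewrite big_nil.
    exact: cdiff_cst.
  have -> : (fun z => \sum_(j <- i :: l) A j * k j z) =
     (fun z => A i * k i z + \sum_(j <- l) A j * k j z).
    by apply/funext => x; rewrite big_cons.
  by apply: cdiffD => //; apply: cdiffM; [exact: cdiff_cst|exact: dk].
have bsum (A : 'I_n -> R[i]) z : (forall i, normc (A i) <= 1) -> normc z = c ->
    normc (\sum_i A i * k i z) <= n%:R * K1.
  move=> hA zc; have := @sum_close n A (fun i => k i z) (fun=> 0) K1 (ltW K10) hA.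
  rewrite [X in _ - X]big1 ?subr0 => [|i _]; last by rewrite mulr0.
  by apply => i; rewrite subr0; apply: hK1; rewrite normcM normc_conj zc pr.
have rep u : (forall z, a' < normc z < b' -> cdiff u z) ->
   (forall z, normc z = c -> normc (u z) <= n%:R * K1) -> forall dl, 0 < dl ->
   \forall M \near \oo, forall i, normc (aip c al M u (k i) - u (p i) * kap%:C) <= B * e + dl.
  move=> du ub dl dl0; apply: filter_forall => i.
  have [|M0 hM0] := szego_reproducing (N := N) (E := B * e) a'0 a'c cr r1 b'1
      (mulr_ge0 B0 e0) du (pr i) _ dl0; last by exists M0.
  move=> z zc; rewrite (normcM (u z * _)) (normcM (u z)).
  have nx : normc (p i / z) = r / c by rewrite normcM normcV pr zc.
  apply: ler_pM; [by apply: mulr_ge0; exact: normc_ge0|exact: normc_ge0| |exact: he].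
  by apply: ler_pM; [exact: normc_ge0|exact: normc_ge0|exact: ub|exact: hK2].
have hA i : normc ((eta i * om (p i))^*) <= 1 by rewrite normc_conj.
have yA i : normc ((eta i)^*) <= 1 by rewrite normc_conj.
have c_in z : normc z = c -> a < normc z < b by move=> ->; rewrite ac (lt_trans c1).
have reph := rep h (dsum _) (fun z => bsum _ z hA).
have repy := rep y (dsum _) (fun z => bsum _ z yA).
have repoh := rep (fun z => om z * h z)
  (fun z hz => cdiffM (dom z (sub z hz)) (dsum _ z hz)) _.
have {}repoh : forall dl, 0 < dl -> \forall M \near \oo, forall i,
    normc (aip c al M (fun z => om z * h z) (k i) - om (p i) * h (p i) * kap%:C) <= B * e + dl.
  apply: repoh => z zc; rewrite normcM -[X in _ <= X]mul1r.
  by apply: ler_pM; rewrite ?normc_ge0 ?bsum// om1 ?c_in.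
pose T := \sum_i (eta i * om (p i)) * (h (p i) * kap%:C).
pose Y := \sum_i eta i * (y (p i) * kap%:C).
have main dl : 0 < dl -> - (6 * n%:R * (B * e + dl)) <= Re (Y - T).
  move=> dl0.
  have [M [rh [ry roh]]] : exists M, (forall i, normc (aip c al M h (k i) - h (p i) * kap%:C) <= B * e + dl) /\
     (forall i, normc (aip c al M y (k i) - y (p i) * kap%:C) <= B * e + dl) /\
     (forall i, normc (aip c al M (fun z => om z * h z) (k i) - om (p i) * h (p i) * kap%:C) <= B * e + dl).
    have [[[N1 _ h1] [N2 _ h2]] [N3 _ h3]] := (reph _ dl0, repy _ dl0, repoh _ dl0).
    exists (maxn N1 (maxn N2 N3)); split; first by apply: h1; rewrite /= leq_maxl.
    split; first by apply: h2; rewrite /= leq_max leq_maxl orbT.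
    by apply: h3; rewrite /= leq_max leq_maxr orbT.
  have D0 : 0 <= B * e + dl by rewrite addr_ge0 ?mulr_ge0// ltW.
  pose D := n%:R * (B * e + dl).
  have e1 : normc ((anorm2 c al M h)%:C - T) <= D.
    rewrite -aip_self {2}/h aip_sumr; apply: (le_trans _ (sum_close D0 A1 rh)).
    by rewrite le_eqVlt; apply/orP; left; apply/eqP; congr (normc (_ - _)); apply: eq_bigr => i _; rewrite conjcK.
  have e2 : normc ((anorm2 c al M y)%:C - Y) <= D.
    rewrite -aip_self {2}/y aip_sumr; apply: (le_trans _ (sum_close D0 eta1 ry)).
    by rewrite le_eqVlt; apply/orP; left; apply/eqP; congr (normc (_ - _)); apply: eq_bigr => i _; rewrite conjcK.
  have e3 : normc (aip c al M (fun z => om z * h z) y - T) <= D.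
    rewrite /y aip_sumr; apply: (le_trans _ (sum_close D0 eta1 roh)).
    rewrite le_eqVlt; apply/orP; left; apply/eqP; congr (normc (_ - _)); apply: eq_bigr => i _; rewrite ?conjcK//.
    by ring.
  have e4 : normc (aip c al M (fun z => om z * h z) y) <= (anorm2 c al M h + anorm2 c al M y) / 2.
    apply: (le_trans (normc_aip_le _ _ _ _ (ltW al0))).
    rewrite ler_wpM2r// lerD2r; apply: anorm2_le; [exact: ltW|exact: ltW|].
    move=> z hz; rewrite normcM -[X in _ <= X]mul1r ler_wpM2r ?normc_ge0// om1//.
    by case: hz => hz; [rewrite hz b1 (lt_trans ac)|exact: c_in].
  have f1 := le_trans (normr_Re_le _) e1; have f2 := le_trans (normr_Re_le _) e2.
  have f3 := le_trans (normr_Re_le _) e3; have f4 := le_trans (normr_Re_le _) e4.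
  have -> : 6 * n%:R * (B * e + dl) = 6 * D by rewrite /D; ring.
  move: f1 f2 f3 f4; clear.
  have ReB (x z : R[i]) : Re (x - z) = Re x - Re z by case: x z => ? ? [].
  rewrite !ReB !ler_norml /=; lra.
have {}main : - (6 * n%:R * B * e) <= Re (Y - T).
  rewrite leNgt; apply/negP => lt.
  pose d := (- (6 * n%:R * B * e) - Re (Y - T)) / (6 * n%:R + 1) / 2.
  have n1 : 0 < 6 * n%:R + 1 :> R by rewrite ltr_wpDl ?mulr_ge0.
  have d0 : 0 < d by rewrite !divr_gt0// subr_gt0.
  have := main d d0.
  have : (6 * n%:R + 1) * d * 2 = - (6 * n%:R * B * e) - Re (Y - T).
    by rewrite /d; field; rewrite gt_eqF.
  by move: n1 d0 lt; clear; lra.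
have YT : Y - T = kap%:C * (\sum_i \sum_j eta i * (eta j)^* * (1 - om (p i) * (om (p j))^*) *
                     szego q al N (p i * (p j)^*)).
  rewrite /Y /T -sumrB mulr_sumr; apply: eq_bigr => i _.
  rewrite /y /h !mulr_suml !mulr_sumr -sumrB; apply: eq_bigr => j _.
  rewrite /k rmorphM /=; ring.
move: main; rewrite YT; set S := (\sum_i _).
have -> : Re (kap%:C * S) = kap * Re S by case: S => ? ? /=; ring.
have kap0 : 0 < kap := lt_le_trans ltr01 kap1.
have -> : - (6 * n%:R * B) * e = - (6 * n%:R * B * e) by ring.
move=> h1; rewrite -(ler_pM2l kap0); apply: le_trans h1.
by rewrite mulrN lerN2 ler_peMl// mulr_ge0.
Qed.

End PickInequality.

(** * Pick's inequality at two points of a circle *)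

Section TwoPoints.
Variable R : realType.
Implicit Types (om : R[i] -> R[i]) (z w : R[i]) (a b c q s r x y : R) (N M n : nat).

(* The square of its limit turns out to be [1 - Kfun c r ^+ 2]. *)
Definition theta_ratio c r N : R :=
  (th (c ^+ 2) N c * th (c ^+ 2) N (r ^+ 2)) / (th (c ^+ 2) N (- c) * th (c ^+ 2) N (- r ^+ 2)).

Lemma conj_div_real z x : (z / x%:C)^* = z^* / x%:C.
Proof. by rewrite rmorphM fmorphV; congr (_ / _); exact: conj_real. Qed.

Lemma conj_real_mulr z x : (x%:C * z)^* = x%:C * z^*.
Proof. by rewrite rmorphM; congr (_ * _); exact: conj_real. Qed.

(** The quadratic form is tested only on the unit square, since [pick_form] asks for [eta] of
    modulus at most 1. The optimal test t = sqrt B, s = sqrt A stays in that range because [A] and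
    [B] are at most 1. *)
Lemma homogeneous_disc (A B D : R) : 0 <= A -> A <= 1 -> 0 <= B -> B <= 1 -> 0 <= D ->
  (forall t s, 0 <= t <= 1 -> 0 <= s <= 1 -> 2 * (t * s * D) <= t ^+ 2 * A + s ^+ 2 * B) ->
  D ^+ 2 <= A * B.
Proof.
move=> A0 A1 B0 B1 D0 h.
have AB0 : 0 <= A * B by rewrite mulr_ge0.
have [D0'|D0'] := eqVneq D 0; first by rewrite D0' expr0n.
have Dpos : 0 < D by rewrite lt_neqAle eq_sym D0' D0.
have D1 : 2 * D <= A + B by have := h 1 1; rewrite lexx ler01 !mulr1 mul1r expr1n !mul1r; exact.
have [A0'|A0'] := eqVneq A 0.
  have := h 1 D; rewrite lexx ler01 D0 mul1r expr1n A0' mulr0 add0r => /(_ isT).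
  have D1' : D <= 1 by lra.
  rewrite D1' => /(_ isT) h1.
  have : D ^+ 2 * B <= D ^+ 2 * 1 by rewrite ler_wpM2l ?exprn_ge0.
  have : 0 < D ^+ 2 by rewrite exprn_gt0.
  by move: h1; rewrite expr2; lra.
have Apos : 0 < A by rewrite lt_neqAle eq_sym A0' A0.
have [B0'|B0'] := eqVneq B 0.
  have := h D 1; rewrite lexx ler01 D0 mulr1 expr1n B0' mulr0 addr0.
  have D1' : D <= 1 by lra.
  rewrite D1' => /(_ isT isT) h1.
  have : D ^+ 2 * A <= D ^+ 2 * 1 by rewrite ler_wpM2l ?exprn_ge0.
  have : 0 < D ^+ 2 by rewrite exprn_gt0.
  by move: h1; rewrite expr2; lra.
have Bpos : 0 < B by rewrite lt_neqAle eq_sym B0' B0.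
pose t := Num.sqrt B; pose s := Num.sqrt A.
have tB : t ^+ 2 = B by rewrite sqr_sqrtr.
have sA : s ^+ 2 = A by rewrite sqr_sqrtr.
have t0 : 0 < t by rewrite sqrtr_gt0.
have s0 : 0 < s by rewrite sqrtr_gt0.
have t1 : t <= 1 by rewrite -(ler_pXn2r (n := 2)) ?nnegrE ?(ltW t0)// tB expr1n.
have s1 : s <= 1 by rewrite -(ler_pXn2r (n := 2)) ?nnegrE ?(ltW s0)// sA expr1n.
have := h t s; rewrite t1 s1 (ltW t0) (ltW s0) => /(_ isT isT).
rewrite tB sA => hD.
have ts0 : 0 < t * s by rewrite mulr_gt0.
have tsE : (t * s) ^+ 2 = A * B by rewrite exprMn tB sA mulrC.
rewrite -tsE lerXn2r ?nnegrE ?(ltW ts0)//.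
rewrite -(ler_pM2l ts0) -expr2 tsE; lra.
Qed.

Lemma th_gt0 q N s : 0 < q -> q < 1 -> q < s -> s < 1 -> 0 < th q N s.
Proof.
move=> q0 q1 qs s1; rewrite mulr_gt0 ?subr_gt0//; apply: thp_gt0 => //.
by rewrite mulr_ilt1// ltW// (lt_trans q0).
Qed.

Lemma th_le1 q N s : 0 < q -> q < 1 -> q < s -> s < 1 -> th q N s <= 1.
Proof.
move=> q0 q1 qs s1; have s0 := lt_trans q0 qs.
have qs1 : q * s < 1 by rewrite mulr_ilt1// ltW.
rewrite /th -[X in _ <= X]mulr1; apply: ler_pM; rewrite ?subr_ge0 ?(ltW s1)//.
- exact/ltW/thp_gt0.
- by rewrite gerBl ltW.
- exact: thp_le1.
Qed.

Lemma thN_ge1 q N s : 0 < q -> 0 < s -> 1 <= th q N (- s).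
Proof.
by move=> q0 s0; rewrite /th opprK mulr_ege1 ?lerDl ?(ltW s0)// thpN_ge1.
Qed.

Lemma theta_ratio_ge0 c r N : 0 < c -> c < r -> r < 1 -> 0 <= theta_ratio c r N.
Proof.
move=> c0 cr r1; have r0 := lt_trans c0 cr; have c1 := lt_trans cr r1.
have q0 : 0 < c ^+ 2 by rewrite exprn_gt0.
have q1 : c ^+ 2 < 1 by rewrite exprn_ilt1// ltW.
have qr : c ^+ 2 < r ^+ 2 by rewrite ltrXn2r ?nnegrE ?(ltW c0) ?(ltW r0).
have r21 : r ^+ 2 < 1 by rewrite exprn_ilt1// ltW.
have r20 : 0 < r ^+ 2 by rewrite exprn_gt0.
have qc : c ^+ 2 < c by rewrite expr2 gtr_pMl.
have h1 := th_gt0 N q0 q1 qc c1; have h2 := th_gt0 N q0 q1 qr r21.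
have h3 := thN_ge1 N q0 c0; have h4 := thN_ge1 N q0 r20.
rewrite /theta_ratio divr_ge0// mulr_ge0//; lra.
Qed.

(** The weight [al] is such that [al * r ^+ 2] equals [c]. On the diagonal the kernel is then
    [th q N (- c) / th q N (r ^+ 2)]. Off the diagonal its modulus is at least
    [th q N c / th q N (- r ^+ 2)], the value at antipodal points, and the ratio of the two is
    [theta_ratio]. *)
Lemma pick_two om a b c r z1 z2 rho : 0 < a -> a < c -> c < r -> r < 1 -> 1 < b ->
  (forall z, a < normc z < b -> cdiff om z) ->
  (forall z, a < normc z < b -> normc (om z) <= 1) ->
  normc z1 = r -> normc z2 = r -> theta_ratio c r N @[N --> \oo] --> rho ->
  (normc (1 - om z1 * (om z2)^*) * rho) ^+ 2 <=
    (1 - normc (om z1) ^+ 2) * (1 - normc (om z2) ^+ 2).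
Proof.
move=> a0 ac cr r1 b1 dom om1 z1r z2r hrho.
have c0 : 0 < c := lt_trans a0 ac; have r0 : 0 < r := lt_trans c0 cr.
have c1 : c < 1 := lt_trans cr r1.
pose q := c ^+ 2; pose al := c / r ^+ 2.
have q0 : 0 < q by rewrite exprn_gt0.
have q1 : q < 1 by rewrite exprn_ilt1// ltW.
have al0 : 0 < al by rewrite divr_gt0// exprn_gt0.
have qr : q < r ^+ 2 by rewrite ltrXn2r ?nnegrE ?(ltW c0) ?(ltW r0).
have r21 : r ^+ 2 < 1 by rewrite exprn_ilt1// ltW.
have r20 : 0 < r ^+ 2 by rewrite exprn_gt0.
have qc : q < c by rewrite /q expr2 gtr_pMl.
have rc1 : 1 < r / c by rewrite ltr_pdivlMr// mul1r.
have qrc : q * (r / c) < 1.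
  have -> : q * (r / c) = c * r by rewrite /q; field; rewrite gt_eqF.
  by rewrite mulr_ilt1// ltW.
have alrc : 1 < al * (r / c).
  have -> : al * (r / c) = r^-1 by rewrite /al; field; rewrite !gt_eqF.
  by rewrite invf_gt1.
have rho0 : 0 <= rho.
  by apply: (cvgr_to_ge hrho); apply: nearW => N; exact: theta_ratio_ge0.
have zin z : normc z = r -> a < normc z < b.
  by move=> ->; rewrite (lt_trans ac)//= (lt_trans r1).
pose A := 1 - normc (om z1) ^+ 2; pose B := 1 - normc (om z2) ^+ 2.
have ge z : normc z = r -> 0 <= 1 - normc (om z) ^+ 2 /\ 1 - normc (om z) ^+ 2 <= 1.
  move=> zr; rewrite subr_ge0 gerBl exprn_ge0 ?normc_ge0// expr_le1// ?normc_ge0//.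
  by rewrite om1// zin.
have [A0 A1] := ge _ z1r; have [B0 B1] := ge _ z2r; rewrite -/A -/B in A0 A1 B0 B1 *.
set D := normc (1 - om z1 * (om z2)^*); have D0 : 0 <= D by exact: normc_ge0.
pose p (i : 'I_2) := if i == ord0 then z1 else z2.
have pr i : normc (p i) = r by rewrite /p; case: ifP.
have [C C0 hC] := pick_form a0 ac cr r1 b1 dom om1 pr.
rewrite -/q -/al in hC.
apply: homogeneous_disc => //; first by rewrite mulr_ge0.
move=> t s /andP[t0 t1] /andP[s0 s1].
have lim : (fun N => 2 * (t * s * (D * theta_ratio c r N))) @ \oo --> 2 * (t * s * (D * rho)).
  by do 3 (apply: cvgM; first exact: cvg_cst).
apply/ler_addgt0Pl => e e0; rewrite addrC.
apply: (cvgr_to_le lim).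
have C1 : 0 < C + 1 by rewrite ltr_wpDl.
have alrc' : 1 < `|al| * (r / c) by rewrite gtr0_norm.
have [N0 hN0] := szego_err_small q0 q1 (lt0r_neq0 al0) rc1 qrc alrc' (divr_gt0 e0 C1).
exists N0 => // N /= NN.
pose W := (1 - om z1 * (om z2)^*) * szego q al N (z1 * z2^*).
(* The phase of [W], equal to 0 when [W] vanishes; it aligns the cross term with its modulus. *)
pose u := W / (normc W)%:C.
have uW : u^* * W = (normc W)%:C.
  have [->|W0] := eqVneq W 0; first by rewrite mulr0 normc0.
  have nW : (normc W)%:C != 0 :> R[i] by rewrite -normc_gt0 normc_pos ?normc_ge0// normc_gt0.
  by rewrite /u conj_div_real mulrAC [W^* * W]mulrC -sqr_normc_conj rmorphXn expr2 mulfK.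
have u1 : normc u <= 1.
  rewrite /u normcM normcV (normc_pos (normc_ge0 W)).
  by have [->|W0] := eqVneq (normc W) 0; rewrite ?mul0r// divff.
pose eta (i : 'I_2) : R[i] := if i == ord0 then t%:C else - (s%:C * u).
have eta1 i : normc (eta i) <= 1.
  rewrite /eta; case: ifP => _; first by rewrite normc_pos.
  by rewrite normcN normcM (normc_pos s0) mulr_ile1 ?normc_ge0.
have e1 : 0 <= e / (C + 1) by rewrite divr_ge0 ?ltW.
have := hC N _ e1 (hN0 N NN) eta eta1.
pose k0 := th q N (- c) / th q N (r ^+ 2).
have szd z : normc z = r -> szego q al N (z * z^*) = k0%:C.
  move=> zr; have -> : k0%:C = (th q N (- c))%:C / (th q N (r ^+ 2))%:C.
    by rewrite /k0 -fmorphV -rmorphM.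
  rewrite -sqr_normc_conj zr /szego !thC; congr (th _ _ _ / _).
  by rewrite mulNr -rmorphM /al divfK ?gt_eqF// rmorphN.
have nzz z : normc z = r -> 1 - om z * (om z)^* = (1 - normc (om z) ^+ 2)%:C.
  by move=> zr; rewrite -sqr_normc_conj rmorphB rmorph1.
rewrite !big_ord_recl !big_ord0 !addr0 /eta /p !eqxx (_ : (lift ord0 ord0 == ord0) = false)//.
rewrite (szd _ z1r) (szd _ z2r) (nzz _ z1r) (nzz _ z2r) -/A -/B.
have cW : (1 - om z2 * (om z1)^*) * szego q al N (z2 * z1^*) = W^*.
  rewrite /W rmorphM rmorphB rmorph1 rmorphM /= conjcK szego_conj rmorphM /= conjcK.
  by rewrite [om z2 * _]mulrC [z2 * _]mulrC.
set X := (X in Re X).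
have XE : Re X <= t ^+ 2 * A * k0 + s ^+ 2 * B * k0 - 2 * (t * s * normc W).
  have -> : X = (t ^+ 2 * A * k0)%:C - (t * s)%:C * (u^* * W) - (t * s)%:C * (u^* * W)^*
      + (s ^+ 2 * normc u ^+ 2 * B * k0)%:C.
    have c1' : (t%:C)^* = t%:C :> R[i] by exact: conj_real.
    have c2' : (- (s%:C * u))^* = - (s%:C * u^*) by rewrite rmorphN; congr (- _); exact: conj_real_mulr.
    have c3' : (u^* * W)^* = u * W^* by rewrite rmorphM; congr (_ * _); exact: conjcK.
    rewrite /X c1' c2' c3' -!(mulrA (_ * _) (1 - _) (szego _ _ _ _)) cW -/W.
    have c4' : (s ^+ 2 * normc u ^+ 2 * B * k0)%:C = s%:C * s%:C * (u * u^*) * B%:C * k0%:C.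
      by rewrite -sqr_normc_conj !rmorphM.
    rewrite c4' !rmorphM; ring.
  rewrite uW /=.
  have k00 : 0 <= k0.
    rewrite divr_ge0//; last exact/ltW/th_gt0.
    by rewrite (le_trans ler01)// thN_ge1.
  have : s ^+ 2 * normc u ^+ 2 * B * k0 <= s ^+ 2 * B * k0.
    rewrite ler_wpM2r// ler_wpM2r// ler_piMr ?exprn_ge0//.
    by rewrite expr_le1 ?normc_ge0.
  by rewrite !mul0r !subr0; lra.
move=> hX; have {hX XE} := le_trans hX XE.
have t1' : th q N (r ^+ 2) <= 1 by exact: th_le1.
have t0' : 0 < th q N (r ^+ 2) by exact: th_gt0.
have tc := thN_ge1 N q0 c0; have tr := thN_ge1 N q0 r20.
have k01 : 1 <= k0 by rewrite /k0 ler_pdivlMr// mul1r (le_trans t1').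
have k0pos : 0 < k0 := lt_le_trans ltr01 k01.
have ratioE : theta_ratio c r N = th q N c / th q N (- r ^+ 2) / k0.
  by rewrite /theta_ratio /k0 -/q; field; rewrite !gt_eqF// (lt_le_trans ltr01).
have thc : 0 < th q N c by exact: th_gt0.
have sW : D * theta_ratio c r N * k0 <= normc W.
  rewrite /W normcM -/D -mulrA ler_wpM2l// ratioE divfK ?gt_eqF//.
  rewrite /szego normcM normcV.
  have nzz' : normc (z1 * z2^*) = r ^+ 2 by rewrite normcM normc_conj z1r z2r expr2.
  have nal : normc (- al%:C * (z1 * z2^*)) = c.
    by rewrite mulNr normcN normcM (normc_pos (ltW al0)) nzz' /al divfK// gt_eqF.
  have qc1 : q * c < 1 by rewrite mulr_ilt1// ltW.
  have lo : th q N c <= normc (th q%:C N (- al%:C * (z1 * z2^*))).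
    rewrite /th normcM; apply: ler_pM.
    - by rewrite subr_ge0 ltW.
    - exact/ltW/thp_gt0.
    - by have := le_normc_sub 1 (- al%:C * (z1 * z2^*)); rewrite normc1 nal.
    - by rewrite -{1}nal; apply: normc_thp_ge => //; rewrite nal.
  have hi : normc (th q%:C N (z1 * z2^*)) <= th q N (- r ^+ 2).
    rewrite /th normcM opprK; apply: ler_pM; rewrite ?normc_ge0//.
    - by rewrite (le_trans (le_normcB _ _))// normc1 nzz'.
    - by rewrite -nzz'; apply: normc_thp_le; exact: ltW.
  have hi0 : 0 < normc (th q%:C N (z1 * z2^*)).
    rewrite normc_gt0; apply: th_neq0; rewrite ?nzz'// ?lt_eqF//.
    by rewrite mulr_ilt1// ?ltW.
  apply: ler_pM => //; [exact: ltW|by rewrite invr_ge0 (le_trans ler01)|].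
  by rewrite lef_pV2 ?posrE// (lt_le_trans ltr01).
have e2 : C * (e / (C + 1)) <= e.
  by rewrite mulrA ler_pdivrMr// mulrC ler_pM2l// lerDl.
move=> h1.
have h2 : 2 * (t * s * (D * theta_ratio c r N)) * k0 <= (t ^+ 2 * A + s ^+ 2 * B) * k0 + e.
  have : t * s * (D * theta_ratio c r N * k0) <= t * s * normc W by rewrite ler_wpM2l// mulr_ge0.
  have -> : 2 * (t * s * (D * theta_ratio c r N)) * k0 = 2 * (t * s * (D * theta_ratio c r N * k0)) by ring.
  by move: h1 e2; clear; lra.
(* Division by [k0] does not enlarge the error [e], since [k0] is at least 1 for every [N]. *)
rewrite -(ler_pM2r k0pos); apply: (le_trans h2).
by rewrite [X in _ <= X]mulrDl lerD2l ler_peMr// ltW.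
Qed.

End TwoPoints.

(** * Passage to the open annulus *)

Section TwoPointsLimit.
Variable R : realType.
Implicit Types (om : R[i] -> R[i]) (z w : R[i]) (a b c d q s r x y : R) (N M n m : nat).

Lemma half_angle_bounds x : 0 <= x -> x < 1 ->
  0 <= 1 - (1 - x) / (1 + x) <= 1 /\ 1 - (1 - x) / (1 + x) <= 2 * x.
Proof.
move=> x0 x1; have p : 0 < 1 + x by rewrite ltr_wpDr.
have -> : 1 - (1 - x) / (1 + x) = 2 * x / (1 + x) by field; rewrite gt_eqF.
rewrite divr_ge0 ?mulr_ge0 ?(ltW p)//= !ler_pdivrMr//; split; first by lra.
by rewrite ler_peMr ?mulr_ge0// lerDl.
Qed.

Lemma prod4_ge (y1 y2 y3 y4 : R) : 0 <= y1 <= 1 -> 0 <= y2 <= 1 -> 0 <= y3 <= 1 -> 0 <= y4 <= 1 ->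
  1 - (y1 + y2 + y3 + y4) <= (1 - y1) * (1 - y2) * (1 - y3) * (1 - y4) <= 1.
Proof.
have step (s y P : R) : 0 <= y <= 1 -> 0 <= s -> 0 <= P <= 1 -> 1 - s <= P ->
    1 - (s + y) <= P * (1 - y) /\ 0 <= P * (1 - y) <= 1.
  move=> /andP[y0 yle] s0 /andP[P0 P1] sP; split.
    rewrite mulrBr mulr1; have : P * y <= 1 * y by rewrite ler_wpM2r.
    lra.
  by rewrite mulr_ge0 ?subr_ge0//= mulr_ile1// ?subr_ge0// gerBl.
move=> h1 h2 h3 h4; have /andP[a1 b1] := h1; have /andP[a2 b2] := h2.
have /andP[a3 b3] := h3; have /andP[a4 b4] := h4.
have P1 : 0 <= 1 - y1 <= 1 by rewrite subr_ge0 gerBl b1.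
have [s2 P2] := step y1 y2 _ h2 a1 P1 (lexx _).
have [s3 P3] := step _ y3 _ h3 (addr_ge0 a1 a2) P2 s2.
have [s4 P4] := step _ y4 _ h4 (addr_ge0 (addr_ge0 a1 a2) a3) P3 s3.
by rewrite s4; case/andP: P4.
Qed.

Definition theta_factor c r N : R :=
  let q := c ^+ 2 in let f x := (1 - x) / (1 + x) in
  f (q ^+ N.+1 * c) * f (q ^+ N.+1 / c) * f (q ^+ N.+1 * r ^+ 2) * f (q ^+ N.+1 / r ^+ 2).

Lemma theta_ratioS c r N : 0 < c -> c < r -> r < 1 ->
  theta_ratio c r N.+1 = theta_ratio c r N * theta_factor c r N.
Proof.
move=> c0 cr r1; have r0 := lt_trans c0 cr.
have q0 : 0 < c ^+ 2 by rewrite exprn_gt0.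
have r20 : 0 < r ^+ 2 by rewrite exprn_gt0.
have E s : th (c ^+ 2) N.+1 s = th (c ^+ 2) N s *
    ((1 - (c ^+ 2) ^+ N.+1 * s) * (1 - (c ^+ 2) ^+ N.+1 / s)) by rewrite /th thpS mulrA.
have h3 : 0 < th (c ^+ 2) N (- c) := lt_le_trans ltr01 (thN_ge1 N q0 c0).
have h4 : 0 < th (c ^+ 2) N (- r ^+ 2) := lt_le_trans ltr01 (thN_ge1 N q0 r20).
rewrite /theta_ratio /theta_factor !E !invrN !mulrN !opprK.
have Q0 : 0 < (c ^+ 2) ^+ N.+1 by rewrite exprn_gt0.
move: (th _ _ c) (th _ _ (r ^+ 2)) (th _ _ (- c)) (th _ _ (- r ^+ 2)) h3 h4 => A B C D C0 D0.
have p1 : 0 < 1 + (c ^+ 2) ^+ N.+1 * c by rewrite addr_gt0// mulr_gt0.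
have p2 : 0 < 1 + (c ^+ 2) ^+ N.+1 / c by rewrite addr_gt0// divr_gt0.
have p3 : 0 < 1 + (c ^+ 2) ^+ N.+1 * r ^+ 2 by rewrite addr_gt0// mulr_gt0.
have p4 : 0 < 1 + (c ^+ 2) ^+ N.+1 / r ^+ 2 by rewrite addr_gt0// divr_gt0.
move: (1 + _ * c) (1 + _ / c) (1 + _ * r ^+ 2) (1 + _ / r ^+ 2) p1 p2 p3 p4 => x1 x2 x3 x4 p1 p2 p3 p4.
move: (1 - _ * c) (1 - _ / c) (1 - _ * r ^+ 2) (1 - _ / r ^+ 2) => y1 y2 y3 y4.
by field; rewrite !gt_eqF.
Qed.

(** Each of the four quotients (1 - x) / (1 + x) is at least 1 - 2 x, with x at most
    [(d ^+ 2) ^+ N.+1 / c0 ^+ 2]; this explains the 8. The bound sees [c] only through [c0] and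
    [d]. *)
Lemma theta_factor_bounds c0 c d r N : 0 < c0 -> c0 <= c -> c <= d -> d < 1 -> c < r -> r < 1 ->
  1 - 8 / c0 ^+ 2 * (d ^+ 2) ^+ N.+1 <= theta_factor c r N <= 1.
Proof.
move=> c00 c0c cd d1 cr r1; have c1 := le_lt_trans cd d1.
have cp : 0 < c := lt_le_trans c00 c0c; have r0 := lt_trans cp cr.
pose q := c ^+ 2; pose Q := (d ^+ 2) ^+ N.+1 / c0 ^+ 2.
have q0 : 0 < q by rewrite exprn_gt0.
have q1 : q < 1 by rewrite exprn_ilt1// ltW.
have qN0 : 0 < q ^+ N.+1 by rewrite exprn_gt0.
have dp := lt_le_trans cp cd.
have qN : q ^+ N.+1 <= (d ^+ 2) ^+ N.+1.
  by rewrite lerXn2r ?nnegrE ?exprn_ge0 ?(ltW cp) ?(ltW dp)// lerXn2r ?nnegrE ?(ltW cp) ?(ltW dp).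
have qNq : q ^+ N.+1 <= q by rewrite exprS ler_piMr ?(ltW q0)// exprn_ile1 ?(ltW q0) ?(ltW q1).
have c02 : 0 < c0 ^+ 2 by rewrite exprn_gt0.
have c021 : c0 ^+ 2 <= 1 by rewrite exprn_ile1 ?(ltW c00)// (le_trans c0c)// ltW.
have r20 : 0 < r ^+ 2 by rewrite exprn_gt0.
have qr : q < r ^+ 2 by rewrite ltrXn2r ?nnegrE ?(ltW cp) ?(ltW r0).
have qc : q < c by rewrite /q expr2 gtr_pMl.
have dQ : (d ^+ 2) ^+ N.+1 <= Q by rewrite /Q ler_pdivlMr// ler_piMr// ?exprn_ge0 ?exprn_ge0 ?(ltW dp).
have r21 : r ^+ 2 < 1 by rewrite exprn_ilt1// ltW.
have B1 : 0 <= q ^+ N.+1 * c /\ q ^+ N.+1 * c < 1 /\ q ^+ N.+1 * c <= Q.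
  have h : q ^+ N.+1 * c <= q ^+ N.+1 by rewrite ler_piMr ?(ltW c1)// ltW.
  rewrite mulr_ge0 ?(ltW cp) ?(ltW qN0)// (le_trans h)// ?(le_trans qN)//.
  by rewrite (le_lt_trans h)// (le_lt_trans qNq).
have B3 : 0 <= q ^+ N.+1 * r ^+ 2 /\ q ^+ N.+1 * r ^+ 2 < 1 /\ q ^+ N.+1 * r ^+ 2 <= Q.
  have h : q ^+ N.+1 * r ^+ 2 <= q ^+ N.+1 by rewrite ler_piMr ?(ltW r21)// ltW.
  rewrite mulr_ge0 ?(ltW r20) ?(ltW qN0)// (le_trans h)// ?(le_trans qN)//.
  by rewrite (le_lt_trans h)// (le_lt_trans qNq).
have B2 : 0 <= q ^+ N.+1 / c /\ q ^+ N.+1 / c < 1 /\ q ^+ N.+1 / c <= Q.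
  rewrite divr_ge0 ?(ltW cp) ?(ltW qN0)//; split=> //; split.
    by rewrite ltr_pdivrMr// mul1r (le_lt_trans qNq).
  rewrite /Q; apply: ler_pM; rewrite ?invr_ge0 ?(ltW qN0) ?(ltW cp)//.
  rewrite lef_pV2 ?posrE//; apply: (le_trans _ c0c).
  by rewrite expr2 ger_pMl// (ltW (le_lt_trans c0c c1)).
have B4 : 0 <= q ^+ N.+1 / r ^+ 2 /\ q ^+ N.+1 / r ^+ 2 < 1 /\ q ^+ N.+1 / r ^+ 2 <= Q.
  rewrite divr_ge0 ?(ltW r20) ?(ltW qN0)//; split=> //; split.
    by rewrite ltr_pdivrMr// mul1r (le_lt_trans qNq).
  rewrite /Q; apply: ler_pM; rewrite ?invr_ge0 ?(ltW qN0) ?(ltW r20)//.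
  rewrite lef_pV2 ?posrE// lerXn2r ?nnegrE ?(ltW c00) ?(ltW r0)//.
  exact: ltW (le_lt_trans c0c cr).
have [B1a [B1b B1c]] := B1; have [B2a [B2b B2c]] := B2.
have [B3a [B3b B3c]] := B3; have [B4a [B4b B4c]] := B4.
have [g1 e1] := half_angle_bounds B1a B1b; have [g2 e2] := half_angle_bounds B2a B2b.
have [g3 e3] := half_angle_bounds B3a B3b; have [g4 e4] := half_angle_bounds B4a B4b.
have := prod4_ge g1 g2 g3 g4; rewrite !subKr => /andP[h ->]; rewrite andbT.
apply: le_trans h.
have -> : 8 / c0 ^+ 2 * (d ^+ 2) ^+ N.+1 = 8 * Q by rewrite /Q mulrAC mulrA.
by move: e1 e2 e3 e4 B1c B2c B3c B4c; clear; lra.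
Qed.

(** Uniformity over inner radii in [[c0, d]] is the point: it lets the limit in [N] be exchanged
    with the limit in the radius. *)
Lemma theta_ratio_tail c0 c d r N m : 0 < c0 -> c0 <= c -> c <= d -> d < 1 -> c < r -> r < 1 ->
  theta_ratio c r N * (1 - 8 / c0 ^+ 2 * ((d ^+ 2) ^+ N.+1 / (1 - d ^+ 2))) <=
    theta_ratio c r (N + m) <= theta_ratio c r N.
Proof.
move=> c00 c0c cd d1 cr r1; have cp : 0 < c := lt_le_trans c00 c0c.
have dp := lt_le_trans cp cd.
have p1 : 0 < 1 - d ^+ 2 by rewrite subr_gt0 exprn_ilt1// ltW.
have ge0 n : 0 <= theta_ratio c r n by exact: theta_ratio_ge0.
have K0 : 0 <= 8 / c0 ^+ 2 by rewrite divr_ge0// exprn_ge0 ?ltW.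
have fb n := theta_factor_bounds n c00 c0c cd d1 cr r1.
have [lo hi] : theta_ratio c r N * (1 - 8 / c0 ^+ 2 * ((d ^+ 2) ^+ N.+1 * \sum_(i < m) (d ^+ 2) ^+ i)) <=
    theta_ratio c r (N + m) /\ theta_ratio c r (N + m) <= theta_ratio c r N.
  elim: m => [|m [ih1 ih2]].
    by rewrite big_ord0 !mulr0 subr0 mulr1 addn0.
  rewrite addnS theta_ratioS//; have /andP[f1 f2] := fb (N + m)%N; split.
    rewrite big_ord_recr /=.
    have h1 : theta_ratio c r (N + m) * (1 - 8 / c0 ^+ 2 * (d ^+ 2) ^+ (N + m).+1) <=
      theta_ratio c r (N + m) * theta_factor c r (N + m) by rewrite ler_wpM2l.
    apply: le_trans h1.
    have E : 0 <= 8 / c0 ^+ 2 * (d ^+ 2) ^+ (N + m).+1 by rewrite mulr_ge0// !exprn_ge0 ?(ltW dp).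
    have h2 := ler_wpM2r E ih2.
    move: ih1 h2; rewrite -addSn exprD; set X := theta_ratio _ _ _; set Y := theta_ratio _ _ _.
    set S := \sum_(i < m) _; set Z := (d ^+ 2) ^+ N.+1; set T := (d ^+ 2) ^+ m.
    by clear; lra.
  by rewrite (le_trans _ ih2)// ler_piMr.
rewrite hi andbT; apply: le_trans lo; rewrite ler_wpM2l// lerD2l lerN2 ler_wpM2l//.
rewrite ler_wpM2l ?exprn_ge0 ?exprn_ge0 ?(ltW dp)//.
rewrite -[X in _ <= X]mul1r ler_pdivlMr// mulrC -opprB mulNr -subrX1 opprB.
by rewrite gerBl !exprn_ge0 ?(ltW dp).
Qed.

Lemma theta_ratio_cvg c r : 0 < c -> c < r -> r < 1 ->
  theta_ratio c r N @[N --> \oo] --> lim (theta_ratio c r N @[N --> \oo]).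
Proof.
move=> c0 cr r1; apply: nonincreasing_is_cvgn.
  apply/nonincreasing_seqP => n.
  by have := theta_ratio_tail n 1 c0 (lexx c) (lexx c) (lt_trans cr r1) cr r1; rewrite addn1 => /andP[].
by exists 0 => _ [n _ <-]; exact: theta_ratio_ge0.
Qed.

Lemma cvg_thp (qn xn : nat -> R) q x N : qn @ \oo --> q -> xn @ \oo --> x -> x != 0 ->
  thp (qn n) N (xn n) @[n --> \oo] --> thp q N x.
Proof.
move=> hq hx x0; elim: N => [|N ih].
  have E (p s : R) : thp p 0 s = 1 by rewrite /thp big_ord0.
  by rewrite E (_ : (fun _ => _) = (fun=> 1)); [exact: cvg_cst|apply/funext => n; rewrite E].
have E (p s : nat -> R) : (fun n => thp (p n) N.+1 (s n)) = (fun n => thp (p n) N (s n) *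
   ((1 - p n ^+ N.+1 * s n) * (1 - p n ^+ N.+1 * (s n)^-1))).
  by apply/funext => n; rewrite thpS.
rewrite E thpS; apply: cvgM => //.
have hqN : qn n ^+ N.+1 @[n --> \oo] --> q ^+ N.+1.
  elim: N.+1 => [|k ihk].
    by rewrite expr0 (_ : (fun _ => _) = (fun=> 1)); [exact: cvg_cst|apply/funext => n; rewrite expr0].
  rewrite exprS (_ : (fun _ => _) = (fun n => qn n * qn n ^+ k)); first exact: cvgM.
  by apply/funext => n; rewrite exprS.
apply: cvgM; apply: cvgB; try exact: cvg_cst; apply: cvgM => //.
exact: cvgV.
Qed.

Lemma cvg_th (qn xn : nat -> R) q x N : qn @ \oo --> q -> xn @ \oo --> x -> x != 0 ->
  th (qn n) N (xn n) @[n --> \oo] --> th q N x.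
Proof.
move=> hq hx x0; apply: cvgM; last exact: cvg_thp.
by apply: cvgB => //; exact: cvg_cst.
Qed.

Lemma cvg_theta_ratio (cn : nat -> R) c r N : 0 < c -> c < r -> cn @ \oo --> c ->
  theta_ratio (cn n) r N @[n --> \oo] --> theta_ratio c r N.
Proof.
move=> c0 cr hc; have r0 := lt_trans c0 cr.
have q0 : 0 < c ^+ 2 by rewrite exprn_gt0.
have r20 : 0 < r ^+ 2 by rewrite exprn_gt0.
have hq : cn n ^+ 2 @[n --> \oo] --> c ^+ 2.
  rewrite (_ : (fun _ => _) = (fun n => cn n * cn n)); first by rewrite expr2; exact: cvgM.
  by apply/funext => n; rewrite expr2.
apply: cvgM.
  by apply: cvgM; apply: cvg_th => //; rewrite ?gt_eqF//; exact: cvg_cst.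
have h3 : 0 < th (c ^+ 2) N (- c) := lt_le_trans ltr01 (thN_ge1 N q0 c0).
have h4 : 0 < th (c ^+ 2) N (- r ^+ 2) := lt_le_trans ltr01 (thN_ge1 N q0 r20).
apply: cvgV; first by rewrite gt_eqF// mulr_gt0.
apply: cvgM; apply: cvg_th; rewrite ?oppr_eq0 ?gt_eqF//; [exact: cvgN|exact: cvg_cst].
Qed.

(** The dilate [om (s * z)] is holomorphic for [c / s < normc z < s^-1], an annulus that contains
    the closed one between [c1] and 1 as soon as [s] exceeds [c / c1]. Let [s] tend to 1. *)
Lemma two_points_smaller om c c1 r z1 z2 rho : 0 < c -> c < c1 -> c1 < r -> r < 1 ->
  (forall z, c < normc z < 1 -> cdiff om z) ->
  (forall z, c < normc z < 1 -> normc (om z) <= 1) ->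
  normc z1 = r -> normc z2 = r -> theta_ratio c1 r N @[N --> \oo] --> rho ->
  (normc (1 - om z1 * (om z2)^*) * rho) ^+ 2 <=
    (1 - normc (om z1) ^+ 2) * (1 - normc (om z2) ^+ 2).
Proof.
move=> c0 cc1 c1r r1 dom om1 z1r z2r hrho.
have c10 := lt_trans c0 cc1; have r0 := lt_trans c10 c1r.
pose s n : R := 1 - n.+2%:R^-1.
have s0 n : 0 < s n by rewrite subr_gt0 invf_lt1// ltr1n.
have s1 n : s n < 1 by rewrite gtrBl invr_gt0.
have hs : s @ \oo --> (1 : R).
  rewrite -[X in _ --> X]subr0; apply: cvgB; first exact: cvg_cst.
  have := @cvg_harmonic R; rewrite -(cvg_shiftS (fun n => n.+1%:R^-1 : R)); exact.
have step n : c / c1 < s n ->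
  (normc (1 - om ((s n)%:C * z1) * (om ((s n)%:C * z2))^*) * rho) ^+ 2 <=
    (1 - normc (om ((s n)%:C * z1)) ^+ 2) * (1 - normc (om ((s n)%:C * z2)) ^+ 2).
  move=> hn.
  have nz z : normc ((s n)%:C * z) = s n * normc z by rewrite normcM normc_pos// ltW.
  have a0 : 0 < c / s n by rewrite divr_gt0.
  have ac1 : c / s n < c1 by rewrite ltr_pdivrMr// mulrC -ltr_pdivrMr.
  have b1 : 1 < (s n)^-1 by rewrite invf_gt1.
  apply: (@pick_two _ (fun z => om ((s n)%:C * z)) (c / s n) (s n)^-1 c1 r z1 z2 rho a0 ac1 c1r r1 b1) => //.
    move=> z /andP[za zb].
    have zin : c < normc ((s n)%:C * z) < 1.
      by rewrite nz mulrC -ltr_pdivrMr// za/= -ltr_pdivlMr// mul1r.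
    have [psi cpsi oE] := dom _ zin.
    exists (fun w => psi ((s n)%:C * w) * (s n)%:C).
      apply: ccontM; last exact: ccont_cst.
      apply: (ccont_comp (f := fun w => (s n)%:C * w)) => //.
      by apply: ccontM; [exact: ccont_cst|exact: ccont_id].
    by move=> w; rewrite oE -mulrBr; ring.
  move=> z /andP[za zb]; apply: om1.
  by rewrite nz mulrC -ltr_pdivrMr// za/= -ltr_pdivlMr// mul1r.
have hom z : normc z = r -> climit (fun n => om ((s n)%:C * z)) (om z).
  move=> zr; apply/climit_epsP => e e0.
  have [|d d0 hd] := cdiff_cont (dom z _) e0; first by rewrite zr (lt_trans cc1).
  move/cvgrPdist_lt : hs => /(_ _ d0)[N _ hN]; exists N => n Nn.
  apply/ltW/hd; have := hN n Nn; rewrite /= => h.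
  rewrite -{2}[z]mul1r -mulrBl normcM zr -(rmorph1 (@real_complex R)) -rmorphB normc_real.
  by rewrite distrC (le_lt_trans _ h)// ler_piMr// ltW.
have l1 := hom _ z1r; have l2 := hom _ z2r.
have lD := climit_normc (climitB (climit_cst 1) (climitM l1 (climit_conj l2))).
have n1 := climit_normc l1; have n2 := climit_normc l2.
have sqE (u : nat -> R) (l : R) : u @ \oo --> l -> u n ^+ 2 @[n --> \oo] --> l ^+ 2.
  move=> h; rewrite (_ : (fun _ => _) = (fun n => u n * u n)); first by rewrite expr2; exact: cvgM.
  by apply/funext => n; rewrite expr2.
have L : (normc (1 - om ((s n)%:C * z1) * (om ((s n)%:C * z2))^*) * rho) ^+ 2 @[n --> \oo] -->
   (normc (1 - om z1 * (om z2)^*) * rho) ^+ 2.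
  by apply: sqE; apply: cvgM => //; exact: cvg_cst.
have L' : (1 - normc (om ((s n)%:C * z1)) ^+ 2) * (1 - normc (om ((s n)%:C * z2)) ^+ 2) @[n --> \oo] -->
   (1 - normc (om z1) ^+ 2) * (1 - normc (om z2) ^+ 2).
  by apply: cvgM; apply: cvgB; try exact: cvg_cst; exact: sqE.
apply: (ler_cvg_to L L').
have cc : 0 < 1 - c / c1 by rewrite subr_gt0 ltr_pdivrMr// mul1r.
move/cvgrPdist_lt : hs => /(_ _ cc)[N _ hN]; exists N => // n Nn; apply: step.
have := hN n Nn => /=; rewrite ger0_norm ?subr_ge0 ?(ltW (s1 n))//; lra.
Qed.

(** At fixed [N] the truncated quotient is continuous in the inner radius, so the inequality
    survives the passage from radii above [c] to [c] itself with the loss [tau N], which then tends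
    to 0. *)
Lemma two_points om c r z1 z2 : 0 < c -> c < r -> r < 1 ->
  (forall z, c < normc z < 1 -> cdiff om z) ->
  (forall z, c < normc z < 1 -> normc (om z) <= 1) ->
  normc z1 = r -> normc z2 = r ->
  (normc (1 - om z1 * (om z2)^*) * lim (theta_ratio c r N @[N --> \oo])) ^+ 2 <=
    (1 - normc (om z1) ^+ 2) * (1 - normc (om z2) ^+ 2).
Proof.
move=> c0 cr r1 dom om1 z1r z2r; have r0 := lt_trans c0 cr.
set AB := (X in _ <= X); set D := normc _; have D0 : 0 <= D by exact: normc_ge0.
(* All approximating radii lie between [c] and this midpoint, hence stay away from [r], and the tail
   estimate is uniform on that interval. *)
pose d := (c + r) / 2.
have cd : c < d by rewrite /d; lra.
have dr : d < r by rewrite /d; lra.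
have d1 := lt_trans dr r1; have d0 := lt_trans c0 cd.
pose tau N := 8 / c ^+ 2 * ((d ^+ 2) ^+ N.+1 / (1 - d ^+ 2)).
have htau : tau @ \oo --> (0 : R).
  rewrite -[X in _ --> X](mulr0 (8 / c ^+ 2)); apply: cvgM; first exact: cvg_cst.
  rewrite -[X in _ --> X](mul0r (1 - d ^+ 2)^-1); apply: cvgM; last exact: cvg_cst.
  have : (fun n => (d ^+ 2) ^+ n) @ \oo --> (0 : R).
    by apply: cvg_expr; rewrite ger0_norm ?exprn_ge0 ?(ltW d0)// exprn_ilt1 ?(ltW d0).
  by rewrite -(cvg_shiftS (fun n => (d ^+ 2) ^+ n)).
pose cn n : R := c + (d - c) * n.+1%:R^-1.
have cnc n : c < cn n by rewrite ltrDl mulr_gt0 ?invr_gt0 ?subr_gt0.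
have cnd n : cn n <= d.
  by rewrite -lerBrDl ler_piMr ?subr_ge0 ?(ltW cd)// invf_le1// ler1n.
have hcn : cn @ \oo --> c.
  rewrite -[X in _ --> X]addr0; apply: cvgD; first exact: cvg_cst.
  rewrite -[X in _ --> X](mulr0 (d - c)); apply: cvgM; first exact: cvg_cst.
  exact: cvg_harmonic.
have step N : tau N <= 1 -> (D * (theta_ratio c r N * (1 - tau N))) ^+ 2 <= AB.
  move=> tN.
  have L : (D * (theta_ratio (cn n) r N * (1 - tau N))) ^+ 2 @[n --> \oo] -->
     (D * (theta_ratio c r N * (1 - tau N))) ^+ 2.
    rewrite expr2 (_ : (fun _ => _) = (fun n => D * (theta_ratio (cn n) r N * (1 - tau N)) *
      (D * (theta_ratio (cn n) r N * (1 - tau N))))); last by apply/funext => n; rewrite expr2.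
    have h : D * (theta_ratio (cn n) r N * (1 - tau N)) @[n --> \oo] --> D * (theta_ratio c r N * (1 - tau N)).
      apply: cvgM; first exact: cvg_cst.
      by apply: cvgM; [exact: cvg_theta_ratio|exact: cvg_cst].
    exact: cvgM.
  apply: (cvgr_to_le L); apply: nearW => n.
  have cn0 := lt_trans c0 (cnc n); have cnr := le_lt_trans (cnd n) dr.
  have hl := theta_ratio_cvg cn0 cnr r1.
  have := two_points_smaller c0 (cnc n) cnr r1 dom om1 z1r z2r hl.
  apply: le_trans; have t0 := theta_ratio_ge0 N cn0 cnr r1.
  have low : theta_ratio (cn n) r N * (1 - tau N) <= lim (theta_ratio (cn n) r N @[N --> \oo]).
    apply: (cvgr_to_ge hl); exists N => // m /= Nm; rewrite -(subnKC Nm).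
    by have /andP[] := theta_ratio_tail N (m - N) c0 (ltW (cnc n)) (cnd n) d1 cnr r1.
  have low0 : 0 <= theta_ratio (cn n) r N * (1 - tau N) by rewrite mulr_ge0// subr_ge0.
  have l0 := le_trans low0 low.
  apply: lerXn2r; [by rewrite nnegrE mulr_ge0|by rewrite nnegrE mulr_ge0|by rewrite ler_wpM2l].
have hl := theta_ratio_cvg c0 cr r1.
have L : (D * (theta_ratio c r N * (1 - tau N))) ^+ 2 @[N --> \oo] -->
    (D * lim (theta_ratio c r N @[N --> \oo])) ^+ 2.
  rewrite (_ : (fun _ => _) = (fun N => D * (theta_ratio c r N * (1 - tau N)) *
      (D * (theta_ratio c r N * (1 - tau N))))); last by apply/funext => n; rewrite expr2.
  have h : D * (theta_ratio c r N * (1 - tau N)) @[N --> \oo] --> D * lim (theta_ratio c r N @[N --> \oo]).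
    apply: cvgM; first exact: cvg_cst.
    rewrite -[X in _ --> X]mulr1; apply: cvgM; first exact: hl.
    by rewrite -[X in _ --> X]subr0; apply: cvgB => //; exact: cvg_cst.
  by rewrite expr2; exact: cvgM.
apply: (cvgr_to_le L).
move/cvgrPdist_lt : htau => /(_ _ ltr01)[N _ hN]; exists N => // n Nn; apply: step.
have := hN n Nn; rewrite /= sub0r normrN => /ltW; exact/le_trans/ler_norm.
Qed.

End TwoPointsLimit.

(** * Jacobi's identity and the function [Kfun] *)

Section JacobiIdentity.
Variable R : realType.
Implicit Types (z w : R[i]) (c d q s r x y e : R) (N M n m : nat).

Lemma thpV (F : fieldType) (q x : F) N : thp q N x^-1 = thp q N x.
Proof. by rewrite /thp; apply: eq_bigr => j _; rewrite invrK mulrC. Qed.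

Lemma thV (F : fieldType) (q x : F) N : x != 0 -> th q N x^-1 = - x^-1 * th q N x.
Proof. by move=> x0; rewrite /th thpV mulrA; congr (_ * _); field. Qed.

(* The elliptic function with period q whose residue sum on an annulus is Jacobi's identity. *)
Definition elliptic q c x N z : R[i] :=
  szego q c N z * szego q (c * x)^-1 N (c%:C * z) * szego q (- x) N (- z).

(** The three weights multiply to -1 and the three shifts contribute three signs, so the period is
    exact up to truncation. Expanding the product of the factors [1 + szego_err] leaves seven terms
    of modulus at most [e]. *)
Lemma elliptic_shift q c x N z (e : R) : 0 < q -> q < 1 -> 0 < c -> c < 1 -> 0 < x ->
  1 < c * normc z -> q * normc z < 1 -> x < normc z -> 1 < x * normc z ->
  0 <= e -> e <= 1 ->
  normc (szego_err q c N z) <= e -> normc (szego_err q (c * x)^-1 N (c%:C * z)) <= e ->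
  normc (szego_err q (- x) N (- z)) <= e ->
  normc (elliptic q c x N z - elliptic q c x N (q%:C * z)) <= normc (elliptic q c x N z) * (7 * e).
Proof.
move=> q0 q1 c0 c1 x0 cz qz xz1 xz e0 e1 h1 h2 h3.
have z0 : 0 < normc z by exact: lt_trans xz1.
have z1 : 1 < normc z by rewrite (lt_trans cz)// gtr_pMl.
have ncz : normc (c%:C * z) = c * normc z by rewrite normcM normc_pos// ltW.
have s1 := szego_shift N q0 q1 (lt0r_neq0 c0) z1 qz _; rewrite gtr0_norm// in s1.
have := s1 cz => {}s1.
have a2 : (c * x)^-1 != 0 by rewrite invr_eq0 mulf_neq0 ?gt_eqF.
have s2 := szego_shift (x := c%:C * z) N q0 q1 a2; rewrite ncz in s2.
have {}s2 := s2 cz; rewrite gtr0_norm ?invr_gt0 ?mulr_gt0// in s2.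
have {}s2 : (c * x)^-1%:C * szego q (c * x)^-1 N (q%:C * (c%:C * z)) =
    - szego q (c * x)^-1 N (c%:C * z) * (1 + szego_err q (c * x)^-1 N (c%:C * z)).
  apply: s2; first by rewrite mulrCA (lt_trans _ c1)// gtr_pMr.
  have -> : (c * x)^-1 * (c * normc z) = normc z / x by field; rewrite !gt_eqF.
  by rewrite ltr_pdivlMr// mul1r.
have s3 := szego_shift (al := - x) (x := - z) N q0 q1; rewrite oppr_eq0 (gt_eqF x0) !normcN in s3.
have {}s3 := s3 isT z1 qz; rewrite normrN gtr0_norm// in s3.
have {}s3 := s3 xz.
have E : elliptic q c x N (q%:C * z) = elliptic q c x N z * ((1 + szego_err q c N z) *
   (1 + szego_err q (c * x)^-1 N (c%:C * z)) * (1 + szego_err q (- x) N (- z))).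
  have al3 : c%:C * (c * x)^-1%:C * (- x)%:C = -1 :> R[i].
    rewrite -!rmorphM -(rmorph1 (@real_complex R)) -rmorphN; congr (_%:C).
    by field; rewrite !gt_eqF.
  apply: oppr_inj; rewrite -mulN1r -al3 /elliptic.
  have -> : c%:C * (q%:C * z) = q%:C * (c%:C * z) by ring.
  have -> : - (q%:C * z) = q%:C * (- z) by ring.
  transitivity ((c%:C * szego q c N (q%:C * z)) * ((c * x)^-1%:C * szego q (c * x)^-1 N (q%:C * (c%:C * z)))
     * ((- x)%:C * szego q (- x) N (q%:C * - z))); first by ring.
  by rewrite s1 s2 s3; ring.
rewrite E -[X in normc (X - _)]mulr1 -mulrBr normcM ler_wpM2l ?normc_ge0//.
move: h1 h2 h3; move: (szego_err _ _ _ _) (szego_err _ _ _ _) (szego_err _ _ _ _) => C B A h1 h2 h3.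
have -> : 1 - (1 + A) * (1 + B) * (1 + C) = - (A + B + C + A * B + A * C + B * C + A * B * C) by ring.
rewrite normcN.
have p (u v : R[i]) : normc u <= e -> normc v <= e -> normc (u * v) <= e.
  by move=> hu hv; rewrite normcM -[X in _ <= X]mulr1 ler_pM ?normc_ge0// (le_trans hv).
apply: (le_trans (le_normcD _ _)); have hABC := p _ _ (p _ _ h1 h2) h3.
apply: (le_trans (lerD (le_normcD _ _) (lexx _))); have hBC := p _ _ h2 h3.
apply: (le_trans (lerD (lerD (le_normcD _ _) (lexx _)) (lexx _))); have hAC := p _ _ h1 h3.
apply: (le_trans (lerD (lerD (lerD (le_normcD _ _) (lexx _)) (lexx _)) (lexx _))); have hAB := p _ _ h1 h2.
apply: (le_trans (lerD (lerD (lerD (lerD (le_normcD _ _) (lexx _)) (lexx _)) (lexx _)) (lexx _))).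
apply: (le_trans (lerD (lerD (lerD (lerD (lerD (le_normcD _ _) (lexx _)) (lexx _)) (lexx _)) (lexx _)) (lexx _))).
by move: h1 h2 h3 hAB hAC hBC hABC; clear; lra.
Qed.

(** The function [elliptic] without its simple poles at 1, 1 / c and -1, which come from the leading
    factors of the three denominators. *)
Definition elliptic_num q c x N z : R[i] :=
  th q%:C N (- c%:C * z) * th q%:C N (- x%:C^-1 * z) * th q%:C N (- x%:C * z) /
  (thp q%:C N (1 * z) * thp q%:C N (c%:C * z) * thp q%:C N (-1 * z)).

Lemma ellipticE q c x N z : c%:C != 0 :> R[i] -> x%:C != 0 :> R[i] ->
  1 - z != 0 -> 1 - c%:C * z != 0 -> 1 + z != 0 ->
  elliptic q c x N z = elliptic_num q c x N z / ((1 - z) * (1 - c%:C * z) * (1 + z)).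
Proof.
move=> c0 x0 h1 h2 h3; rewrite /elliptic /szego /elliptic_num.
have -> : - (c * x)^-1%:C * (c%:C * z) = - x%:C^-1 * z.
  by rewrite fmorphV rmorphM; field; rewrite c0 x0.
have -> : - (- x)%:C * (- z) = - x%:C * z by rewrite rmorphN; ring.
rewrite mul1r mulN1r /th opprK !invfM; ring.
Qed.

(** Its vanishing in the limit is Jacobi's identity th(c)^2 th(x)^2 + x th(-1)^2 th(-c x)^2 =
    th(-c)^2 th(-x)^2. The last quotient in the numerator is a truncation factor tending to 1. *)
Definition jacobi_residue q c x N : R :=
  (th q N c ^+ 2 * th q N x ^+ 2 - th q N (- c) ^+ 2 * th q N (- x) ^+ 2 +
     x * th q N (-1) ^+ 2 * th q N (- (c * x)) ^+ 2 * ((1 + q ^+ N * (c / x)) / (1 + q ^+ N.+1 * (x / c)))) /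
  (x * thp q N 1 * th q N c * th q N (- c) * th q N (- 1)).

(** The coefficients are those of the partial fractions of 1 / ((1 - z) (1 - c z) (1 + z)).
    Inversion of the argument, and one shift by the period, bring the theta values at the three
    poles to the arguments occurring in [jacobi_residue]. *)
Lemma elliptic_residues c x N : 0 < c -> c < 1 -> c ^+ 2 < x -> x < 1 ->
  let q := c ^+ 2 in
  - (2 * (1 - c%:C))^-1 * elliptic_num q c x N 1 - (2 * (1 + c%:C))^-1 * elliptic_num q c x N (-1) +
    c%:C / (1 - c%:C ^+ 2) * (c%:C * elliptic_num q c x N c%:C^-1) = (jacobi_residue q c x N)%:C.
Proof.
move=> c0 c1 qx x1 q.
have q0 : 0 < q by rewrite exprn_gt0.
have q1 : q < 1 by rewrite exprn_ilt1// ltW.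
have qc : q < c by rewrite /q expr2 gtr_pMl.
have x0 : 0 < x := lt_trans q0 qx.
pose hn (z : R) : R := th q N (- c * z) * th q N (- x^-1 * z) * th q N (- x * z) /
  (thp q N (1 * z) * thp q N (c * z) * thp q N (-1 * z)).
have hE (t : R) : elliptic_num q c x N t%:C = (hn t)%:C.
  have m (a b : R) : a%:C * b%:C = (a * b)%:C by rewrite -rmorphM.
  rewrite /elliptic_num -fmorphV -rmorphN -(rmorphN _ x^-1) -(rmorphN _ x) -(rmorph1 (@real_complex R)).
  by rewrite -rmorphN !m -!thC -!thpC !m -fmorphV m.
have -> : elliptic_num q c x N 1 = (hn 1)%:C by rewrite -hE rmorph1.
have -> : elliptic_num q c x N (-1) = (hn (-1))%:C by rewrite -hE rmorphN rmorph1.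
have -> : elliptic_num q c x N c%:C^-1 = (hn c^-1)%:C by rewrite -hE fmorphV.
have -> : - (2 * (1 - c%:C))^-1 * (hn 1)%:C - (2 * (1 + c%:C))^-1 * (hn (-1))%:C +
    c%:C / (1 - c%:C ^+ 2) * (c%:C * (hn c^-1)%:C) =
    (- (2 * (1 - c))^-1 * hn 1 - (2 * (1 + c))^-1 * hn (-1) + c / (1 - c ^+ 2) * (c * hn c^-1))%:C.
  move: (hn 1) (hn (-1)) (hn c^-1) => A B C.
  have C2 : (2 : R[i]) = 2%:C by rewrite rmorph_nat.
  rewrite C2 -(rmorph1 (@real_complex R)) !expr2.
  by rewrite -!(rmorphM, rmorphN, rmorphD) -!fmorphV -!(rmorphM, rmorphN, rmorphD).
congr (_%:C).
have f1 : th q N (- x^-1) = x^-1 * th q N (- x) by rewrite -invrN thV ?oppr_eq0 ?gt_eqF// invrN opprK.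
have f2 : th q N x^-1 = - x^-1 * th q N x by rewrite thV ?gt_eqF.
have f3 : th q N (- (c * x)^-1) = (c * x)^-1 * th q N (- (c * x)).
  by rewrite -invrN thV ?oppr_eq0 ?mulf_neq0 ?gt_eqF// invrN opprK.
have n0 : 0 < 1 + q ^+ N.+1 * (x / c) by rewrite addr_gt0// mulr_gt0 ?divr_gt0// exprn_gt0.
(* At the pole 1 / c the argument is one period away from [- (c * x)]; the shift is the source of
   the truncation factor in [jacobi_residue]. *)
have f4 : th q N (- (x / c)) = x / c * th q N (- (c * x)) * ((1 + q ^+ N * (c / x)) / (1 + q ^+ N.+1 * (x / c))).
  have y0 : - (x / c) != 0 by rewrite oppr_eq0 mulf_neq0 ?invr_eq0 ?gt_eqF.
  have := th_shift N (lt0r_neq0 q0) y0.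
  have -> : q * - (x / c) = - (c * x) by rewrite /q; field; rewrite gt_eqF.
  have -> : q ^+ N / - (x / c) = - (q ^+ N * (c / x)) by field; rewrite !gt_eqF.
  have -> : - (- (x / c))^-1 = c / x by field; rewrite !gt_eqF.
  have -> : q ^+ N.+1 * - (x / c) = - (q ^+ N.+1 * (x / c)) by ring.
  rewrite !opprK => h; apply: (mulIf (lt0r_neq0 n0)); rewrite -[RHS]mulrA divfK ?gt_eqF//.
  by rewrite -[RHS]mulrA h; field; rewrite !gt_eqF.
have p1 : thp q N c^-1 = thp q N c by rewrite thpV.
have p2 : thp q N (- c^-1) = thp q N (- c) by rewrite -invrN thpV.
have P1 : 0 < thp q N 1 by apply: thp_gt0; rewrite ?mulr1.
have Pc : 0 < thp q N c by apply: thp_gt0; rewrite // (lt_trans _ c1)// gtr_pMl.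
have PNc : 0 < thp q N (- c) by rewrite (lt_le_trans ltr01)// thpN_ge1.
have PN1 : 0 < thp q N (-1) by rewrite (lt_le_trans ltr01)// thpN_ge1.
have tcE : th q N c = (1 - c) * thp q N c by [].
have tNcE : th q N (- c) = (1 + c) * thp q N (- c) by rewrite /th opprK.
have tN1E : th q N (-1) = 2 * thp q N (-1) by rewrite /th opprK.
have h1 : hn 1 = th q N (- c) * (x^-1 * th q N (- x)) * th q N (- x) / (thp q N 1 * thp q N c * thp q N (-1)).
  by rewrite /hn !mulr1 f1.
have h2 : hn (-1) = th q N c * (- x^-1 * th q N x) * th q N x / (thp q N (-1) * thp q N (- c) * thp q N 1).
  by rewrite /hn !mulrN1 !opprK f2.
have h3 : hn c^-1 = th q N (-1) * ((c * x)^-1 * th q N (- (c * x))) *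
    (x / c * th q N (- (c * x)) * ((1 + q ^+ N * (c / x)) / (1 + q ^+ N.+1 * (x / c)))) / (thp q N c * thp q N 1 * thp q N (- c)).
  rewrite /hn mul1r mulN1r p1 p2 -f3 -f4 !mulNr divff ?gt_eqF// -invfM [x * c]mulrC.
  by rewrite invfM.
rewrite h1 h2 h3 /jacobi_residue tN1E tcE tNcE.
move: (th q N (- x)) (th q N x) (th q N (- (c * x))) => A B C.
move: (1 + q ^+ N.+1 * (x / c)) n0 => D n0.
move: (1 + q ^+ N * (c / x)) => D'.
move: (thp q N 1) P1 (thp q N c) Pc (thp q N (- c)) PNc (thp q N (-1)) PN1 => T1 T10 T2 T20 T3 T30 T4 T40.
field.
have c1' : 0 < 1 - c by rewrite subr_gt0.
have c1'' : 0 < 1 + c by rewrite addr_gt0.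
have cc : 0 < 1 - c ^+ 2 by rewrite subr_gt0.
by rewrite !lt0r_neq0.
Qed.

End JacobiIdentity.

(** * Vanishing of the residue sum *)

Section JacobiLimit.
Variable R : realType.
Implicit Types (z w : R[i]) (c d q s r x y e : R) (N M n m : nat).

Lemma avgc_scale M r q (u : R[i] -> R[i]) : avgc M (q * r) u = avgc M r (fun z => u (q%:C * z)).
Proof.
rewrite /avgc; congr (_ * _); apply: eq_bigr => j _; congr u.
by rewrite /circle_pt rmorphM -mulrA.
Qed.

Lemma elliptic_bounded q c x rho : 0 < q -> q < 1 -> 0 < c -> c < 1 -> 0 < x ->
  1 < c * rho -> q * rho < 1 ->
  exists2 K, 0 < K & forall N z, normc z = rho -> normc (elliptic q c x N z) <= K.
Proof.
move=> q0 q1 c0 c1 x0 crho qrho.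
have rho1 : 1 < rho.
  have rho0 : 0 < rho by rewrite -(pmulr_rgt0 _ c0) (lt_trans ltr01).
  by rewrite (lt_trans crho)// gtr_pMl.
have al2 : (c * x)^-1 != 0 by rewrite invr_eq0 mulf_neq0 ?gt_eqF.
have al3 : - x != 0 by rewrite oppr_eq0 gt_eqF.
have qcrho : q * (c * rho) < 1 by rewrite mulrCA (lt_trans _ c1)// gtr_pMr.
have n1 : rho != 1 by rewrite gt_eqF.
have n2 : c * rho != 1 by rewrite gt_eqF.
have [K1 K10 h1] := szego_bounded q0 q1 (lt0r_neq0 c0) (lt_trans q1 rho1) qrho n1.
have [K2 K20 h2] := szego_bounded q0 q1 al2 (lt_trans q1 crho) qcrho n2.
have [K3 K30 h3] := szego_bounded q0 q1 al3 (lt_trans q1 rho1) qrho n1.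
exists (K1 * K2 * K3); first by rewrite !mulr_gt0.
move=> N z zr; rewrite /elliptic (normcM (_ * _)) (normcM (szego _ _ _ _)).
apply: ler_pM; rewrite ?normc_ge0 ?mulr_ge0 ?normc_ge0//; last by apply: h3; rewrite normcN.
apply: ler_pM; rewrite ?normc_ge0//; first exact: h1.
by apply: h2; rewrite normcM zr normc_pos// ltW.
Qed.

Lemma cdiff_elliptic_num c x N z : 0 < c -> c < 1 -> c < normc z -> c ^+ 2 * normc z < 1 ->
  cdiff (elliptic_num (c ^+ 2) c x N) z.
Proof.
move=> c0 c1 cz qz; set q := c ^+ 2 in qz *.
have q0 : 0 < q by rewrite exprn_gt0.
have q1 : q < 1 by rewrite exprn_ilt1// ltW.
have qc : q < c by rewrite /q expr2 gtr_pMl.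
have z0 : z != 0 by rewrite -normc_gt0 (lt_trans c0).
have n0 w : q < normc w -> q * normc w < 1 -> thp q%:C N w != 0.
  move=> h1 h2; rewrite -normc_gt0.
  exact: lt_le_trans (thp_gt0 N q0 q1 h1 h2) (normc_thp_ge N q0 q1 h1 h2).
have ncz : normc (c%:C * z) = c * normc z by rewrite normcM normc_pos// ltW.
have qz1 : q < normc z := lt_trans qc cz.
have qcz : q < c * normc z by rewrite /q expr2 ltr_pM2l.
have qcz1 : q * (c * normc z) < 1 by rewrite mulrCA (lt_trans _ c1)// gtr_pMr.
apply: cdiff_div.
- by rewrite !mulf_neq0// n0 ?mul1r ?mulN1r ?normcN ?ncz.
- by apply: cdiffM; [apply: cdiffM|]; exact: cdiff_th.
by apply: cdiffM; [apply: cdiffM|]; exact: cdiff_thp.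
Qed.

(** The difference of the means of [elliptic] over the circles of radii [rho] and [q * rho] tends,
    by Cauchy's formula, to the sum of the residues between them. By approximate periodicity it is
    also small, uniformly in the number of sample points. *)
Lemma jacobi_residue_small c x : 0 < c -> c < 1 -> c ^+ 2 < x -> x < 1 ->
  forall e, 0 < e -> exists N0, forall N, (N0 <= N)%N -> `|jacobi_residue (c ^+ 2) c x N| <= e.
Proof.
move=> c0 c1 qx x1 e e0; set q := c ^+ 2 in qx *.
have q0 : 0 < q by rewrite exprn_gt0.
have q1 : q < 1 by rewrite exprn_ilt1// ltW.
have qc : q < c by rewrite /q expr2 gtr_pMl.
have x0 : 0 < x := lt_trans q0 qx.
(* The annulus between [q * rho] and [rho] has to contain 1, -1 and 1 / c but no other pole, and the
   truncation errors need [x * rho] above 1; the constraints leave the interval from the maximum of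
   1 / c and 1 / x to 1 / q. *)
pose rho := (Num.max c^-1 x^-1 + q^-1) / 2.
have [rc rx rq] : [/\ c^-1 < rho, x^-1 < rho & rho < q^-1].
  have h : Num.max c^-1 x^-1 < q^-1 by rewrite gt_max !ltf_pV2 ?posrE// qc qx.
  have l1 : c^-1 <= Num.max c^-1 x^-1 by rewrite le_max lexx.
  have l2 : x^-1 <= Num.max c^-1 x^-1 by rewrite le_max lexx orbT.
  by rewrite /rho; split; lra.
have crho : 1 < c * rho by rewrite mulrC -ltr_pdivrMr// div1r.
have xrho : 1 < x * rho by rewrite mulrC -ltr_pdivrMr// div1r.
have qrho : q * rho < 1 by rewrite mulrC -ltr_pdivlMr// div1r.
have rho0 : 0 < rho by rewrite (lt_trans _ rc)// invr_gt0.
have rho1 : 1 < rho by rewrite (lt_trans crho)// gtr_pMl.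
have xrho' : x < rho := lt_trans x1 rho1.
have [K K0 hK] := elliptic_bounded q0 q1 c0 c1 x0 crho qrho.
pose d := Num.min 1 (e / (7 * K)).
have d0 : 0 < d by rewrite lt_min ltr01 divr_gt0// mulr_gt0.
have d1 : d <= 1 by rewrite ge_min lexx.
have dK : K * (7 * d) <= e.
  have : d <= e / (7 * K) by rewrite ge_min lexx orbT.
  by rewrite ler_pdivlMr ?mulr_gt0//; lra.
have al2 : (c * x)^-1 != 0 by rewrite invr_eq0 mulf_neq0 ?gt_eqF.
have al3 : - x != 0 by rewrite oppr_eq0 gt_eqF.
have qcrho : q * (c * rho) < 1 by rewrite mulrCA (lt_trans _ c1)// gtr_pMr.
have a1 : 1 < `|c| * rho by rewrite gtr0_norm.
have a2 : 1 < `|(c * x)^-1| * (c * rho).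
  rewrite gtr0_norm ?invr_gt0 ?mulr_gt0//.
  have -> : (c * x)^-1 * (c * rho) = rho / x by field; rewrite !gt_eqF.
  by rewrite ltr_pdivlMr// mul1r.
have a3 : 1 < `|- x| * rho by rewrite normrN gtr0_norm.
have [N1 h1] := szego_err_small q0 q1 (lt0r_neq0 c0) rho1 qrho a1 d0.
have [N2 h2] := szego_err_small q0 q1 al2 crho qcrho a2 d0.
have [N3 h3] := szego_err_small q0 q1 al3 rho1 qrho a3 d0.
exists (maxn N1 (maxn N2 N3)) => N; rewrite !geq_max => /and3P[NN1 NN2 NN3].
(* The means are against dz / z, so dividing by [z] makes the Cauchy kernel [z / (z - w)] produce
   the partial fraction 1 / (z - w). *)
pose v z := elliptic_num q c x N z / z.
have dv z : c < normc z < q^-1 -> cdiff v z.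
  move=> /andP[z1 z2]; apply: cdiff_div; last exact: cdiff_id.
    by rewrite -normc_gt0 (lt_trans c0).
  by apply: cdiff_elliptic_num; rewrite // mulrC -ltr_pdivlMr// div1r.
have inner : c < q * rho by rewrite /q expr2 -mulrA ltr_pMr.
pose A z : R[i] := - (2 * (1 - c%:C))^-1 * (v z * (z / (z - 1))).
pose B z : R[i] := (2 * (1 + c%:C))^-1 * (v z * (z / (z - (-1)))).
pose C z : R[i] := c%:C / (1 - c%:C ^+ 2) * (v z * (z / (z - c%:C^-1))).
have cC : c%:C != 0 :> R[i] by rewrite -normc_gt0 normc_pos// ltW.
have xC : x%:C != 0 :> R[i] by rewrite -normc_gt0 normc_pos// ltW.
have nc : normc (c%:C : R[i]) = c by rewrite normc_pos// ltW.
have c1C : 1 - c%:C != 0 :> R[i] by apply: normc_1B_neq0; rewrite nc.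
have c2C : 1 + c%:C != 0 :> R[i].
  by have := @normc_1B_neq0 R (- c%:C); rewrite opprK normcN nc; exact.
have two : (2 : R[i]) != 0 by rewrite pnatr_eq0.
have split_ z : normc z != 1 -> normc z != c^-1 -> z != 0 -> elliptic q c x N z = A z + B z + C z.
  move=> z1 z2 z0.
  have e1 : 1 - z != 0 by rewrite subr_eq0; apply: contra_neq z1 => <-; rewrite normc1.
  have e2 : 1 - c%:C * z != 0.
    rewrite subr_eq0; apply: contra_neq z2 => h.
    have <- : c%:C^-1 = z by apply: (mulfI cC); rewrite divff.
    by rewrite normcV nc.
  have e3 : 1 + z != 0.
    rewrite addrC addr_eq0; apply: contra_neq z1 => ->; by rewrite normcN normc1.
  rewrite ellipticE// /A /B /C /v.
  move: (elliptic_num _ _ _ _ _) => E.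
  have e4 : z - 1 != 0 by rewrite -opprB oppr_eq0.
  have e5 : z + 1 != 0 by rewrite addrC.
  have e6 : z * c%:C - 1 != 0 by rewrite mulrC -opprB oppr_eq0.
  have -> : 1 - c%:C ^+ 2 = (1 - c%:C) * (1 + c%:C) by ring.
  by field; rewrite cC e6 z0 c2C c1C e5 e4 e2 e1.
have onE M : avgc M rho (elliptic q c x N) - avgc M (q * rho) (elliptic q c x N) =
  (avgc M rho A - avgc M (q * rho) A) + (avgc M rho B - avgc M (q * rho) B) + (avgc M rho C - avgc M (q * rho) C).
  have E s : 0 < s -> s != 1 -> s != c^-1 -> avgc M s (elliptic q c x N) = avgc M s A + avgc M s B + avgc M s C.
    move=> s0 s1 s2; rewrite -!avgcD; apply: eq_avgc; first exact: ltW.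
    by move=> z zs; apply: split_; rewrite ?zs// -normc_gt0 zs.
  have qrho0 : 0 < q * rho by rewrite mulr_gt0.
  have qc1 : q * rho < c^-1 by rewrite (lt_trans qrho)// invf_gt1.
  rewrite !E ?(gt_eqF rho1) ?(gt_eqF rc) ?(lt_eqF qrho) ?(lt_eqF qc1)//; ring.
have cau w : q * rho < normc w -> normc w < rho ->
    climit (fun M => avgc M rho (fun z => v z * (z / (z - w))) -
                     avgc M (q * rho) (fun z => v z * (z / (z - w)))) (v w).
  by move=> w1 w2; apply: (@cauchy_annulus _ v c q^-1) => //; exact: ltW.
have lim : climit (fun M => avgc M rho (elliptic q c x N) - avgc M (q * rho) (elliptic q c x N))
    ((jacobi_residue q c x N)%:C).
  have := elliptic_residues N c0 c1 qx x1; rewrite -/q => <-.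
  have v1 : v 1 = elliptic_num q c x N 1 by rewrite /v divr1.
  have v2 : v (-1) = - elliptic_num q c x N (-1) by rewrite /v invrN1 mulrN1.
  have v3 : v c%:C^-1 = c%:C * elliptic_num q c x N c%:C^-1 by rewrite /v invrK mulrC.
  have n1 : normc (1 : R[i]) = 1 by rewrite normc1.
  have n2 : normc (-1 : R[i]) = 1 by rewrite normcN normc1.
  have n3 : normc (c%:C^-1 : R[i]) = c^-1 by rewrite normcV nc.
  have l1 : climit _ _ := cau 1 _ _; rewrite n1 in l1; have {}l1 := l1 qrho rho1.
  have l2 : climit _ _ := cau (-1) _ _; rewrite n2 in l2; have {}l2 := l2 qrho rho1.
  have l3 : climit _ _ := cau c%:C^-1 _ _; rewrite n3 in l3.
  have c1V : 1 < c^-1 by rewrite invf_gt1.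
  have {}l3 := l3 (lt_trans qrho c1V) rc.
  have L := climitD (climitD (climitZ (- (2 * (1 - c%:C))^-1) l1) (climitZ (2 * (1 + c%:C))^-1 l2))
     (climitZ (c%:C / (1 - c%:C ^+ 2)) l3).
  have -> : - (2 * (1 - c%:C))^-1 * elliptic_num q c x N 1 -
      (2 * (1 + c%:C))^-1 * elliptic_num q c x N (-1) +
      c%:C / (1 - c%:C ^+ 2) * (c%:C * elliptic_num q c x N c%:C^-1) =
      - (2 * (1 - c%:C))^-1 * v 1 + (2 * (1 + c%:C))^-1 * v (-1) + c%:C / (1 - c%:C ^+ 2) * v c%:C^-1.
    by rewrite v1 v2 v3 mulrN.
  apply: climit_eq L => M; rewrite onE /A /B /C !avgcZ; ring.
rewrite -normc_real; apply: (climit_le lim); apply: nearW => M.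
rewrite avgc_scale -avgcB; apply: normc_avgc_le_cst; [exact: ltW|exact: ltW|].
move=> z zr; apply: (@le_trans _ _ (normc (elliptic q c x N z) * (7 * d))).
  apply: elliptic_shift; rewrite ?zr//; first exact: ltW.
  - exact: h1.
  - by apply: h2 => //; rewrite normcM nc zr.
  - by apply: h3 => //; rewrite normcN.
apply: le_trans dK; apply: ler_wpM2r; last exact: hK.
by rewrite mulr_ge0// ltW.
Qed.

End JacobiLimit.

(** * The product defining [Kfun] in terms of theta functions *)

Section KfunEquation.
Variable R : realType.
Implicit Types (c d q s r x y e : R) (N M n m : nat).

(** Its square is the middle term of Jacobi's identity after division by th(-c)^2 th(-x)^2 with x =
    r^2, and its limit is [Kfun]. *)
Definition theta_quotient c r N : R :=
  r * th (c ^+ 2) N (-1) * th (c ^+ 2) N (- (c * r ^+ 2)) /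
  (th (c ^+ 2) N (- c) * th (c ^+ 2) N (- r ^+ 2)).

(* The factors by which the truncation of the product defining [Kfun] after the N-th factor
   differs from the corresponding quotient of truncated theta functions. *)
Definition Kfun_boundary c r N : R :=
  (1 + (c ^+ 2) ^+ N * c / r ^+ 2) * (1 + r ^+ 2 * (c ^+ 2) ^+ N) * (1 + (c ^+ 2) ^+ N * c) /
  (1 + r ^+ 2 * (c ^+ 2) ^+ N * c).

Lemma Kfun_partial c r N : 0 < c -> 0 < r ->
  2 * r * (1 + c / r ^+ 2) * \prod_(1 <= n < N.+1) Kfactor c r n =
  theta_quotient c r N * Kfun_boundary c r N.
Proof.
move=> c0 r0; have x0 : 0 < r ^+ 2 by rewrite exprn_gt0.
have xc0 : 0 < 1 + r ^+ 2 * c by rewrite addr_gt0// mulr_gt0.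
elim: N => [|N ih].
  rewrite big_geq// /theta_quotient /Kfun_boundary /th /thp !big_ord0 !opprK expr0.
  by field; rewrite !gt_eqF// ?addr_gt0// mulr_gt0.
rewrite big_nat_recr//= mulrA ih.
have q0 : 0 < c ^+ 2 by rewrite exprn_gt0.
have thS y : th (c ^+ 2) N.+1 y = th (c ^+ 2) N y *
   ((1 - (c ^+ 2) ^+ N.+1 * y) * (1 - (c ^+ 2) ^+ N.+1 / y)) by rewrite /th thpS mulrA.
have h3 : 0 < th (c ^+ 2) N (- c) := lt_le_trans ltr01 (thN_ge1 N q0 c0).
have h4 : 0 < th (c ^+ 2) N (- r ^+ 2) := lt_le_trans ltr01 (thN_ge1 N q0 x0).
rewrite /theta_quotient /Kfun_boundary !thS (exprS (c ^+ 2) N).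
have -> : Kfactor c r N.+1 =
  ((1 + r ^+ 2 * ((c ^+ 2) ^+ N * c)) * (1 + (r ^+ 2)^-1 * ((c ^+ 2) ^+ N * c ^+ 3)) *
     (1 + (c ^+ 2) ^+ N * c ^+ 2) ^+ 2) /
  ((1 + r ^+ 2 * (c ^+ 2) ^+ N) * (1 + (r ^+ 2)^-1 * ((c ^+ 2) ^+ N * c ^+ 2)) *
     (1 + (c ^+ 2) ^+ N * c) ^+ 2).
  (* The subtractions of natural numbers in [Kfactor] are exact here because the index is at least
     1. *)
  have e1 : (2 * N.+1 - 1 = 2 * N + 1)%N by lia.
  have e2 : (2 * N.+1 + 1 = 2 * N + 3)%N by lia.
  have e3 : (2 * N.+1 - 2 = 2 * N)%N by lia.
  have e4 : (2 * N.+1 = 2 * N + 2)%N by lia.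
  have E k : c ^+ (2 * N + k) = (c ^+ 2) ^+ N * c ^+ k by rewrite exprD exprM.
  have E0 : c ^+ (2 * N) = (c ^+ 2) ^+ N by rewrite exprM.
  by rewrite /Kfactor e1 e2 e3 e4 !E E0.
have p0 : 0 < (c ^+ 2) ^+ N by rewrite exprn_gt0.
move: (th _ _ (- c)) h3 (th _ _ (- r ^+ 2)) h4 (th _ _ (-1)) (th _ _ (- (c * r ^+ 2))) => A A0 B B0 C D.
move: (r ^+ 2) x0 xc0 ((c ^+ 2) ^+ N) p0 => x x0 xc0 p p0.
have P u v : 0 < u -> 0 < v -> 0 < u + v := @addr_gt0 R u v.
have xp : 0 < x * p by rewrite mulr_gt0.
have pc : 0 < p * c by rewrite mulr_gt0.
have qp : 0 < c ^+ 2 * p by rewrite mulr_gt0.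
field.
rewrite !mulrN !opprK -!opprD !oppr_eq0 !gt_eqF ?(P 1) ?mulr_gt0 ?P//.
by rewrite mulr_gt0 ?exprn_gt0.
Qed.

Lemma jacobi_truncated c r N : 0 < c -> c < r -> r < 1 -> let q := c ^+ 2 in let x := r ^+ 2 in
  theta_ratio c r N ^+ 2 - 1 +
    theta_quotient c r N ^+ 2 * ((1 + q ^+ N * (c / x)) / (1 + q ^+ N.+1 * (x / c))) =
  jacobi_residue q c x N *
    (x * thp q N 1 * th q N c * th q N (-1) / (th q N (- c) * th q N (- x) ^+ 2)).
Proof.
move=> c0 cr r1 q x; have r0 := lt_trans c0 cr; have c1 := lt_trans cr r1.
have q0 : 0 < q by rewrite exprn_gt0.
have q1 : q < 1 by rewrite exprn_ilt1// ltW.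
have x0 : 0 < x by rewrite exprn_gt0.
have qc : q < c by rewrite /q expr2 gtr_pMl.
have h1 : 0 < th q N (- c) := lt_le_trans ltr01 (thN_ge1 N q0 c0).
have h2 : 0 < th q N (- x) := lt_le_trans ltr01 (thN_ge1 N q0 x0).
have h3 : 0 < th q N (-1) := lt_le_trans ltr01 (thN_ge1 N q0 ltr01).
have h4 : 0 < th q N c by exact: th_gt0.
have h5 : 0 < thp q N 1 by apply: thp_gt0; rewrite ?mulr1.
rewrite /theta_ratio /theta_quotient /jacobi_residue -/q -/x.
move: (_ / (1 + q ^+ N.+1 * _)) => mu.
move: (th _ _ (- c)) h1 (th _ _ (- x)) h2 (th _ _ (-1)) h3 (th _ _ c) h4 (thp _ _ _) h5 => A h1 B h2 C h3 D h4 E h5.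
rewrite /x; move: (th _ _ _) (th _ _ _) => F G; field.
by rewrite !gt_eqF.
Qed.

(** Jacobi's identity divided by th(-c)^2 th(-x)^2 reads X^2 + K^2 = 1. Positivity of X, which keeps
    1 - K^2 invertible, is proved separately from the tail estimate. *)
Lemma Kfun_sqr c r : 0 < c -> c < r -> r < 1 ->
  let X := lim (theta_ratio c r N @[N --> \oo]) in
  0 < X /\ Kfun c r ^+ 2 = 1 - X ^+ 2.
Proof.
move=> c0 cr r1 X; have r0 := lt_trans c0 cr; have c1 := lt_trans cr r1.
pose q := c ^+ 2; pose x := r ^+ 2.
have q0 : 0 < q by rewrite exprn_gt0.
have q1 : q < 1 by rewrite exprn_ilt1// ltW.
have x0 : 0 < x by rewrite exprn_gt0.
have x1 : x < 1 by rewrite exprn_ilt1// ltW.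
have qx : q < x by rewrite ltrXn2r ?nnegrE ?(ltW c0) ?(ltW r0).
have qc : q < c by rewrite /q expr2 gtr_pMl.
have hX : theta_ratio c r N @[N --> \oo] --> X := theta_ratio_cvg c0 cr r1.
have hq : (fun n => q ^+ n) @ \oo --> (0 : R) by apply: cvg_expr; rewrite gtr0_norm.
have hcst (a : R) : (fun=> a) @ \oo --> a by exact: cvg_cst.
have hqS : (fun n => q ^+ n.+1) @ \oo --> (0 : R) by rewrite (cvg_shiftS (fun n => q ^+ n)).
have sqrE (u : nat -> R) (l : R) : u @ \oo --> l -> u n ^+ 2 @[n --> \oo] --> l ^+ 2.
  move=> h; rewrite (_ : (fun _ => _) = (fun n => u n * u n)); first by rewrite expr2; exact: cvgM.
  by apply/funext => n; rewrite expr2.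
have t_gt0 s N : q < s -> s < 1 -> 0 < th q N s by exact: th_gt0.
have tN N s : 0 < s -> 1 <= th q N (- s) by exact: thN_ge1.
have tr_gt0 N : 0 < theta_ratio c r N.
  by apply: divr_gt0; apply: mulr_gt0; rewrite ?(t_gt0 c) ?(t_gt0 x) ?(lt_le_trans ltr01 (tN N c c0)) ?(lt_le_trans ltr01 (tN N x x0)).
split.
  (* For such an [N] the tail estimate bounds the limit below by a positive multiple of one positive
     term. *)
  have [N hN] : exists N, 8 / c ^+ 2 * ((c ^+ 2) ^+ N.+1 / (1 - c ^+ 2)) < 1.
    have h : (fun N => 8 / c ^+ 2 * ((c ^+ 2) ^+ N.+1 / (1 - c ^+ 2))) @ \oo --> (0 : R).
      rewrite -[X in _ --> X](mulr0 (8 / c ^+ 2)); apply: cvgM => //.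
      by rewrite -[X in _ --> X](mul0r (1 - c ^+ 2)^-1); apply: cvgM.
    move/cvgrPdist_lt : h => /(_ _ ltr01)[N _ hN]; exists N.
    have := hN N (leqnn N); rewrite /= sub0r normrN; apply: le_lt_trans; exact: ler_norm.
  apply: (@lt_le_trans _ _ (theta_ratio c r N * (1 - 8 / c ^+ 2 * ((c ^+ 2) ^+ N.+1 / (1 - c ^+ 2))))).
    by rewrite mulr_gt0// subr_gt0.
  apply: (cvgr_to_ge hX); exists N => // m /= Nm; rewrite -(subnKC Nm).
  by have /andP[] := theta_ratio_tail N (m - N) c0 (lexx c) (lexx c) c1 cr r1.
pose mu N := (1 + q ^+ N * (c / x)) / (1 + q ^+ N.+1 * (x / c)).
have hmu : mu @ \oo --> (1 : R).
  rewrite -[X in _ --> X](divr1 1); apply: cvgM; last apply: cvgV; rewrite ?oner_eq0//.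
    rewrite -[X in _ --> X]addr0; apply: cvgD => //.
    by rewrite -[X in _ --> X](mul0r (c / x)); apply: cvgM.
  rewrite -[X in _ --> X]addr0; apply: cvgD => //.
  by rewrite -[X in _ --> X](mul0r (x / c)); apply: cvgM.
have mu_gt0 N : 0 < mu N.
  by rewrite divr_gt0// addr_gt0// mulr_gt0 ?exprn_gt0// divr_gt0.
have hbd : Kfun_boundary c r N @[N --> \oo] --> (1 : R).
  have hb1 (a b : R) : 1 + a * q ^+ N * b @[N --> \oo] --> (1 : R).
    rewrite -[X in _ --> X]addr0; apply: cvgD => //.
    rewrite -[X in _ --> X](mul0r b); apply: cvgM => //.
    by rewrite -[X in _ --> X](mulr0 a); apply: cvgM.
  have -> : Kfun_boundary c r = (fun N => (1 + 1 * q ^+ N * (c / x)) * (1 + x * q ^+ N * 1) * (1 + 1 * q ^+ N * c) /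
      (1 + x * q ^+ N * c)).
    by apply/funext => N; rewrite /Kfun_boundary -/q -/x !mul1r mulr1 mulrA.
  rewrite -[X in _ --> X](divr1 1); apply: cvgM; last by apply: cvgV; rewrite ?oner_eq0//; exact: hb1.
  rewrite -[X in _ --> X](mulr1 1); apply: cvgM; last exact: hb1.
  rewrite -[X in _ --> X](mulr1 1); apply: cvgM; exact: hb1.
pose W N := x * thp q N 1 * th q N c * th q N (-1) / (th q N (- c) * th q N (- x) ^+ 2).
have [U U0 hU] := thpN_bounded q0 q1 (ltr01 : 0 < 1 :> R).
have W_le N : `|W N| <= 2 * U.
  have p1 : 0 < thp q N 1 by apply: thp_gt0; rewrite ?mulr1.
  have p1' : thp q N 1 <= 1 by apply: thp_le1; rewrite ?mulr1.
  have pc := t_gt0 c N qc c1; have pc' := th_le1 N q0 q1 qc c1.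
  have D1 : 1 <= th q N (- c) * th q N (- x) ^+ 2.
    by rewrite mulr_ege1 ?tN// expr_ge1 ?tN// (le_trans ler01)// tN.
  have n1 : 0 < th q N (-1) by rewrite (lt_le_trans ltr01)// tN.
  have num0 : 0 <= x * thp q N 1 * th q N c * th q N (-1).
    by do 3 (apply: mulr_ge0; last exact: ltW); exact: ltW.
  rewrite /W ger0_norm; last by rewrite divr_ge0// (le_trans ler01).
  rewrite ler_pdivrMr ?(lt_le_trans ltr01)//.
  apply: (@le_trans _ _ (2 * U)); last by rewrite ler_peMr// mulr_ge0// ltW.
  have n1' : th q N (-1) <= 2 * U by rewrite /th opprK ler_wpM2l.
  rewrite -[2 * U]mul1r; apply: ler_pM => //.
  - by do 2 (apply: mulr_ge0; last exact: ltW); exact: ltW.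
  - exact: ltW.
  apply: mulr_ile1 pc' => //; [by apply: mulr_ge0; exact: ltW|exact: ltW|].
  by apply: mulr_ile1 p1'; exact: ltW.
have hjr : jacobi_residue q c x N * W N @[N --> \oo] --> (0 : R).
  apply/cvgrPdist_le => e e0; have e1 : 0 < e / (2 * U) by rewrite divr_gt0// mulr_gt0.
  have [N0 hN0] := jacobi_residue_small c0 c1 qx x1 e1; exists N0 => // N /= /hN0 h.
  rewrite sub0r normrN normrM.
  have -> : e = e / (2 * U) * (2 * U) by rewrite divfK// gt_eqF// mulr_gt0.
  by apply: ler_pM.
have htq : theta_quotient c r N ^+ 2 * mu N @[N --> \oo] --> 1 - X ^+ 2.
  have -> : (fun N => theta_quotient c r N ^+ 2 * mu N) =
      (fun N => jacobi_residue q c x N * W N + (1 - theta_ratio c r N ^+ 2)).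
    by apply/funext => N; rewrite -(jacobi_truncated N c0 cr r1) -/q -/x -/(mu N); ring.
  rewrite -[X in _ --> X]add0r; apply: cvgD => //; apply: cvgB => //; exact: sqrE.
pose Kp N := theta_quotient c r N * Kfun_boundary c r N.
have hKp2 : Kp N ^+ 2 @[N --> \oo] --> 1 - X ^+ 2.
  have -> : (fun N => Kp N ^+ 2) =
      (fun N => theta_quotient c r N ^+ 2 * mu N * (Kfun_boundary c r N ^+ 2 / mu N)).
    apply/funext => N; rewrite /Kp; field; exact: lt0r_neq0.
  rewrite -[X in _ --> X](mulr1 (1 - X ^+ 2)); apply: cvgM => //.
  rewrite -[X in _ --> X](divr1 1); apply: cvgM; last by apply: cvgV; rewrite ?oner_eq0.
  by rewrite -(expr1n _ 2); exact: sqrE.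
have Kp0 N : 0 <= Kp N.
  have p s : 0 < s -> 0 <= th q N (- s) by move=> s0; exact: le_trans ler01 (tN N s s0).
  apply: mulr_ge0.
    apply: divr_ge0; last by apply: mulr_ge0; exact: p.
    apply: mulr_ge0; last by apply: p; exact: mulr_gt0.
    by apply: mulr_ge0; [exact: ltW|exact: p].
  by rewrite divr_ge0// ?mulr_ge0// addr_ge0// ?mulr_ge0 ?exprn_ge0 ?(ltW c0) ?(ltW q0) ?(ltW r0) ?(ltW x0) ?invr_ge0 ?(ltW x0).
have L0 : 0 <= 1 - X ^+ 2 by apply: (cvgr_to_ge hKp2); apply: nearW => N; exact: exprn_ge0.
(* The identity controls squares only; nonnegativity of [Kp] allows a square root to be taken.
   Convergence of the product in [Kfun] follows from this, so that its [lim] is a genuine limit. *)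
have hKp : Kp @ \oo --> Num.sqrt (1 - X ^+ 2).
  have -> : Kp = (fun N => Num.sqrt (Kp N ^+ 2)) by apply/funext => N; rewrite sqrtr_sqr ger0_norm.
  exact: (continuous_cvg (h := @Num.sqrt R) _ (@sqrt_continuous R _) hKp2).
pose a := 2 * r * (1 + c / r ^+ 2).
have a0 : 0 < a by rewrite !mulr_gt0// addr_gt0// divr_gt0.
have hprod : (fun N => \prod_(1 <= n < N.+1) Kfactor c r n) @ \oo --> Num.sqrt (1 - X ^+ 2) / a.
  have -> : (fun N => \prod_(1 <= n < N.+1) Kfactor c r n) = (fun N => Kp N / a).
    by apply/funext => N; rewrite /Kp -Kfun_partial// -/a mulrAC divff ?mul1r// gt_eqF.
  by apply: cvgM.
rewrite /Kfun (cvg_lim _ hprod)// -/a mulrC divfK ?gt_eqF// sqr_sqrtr//.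
Qed.

End KfunEquation.

(** * Inequalities between Taylor coefficients *)

Section CoefficientSums.
Variable R : realType.
Implicit Types (u v f g : R[i] -> R[i]) (z w : R[i]) (c r s t x y e K : R) (N M n m : nat).

(** By Lagrange's identity the difference of the two sides is half a double sum of squares. *)
Lemma sum_CS (I : finType) (P : pred I) (a b : I -> R) :
  (\sum_(i | P i) a i * b i) ^+ 2 <= (\sum_(i | P i) a i ^+ 2) * (\sum_(i | P i) b i ^+ 2).
Proof.
have E : \sum_(i | P i) \sum_(j | P j) (a i * b j - a j * b i) ^+ 2 =
   2 * ((\sum_(i | P i) a i ^+ 2) * (\sum_(i | P i) b i ^+ 2) - (\sum_(i | P i) a i * b i) ^+ 2).
  have -> : \sum_(i | P i) \sum_(j | P j) (a i * b j - a j * b i) ^+ 2 =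
    \sum_(i | P i) (a i ^+ 2 * (\sum_(j | P j) b j ^+ 2) + b i ^+ 2 * (\sum_(j | P j) a j ^+ 2)
       - 2 * (a i * b i) * (\sum_(j | P j) a j * b j)).
    apply: eq_bigr => i _; rewrite !mulr_sumr -big_split -sumrB /=; apply: eq_bigr => j _; ring.
  rewrite sumrB big_split /= -!mulr_suml -mulr_sumr; ring.
rewrite -subr_ge0 -(pmulr_rge0 _ (ltr0n R 2)) -E.
by apply: sumr_ge0 => i _; apply: sumr_ge0 => j _; exact: sqr_ge0.
Qed.

(* Cauchy-Schwarz on S and on its complement, then the arithmetic-geometric mean inequality for
   the cross terms of the Gram determinant. *)
Lemma gram_split (I : finType) (S : pred I) (a b : I -> R[i]) (tau : I -> R) :
  (forall i, 0 <= tau i) ->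
  let x := \sum_(i | S i) (normc (b i) ^+ 2 - normc (a i) ^+ 2) * tau i in
  let y := \sum_(i | ~~ S i) (normc (b i) ^+ 2 - normc (a i) ^+ 2) * tau i in
  - (x * y) <= (\sum_i normc (b i) ^+ 2 * tau i) * (\sum_i normc (a i) ^+ 2 * tau i) -
     normc (\sum_i a i * (b i)^* * (tau i)%:C) ^+ 2.
Proof.
move=> tau0; cbv zeta.
set x := \sum_(i | S i) _; set y := \sum_(i | ~~ S i) _.
pose A (P : pred I) := \sum_(i | P i) normc (b i) ^+ 2 * tau i.
pose B (P : pred I) := \sum_(i | P i) normc (a i) ^+ 2 * tau i.
pose C (P : pred I) := normc (\sum_(i | P i) a i * (b i)^* * (tau i)%:C).
have A0 P : 0 <= A P by apply: sumr_ge0 => i _; rewrite mulr_ge0// exprn_ge0 ?normc_ge0.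
have B0 P : 0 <= B P by apply: sumr_ge0 => i _; rewrite mulr_ge0// exprn_ge0 ?normc_ge0.
have C0 P : 0 <= C P by exact: normc_ge0.
have CS P : C P ^+ 2 <= A P * B P.
  have e1 : A P = \sum_(i | P i) (normc (b i) * Num.sqrt (tau i)) ^+ 2.
    by apply: eq_bigr => i _; rewrite exprMn sqr_sqrtr.
  have e2 : B P = \sum_(i | P i) (normc (a i) * Num.sqrt (tau i)) ^+ 2.
    by apply: eq_bigr => i _; rewrite exprMn sqr_sqrtr.
  rewrite e1 e2; apply: le_trans (sum_CS _ _ _).
  rewrite lerXn2r ?nnegrE// ?sumr_ge0// => [i _|]; first by rewrite !mulr_ge0 ?normc_ge0 ?sqrtr_ge0.
  apply: (le_trans (normc_sum _ _ _)); apply: ler_sum => i _.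
  rewrite (normcM (a i * _)) normcM normc_conj (normc_pos (tau0 i)).
  have -> : normc (b i) * Num.sqrt (tau i) * (normc (a i) * Num.sqrt (tau i)) =
     normc (a i) * normc (b i) * (Num.sqrt (tau i) ^+ 2) by ring.
  by rewrite sqr_sqrtr.
have xE : x = A S - B S by rewrite /x /A /B -sumrB; apply: eq_bigr => i _; rewrite mulrBl.
have yE : y = A (predC S) - B (predC S).
  by rewrite /y /A /B -sumrB; apply: eq_bigr => i _; rewrite mulrBl.
have AE : \sum_i normc (b i) ^+ 2 * tau i = A S + A (predC S) by rewrite (bigID S).
have BE : \sum_i normc (a i) ^+ 2 * tau i = B S + B (predC S) by rewrite (bigID S).
have CE : normc (\sum_i a i * (b i)^* * (tau i)%:C) <= C S + C (predC S).
  by rewrite (bigID S) /=; exact: le_normcD.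
have {}CE : normc (\sum_i a i * (b i)^* * (tau i)%:C) ^+ 2 <= (C S + C (predC S)) ^+ 2.
  by rewrite lerXn2r ?nnegrE ?normc_ge0// addr_ge0.
rewrite AE BE; move: CE; set D := _ ^+ 2; rewrite xE yE => CE.
have am : 2 * (C S * C (predC S)) <= A S * A (predC S) + B S * B (predC S).
  have h0 : 0 <= A S * A (predC S) + B S * B (predC S) by rewrite addr_ge0// mulr_ge0.
  rewrite -(ler_pXn2r (n := 2)) ?nnegrE// ?mulr_ge0//.
  have h1 : C S ^+ 2 * C (predC S) ^+ 2 <= A S * B S * (A (predC S) * B (predC S)).
    by apply: ler_pM => //; exact: exprn_ge0.
  have h2 : 0 <= (A S * A (predC S) - B S * B (predC S)) ^+ 2 by exact: sqr_ge0.
  rewrite !exprMn; move: h1 h2; clear.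
  move: (A S) (B S) (C S) (A (predC S)) (B (predC S)) (C (predC S)) => a1 b1 c1 a2 b2 c2 h1 h2.
  have -> : 2 ^+ 2 * (c1 ^+ 2 * c2 ^+ 2) = 4 * (c1 ^+ 2 * c2 ^+ 2) by ring.
  have -> : (a1 * a2 + b1 * b2) ^+ 2 = (a1 * a2 - b1 * b2) ^+ 2 + 4 * (a1 * b1 * (a2 * b2)) by ring.
  by move: (c1 ^+ 2 * c2 ^+ 2) ((a1 * a2 - b1 * b2) ^+ 2) (a1 * b1 * (a2 * b2)) h1 h2 => u v w h1 h2; lra.
have h1 := CS S; have h2 := CS (predC S).
move: CE am h1 h2; clear; move: (A S) (B S) (C S) (A (predC S)) (B (predC S)) (C (predC S)) => a1 b1 c1 a2 b2 c2.
rewrite sqrrD => h1 h2 h3 h4; move: (c1 * c2) (c1 ^+ 2) (c2 ^+ 2) D h1 h2 h3 h4 => u v w D h1 h2 h3 h4.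
have -> : - ((a1 - b1) * (a2 - b2)) = a1 * b2 + a2 * b1 - (a1 * a2 + b1 * b2) by ring.
have -> : (a1 + a2) * (b1 + b2) = a1 * b1 + a2 * b2 + (a1 * b2 + a2 * b1) by ring.
move: (a1 * b2) (a2 * b1) (a1 * a2) (b1 * b2) (a1 * b1) (a2 * b2) h2 h3 h4 => *; lra.
Qed.

Definition taylor v M z : R[i] := \sum_(n < M) coef v n * z ^+ n.

Definition coef_prod u v r M : R[i] := \sum_(n < M) coef u n * (coef v n)^* * (r ^+ n.*2)%:C.

Lemma avgc_polynomial (a b : nat -> R[i]) r M : 0 <= r ->
  avgc M r (fun z => (\sum_(n < M) a n * z ^+ n) * (\sum_(n < M) b n * z ^+ n)^*) =
  \sum_(n < M) a n * (b n)^* * (r ^+ n.*2)%:C.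
Proof.
move=> r0.
have -> : (fun z => (\sum_(n < M) a n * z ^+ n) * (\sum_(n < M) b n * z ^+ n)^*) =
   (fun z => \sum_(n < M) \sum_(m < M) a n * (b m)^* * (z ^+ n * (z ^* ) ^+ m)).
  apply/funext => z; rewrite mulr_suml; apply: eq_bigr => n _.
  rewrite rmorph_sum mulr_sumr; apply: eq_bigr => m _.
  by rewrite rmorphM rmorphXn /=; ring.
rewrite avgc_sum; apply: eq_bigr => n _; rewrite avgc_sum (bigD1 n)//= big1 => [|m mn].
  by rewrite addr0 avgcZ avgc_monomials// eqxx.
rewrite avgcZ avgc_monomials// (_ : (_ == _) = false) ?mulr0//.
by apply/negbTE; apply: contra_neq mn => /val_inj.
Qed.

Lemma avgc_taylor u v r M : 0 <= r ->
  avgc M r (fun z => taylor u M z * (taylor v M z)^*) = coef_prod u v r M.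
Proof. exact: avgc_polynomial. Qed.

Lemma taylor_uniform v r : holo v -> 0 < r -> r < 1 ->
  exists2 d : nat -> R, d @ \oo --> (0 : R) &
    forall M z, normc z <= r -> normc (v z - taylor v M z) <= d M.
Proof.
move=> hv r0 r1; pose s := (r + 1) / 2.
have rs : r < s by rewrite /s; lra.
have s1 : s < 1 by rewrite /s; lra.
have s0 := lt_trans r0 rs.
have [K K0 hK] := holo_bounded hv (ltW s0) s1.
exists (fun M => K * (s / (s - r)) * (r / s) ^+ M).
  rewrite -[X in _ --> X](mulr0 (K * (s / (s - r)))); apply: cvgM; first exact: cvg_cst.
  by apply: cvg_expr; rewrite ger0_norm ?(divr_ge0 (ltW r0) (ltW s0))// ltr_pdivrMr// mul1r.
move=> M z zr; have -> : taylor v M z = \sum_(n <- iota 0 M) coef v n * z ^+ n.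
  by rewrite /taylor -(big_mkord xpredT (fun n => coef v n * z ^+ n)) /index_iota subn0.
exact: taylor_bound.
Qed.

(** The Taylor polynomials are cut at the number [M] of sample points, so that their means are given
    exactly by orthogonality; uniform approximation on the circle takes care of the rest. *)
Lemma avgc_parseval u v r : holo u -> holo v -> 0 < r -> r < 1 ->
  climit (fun M => avgc M r (fun z => u z * (v z)^*) - coef_prod u v r M) 0.
Proof.
move=> hu hv r0 r1.
have [Ku Ku0 hKu] := holo_bounded hu (ltW r0) r1.
have [Kv Kv0 hKv] := holo_bounded hv (ltW r0) r1.
have [d hd du] := taylor_uniform hu r0 r1.
have [d' hd' dv] := taylor_uniform hv r0 r1.
have d0 M : 0 <= d M by have := du M r%:C; rewrite normc_pos ?(ltW r0)// lexx => /(_ isT); exact/le_trans/normc_ge0.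
have d0' M : 0 <= d' M by have := dv M r%:C; rewrite normc_pos ?(ltW r0)// lexx => /(_ isT); exact/le_trans/normc_ge0.
apply: (@climit_squeeze _ _ _ (fun M => d M * Kv + (Ku + d M) * d' M)).
  move=> M; rewrite subr0 -avgc_taylor ?(ltW r0)// -avgcB; apply: normc_avgc_le_cst.
  - exact: ltW.
  - by rewrite addr_ge0 ?mulr_ge0 ?addr_ge0.
  move=> z zr; have hz1 := du M z; have hz2 := dv M z; rewrite zr lexx in hz1 hz2.
  have {}hz1 := hz1 isT; have {}hz2 := hz2 isT.
  have -> : u z * (v z)^* - taylor u M z * (taylor v M z)^* =
     (u z - taylor u M z) * (v z)^* + taylor u M z * (v z - taylor v M z)^*.
    by rewrite rmorphB /=; ring.
  apply: (le_trans (le_normcD _ _)); apply: lerD; rewrite normcM normc_conj; apply: ler_pM; rewrite ?normc_ge0 ?hKv//.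
  have -> : taylor u M z = u z - (u z - taylor u M z) by ring.
  by apply: (le_trans (le_normcB _ _)); rewrite lerD ?hKu.
rewrite -[X in _ --> X]addr0; apply: cvgD.
  by rewrite -[X in _ --> X](mul0r Kv); apply: cvgM => //; exact: cvg_cst.
rewrite -[X in _ --> X](mulr0 (Ku + 0)); apply: cvgM => //.
by apply: cvgD => //; exact: cvg_cst.
Qed.

End CoefficientSums.

(** * The two-point inequality averaged over a circle *)

Section SeriesInequality.
Variable R : realType.
Implicit Types (f g : R[i] -> R[i]) (z w : R[i]) (c r s t x y e K : R) (N M n m : nat).

(** Through this identity Pick's inequality becomes a bound on [o1 - o2], which after multiplication
    by values of g is the determinant of f and g. *)
Lemma normc_pseudo_dist (o1 o2 : R[i]) :
  normc (1 - o1 * o2^*) ^+ 2 =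
  normc (o1 - o2) ^+ 2 + (1 - normc o1 ^+ 2) * (1 - normc o2 ^+ 2).
Proof.
by rewrite !sqr_normcE; case: o1 => a b; case: o2 => a' b' /=; ring.
Qed.

(** Multiplying the inequality for the quotient by the squared moduli of [g z] and [g w] clears the
    denominators, so the result holds at zeros of [g] too. If [g] vanishes identically, so does [f]
    on the annulus. *)
Lemma pair_inequality f g c r z w : 0 < c -> c < r -> r < 1 -> holo f -> holo g ->
  (forall z, c < normc z < 1 -> normc (f z) <= normc (g z)) ->
  normc z = r -> normc w = r ->
  let X := lim (theta_ratio c r N @[N --> \oo]) in
  X ^+ 2 * normc (g z * f w - f z * g w) ^+ 2 <=
  (1 - X ^+ 2) * ((normc (g z) ^+ 2 - normc (f z) ^+ 2) * (normc (g w) ^+ 2 - normc (f w) ^+ 2)).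
Proof.
move=> c0 cr r1 hf hg fg zr wr; cbv zeta; set X := lim _.
have zin : c < normc z < 1 by rewrite zr cr.
have win : c < normc w < 1 by rewrite wr cr.
have [g0|[om hom]] := quotient_holomorphic c0 hf hg fg.
  have E (y : R[i]) : c < normc y < 1 -> g y = 0 /\ f y = 0.
    move=> yin; have gy : g y = 0 by apply: g0; case/andP: yin.
    split=> //; apply/eqP; rewrite -normc_eq0 eq_le normc_ge0 andbT.
    by have := fg _ yin; rewrite gy normc0.
  have [-> ->] := E _ zin; have [-> ->] := E _ win.
  by rewrite !mul0r subrr normc0 !expr0n /= subrr !mulr0.
have [_ _ fz] := hom _ zin; have [_ _ fw] := hom _ win.
have := two_points c0 cr r1 (fun (y : R[i]) hy => let: And3 p _ _ := hom y hy in p)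
   (fun (y : R[i]) hy => let: And3 _ p _ := hom y hy in p) zr wr; rewrite -/X.
rewrite exprMn normc_pseudo_dist fz fw.
have -> : g z * (om w * g w) - om z * g z * g w = g z * g w * (om w - om z) by ring.
rewrite (normcM (g z * g w)) (normcM (om z)) (normcM (om w)) (normcM (g z)) (normcC (om w)).
move: (normc (om z - om w)) (normc (om z)) (normc (om w)) (normc (g z)) (normc (g w)) => d a b p q h.
have -> : X ^+ 2 * (p * q * d) ^+ 2 = (p * q) ^+ 2 * (X ^+ 2 * d ^+ 2) by ring.
have -> : (1 - X ^+ 2) * ((p ^+ 2 - (a * p) ^+ 2) * (q ^+ 2 - (b * q) ^+ 2)) =
   (p * q) ^+ 2 * ((1 - X ^+ 2) * ((1 - a ^+ 2) * (1 - b ^+ 2))) by ring.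
apply: ler_wpM2l; first exact: sqr_ge0.
by move: h; rewrite mulrDl [X in X <= _ -> _]addrC -lerBrDl; move: (_ * (1 - b ^+ 2)) => u h; lra.
Qed.

(** Expansion of the square: the two diagonal products coincide after averaging, and so do the two
    cross terms. What remains is twice the Gram determinant of the sampled functions. *)
Lemma ravg_determinant M r f g :
  ravg M r (fun z => ravg M r (fun w => normc (g z * f w - f z * g w) ^+ 2)) =
  2 * (ravg M r (fun z => normc (g z) ^+ 2) * ravg M r (fun z => normc (f z) ^+ 2) -
       normc (avgc M r (fun z => f z * (g z)^*)) ^+ 2).
Proof.
pose A := ravg M r (fun z => normc (g z) ^+ 2); pose B := ravg M r (fun z => normc (f z) ^+ 2).
pose C := avgc M r (fun z => f z * (g z)^*).
have CE : avgc M r (fun z => g z * (f z)^*) = C^*.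
  by rewrite /C avgc_conj; congr avgc; apply/funext => z; rewrite rmorphM /= conjcK mulrC.
have inner z : (ravg M r (fun w => normc (g z * f w - f z * g w) ^+ 2))%:C =
   B%:C * (g z * (g z)^*) - C * (g z * (f z)^*) - C^* * (f z * (g z)^*) + A%:C * (f z * (f z)^*).
  rewrite ravgC.
  have -> : (fun w => (normc (g z * f w - f z * g w) ^+ 2)%:C) =
    (fun w => (g z * (g z)^*) * (normc (f w) ^+ 2)%:C - (g z * (f z)^*) * (f w * (g w)^*)
      - (f z * (g z)^*) * (g w * (f w)^*) + (f z * (f z)^*) * (normc (g w) ^+ 2)%:C).
    by apply/funext => w; rewrite !sqr_normc_conj rmorphB !rmorphM /=; ring.
  by rewrite avgcD !avgcB !avgcZ CE -!ravgC -/C -/A -/B; ring.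
apply: complexI.
rewrite ravgC.
have -> : (fun z => (ravg M r (fun w => normc (g z * f w - f z * g w) ^+ 2))%:C) =
  (fun z => B%:C * (normc (g z) ^+ 2)%:C - C * (g z * (f z)^*) - C^* * (f z * (g z)^*) +
     A%:C * (normc (f z) ^+ 2)%:C).
  by apply/funext => z; rewrite inner !sqr_normc_conj.
rewrite avgcD !avgcB !avgcZ CE -!ravgC -/C -/A -/B.
have -> : (2 * (A * B - normc C ^+ 2))%:C = 2 * (A%:C * B%:C - C * C^*) :> R[i].
  by rewrite -sqr_normc_conj -rmorphM -rmorphB -(rmorph_nat (@real_complex R)) -rmorphM.
by ring.
Qed.

Lemma determinant_inequality f g c r M : 0 < c -> c < r -> r < 1 -> holo f -> holo g ->
  (forall z, c < normc z < 1 -> normc (f z) <= normc (g z)) ->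
  let X := lim (theta_ratio c r N @[N --> \oo]) in
  let A := ravg M r (fun z => normc (g z) ^+ 2) in
  let B := ravg M r (fun z => normc (f z) ^+ 2) in
  X ^+ 2 * (2 * (A * B - normc (avgc M r (fun z => f z * (g z)^*)) ^+ 2)) <=
  (1 - X ^+ 2) * (A - B) ^+ 2.
Proof.
move=> c0 cr r1 hf hg fg; cbv zeta; set X := lim _.
have r0 := ltW (lt_trans c0 cr).
rewrite -ravg_determinant -ravgZ -ravgB.
set phi := fun z => normc (g z) ^+ 2 - normc (f z) ^+ 2.
have -> : (1 - X ^+ 2) * ravg M r phi ^+ 2 =
    ravg M r (fun z => ravg M r (fun w => (1 - X ^+ 2) * phi z * phi w)).
  have -> : (fun z => ravg M r (fun w => (1 - X ^+ 2) * phi z * phi w)) =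
      (fun z => ((1 - X ^+ 2) * ravg M r phi) * phi z).
    by apply/funext => z; rewrite ravgZ; ring.
  by rewrite ravgZ; ring.
apply: ravg_le => // z zr; rewrite -ravgZ; apply: ravg_le => // w wr.
rewrite -mulrA; exact: pair_inequality.
Qed.

End SeriesInequality.

(** * From averages to coefficient series *)

Section WeightedCoefficients.
Variable R : realType.
Implicit Types (f g : R[i] -> R[i]) (z w : R[i]) (c r s t x y e K : R) (N M n m : nat).

Definition coef_gap f g n : R := normc (coef g n) ^+ 2 - normc (coef f n) ^+ 2.

Definition pos_part x : R := Num.max x 0.

Lemma pos_part_ge0 x : 0 <= pos_part x.
Proof. by rewrite le_max lexx orbT. Qed.

Lemma pos_partB x : pos_part x - pos_part (- x) = x.
Proof.
rewrite /pos_part /Num.max oppr_lt0.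
by case: ltgtP => [||->]; rewrite ?subr0 ?sub0r ?opprK// addr0.
Qed.

Lemma sum_bounded_cvg (a : nat -> R) B : (forall n, 0 <= a n) ->
  (forall M, \sum_(n < M) a n <= B) -> cvgn (fun M => \sum_(n < M) a n).
Proof.
move=> a0 aB; apply: nondecreasing_is_cvgn; last by exists B => _ [M _ <-].
by apply/nondecreasing_seqP => n; rewrite big_ord_recr lerDl.
Qed.

Definition mass v r M : R := \sum_(n < M) normc (coef v n) ^+ 2 * r ^+ n.*2.

(** The nondecreasing partial sums differ from bounded means by a null sequence; hence they
    converge, and the means converge to the same limit. *)
Lemma mass_limit v r : holo v -> 0 < r -> r < 1 ->
  exists a : R, mass v r @ \oo --> a /\
    ravg M r (fun z => normc (v z) ^+ 2) @[M --> \oo] --> a.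
Proof.
move=> hv r0 r1.
have H := avgc_parseval hv hv r0 r1.
have E M : coef_prod v v r M = (mass v r M)%:C.
  rewrite /coef_prod rmorph_sum; apply: eq_bigr => n _.
  by rewrite -sqr_normc_conj -rmorphM.
have D : ravg M r (fun z => normc (v z) ^+ 2) - mass v r M @[M --> \oo] --> (0 : R).
  apply/cvgrPdist_le => e e0; move/climit_epsP : H => /(_ _ e0)[M0 h]; exists M0 => // M /= MM.
  have := h M MM; rewrite subr0 E.
  have -> : (fun z => v z * (v z)^*) = (fun z => (normc (v z) ^+ 2)%:C).
    by apply/funext => z; rewrite sqr_normc_conj.
  by rewrite -ravgC -rmorphB normc_real sub0r normrN.
have [K K0 hK] := holo_bounded hv (ltW r0) r1.
have rK M : ravg M r (fun z => normc (v z) ^+ 2) <= K ^+ 2.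
  apply: le_trans (ravg_cst_le M r (sqr_ge0 K)); apply: ravg_le; first exact: ltW.
  by move=> z zr; rewrite lerXn2r ?nnegrE ?normc_ge0// hK.
have t0 n : 0 <= normc (coef v n) ^+ 2 * r ^+ n.*2 by rewrite mulr_ge0// exprn_ge0 ?normc_ge0// ltW.
have mono m n : (m <= n)%N -> mass v r m <= mass v r n.
  move=> mn; rewrite -(subnKC mn); elim: (n - m)%N => [|k ih]; first by rewrite addn0.
  by rewrite addnS (le_trans ih)// /mass big_ord_recr lerDl.
have bnd M : mass v r M <= K ^+ 2 + 1.
  move/cvgrPdist_le : D => /(_ _ ltr01)[M0 _ h].
  have := h (maxn M M0) (leq_maxr _ _); rewrite /= sub0r normrN => h1.
  have := mono _ _ (leq_maxl M M0); have := rK (maxn M M0).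
  by move: h1; rewrite ler_norml; lra.
have cv : cvgn (mass v r) := sum_bounded_cvg t0 bnd.
exists (lim (mass v r @ \oo)); split=> //.
have -> : (fun M => ravg M r (fun z => normc (v z) ^+ 2)) =
   (fun M => (ravg M r (fun z => normc (v z) ^+ 2) - mass v r M) + mass v r M).
  by apply/funext => M; rewrite subrK.
by rewrite -[X in _ --> X]add0r; apply: cvgD.
Qed.

(** At each [M] the splitting inequality is applied to the first [M] coefficients, whose Gram
    determinant differs from the sampled one by terms tending to 0. The existence of the two sums
    and [N <= P] need no [kap], so the case of the inner circle can use them alone. *)
Lemma coef_series f g r : holo f -> holo g -> 0 < r -> r < 1 ->
  (forall z, normc z = r -> normc (f z) <= normc (g z)) ->
  exists P N : R, [/\ (fun M => \sum_(n < M) pos_part (coef_gap f g n) * r ^+ n.*2) @ \oo --> P,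
    (fun M => \sum_(n < M) pos_part (- coef_gap f g n) * r ^+ n.*2) @ \oo --> N, N <= P &
    forall kap : R, (forall M, 2 * (ravg M r (fun z => normc (g z) ^+ 2) * ravg M r (fun z => normc (f z) ^+ 2)
      - normc (avgc M r (fun z => f z * (g z)^*)) ^+ 2) <=
      kap * (ravg M r (fun z => normc (g z) ^+ 2) - ravg M r (fun z => normc (f z) ^+ 2)) ^+ 2) ->
    2 * (P * N) <= kap * (P - N) ^+ 2].
Proof.
move=> hf hg r0 r1 fg.
have [a [ha hA]] := mass_limit hg r0 r1; have [b [hb hB]] := mass_limit hf r0 r1.
have tau0 n : 0 <= r ^+ n.*2 by rewrite exprn_ge0// ltW.
set Ps := fun M => \sum_(n < M) pos_part (coef_gap f g n) * r ^+ n.*2.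
set Ns := fun M => \sum_(n < M) pos_part (- coef_gap f g n) * r ^+ n.*2.
have pn v n : 0 <= normc (coef v n) ^+ 2 * r ^+ n.*2 by rewrite mulr_ge0// exprn_ge0// normc_ge0.
have mass_le v l M : mass v r @ \oo --> l -> mass v r M <= l.
  move=> hl; have ndv : nondecreasing_seq (mass v r).
    by apply/nondecreasing_seqP => n; rewrite /mass big_ord_recr lerDl.
  have -> : l = lim (mass v r @ \oo) by rewrite (cvg_lim _ hl).
  by apply: nondecreasing_cvgn_le => //; apply/cvg_ex; exists l.
have gapE n : coef_gap f g n * r ^+ n.*2 = normc (coef g n) ^+ 2 * r ^+ n.*2 - normc (coef f n) ^+ 2 * r ^+ n.*2.
  by rewrite -mulrBl.
have Pa M : Ps M <= mass g r M.
  apply: ler_sum => n _; rewrite ler_wpM2r// /pos_part ge_max exprn_ge0 ?normc_ge0// andbT.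
  by rewrite /coef_gap gerBl exprn_ge0 ?normc_ge0.
have Nb M : Ns M <= mass f r M.
  apply: ler_sum => n _; rewrite ler_wpM2r// /pos_part ge_max exprn_ge0 ?normc_ge0// andbT.
  by rewrite /coef_gap opprB gerBl exprn_ge0 ?normc_ge0.
have cP : cvgn Ps.
  apply: (@sum_bounded_cvg (fun n => pos_part (coef_gap f g n) * r ^+ n.*2) a) => [n|M]; first by rewrite mulr_ge0// pos_part_ge0.
  exact: le_trans (Pa M) (mass_le _ _ _ ha).
have cN : cvgn Ns.
  apply: (@sum_bounded_cvg (fun n => pos_part (- coef_gap f g n) * r ^+ n.*2) b) => [n|M]; first by rewrite mulr_ge0// pos_part_ge0.
  exact: le_trans (Nb M) (mass_le _ _ _ hb).
have PNE M : Ps M - Ns M = mass g r M - mass f r M.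
  rewrite /Ps /Ns /mass -!sumrB; apply: eq_bigr => n _.
  by rewrite -!mulrBl pos_partB.
pose P := lim (Ps @ \oo); pose N := lim (Ns @ \oo).
have hP : Ps @ \oo --> P by []. have hN : Ns @ \oo --> N by [].
have PN : P - N = a - b.
  have h1 : (fun M => Ps M - Ns M) @ \oo --> P - N by exact: cvgB.
  have h2 : (fun M => Ps M - Ns M) @ \oo --> a - b.
    by rewrite (_ : (fun M => _) = (fun M => mass g r M - mass f r M)); [exact: cvgB|apply/funext].
  by rewrite -(cvg_lim _ h1)// -(cvg_lim _ h2).
exists P, N; split=> //.
  have hAB : ravg M r (fun z => normc (g z) ^+ 2) - ravg M r (fun z => normc (f z) ^+ 2) @[M --> \oo] --> a - b.
    exact: cvgB.
  rewrite -subr_ge0 PN; apply: (cvgr_to_ge hAB); apply: nearW => M.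
  rewrite subr_ge0; apply: ravg_le; first exact: ltW.
  by move=> z zr; rewrite lerXn2r ?nnegrE ?normc_ge0// fg.
move=> kap hkap.
pose A M := ravg M r (fun z => normc (g z) ^+ 2); pose B M := ravg M r (fun z => normc (f z) ^+ 2).
pose C M := avgc M r (fun z => f z * (g z)^*).
(* The discrepancy between the coefficient version and the sampled version of the inner product of
   [f] and [g], squared. *)
pose D M := normc (coef_prod f g r M) ^+ 2 - normc (C M) ^+ 2.
have hD : D @ \oo --> (0 : R).
  have [Kf Kf0 hKf] := holo_bounded hf (ltW r0) r1; have [Kg Kg0 hKg] := holo_bounded hg (ltW r0) r1.
  have CK M : normc (C M) <= Kf * Kg.
    apply: normc_avgc_le_cst; [exact: ltW|exact: mulr_ge0|].
    by move=> z zr; rewrite normcM normc_conj ler_pM ?normc_ge0 ?hKf ?hKg.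
  pose d M := normc (C M - coef_prod f g r M).
  have hd : d @ \oo --> (0 : R).
    have := avgc_parseval hf hg r0 r1; rewrite /climit.
    by rewrite (_ : (fun M => _) = d)//; apply/funext => M; rewrite subr0.
  have bound M : `|D M| <= d M * (2 * (Kf * Kg) + d M).
    rewrite /D subr_sqr normrM; apply: ler_pM => //.
      rewrite ler_norml /d; have := le_normc_sub (C M) (coef_prod f g r M).
      have := le_normc_sub (coef_prod f g r M) (C M); rewrite (normcC (coef_prod _ _ _ _)); lra.
    rewrite ger0_norm ?addr_ge0 ?normc_ge0//.
    have := le_normc_sub (coef_prod f g r M) (C M); rewrite (normcC (coef_prod _ _ _ _)) -/(d M).
    have := CK M; lra.
  have h0 : (fun M => d M * (2 * (Kf * Kg) + d M)) @ \oo --> (0 : R).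
    rewrite -[X in _ --> X](mul0r (2 * (Kf * Kg) + 0)); apply: cvgM => //.
    by apply: cvgD => //; exact: cvg_cst.
  apply/cvgrPdist_le => e e0; move/cvgrPdist_le : h0 => /(_ _ e0).
  apply: filterS => M; rewrite !sub0r !normrN => h; apply: le_trans h.
  exact: le_trans (bound M) (ler_norm _).
(* The last term collects the two differences between the Gram determinants and vanishes in the
   limit. *)
have main M : 2 * (Ps M * Ns M) <= kap * (A M - B M) ^+ 2 + 2 * (mass g r M * mass f r M - A M * B M - D M).
  have := @gram_split R 'I_M (fun n : 'I_M => 0 < coef_gap f g n) (fun n : 'I_M => coef f n) (fun n : 'I_M => coef g n)
    (fun n : 'I_M => r ^+ n.*2) (fun n : 'I_M => tau0 n); cbv zeta.
  have -> : \sum_(i < M | 0 < coef_gap f g i) (normc (coef g i) ^+ 2 - normc (coef f i) ^+ 2) * r ^+ i.*2 = Ps M.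
    rewrite big_mkcond; apply: eq_bigr => n _; rewrite -/(coef_gap f g n) /pos_part /Num.max.
    by case: ltgtP => [||<-]; rewrite ?mul0r.
  have -> : \sum_(i < M | ~~ (0 < coef_gap f g i)) (normc (coef g i) ^+ 2 - normc (coef f i) ^+ 2) * r ^+ i.*2 = - Ns M.
    rewrite big_mkcond -sumrN; apply: eq_bigr => n _; rewrite -/(coef_gap f g n) /pos_part /Num.max oppr_lt0.
    by case: ltgtP => [||<-]; rewrite ?mul0r ?oppr0 ?mulNr ?opprK// mul0r oppr0.
  have := hkap M; rewrite -/(A M) -/(B M) -/(C M) -/(coef_prod f g r M) -/(mass g r M) -/(mass f r M) /D.
  rewrite mulrN opprK; move: (kap * _) (Ps M * Ns M) (A M * B M) (mass g r M * mass f r M).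
  by move: (normc (C M) ^+ 2) (normc _ ^+ 2) => *; lra.
have L : (fun M => 2 * (Ps M * Ns M)) @ \oo --> 2 * (P * N).
  by apply: cvgM; [exact: cvg_cst|exact: cvgM].
have L' : (fun M => kap * (A M - B M) ^+ 2 + 2 * (mass g r M * mass f r M - A M * B M - D M)) @ \oo -->
   kap * (P - N) ^+ 2.
  rewrite PN -[X in _ --> X]addr0; apply: cvgD.
    have -> : (fun M => kap * (A M - B M) ^+ 2) = (fun M => kap * ((A M - B M) * (A M - B M))).
      by apply/funext => M; rewrite expr2.
    by rewrite expr2; apply: cvgM; [exact: cvg_cst|apply: cvgM; exact: cvgB].
  rewrite -[X in _ --> X](mulr0 2); apply: cvgM; first exact: cvg_cst.
  have -> : (0 : R) = a * b - a * b - 0 by rewrite subrr subr0.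
  by apply: cvgB => //; apply: cvgB; exact: cvgM.
apply: (ler_cvg_to L L'); exact: nearW.
Qed.

End WeightedCoefficients.

(** * The bound of the negative part by [beta] *)

Section BetaInequality.
Variable R : realType.
Implicit Types (f g : R[i] -> R[i]) (z w : R[i]) (c r s t x y e K : R) (N M n m : nat).

(** The measure may have an atom at c^2, so the radius [c] itself must be covered; continuity
    extends the domination to that circle. *)
Lemma dominated_inner_circle f g c z : 0 < c -> c < 1 -> holo f -> holo g ->
  (forall z, c < normc z < 1 -> normc (f z) <= normc (g z)) ->
  normc z = c -> normc (f z) <= normc (g z).
Proof.
move=> c0 c1 hf hg fg zc; rewrite leNgt; apply/negP => lt.
have z1 : normc z < 1 by rewrite zc.
pose e := (normc (f z) - normc (g z)) / 2.
have e0 : 0 < e by rewrite divr_gt0// subr_gt0.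
have [d d0 hd] := cdiff_cont (hf z z1) e0; have [d' d0' hd'] := cdiff_cont (hg z z1) e0.
pose h := Num.min (1 - c) (Num.min d d') / 2.
have m0 : 0 < Num.min (1 - c) (Num.min d d') by rewrite !lt_min subr_gt0 c1 d0.
have h0 : 0 < h by rewrite divr_gt0.
have [hc hdd hdd'] : [/\ h < 1 - c, h < d & h < d'].
  have : h < Num.min (1 - c) (Num.min d d') by rewrite /h; lra.
  by rewrite !lt_min => /and3P[].
pose w := ((c + h) / c)%:C * z.
have wE : normc w = c + h.
  by rewrite /w normcM (normc_pos (divr_ge0 (addr_ge0 (ltW c0) (ltW h0)) (ltW c0))) zc divfK// gt_eqF.
have wz : normc (w - z) = h.
  rewrite /w -{2}[z]mul1r -mulrBl normcM zc -(rmorph1 (@real_complex R)) -rmorphB normc_real.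
  have -> : (c + h) / c - 1 = h / c by field; rewrite gt_eqF.
  by rewrite (ger0_norm (divr_ge0 (ltW h0) (ltW c0))) divfK// gt_eqF.
have win : c < normc w < 1 by rewrite wE ltrDl h0/=; lra.
have := fg w win; have := hd w; have := hd' w; rewrite wz => /(_ hdd') b1 /(_ hdd) b2.
have := le_normc_sub (f z) (f w); rewrite normcC.
have := le_normc_sub (g w) (g z).
by move: b1 b2 e0; rewrite /e; lra.
Qed.

(** Writing G = (1 + s) / 2 gives G (G - 1) = (s^2 - 1) / 4, and the radicand in [Gfun] is chosen to
    make this K^2 / (1 - K^2). Only [K < 1] in square, from [Kfun_sqr], has to be known about the
    product. *)
Lemma Gfun_root c r : 0 < c -> c < r -> r < 1 ->
  [/\ 0 <= Kfun c r ^+ 2, Kfun c r ^+ 2 < 1, 1 <= Gfun c r &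
      Gfun c r * (Gfun c r - 1) = Kfun c r ^+ 2 / (1 - Kfun c r ^+ 2)].
Proof.
move=> c0 cr r1; have [X0 KE] := Kfun_sqr c0 cr r1.
have k0 : 0 <= Kfun c r ^+ 2 by exact: sqr_ge0.
have k1 : Kfun c r ^+ 2 < 1 by rewrite KE gtrBl exprn_gt0.
rewrite /Gfun; move: (Kfun c r ^+ 2) k0 k1 => k k0 k1 {X0 KE}.
have d0 : 0 < 1 - k by rewrite subr_gt0.
have s2 : Num.sqrt ((1 + 3 * k) / (1 - k)) ^+ 2 = (1 + 3 * k) / (1 - k).
  by rewrite sqr_sqrtr// divr_ge0 ?(ltW d0)//; lra.
have s1 : 1 <= Num.sqrt ((1 + 3 * k) / (1 - k)).
  by rewrite -[X in X <= _]sqrtr1 ler_wsqrtr// ler_pdivlMr// mul1r; lra.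
split=> //; first by lra.
move: s2; set s := Num.sqrt _ => s2.
have -> : 2^-1 * (1 + s) * (2^-1 * (1 + s) - 1) = (s ^+ 2 - 1) / 4 by field.
by rewrite s2; field; rewrite gt_eqF.
Qed.

Lemma beta_bounds c r : 0 < c -> 0 <= beta c r <= 1.
Proof.
move=> c0; rewrite /beta; case: ifP => [/andP[cr r1]|_]; last by rewrite ler01 lexx.
have [_ _ G1 _] := Gfun_root c0 cr r1.
have G0 := lt_le_trans ltr01 G1.
by rewrite subr_ge0 invf_le1// G1 gerBl invr_ge0 ltW.
Qed.

Lemma coef_beta f g c r : 0 < c -> c <= r -> r < 1 -> holo f -> holo g ->
  (forall z, c < normc z < 1 -> normc (f z) <= normc (g z)) ->
  exists P N : R, [/\ (fun M => \sum_(n < M) pos_part (coef_gap f g n) * r ^+ n.*2) @ \oo --> P,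
    (fun M => \sum_(n < M) pos_part (- coef_gap f g n) * r ^+ n.*2) @ \oo --> N &
    N <= beta c r * P].
Proof.
move=> c0 cr r1 hf hg fg; have r0 := lt_le_trans c0 cr; have c1 := le_lt_trans cr r1.
have fgr z : normc z = r -> normc (f z) <= normc (g z).
  move=> zr; move: cr; rewrite le_eqVlt => /orP[/eqP rc|rc].
    by apply: (dominated_inner_circle c0 c1 hf hg fg); rewrite zr.
  by apply: fg; rewrite zr rc.
have [P [N [hP hN NP main]]] := coef_series hf hg r0 r1 fgr.
exists P, N; split=> //; rewrite /beta; case: ifP => [/andP[cr' _]|_]; last by rewrite mul1r.
have [X0 KE] := Kfun_sqr c0 cr' r1; have [k0 k1 G1 Geq] := Gfun_root c0 cr' r1.
have X20 := exprn_gt0 2 X0.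
have {main} := main (Kfun c r ^+ 2 / (1 - Kfun c r ^+ 2)).
move=> main; have {}main : 2 * (P * N) <= Kfun c r ^+ 2 / (1 - Kfun c r ^+ 2) * (P - N) ^+ 2.
  apply: main => M.
  have -> : 1 - Kfun c r ^+ 2 = lim (theta_ratio c r N @[N --> \oo]) ^+ 2 by rewrite KE; ring.
  rewrite [X in _ <= X]mulrAC ler_pdivlMr// mulrC KE; exact: determinant_inequality.
have kap0 : 0 <= Kfun c r ^+ 2 / (1 - Kfun c r ^+ 2) by rewrite divr_ge0 ?subr_ge0 ?(ltW k1).
rewrite -Geq in kap0 main; move: (Gfun c r) G1 kap0 main => G G1 kap0 main.
have G0 := lt_le_trans ltr01 G1.
have -> : (1 - G^-1) * P = (G - 1) * P / G by field; rewrite gt_eqF.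
(* Otherwise P exceeds G (P - N). The product of P - G (P - N) and P + (G - 1) (P - N) is then
   positive, that is P N > G (G - 1) (P - N)^2, against [main]. *)
rewrite ler_pdivlMr// leNgt; apply/negP => lt.
have F0 : 0 <= P - N by rewrite subr_ge0.
have p1 : 0 < P - G * (P - N) by move: lt; clear; lra.
have GF : 0 <= G * (P - N) by rewrite mulr_ge0// ltW.
have p2 : 0 < P + (G - 1) * (P - N).
  by rewrite ltr_wpDr ?mulr_ge0 ?subr_ge0//; lra.
have := mulr_gt0 p1 p2.
have -> : (P - G * (P - N)) * (P + (G - 1) * (P - N)) = P * N - G * (G - 1) * (P - N) ^+ 2 by ring.
have : 0 <= G * (G - 1) * (P - N) ^+ 2 by rewrite mulr_ge0// sqr_ge0.
by move: main; move: (P * N) (_ * (_ ^+ 2)) => u v; lra.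
Qed.

End BetaInequality.

(** * Area integrals of holomorphic functions *)

Section AffineSubstitution.
Variable R : realType.
Implicit Types (s a b : R) (h : R -> \bar R).
Local Notation mu := (@lebesgue_measure R).

Lemma measurable_affine s a : measurable_fun setT (fun x : measurableTypeR R => s * x + a : measurableTypeR R).
Proof. by apply: measurable_funD => //; apply: measurable_funM. Qed.

Definition affine_image s a : {measure set (measurableTypeR R) -> \bar R} :=
  measure_function_pushforward__canonical__measure_function_Measure mu (measurable_affine s a).

(** The rescaled image measure agrees with interval length on half-open intervals, and this
    determines Lebesgue measure. *)
Lemma lebesgue_affine s a (s0 : 0 < s) (A : set R) : measurable A ->
  mu A = mscale (NngNum (ltW s0)) (affine_image s a) A.
Proof.
move=> mA; apply: lebesgue_measure_unique => // _ [[x y]] _ <-.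
transitivity (s%:E * mu `]((x - a) / s)%R, ((y - a) / s)%R]%classic)%E; last first.
  congr (_ * mu _)%E; apply/seteqP; split=> t /=;
  by rewrite !in_itv/= ltr_pdivrMr// ler_pdivlMr// [t * s]mulrC ltrBlDr lerBrDr.
rewrite !lebesgue_measure_itv/= !lte_fin ltr_pM2r ?invr_gt0// ltrD2r.
case: ifPn => xy; last by rewrite mule0.
by rewrite -!EFinB -EFinM; congr (_%:E); field; rewrite gt_eqF.
Qed.

Lemma integral_affine s a h : 0 < s -> measurable_fun setT h -> (forall x, (0 <= h x)%E) ->
  (\int[mu]_x h (s * x + a)%R = (s^-1)%:E * \int[mu]_x h x)%E.
Proof.
move=> s0 mh h0.
have -> : (\int[mu]_x h x = \int[mscale (NngNum (ltW s0)) (affine_image s a)]_x h x)%E.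
  by apply: eq_measure_integral => A mA _; exact: lebesgue_affine.
rewrite ge0_integral_mscale//.
rewrite (ge0_integral_pushforward (measurable_affine s a) mu) //=.
by rewrite muleA -EFinM mulVf ?gt_eqF// mul1e preimage_setT.
Qed.

End AffineSubstitution.

(** * Shears, rotations and dilations of the plane *)

Section PlaneIntegrals.
Variable R : realType.
Implicit Types (s a b u v : R) (z w : R[i]).
Local Notation mu := (@lebesgue_measure R).
Local Notation Pt := (measurableTypeR R * measurableTypeR R)%type.
Implicit Types (H : Pt -> \bar R) (F : R[i] -> \bar R).

Lemma shear1 a H : measurable_fun setT H -> (forall p, (0 <= H p)%E) ->
  (\int[mu \x mu]_p H ((p.1 + a * p.2)%R, p.2) = \int[mu \x mu]_p H p)%E.
Proof.
move=> mH H0.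
have mS : measurable_fun setT (fun p : Pt => H ((p.1 + a * p.2)%R, p.2)).
  apply: (measurableT_comp mH); apply: measurable_fun_pair; last exact: measurable_snd.
  by apply: measurable_funD => //; apply: measurable_funM.
rewrite fubini_tonelli2// [RHS]fubini_tonelli2//.
apply: eq_integral => y _; rewrite /fubini_G /=.
have := @integral_affine R 1 (a * y) (fun x => H (x, y)) ltr01.
rewrite invr1 mul1e => <-//; last exact: measurableT_comp.
by apply: eq_integral => x _; rewrite mul1r.
Qed.

Lemma shear2 a H : measurable_fun setT H -> (forall p, (0 <= H p)%E) ->
  (\int[mu \x mu]_p H (p.1, (p.2 + a * p.1)%R) = \int[mu \x mu]_p H p)%E.
Proof.
move=> mH H0.
have mS : measurable_fun setT (fun p : Pt => H (p.1, (p.2 + a * p.1)%R)).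
  apply: (measurableT_comp mH); apply: measurable_fun_pair; first exact: measurable_fst.
  by apply: measurable_funD => //; apply: measurable_funM.
rewrite fubini_tonelli1// [RHS]fubini_tonelli1//.
apply: eq_integral => x _; rewrite /fubini_F /=.
have := @integral_affine R 1 (a * x) (fun y => H (x, y)) ltr01.
rewrite invr1 mul1e => <-//; last exact: measurableT_comp.
by apply: eq_integral => y _; rewrite mul1r.
Qed.

Lemma plane_scale s H : 0 < s -> measurable_fun setT H -> (forall p, (0 <= H p)%E) ->
  (\int[mu \x mu]_p H ((s * p.1)%R, (s * p.2)%R) = (s ^- 2)%:E * \int[mu \x mu]_p H p)%E.
Proof.
move=> s0 mH H0.
have mS : measurable_fun setT (fun p : Pt => H ((s * p.1)%R, (s * p.2)%R)).
  apply: (measurableT_comp mH); apply: measurable_fun_pair; exact: measurable_funM.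
rewrite fubini_tonelli1// [in RHS]fubini_tonelli1//.
have E h : measurable_fun setT h -> (forall x, (0 <= h x)%E) ->
    (\int[mu]_x h (s * x)%R = (s^-1)%:E * \int[mu]_x h x)%E.
  move=> mh h0; rewrite -(@integral_affine R s 0 h s0 mh h0).
  by apply: eq_integral => x _; rewrite addr0.
have mF : measurable_fun setT (fubini_F mu H) by exact: measurable_fun_fubini_tonelli_F.
have F0 x : (0 <= fubini_F mu H x)%E by apply: integral_ge0.
have -> : (\int[mu]_x fubini_F mu (fun p : Pt => H ((s * p.1)%R, (s * p.2)%R)) x =
   \int[mu]_x ((s^-1)%:E * fubini_F mu H (s * x)%R))%E.
  apply: eq_integral => x _; rewrite /fubini_F /= -E//.
  exact: measurableT_comp.
rewrite ge0_integralZl//; last 2 first.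
  - by apply: (measurableT_comp mF); exact: measurable_funM.
  - by rewrite lee_fin invr_ge0 ltW.
by rewrite E// muleA -EFinM -invfM expr2.
Qed.

Lemma plane_rotation u v H : u ^+ 2 + v ^+ 2 = 1 -> measurable_fun setT H -> (forall p, (0 <= H p)%E) ->
  (\int[mu \x mu]_p H ((u * p.1 - v * p.2)%R, (v * p.1 + u * p.2)%R) = \int[mu \x mu]_p H p)%E.
Proof.
(* A rotation other than the half-turn is a product of three shears. *)
have main (u' v' : R) H' : u' ^+ 2 + v' ^+ 2 = 1 -> u' != -1 -> measurable_fun setT H' ->
    (forall p, (0 <= H' p)%E) ->
    (\int[mu \x mu]_p H' ((u' * p.1 - v' * p.2)%R, (v' * p.1 + u' * p.2)%R) = \int[mu \x mu]_p H' p)%E.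
  move=> uv u1 mH H0.
  have u1' : 1 + u' != 0 by rewrite addrC -[1]opprK subr_eq0.
  (* The tangent of half the rotation angle. *)
  pose t := v' / (1 + u').
  have tv : t * v' = 1 - u'.
    have -> : t * v' = v' ^+ 2 / (1 + u') by rewrite /t; field.
    have -> : v' ^+ 2 = (1 - u') * (1 + u') by rewrite -[v' ^+ 2](addKr (u' ^+ 2)) uv; ring.
    by rewrite mulfK.
  have tu : t * (1 + u') = v' by rewrite /t divfK.
  pose H1 (p : Pt) := H' ((p.1 + (- t) * p.2)%R, p.2).
  have mH1 : measurable_fun setT H1.
    apply: (measurableT_comp mH); apply: measurable_fun_pair; last exact: measurable_snd.
    by apply: measurable_funD => //; apply: measurable_funM.
  pose H2 (p : Pt) := H1 (p.1, (p.2 + v' * p.1)%R).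
  have mH2 : measurable_fun setT H2.
    apply: (measurableT_comp mH1); apply: measurable_fun_pair; first exact: measurable_fst.
    by apply: measurable_funD => //; apply: measurable_funM.
  rewrite -(shear1 (- t) mH H0) -(shear2 v' mH1 (fun p => H0 _)) -(shear1 (- t) mH2 (fun p => H0 _)).
  apply: eq_integral => p _; rewrite /H2 /H1 /=; congr H'; congr pair.
    transitivity ((1 - t * v') * p.1 - t * (1 + (1 - t * v')) * p.2); last by ring.
    by rewrite tv subKr tu.
  transitivity (v' * p.1 + (1 - t * v') * p.2); last by ring.
  by rewrite tv subKr.
(* The half-turn, for which that tangent is infinite, is obtained as the square of a
   quarter-turn. *)
move=> uv mH H0; have [u1|u1] := eqVneq u (-1); last exact: main.
have v0 : v = 0 by apply/eqP; rewrite -sqrf_eq0 -[v ^+ 2](addKr (u ^+ 2)) uv u1; apply/eqP; ring.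
have i1 : (0 : R) ^+ 2 + 1 ^+ 2 = 1 by ring.
have i2 : (0 : R) != -1 by rewrite eq_sym oppr_eq0 oner_eq0.
pose H1 (p : Pt) := H ((0 * p.1 - 1 * p.2)%R, (1 * p.1 + 0 * p.2)%R).
have mH1 : measurable_fun setT H1.
  apply: (measurableT_comp mH); apply: measurable_fun_pair.
    by apply: measurable_funB; apply: measurable_funM.
  by apply: measurable_funD; apply: measurable_funM.
rewrite -(main _ _ _ i1 i2 mH H0) -(main _ _ _ i1 i2 mH1 (fun p => H0 _)).
by apply: eq_integral => p _; rewrite /H1 /= u1 v0; congr H; congr pair; ring.
Qed.

Definition area F : \bar R := (\int[mu \x mu]_p F (p.1 +i* p.2)%C)%E.

Definition plane_measurable F := measurable_fun setT (fun p : Pt => F (p.1 +i* p.2)%C).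

Lemma area_rotation F w : plane_measurable F -> (forall z, (0 <= F z)%E) -> normc w = 1 ->
  area (fun z => F (w * z)) = area F.
Proof.
move=> mF F0 w1; have uv : Re w ^+ 2 + Im w ^+ 2 = 1 by rewrite -sqr_normcE w1 expr1n.
rewrite /area -(plane_rotation uv mF (fun p => F0 _)); apply: eq_integral => p _ /=.
by congr F; case: w {w1 uv} => a b; apply/eqP; rewrite eq_complex /= !eqxx/= addrC.
Qed.

Lemma area_scale F s : plane_measurable F -> (forall z, (0 <= F z)%E) -> 0 < s ->
  area (fun z => F (s%:C * z)) = ((s ^- 2)%:E * area F)%E.
Proof.
move=> mF F0 s0; rewrite /area -(plane_scale s0 mF (fun p => F0 _)); apply: eq_integral => p _ /=.
by congr F; apply/eqP; rewrite eq_complex /= !mul0r subr0 addr0 !eqxx.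
Qed.

Definition cmeasurable (G : Pt -> R[i]) :=
  measurable_fun setT (fun p => Re (G p)) /\ measurable_fun setT (fun p => Im (G p)).

Lemma cmeasurable_cst z : cmeasurable (fun=> z).
Proof. by split. Qed.

Lemma cmeasurableD G1 G2 : cmeasurable G1 -> cmeasurable G2 -> cmeasurable (fun p => G1 p + G2 p).
Proof.
move=> [r1 i1] [r2 i2]; split.
  rewrite (_ : (fun p => _) = (fun p => Re (G1 p)) \+ (fun p => Re (G2 p))); first exact: measurable_funD.
  by apply/funext => p /=; case: (G1 p) (G2 p) => ? ? [].
rewrite (_ : (fun p => _) = (fun p => Im (G1 p)) \+ (fun p => Im (G2 p))); first exact: measurable_funD.
by apply/funext => p /=; case: (G1 p) (G2 p) => ? ? [].
Qed.

Lemma cmeasurableM G1 G2 : cmeasurable G1 -> cmeasurable G2 -> cmeasurable (fun p => G1 p * G2 p).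
Proof.
move=> [r1 i1] [r2 i2]; split.
  rewrite (_ : (fun p => _) = ((fun p => Re (G1 p)) \* (fun p => Re (G2 p))) \-
     ((fun p => Im (G1 p)) \* (fun p => Im (G2 p)))).
    by apply: measurable_funB; exact: measurable_funM.
  by apply/funext => p /=; case: (G1 p) (G2 p) => ? ? [].
rewrite (_ : (fun p => _) = ((fun p => Re (G1 p)) \* (fun p => Im (G2 p))) \+
   ((fun p => Im (G1 p)) \* (fun p => Re (G2 p)))).
  by apply: measurable_funD; exact: measurable_funM.
by apply/funext => p /=; case: (G1 p) (G2 p) => ? ? [].
Qed.

Lemma cmeasurable_id : cmeasurable (fun p => (p.1 +i* p.2)%C).
Proof. by split => /=; [exact: measurable_fst|exact: measurable_snd]. Qed.

Lemma cmeasurableX G n : cmeasurable G -> cmeasurable (fun p => G p ^+ n).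
Proof.
move=> mG; elim: n => [|n ih].
  by rewrite (_ : (fun p => _) = (fun=> 1)); [exact: cmeasurable_cst|apply/funext => p; rewrite expr0].
rewrite (_ : (fun p => _) = (fun p => G p * G p ^+ n)); first exact: cmeasurableM.
by apply/funext => p; rewrite exprS.
Qed.

Lemma cmeasurable_sum n (G : 'I_n -> Pt -> R[i]) : (forall i, cmeasurable (G i)) ->
  cmeasurable (fun p => \sum_i G i p).
Proof.
move=> mG; elim: (index_enum _) => [|i l ih].
  by rewrite (_ : (fun p => _) = (fun=> 0)); [exact: cmeasurable_cst|apply/funext => p; rewrite big_nil].
rewrite (_ : (fun p => _) = (fun p => G i p + \sum_(j <- l) G j p)); first exact: cmeasurableD.
by apply/funext => p; rewrite big_cons.
Qed.

Lemma measurable_sqr_normc G : cmeasurable G -> measurable_fun setT (fun p => normc (G p) ^+ 2).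
Proof.
move=> [r i]; rewrite (_ : (fun p => _) = (fun p => Re (G p) ^+ 2) \+ (fun p => Im (G p) ^+ 2)).
  by apply: measurable_funD; exact: measurable_funX.
by apply/funext => p; rewrite sqr_normcE.
Qed.

End PlaneIntegrals.

(** * Integrals over disks and their measurability *)

Section DiskIntegrals.
Variable R : realType.
Implicit Types (s a b u x K : R) (v f : R[i] -> R[i]) (z w : R[i]) (rho r : R) (n m M j : nat).
Local Notation mu := (@lebesgue_measure R).
Local Notation Pt := (measurableTypeR R * measurableTypeR R)%type.
Implicit Types (F G : R[i] -> \bar R) (phi psi : R[i] -> R).

(** Extension by zero, so that all integrals run over the whole plane and substitutions do not
    change the domain. *)
Definition on_disk rho phi z : \bar R := (if normc z < rho then phi z else 0)%:E.

Definition real_measurable phi := measurable_fun setT (fun p : Pt => phi (p.1 +i* p.2)%C).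

Lemma area_le F G : plane_measurable F -> plane_measurable G -> (forall z, (0 <= F z)%E) ->
  (forall z, (F z <= G z)%E) -> (area F <= area G)%E.
Proof. by move=> mF mG F0 FG; apply: ge0_le_integral. Qed.

Lemma areaD F G : plane_measurable F -> plane_measurable G -> (forall z, (0 <= F z)%E) ->
  (forall z, (0 <= G z)%E) -> area (fun z => F z + G z)%E = (area F + area G)%E.
Proof. by move=> mF mG F0 G0; rewrite /area ge0_integralD. Qed.

Lemma areaZ F x : plane_measurable F -> (forall z, (0 <= F z)%E) -> 0 <= x ->
  area (fun z => x%:E * F z)%E = (x%:E * area F)%E.
Proof. by move=> mF F0 x0; rewrite /area ge0_integralZl_EFin. Qed.

Lemma eq_area F G : (forall z, F z = G z) -> area F = area G.
Proof. by move=> FG; congr area; apply/funext. Qed.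

Lemma measurable_normc_lt rho : measurable_fun setT (fun p : Pt => normc (p.1 +i* p.2)%C < rho).
Proof.
have [r0|r0] := leP 0 rho; last first.
  rewrite (_ : (fun p => _) = (fun=> false)) //; apply/funext => p; apply/negbTE.
  by rewrite -leNgt (le_trans (ltW r0))// normc_ge0.
rewrite (_ : (fun p => _) = (fun p : Pt => normc (p.1 +i* p.2)%C ^+ 2 < rho ^+ 2)).
  apply: measurable_fun_ltr; last exact: measurable_cst.
  by apply: measurable_sqr_normc; exact: cmeasurable_id.
by apply/funext => p; rewrite ltr_pXn2r ?nnegrE ?normc_ge0.
Qed.

Lemma measurable_on_disk rho phi : real_measurable phi -> plane_measurable (on_disk rho phi).
Proof.
move=> mphi; apply/measurable_EFinP; apply: measurable_fun_ifT => //.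
exact: measurable_normc_lt.
Qed.

Lemma on_disk_ge0 rho phi z : (forall z, normc z < rho -> 0 <= phi z) -> (0 <= on_disk rho phi z)%E.
Proof. by move=> h; rewrite /on_disk lee_fin; case: ifP => // /h. Qed.

Lemma real_measurable_pow n : real_measurable (fun z => normc z ^+ n.*2).
Proof.
rewrite /real_measurable (_ : (fun p => _) = (fun p : Pt => (normc (p.1 +i* p.2)%C ^+ 2) ^+ n)).
  by apply: measurable_funX; apply: measurable_sqr_normc; exact: cmeasurable_id.
by apply/funext => p; rewrite -exprM -muln2 mulnC.
Qed.

Lemma taylor_cvg v z : holo v -> normc z < 1 ->
  normc (taylor v M z) ^+ 2 @[M --> \oo] --> normc (v z) ^+ 2.
Proof.
move=> hv z1; pose r := (normc z + 1) / 2.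
have z0 := normc_ge0 z.
have r0 : 0 < r by rewrite /r; lra.
have r1 : r < 1 by rewrite /r; lra.
have zr : normc z <= r by rewrite /r; lra.
have [d hd hdv] := taylor_uniform hv r0 r1.
have L : climit (fun M => taylor v M z) (v z).
  by apply: (@climit_squeeze R _ _ d) => // M; rewrite normcC; exact: (hdv M z zr).
have h := climit_normc L; rewrite expr2.
rewrite (_ : (fun M => _) = (fun M => normc (taylor v M z) * normc (taylor v M z))); first exact: cvgM.
by apply/funext => M; rewrite expr2.
Qed.

(** The squared modulus is a pointwise limit of those of the Taylor polynomials, which are
    polynomial in the two real coordinates. *)
Lemma measurable_holo rho v : holo v -> rho <= 1 ->
  plane_measurable (on_disk rho (fun z => normc (v z) ^+ 2)).
Proof.
move=> hv r1; apply/measurable_EFinP.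
pose h M (p : Pt) := if normc (p.1 +i* p.2)%C < rho then normc (taylor v M (p.1 +i* p.2)%C) ^+ 2 else 0.
apply: (@measurable_fun_cvg _ _ _ _ h).
  move=> M; apply: measurable_fun_ifT => //; first exact: measurable_normc_lt.
  apply: measurable_sqr_normc; apply: cmeasurable_sum => i; apply: cmeasurableM.
    exact: cmeasurable_cst.
  by apply: cmeasurableX; exact: cmeasurable_id.
move=> p _; rewrite /h; case: ifP => hp; last exact: cvg_cst.
by apply: taylor_cvg => //; exact: lt_le_trans hp r1.
Qed.

Definition disk_moment n : \bar R := area (on_disk 1 (fun z => normc z ^+ n.*2)).

Lemma pow_ge0 n z : 0 <= normc z ^+ n.*2.
Proof. by rewrite exprn_ge0 ?normc_ge0. Qed.

Lemma disk_moment_fin n : exists2 x, 0 <= x & disk_moment n = x%:E.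
Proof.
pose I : set R := `[-1, 1]%classic.
pose S : set Pt := I `*` I.
have mI : measurable (I : set (measurableTypeR R)) by exact: measurable_itv.
have mS : measurable S by exact: measurableX.
have lS : (mu \x mu)%E S = 4%:E.
  have lI : mu I = 2%:E.
    rewrite /I lebesgue_measure_itv/= lte_fin (_ : (-1 < 1) = true); last by lra.
    by rewrite -EFinB opprK.
  transitivity (mu I * mu I)%E; first exact: (product_measure1E mu mu mI mI).
  by rewrite lI -EFinM; congr (_%:E); ring.
have le4 : (disk_moment n <= 4%:E)%E.
  rewrite -lS -[S]setIT -integral_indic//; apply: ge0_le_integral => //.
  - by move=> p _; apply: on_disk_ge0 => z _; exact: pow_ge0.
  - by apply: measurable_on_disk; exact: real_measurable_pow.
  - by apply/measurable_EFinP; exact: measurable_indic.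
  move=> p _; rewrite lee_fin; case: ifPn => [p1|]; last by rewrite indicE.
  rewrite indicE mem_set ?exprn_ile1 ?normc_ge0 ?(ltW p1)//=.
  have hr := le_trans (normr_Re_le (p.1 +i* p.2)%C) (ltW p1).
  have hi := le_trans (normr_Im_le (p.1 +i* p.2)%C) (ltW p1).
  by move: hr hi; rewrite /S /I /= !in_itv/= !ler_norml.
have ge0 : (0 <= disk_moment n)%E.
  by apply: integral_ge0 => p _; apply: on_disk_ge0 => z _; exact: pow_ge0.
move: le4 ge0; case: (disk_moment n) => [x|//|//] _; rewrite lee_fin => x0.
by exists x.
Qed.

Lemma area_pow rho n : 0 < rho ->
  area (on_disk rho (fun z => normc z ^+ n.*2)) = ((rho ^+ n.+1.*2)%:E * disk_moment n)%E.
Proof.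
move=> r0; set P := (fun z => normc z ^+ n.*2); have rV : 0 < rho^-1 by rewrite invr_gt0.
have mF := measurable_on_disk 1 (real_measurable_pow n).
have F0 z : (0 <= on_disk 1 P z)%E by apply: on_disk_ge0 => w _; exact: pow_ge0.
have E z : on_disk rho P z = ((rho ^+ n.*2)%:E * on_disk 1 P ((rho^-1)%:C * z)%R)%E.
  rewrite /on_disk /P normcM (normc_pos (ltW rV)) mulrC ltr_pdivrMr// mul1r.
  case: ifP => _; last by rewrite mule0.
  by rewrite -EFinM exprMn mulrCA -exprMn divff ?gt_eqF// expr1n mulr1.
rewrite (eq_area E) areaZ.
- rewrite area_scale// muleA -EFinM; congr (_%:E * _)%E.
  by rewrite exprVn invrK -exprD doubleS addn2.
- have mid : measurable_fun setT (fun p : Pt => ((rho^-1 * p.1)%R, (rho^-1 * p.2)%R) : Pt).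
    by apply: measurable_fun_pair; exact: measurable_funM.
  have := measurableT_comp mF mid; apply: eq_measurable_fun => p _ /=.
  by congr (on_disk _ _ _); apply/eqP; rewrite eq_complex /= !mul0r subr0 addr0 !eqxx.
- by move=> z; exact: F0.
by rewrite exprn_ge0// ltW.
Qed.

End DiskIntegrals.

(** * Exact moments of the disk and rotational averages *)

Section BergmanNorm.
Variable R : realType.
Implicit Types (s a b u x K : R) (v f : R[i] -> R[i]) (z w : R[i]) (rho r : R) (n m M j : nat).
Local Notation mu := (@lebesgue_measure R).
Local Notation Pt := (measurableTypeR R * measurableTypeR R)%type.
Implicit Types (F G : R[i] -> \bar R) (phi psi : R[i] -> R).

(** This is pi; it is carried as a symbolic factor common to both norms and is cancelled at the end
    by its positivity. *)
Definition disk_area : R := fine (disk_moment R 0).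

Lemma disk_areaE : disk_moment R 0 = disk_area%:E.
Proof. by rewrite /disk_area; have [x _ ->] := disk_moment_fin R 0. Qed.

Lemma disk_area_ge0 : 0 <= disk_area.
Proof. by have [x x0 E] := disk_moment_fin R 0; rewrite /disk_area E. Qed.

(* Obtained by comparing the unit disk with the disk of radius rho; the exact value of the
   moment follows by letting rho tend to 1. *)
Lemma disk_moment_bounds n a rho : disk_moment R n = a%:E -> 0 < rho -> rho < 1 ->
  rho ^+ n.*2 * disk_area <= a * \sum_(i < n.+1) (rho ^+ 2) ^+ i <= disk_area.
Proof.
move=> aE r0 r1; set b := disk_area.
pose P k : R[i] -> R := fun z => normc z ^+ k.*2.
have mP k s : plane_measurable (on_disk s (P k)).
  by apply: measurable_on_disk; exact: real_measurable_pow.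
have P0 k s z : (0 <= on_disk s (P k) z)%E by apply: on_disk_ge0 => y _; exact: pow_ge0.
have aP k s : 0 < s -> area (on_disk s (P k)) = ((s ^+ k.+1.*2)%:E * disk_moment R k)%E.
  by move=> s0; exact: area_pow.
have a1 : area (on_disk 1 (P n)) = a%:E by rewrite aP// expr1n mul1e.
have b1 : area (on_disk 1 (P 0%N)) = b%:E by rewrite aP// expr1n mul1e disk_areaE.
have ar : area (on_disk rho (P n)) = (rho ^+ n.+1.*2 * a)%:E by rewrite aP// aE.
have br : area (on_disk rho (P 0%N)) = (rho ^+ 2 * b)%:E by rewrite aP// disk_areaE.
have rle (z : R[i]) : normc z < rho -> normc z < 1 by move=> h; exact: lt_trans r1.
have le1 (z : R[i]) : normc z < 1 -> P n z <= 1 by move=> h; rewrite exprn_ile1 ?normc_ge0 ?(ltW h).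
have cst z : P 0%N z = 1 by rewrite /P expr0.
have c0 : 0 <= rho ^+ n.*2 by rewrite exprn_ge0 ?(ltW r0).
have mZ s : plane_measurable (fun z => (rho ^+ n.*2)%:E * on_disk s (P 0%N) z)%E.
  by apply: emeasurable_funM => //; exact: mP.
have Z0 s z : (0 <= (rho ^+ n.*2)%:E * on_disk s (P 0%N) z)%E by rewrite mule_ge0.
(* On the ring [rho <= normc z < 1] the integrand lies between [rho ^+ n.*2] and 1. Both
   comparisons, here and in [h2], are written additively to avoid differences of extended reals. *)
have h1 : a + rho ^+ 2 * b <= rho ^+ n.+1.*2 * a + b.
  rewrite -lee_fin !EFinD -a1 -br -ar -b1 -!areaD//; apply: area_le.
  - by apply: emeasurable_funD; exact: mP.
  - by apply: emeasurable_funD; exact: mP.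
  - by move=> z; rewrite adde_ge0.
  move=> z; rewrite /on_disk !cst -!EFinD lee_fin.
  have [z1|z1] := ltP (normc z) 1; have [z2|z2] := ltP (normc z) rho => //.
  - by rewrite addr0 add0r le1.
  - by have := lt_trans z2 r1; rewrite ltNge z1.
have h2 : rho ^+ n.+1.*2 * a + rho ^+ n.*2 * b <= a + rho ^+ n.*2 * (rho ^+ 2 * b).
  rewrite -lee_fin !EFinD !(EFinM (rho ^+ n.*2)) -a1 -br -ar -b1.
  rewrite -!(areaZ (mP _ _) (P0 _ _) c0) -!areaD//; apply: area_le.
  - by apply: emeasurable_funD; [exact: mP|exact: mZ].
  - by apply: emeasurable_funD; [exact: mP|exact: mZ].
  - by move=> z; rewrite adde_ge0.
  move=> z; rewrite /on_disk !cst -!EFinM -!EFinD lee_fin.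
  have [z1|z1] := ltP (normc z) 1; have [z2|z2] := ltP (normc z) rho => //.
  - by rewrite mulr0 mulr1 addr0 add0r /P lerXn2r ?nnegrE ?normc_ge0 ?(ltW r0).
  - by have := lt_trans z2 r1; rewrite ltNge z1.
have u1 : 0 < 1 - rho ^+ 2 by rewrite subr_gt0 exprn_ilt1// ltW.
have S : 1 - rho ^+ n.+1.*2 = (1 - rho ^+ 2) * \sum_(i < n.+1) (rho ^+ 2) ^+ i.
  by have := subrX1 (rho ^+ 2) n.+1; rewrite -exprM mul2n; move: (\sum_(i < _) _) => t; lra.
have key : (1 - rho ^+ 2) * (a * \sum_(i < n.+1) (rho ^+ 2) ^+ i) = a * (1 - rho ^+ n.+1.*2).
  by rewrite S; ring.
apply/andP; split; rewrite -(ler_pM2l u1) key; move: h1 h2; clear;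
by move: (rho ^+ n.+1.*2) (rho ^+ n.*2) (rho ^+ 2) => x y u; lra.
Qed.

Definition radius m : R := 1 - m.+2%:R^-1.

Lemma radius_gt0 m : 0 < radius m.
Proof. by rewrite subr_gt0 invf_lt1// ltr1n. Qed.

Lemma radius_lt1 m : radius m < 1.
Proof. by rewrite gtrBl invr_gt0. Qed.

Lemma radius_cvg : radius @ \oo --> (1 : R).
Proof.
rewrite -[X in _ --> X]subr0; apply: cvgB; first exact: cvg_cst.
by have := @cvg_harmonic R; rewrite -(cvg_shiftS (fun n => n.+1%:R^-1 : R)); exact.
Qed.

Lemma radius_cvgX k : radius m ^+ k @[m --> \oo] --> (1 : R).
Proof.
elim: k => [|k ih].
  by rewrite (_ : (fun m => _) = (fun=> 1)); [exact: cvg_cst|apply/funext => m; rewrite expr0].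
rewrite (_ : (fun m => _) = (fun m => radius m * radius m ^+ k)); last by apply/funext => m; rewrite exprS.
by rewrite -[X in _ --> X]mulr1; apply: cvgM => //; exact: radius_cvg.
Qed.

Lemma disk_momentE n : disk_moment R n = (disk_area / n.+1%:R)%:E.
Proof.
have [a a0 aE] := disk_moment_fin R n; rewrite aE; congr (_%:E).
have hX := radius_cvgX; have r0 := radius_gt0; have r1 := radius_lt1.
have hS k : \sum_(i < k) (radius m ^+ 2) ^+ i @[m --> \oo] --> (k%:R : R).
  elim: k => [|k ih].
    by rewrite (_ : (fun m => _) = (fun=> 0)); [exact: cvg_cst|apply/funext => m; rewrite big_ord0].
  rewrite (_ : (fun m => _) = (fun m => \sum_(i < k) (radius m ^+ 2) ^+ i + radius m ^+ (2 * k))).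
    by rewrite -natr1; apply: cvgD.
  by apply/funext => m; rewrite big_ord_recr /= exprM.
have hSa : a * \sum_(i < n.+1) (radius m ^+ 2) ^+ i @[m --> \oo] --> a * n.+1%:R.
  by apply: cvgM => //; exact: cvg_cst.
have hl : radius m ^+ n.*2 * disk_area @[m --> \oo] --> disk_area.
  by rewrite -[X in _ --> X]mul1r; apply: cvgM => //; exact: cvg_cst.
have E : a * n.+1%:R = disk_area.
  apply/le_anti/andP; split.
    apply: (cvgr_to_le hSa); apply: nearW => m.
    by have /andP[] := disk_moment_bounds aE (r0 m) (r1 m).
  apply: (ler_cvg_to hl hSa); apply: nearW => m.
  by have /andP[] := disk_moment_bounds aE (r0 m) (r1 m).
by rewrite -E mulfK ?pnatr_eq0.
Qed.

Lemma plane_measurableM F w : plane_measurable F -> plane_measurable (fun z => F (w * z)).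
Proof.
move=> mF.
have mid : measurable_fun setT (fun p : Pt =>
    ((Re w * p.1 - Im w * p.2)%R, (Re w * p.2 + Im w * p.1)%R) : Pt).
  by apply: measurable_fun_pair; [apply: measurable_funB|apply: measurable_funD]; apply: measurable_funM.
have := measurableT_comp mF mid; apply: eq_measurable_fun => p _ /=.
by case: w {mid} => a b.
Qed.

Lemma area_sum n (F : 'I_n -> R[i] -> \bar R) : (forall i, plane_measurable (F i)) ->
  (forall i z, (0 <= F i z)%E) ->
  area (fun z => \sum_i F i z)%E = (\sum_i area (F i))%E.
Proof. by move=> mF F0; rewrite /area ge0_integral_sum. Qed.

(** By orthogonality this is the mean of the squared modulus of [taylor v M] over the rotations of
    [z] by [M]-th roots of unity. *)
Definition disk_poly v M z : R := \sum_(n < M) normc (coef v n) ^+ 2 * normc z ^+ n.*2.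

Definition disk_mass v rho M : R := \sum_(n < M) normc (coef v n) ^+ 2 * rho ^+ n.+1.*2 / n.+1%:R.

Lemma real_measurable_disk_poly v M : real_measurable (disk_poly v M).
Proof.
apply: measurable_sum => i; apply: measurable_funM => //; exact: real_measurable_pow.
Qed.

Lemma disk_poly_ge0 v M z : 0 <= disk_poly v M z.
Proof. by apply: sumr_ge0 => i _; rewrite mulr_ge0 ?pow_ge0// exprn_ge0 ?normc_ge0. Qed.

Lemma area_disk_poly v M rho : 0 < rho ->
  area (on_disk rho (disk_poly v M)) = (disk_area * disk_mass v rho M)%:E.
Proof.
move=> r0; have c0 n : 0 <= normc (coef v n) ^+ 2 by rewrite exprn_ge0 ?normc_ge0.
pose P n : R[i] -> R := fun z => normc z ^+ n.*2.
have mP n : plane_measurable (on_disk rho (P n)).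
  by apply: measurable_on_disk; exact: real_measurable_pow.
have P0 n z : (0 <= on_disk rho (P n) z)%E by apply: on_disk_ge0 => y _; exact: pow_ge0.
pose F (i : 'I_M) z := ((normc (coef v i) ^+ 2)%:E * on_disk rho (P i) z)%E.
have E z : on_disk rho (disk_poly v M) z = (\sum_i F i z)%E.
  rewrite /F /on_disk; case: ifP => _; last by rewrite big1// => i _; rewrite mule0.
  by rewrite /disk_poly sumEFin.
rewrite (eq_area E) area_sum; last 2 first.
- by move=> i; apply: emeasurable_funM => //; exact: mP.
- by move=> i z; apply: mule_ge0; [rewrite lee_fin|exact: P0].
rewrite /disk_mass mulr_sumr -sumEFin; apply: eq_bigr => i _.
rewrite /F areaZ// area_pow// disk_momentE -!EFinM; congr (_%:E); ring.
Qed.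

(** Rotation invariance takes the place of polar coordinates: the integrand may be replaced by its
    mean over [M] rotations without changing the integral. *)
Lemma disk_average v rho M : holo v -> rho < 1 -> (0 < M)%N ->
  area (on_disk rho (fun z => normc (v z) ^+ 2)) =
  area (on_disk rho (fun z => ravg M 1 (fun w => normc (v (w * z)) ^+ 2))) /\
  plane_measurable (on_disk rho (fun z => ravg M 1 (fun w => normc (v (w * z)) ^+ 2))).
Proof.
move=> hv r1 M0; pose F := on_disk rho (fun z => normc (v z) ^+ 2).
have mF : plane_measurable F by apply: measurable_holo => //; exact: ltW.
have F0 z : (0 <= F z)%E by apply: on_disk_ge0 => y _; rewrite exprn_ge0 ?normc_ge0.
pose G (i : 'I_M) z := F (circle_pt M 1 i * z).
have mG i : plane_measurable (G i) by exact: plane_measurableM.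
have Mi : 0 <= M%:R^-1 :> R by rewrite invr_ge0.
have E z : on_disk rho (fun z => ravg M 1 (fun w => normc (v (w * z)) ^+ 2)) z =
    ((M%:R^-1)%:E * \sum_i G i z)%E.
  rewrite /G /F /on_disk.
  have nz (i : 'I_M) : normc (circle_pt M 1 i * z) = normc z.
    by rewrite normcM normc_circle_pt// mul1r.
  under eq_bigr do rewrite nz.
  case: ifP => _; last by rewrite big1 ?mule0.
  by rewrite /ravg sumEFin -EFinM.
have mS : plane_measurable (fun z => \sum_i G i z)%E by apply: emeasurable_sum => i; exact: mG.
have -> : on_disk rho (fun z => ravg M 1 (fun w => normc (v (w * z)) ^+ 2)) =
   (fun z => (M%:R^-1)%:E * \sum_i G i z)%E by apply/funext => z; exact: E.
split; last exact: measurable_funeM.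
rewrite areaZ//; last by move=> z; apply: sume_ge0 => i _; exact: F0.
rewrite area_sum//; last by move=> i z; exact: F0.
rewrite (eq_bigr (fun=> area F)) => [|i _]; last by apply: area_rotation; rewrite ?normc_circle_pt.
have cst k : (\sum_(i < k) area F)%E = (k%:R%:E * area F)%E.
  elim: k => [|k ih]; first by rewrite big_ord0 mul0e.
  by rewrite big_ord_recr /= ih -natr1 EFinD ge0_muleDl ?lee_fin// mul1e.
by rewrite cst muleA -EFinM mulVf ?mul1e// pnatr_eq0 -lt0n.
Qed.

End BergmanNorm.

(** * The Bergman norm as a sum over coefficients *)

Section BergmanNormBounds.
Variable R : realType.
Implicit Types (s a b u x K : R) (v f : R[i] -> R[i]) (z w : R[i]) (rho r : R) (n m M j : nat).
Local Notation mu := (@lebesgue_measure R).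
Local Notation Pt := (measurableTypeR R * measurableTypeR R)%type.
Local Notation i0 := (disk_area R).

(** The rotational mean of the Taylor polynomial is exactly [disk_poly], so only the uniform Taylor
    error enters. *)
Lemma average_close v rho : holo v -> 0 < rho -> rho < 1 ->
  exists d : nat -> R, [/\ d @ \oo --> (0 : R), forall M, 0 <= d M &
    forall M z, normc z < rho ->
      `|ravg M 1 (fun w => normc (v (w * z)) ^+ 2) - disk_poly v M z| <= d M].
Proof.
move=> hv r0 r1; have [d hd hdv] := taylor_uniform hv r0 r1.
have d0 M : 0 <= d M by have := hdv M 0; rewrite normc0 (ltW r0) => /(_ isT); exact/le_trans/normc_ge0.
(* The Taylor polynomial of length 0 is zero, so [d 0%N] bounds [v] itself on the disk. *)
exists (fun M => d M * (2 * d 0%N + d M)); split.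
- rewrite -[X in _ --> X](mul0r (2 * d 0%N + 0)); apply: cvgM => //.
  by apply: cvgD => //; exact: cvg_cst.
- by move=> M; rewrite mulr_ge0 ?addr_ge0 ?mulr_ge0.
move=> M z zr.
have polyE : disk_poly v M z = ravg M 1 (fun w => normc (taylor v M (w * z)) ^+ 2).
  apply: complexI; rewrite ravgC.
  have -> : (fun w => (normc (taylor v M (w * z)) ^+ 2)%:C) =
     (fun w => (\sum_(n < M) (coef v n * z ^+ n) * w ^+ n) * (\sum_(n < M) (coef v n * z ^+ n) * w ^+ n)^*).
    apply/funext => w; rewrite sqr_normc_conj.
    have -> : taylor v M (w * z) = \sum_(n < M) (coef v n * z ^+ n) * w ^+ n.
      by apply: eq_bigr => n _; rewrite exprMn; ring.
    by [].
  rewrite (avgc_polynomial (fun n => coef v n * z ^+ n) (fun n => coef v n * z ^+ n) M ler01).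
  rewrite /disk_poly rmorph_sum; apply: eq_bigr => n _.
  by rewrite expr1n rmorph1 mulr1 -sqr_normc_conj (normcM (coef v n)) normcX exprMn -exprM muln2.
have close w : normc w = 1 -> `|normc (v (w * z)) ^+ 2 - normc (taylor v M (w * z)) ^+ 2| <= d M * (2 * d 0%N + d M).
  move=> w1; have wz : normc (w * z) <= rho by rewrite normcM w1 mul1r ltW.
  have h1 := hdv M _ wz; have := hdv 0%N _ wz; rewrite /taylor big_ord0 subr0 => h2.
  rewrite subr_sqr normrM.
  have b1 := le_normc_sub (v (w * z)) (taylor v M (w * z)).
  have b2 := le_normc_sub (taylor v M (w * z)) (v (w * z)).
  rewrite normcC in b2.
  apply: ler_pM => //; first by rewrite ler_norml; move: b1 b2 h1; clear; lra.
  rewrite ger0_norm ?addr_ge0 ?normc_ge0//; move: b1 b2 h1 h2; clear.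
  by rewrite /taylor; lra.
rewrite polyE -ravgB ler_norml.
have D0 : 0 <= d M * (2 * d 0%N + d M) by rewrite mulr_ge0 ?addr_ge0 ?mulr_ge0.
apply/andP; split.
  rewrite lerNl -[X in X <= _]mulN1r -ravgZ; apply: le_trans (ravg_cst_le M 1 D0).
  by apply: ravg_le => // w w1; have := close w w1; rewrite ler_norml; lra.
apply: le_trans (ravg_cst_le M 1 D0).
by apply: ravg_le => // w w1; have := close w w1; rewrite ler_norml => /andP[].
Qed.

Lemma disk_area_bounds v rho : holo v -> 0 < rho -> rho < 1 ->
  exists d : nat -> R, d @ \oo --> (0 : R) /\ forall M, (0 < M)%N ->
    (area (on_disk rho (fun z => (normc (v z) ^+ 2)%R)) <= (i0 * (disk_mass v rho M + d M))%:E)%E /\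
    ((i0 * (disk_mass v rho M - d M))%:E <= area (on_disk rho (fun z => (normc (v z) ^+ 2)%R)))%E.
Proof.
move=> hv r0 r1; have [d [hd d0 hdv]] := average_close hv r0 r1.
exists (fun M => rho ^+ 2 * d M); split.
  by rewrite -[X in _ --> X](mulr0 (rho ^+ 2)); apply: cvgM => //; exact: cvg_cst.
move=> M M0; have [-> mA] := disk_average hv r1 M0.
pose A z := ravg M 1 (fun w => normc (v (w * z)) ^+ 2).
have A0 z : 0 <= A z by apply: ravg_ge0 => // w _; rewrite exprn_ge0 ?normc_ge0.
have mP : plane_measurable (on_disk rho (disk_poly v M)).
  by apply: measurable_on_disk; exact: real_measurable_disk_poly.
have P0 z : (0 <= on_disk rho (disk_poly v M) z)%E by apply: on_disk_ge0 => y _; exact: disk_poly_ge0.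
pose E := fun z => ((d M)%:E * on_disk rho (fun z => (normc z ^+ 0.*2)%R) z)%E.
have mO : plane_measurable (on_disk rho (fun z => normc z ^+ 0.*2)).
  by apply: measurable_on_disk; exact: real_measurable_pow.
have O0 z : (0 <= on_disk rho (fun z => (normc z ^+ 0.*2)%R) z)%E by apply: on_disk_ge0 => y _; exact: pow_ge0.
have mE : plane_measurable E by exact: measurable_funeM.
have E0 z : (0 <= E z)%E by apply: mule_ge0; [rewrite lee_fin; exact: d0|exact: O0].
have aE : area E = (i0 * (rho ^+ 2 * d M))%:E.
  by rewrite areaZ// area_pow// disk_areaE -!EFinM; congr (_%:E); rewrite doubleS; ring.
have aP := area_disk_poly v M r0.
have pA z : (0 <= on_disk rho A z)%E by apply: on_disk_ge0.
split.
  rewrite mulrDr EFinD -aE -aP -areaD//; apply: area_le => //.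
    by apply: emeasurable_funD.
  move=> z; rewrite /E /on_disk -EFinM -EFinD lee_fin; case: ifPn => [zr|_]; last by rewrite mulr0 addr0.
  by have := hdv M z zr; rewrite ler_norml /A expr0; lra.
have : (area (on_disk rho (disk_poly v M)) <= area (on_disk rho A) + area E)%E.
  rewrite -areaD//; apply: area_le => //; first by apply: emeasurable_funD.
  move=> z; rewrite /E /on_disk -EFinM -EFinD lee_fin; case: ifPn => [zr|_]; last by rewrite mulr0 addr0.
  by have := hdv M z zr; rewrite ler_norml /A expr0; lra.
rewrite aE aP -/A; case: (area (on_disk rho A)) => [x||]; rewrite ?leey ?leNye//.
  by rewrite -EFinD !lee_fin mulrBr lerBlDr.
Qed.

Definition bergman_mass v M : R := \sum_(n < M) normc (coef v n) ^+ 2 / n.+1%:R.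

Lemma disk_mass_cvg v M : disk_mass v (radius R m) M @[m --> \oo] --> bergman_mass v M.
Proof.
rewrite /bergman_mass /disk_mass; elim: M => [|M ih].
  rewrite big_ord0 (_ : (fun m => _) = (fun=> 0)); first exact: cvg_cst.
  by apply/funext => m; rewrite big_ord0.
rewrite big_ord_recr /= (_ : (fun m => _) = (fun m => disk_mass v (radius R m) M +
   normc (coef v M) ^+ 2 * radius R m ^+ M.+1.*2 / M.+1%:R)); last first.
  by apply/funext => m; rewrite /disk_mass big_ord_recr.
apply: cvgD => //; apply: cvgM; last exact: cvg_cst.
rewrite -[X in _ --> X]mulr1; apply: cvgM; first exact: cvg_cst.
exact: radius_cvgX.
Qed.

Lemma disk_mass_le v rho M L : 0 < rho -> (M <= L)%N -> disk_mass v rho M <= disk_mass v rho L.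
Proof.
move=> r0 ML; rewrite -(subnKC ML); elim: (L - M)%N => [|k ih]; first by rewrite addn0.
rewrite addnS (le_trans ih)// /disk_mass big_ord_recr /= lerDl.
by rewrite divr_ge0// mulr_ge0// exprn_ge0 ?normc_ge0 ?(ltW r0).
Qed.

Lemma disk_mass_le_bergman v rho M : 0 < rho -> rho < 1 -> disk_mass v rho M <= bergman_mass v M.
Proof.
move=> r0 r1; apply: ler_sum => n _; rewrite ler_wpM2r ?invr_ge0// ler_piMr ?exprn_ge0 ?normc_ge0//.
by rewrite exprn_ile1 ?(ltW r0) ?(ltW r1).
Qed.

(** Monotonicity of [disk_mass] keeps [M] fixed while the error at a larger length [L] tends to 0;
    only then does the radius tend to 1. *)
Lemma bergman_ge v M : holo v ->
  ((i0 * bergman_mass v M)%:E <= area (on_disk 1 (fun z => (normc (v z) ^+ 2)%R)))%E.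
Proof.
move=> hv; set J := area _.
have step m : ((i0 * disk_mass v (radius R m) M)%:E <= J)%E.
  have r0 := radius_gt0 R m; have r1 := radius_lt1 R m; set rho := radius R m in r0 r1 *.
  apply: (@le_trans _ _ (area (on_disk rho (fun z => (normc (v z) ^+ 2)%R)))); last first.
    apply: area_le; [exact: measurable_holo hv (ltW r1)|exact: measurable_holo| |] => z.
      by apply: on_disk_ge0 => y _; rewrite exprn_ge0 ?normc_ge0.
    rewrite /on_disk lee_fin; case: ifPn => [h|_]; first by rewrite (lt_trans h r1).
    by case: ifP => _ //; rewrite exprn_ge0 ?normc_ge0.
  have [d [hd hb]] := disk_area_bounds hv r0 r1.
  have low L : (maxn M 1 <= L)%N -> ((i0 * (disk_mass v rho M - d L))%:E <=
      area (on_disk rho (fun z => (normc (v z) ^+ 2)%R)))%E.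
    rewrite geq_max => /andP[ML L0]; have [_ h] := hb L L0; apply: le_trans h.
    by rewrite lee_fin ler_wpM2l ?disk_area_ge0// lerD2r disk_mass_le.
  move: low; case: (area _) => [x||] low; rewrite ?leey//; last by have := low _ (leqnn _).
  rewrite lee_fin.
  have L : i0 * (disk_mass v rho M - d L) @[L --> \oo] --> i0 * disk_mass v rho M.
    apply: cvgM; first exact: cvg_cst.
    by rewrite -[X in _ --> X]subr0; apply: cvgB => //; exact: cvg_cst.
  by apply: (cvgr_to_le L); exists (maxn M 1) => // k /= /low; rewrite lee_fin.
move: step; case: J => [x||] step; rewrite ?leey//; last by have := step 0%N.
rewrite lee_fin.
have L : i0 * disk_mass v (radius R m) M @[m --> \oo] --> i0 * bergman_mass v M.
  by apply: cvgM; [exact: cvg_cst|exact: disk_mass_cvg].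
by apply: (cvgr_to_le L); apply: nearW => m; have := step m; rewrite lee_fin.
Qed.

(** The bound holds on each disk of radius [radius m]; these disks exhaust the unit disk, and
    monotone convergence gives the bound there. *)
Lemma bergman_le v S : holo v -> (forall M, bergman_mass v M <= S) ->
  (area (on_disk 1 (fun z => (normc (v z) ^+ 2)%R)) <= (i0 * S)%:E)%E.
Proof.
move=> hv hS; pose phi z := normc (v z) ^+ 2.
have phi0 z : 0 <= phi z by rewrite exprn_ge0 ?normc_ge0.
have step m : (area (on_disk (radius R m) phi) <= (i0 * S)%:E)%E.
  have r0 := radius_gt0 R m; have r1 := radius_lt1 R m; set rho := radius R m in r0 r1 *.
  have [d [hd hb]] := disk_area_bounds hv r0 r1.
  have up L : (0 < L)%N -> (area (on_disk rho phi) <= (i0 * (S + d L))%:E)%E.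
    move=> L0; have [h _] := hb L L0; apply: (le_trans h).
    rewrite lee_fin ler_wpM2l ?disk_area_ge0// lerD2r.
    exact: le_trans (disk_mass_le_bergman v L r0 r1) (hS L).
  move: up; case: (area _) => [x||] up; rewrite ?leNye//; last by have := up _ (leqnn 1).
  rewrite lee_fin.
  have L : i0 * (S + d L) @[L --> \oo] --> i0 * S.
    apply: cvgM; first exact: cvg_cst.
    by rewrite -[X in _ --> X]addr0; apply: cvgD => //; exact: cvg_cst.
  by apply: (cvgr_to_ge L); exists 1%N => // k /= /up; rewrite lee_fin.
have mono m n : (m <= n)%N -> radius R m <= radius R n.
  by move=> mn; rewrite lerD2l lerN2 lef_pV2 ?posrE// ler_nat.
pose g m (p : Pt) := on_disk (radius R m) phi (p.1 +i* p.2)%C.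
have mg m : measurable_fun setT (g m) by exact: measurable_holo hv (ltW (radius_lt1 R m)).
have g0 m p : (0 <= g m p)%E by apply: on_disk_ge0.
have gm p : {homo g^~ p : n m / (n <= m)%N >-> (n <= m)%E}.
  move=> m n mn; rewrite /g /on_disk lee_fin; case: ifPn => [h|_]; first by rewrite (lt_le_trans h (mono _ _ mn)).
  by case: ifP => _.
have lim p : limn (g^~ p) = on_disk 1 phi (p.1 +i* p.2)%C.
  apply/cvg_lim => //; rewrite /g; set z := (_ +i* _)%C; rewrite /on_disk.
  have [z1|z1] := ltP (normc z) 1; last first.
    rewrite (_ : (fun _ => _) = (fun=> 0%:E)); first exact: cvg_cst.
    apply/funext => m; rewrite ltNge (le_trans (ltW (radius_lt1 R m)))//.
  have e0 : 0 < 1 - normc z by rewrite subr_gt0.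
  have := @radius_cvg R; move/cvgrPdist_lt => /(_ _ e0)[N _ hN].
  apply: cvg_near_cst; exists N => // m /hN /=.
  rewrite ger0_norm ?subr_ge0 ?(ltW (radius_lt1 R m))// => h.
  by rewrite (_ : normc z < radius R m)//; lra.
have -> : area (on_disk 1 phi) = (\int[mu \x mu]_p limn (g^~ p))%E.
  by apply: eq_integral => p _; rewrite lim.
rewrite monotone_convergence//.
apply: lime_le.
  apply: ereal_nondecreasing_is_cvgn => m n mn; apply: ge0_le_integral => //.
  by move=> p _; apply: gm.
exact: nearW.
Qed.

End BergmanNormBounds.

(** * Comparison of the moments *)

Section BetaMeasurable.
Variable R : realType.
Implicit Types (c r t : R) (N k : nat).
Local Notation T := (measurableTypeR R).
Implicit Types (D : set T) (u : T -> R).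

Lemma measurable_funV_gt0 D u : measurable D -> measurable_fun D u -> (forall t, D t -> 0 < u t) ->
  measurable_fun D (fun t => (u t)^-1).
Proof.
move=> mD mu u0; apply: (eq_measurable_fun (fun t => u t `^ (-1))).
  by move=> t; rewrite inE => /u0/ltW; exact: powR_inv1.
by apply: (@measurableT_comp _ _ _ _ _ _ (@powR R ^~ (-1)) D u).
Qed.

Lemma measurable_th D u q N : measurable_fun D u -> measurable_fun D (fun t => (u t)^-1) ->
  measurable_fun D (fun t => th q N (u t)).
Proof.
move=> mu mV.
have mthp : measurable_fun D (fun t => thp q N (u t)).
  elim: N => [|n ih].
    rewrite (_ : (fun t => _) = (fun=> 1)); first exact: measurable_cst.
    by apply/funext => t; rewrite /thp big_ord0.
  rewrite (_ : (fun t => _) = (fun t => thp q n (u t)) \*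
     ((fun t => 1 - q ^+ n.+1 * u t) \* (fun t => 1 - q ^+ n.+1 * (u t)^-1))); last first.
    by apply/funext => t; rewrite thpS.
  apply: measurable_funM => //; apply: measurable_funM; apply: measurable_funB => //;
  exact: measurable_funM.
by apply: measurable_funM => //; exact: measurable_funB.
Qed.

Lemma measurable_sqrt D : measurable_fun D (fun t => Num.sqrt t : R).
Proof.
apply: measurable_funTS; apply: continuous_measurable_fun; exact: sqrt_continuous.
Qed.

(** Measurability is read off the theta quotient instead of the product: [Kfun ^+ 2] is 1 minus the
    square of a pointwise limit of rational functions of [t], as the square root enters only through
    its square. *)
Lemma measurable_beta c : 0 < c -> measurable_fun setT (fun t : T => beta c (Num.sqrt t)).
Proof.
move=> c0.
pose b (t : T) := (c < Num.sqrt t) && (Num.sqrt t < 1).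
have mb : measurable_fun setT b.
  by apply: measurable_and; apply: measurable_fun_ltr => //; exact: measurable_sqrt.
pose D : set T := [set t | b t].
have mD : measurable D by have := mb measurableT [set true]; rewrite setTI; exact.
have DP t : D t -> [/\ 0 < t, c < Num.sqrt t, Num.sqrt t < 1 & Num.sqrt t ^+ 2 = t].
  move=> /andP[h1 h2]; have t0 : 0 < t by rewrite -sqrtr_gt0 (lt_trans c0).
  by split=> //; rewrite sqr_sqrtr// ltW.
apply: measurable_fun_if => //.
rewrite setTI (_ : _ @^-1` _ = D)//.
have mV : measurable_fun D (fun t : T => t^-1).
  by apply: measurable_funV_gt0 => // t /DP[].
have mNV : measurable_fun D (fun t : T => (- t)^-1).
  rewrite (_ : (fun t => _) = (fun t : T => - (t^-1))); first exact: measurable_funN.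
  by apply/funext => t; rewrite invrN.
pose tr N (t : T) := theta_ratio c (Num.sqrt t) N.
have mtr N : measurable_fun D (tr N).
  apply: (eq_measurable_fun (fun t => (th (c ^+ 2) N c * th (c ^+ 2) N t) *
     (th (c ^+ 2) N (- c) * th (c ^+ 2) N (- t))^-1)).
    by move=> t; rewrite inE => /DP[_ _ _ tE]; rewrite /tr /theta_ratio tE.
  apply: measurable_funM.
    by apply: measurable_funM => //; exact: measurable_th.
  apply: measurable_funV_gt0 => //.
    by apply: measurable_funM => //; apply: measurable_th => //; exact: measurable_funN.
  have q0 : 0 < c ^+ 2 by rewrite exprn_gt0.
  by move=> t /DP[t0 _ _ _]; rewrite mulr_gt0// (lt_le_trans ltr01)// thN_ge1.
pose X (t : T) := lim (theta_ratio c (Num.sqrt t) N @[N --> \oo]).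
have mX : measurable_fun D X.
  apply: (measurable_fun_cvg mtr) => t /DP[_ h1 h2 _]; exact: theta_ratio_cvg.
have mK : measurable_fun D (fun t : T => Kfun c (Num.sqrt t) ^+ 2).
  apply: (eq_measurable_fun (fun t => 1 - X t ^+ 2)).
    by move=> t; rewrite inE => /DP[_ h1 h2 _]; have [_ ->] := Kfun_sqr c0 h1 h2.
  by apply: measurable_funB => //; exact: measurable_funX.
have mG : measurable_fun D (fun t : T => Gfun c (Num.sqrt t)).
  apply: measurable_funM => //; apply: measurable_funD => //.
  apply: (@measurableT_comp _ _ _ _ _ _ (@Num.sqrt R) D); first exact: measurable_sqrt.
  apply: measurable_funM.
    by apply: measurable_funD => //; exact: measurable_funM.
  apply: measurable_funV_gt0 => //; first exact: measurable_funB.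
  by move=> t /DP[_ h1 h2 _]; have [_ h _ _] := Gfun_root c0 h1 h2; rewrite subr_gt0.
apply: measurable_funB => //; apply: measurable_funV_gt0 => //.
by move=> t /DP[_ h1 h2 _]; have [_ _ h _] := Gfun_root c0 h1 h2; exact: lt_le_trans h.
Qed.

End BetaMeasurable.

(** * Integration against the measure *)

Section MomentComparison.
Variable R : realType.

(** The pointwise inequality between negative and positive part is integrated. The lower moment
    bounds apply to the nonnegative [n k] and the upper ones to the nonnegative [p k]. The negative
    side is cut at [M] and the positive side is a monotone limit of partial sums [Ps L], so every
    integrand is nonnegative. *)
Lemma moment_comparison (c : R) (c_gt0 : 0 < c) (c_lt1 : c < 1)
  (mu : probability (measurableTypeR R) R)
  (mu_supp : mu `[c ^+ 2, 1]%classic = 1%:E)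
  (mu_1 : mu [set 1] = 0%:E)
  (mu_moment : forall k : nat,
     ((k.+1%:R^-1)%:E <= \int[mu]_(t in `[(c ^+ 2)%R, 1%R]) (t ^+ k)%:E)%E)
  (mu_beta_moment : forall k : nat, (1 <= k)%N ->
     (\int[mu]_(t in `[(c ^+ 2)%R, 1%R]) (beta c (Num.sqrt t) * t ^+ k)%:E
        <= (k.+1%:R^-1)%:E)%E)
  (f g : R[i] -> R[i]) (S : R) : holo f -> holo g ->
  (forall z, c < normc z < 1 -> normc (f z) <= normc (g z)) ->
  (forall L, \sum_(k < L) pos_part (coef_gap f g k) / k.+1%:R <= S) ->
  forall M, \sum_(k < M) pos_part (- coef_gap f g k) / k.+1%:R <= S.
Proof.
move=> hf hg fg hS M; pose D : set (measurableTypeR R) := `[c ^+ 2, 1]%classic.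
pose p k := pos_part (coef_gap f g k); pose n k := pos_part (- coef_gap f g k).
have p0 k : 0 <= p k by exact: pos_part_ge0.
have n0 k : 0 <= n k by exact: pos_part_ge0.
have mD : measurable D by exact: measurable_itv.
have D0 t : D t -> 0 <= t.
  by rewrite /D /= in_itv/= => /andP[h _]; apply: le_trans h; rewrite exprn_ge0 ?ltW.
pose b (t : R) := beta c (Num.sqrt t).
have b0 t : 0 <= b t by have /andP[] := beta_bounds (Num.sqrt t) c_gt0.
have b1 t : b t <= 1 by have /andP[] := beta_bounds (Num.sqrt t) c_gt0.
have mb : measurable_fun D (b : measurableTypeR R -> R).
  by apply: measurable_funTS; exact: measurable_beta.
have mt k : measurable_fun D (fun t : measurableTypeR R => (t : R) ^+ k).
  by apply: measurable_funX.
have mbt k : measurable_fun D (fun t : measurableTypeR R => (b t * t ^+ k)%:E).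
  by apply/measurable_EFinP; apply: measurable_funM.
have bt0 k t : D t -> (0 <= (b t * t ^+ k)%:E)%E.
  by move=> /D0 t0; rewrite lee_fin mulr_ge0// exprn_ge0.
(* The case [k = 0] is outside the hypothesis on [beta]; it follows from [beta <= 1] and total mass
   1. *)
have moment k : (\int[mu]_(t in D) (b t * t ^+ k)%:E <= (k.+1%:R^-1)%:E)%E.
  case: k => [|k]; last exact: mu_beta_moment.
  apply: (@le_trans _ _ (\int[mu]_(t in D) (cst 1%:E) t)%E).
    apply: ge0_le_integral => //; first by move=> t /bt0.
    by move=> t _; rewrite expr0 mulr1 lee_fin.
  by rewrite integral_cst// invr1 mul1e -mu_supp.
pose Ps L (t : measurableTypeR R) : \bar R := (\sum_(k < L) (p k)%:E * (b t * t ^+ k)%:E)%E.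
pose Ns (t : measurableTypeR R) : \bar R := (\sum_(k < M) (n k)%:E * (t ^+ k)%:E)%E.
have mPs L : measurable_fun D (Ps L).
  by apply: emeasurable_sum => k; exact: measurable_funeM.
have Ps0 L t : D t -> (0 <= Ps L t)%E.
  by move=> Dt; apply: sume_ge0 => k _; rewrite mule_ge0 ?lee_fin// -lee_fin; exact: bt0.
have mNs : measurable_fun D Ns.
  by apply: emeasurable_sum => k; apply: measurable_funeM; apply/measurable_EFinP.
have Ns0 t : D t -> (0 <= Ns t)%E.
  by move=> /D0 t0; apply: sume_ge0 => k _; rewrite mule_ge0 ?lee_fin// exprn_ge0.
have PsM t : D t -> {homo Ps^~ t : i j / (i <= j)%N >-> (i <= j)%E}.
  move=> Dt i j ij; rewrite -(subnKC ij); elim: (j - i)%N => [|l ih]; first by rewrite addn0.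
  rewrite addnS (le_trans ih)// /Ps big_ord_recr /= leeDl// mule_ge0 ?lee_fin// -lee_fin; exact: bt0.
have intP L : (\int[mu]_(t in D) Ps L t <= S%:E)%E.
  rewrite /Ps ge0_integral_sum//; last 2 first.
  - by move=> k; exact: measurable_funeM.
  - by move=> k t Dt; rewrite mule_ge0 ?lee_fin// -lee_fin; exact: bt0.
  apply: le_trans (_ : (\sum_(k < L) p k / k.+1%:R)%:E <= _)%E; last by rewrite lee_fin.
  rewrite -sumEFin; apply: lee_sum => k _.
  rewrite ge0_integralZl_EFin//; last exact: bt0.
  by rewrite (EFinM (p k)) lee_wpmul2l ?lee_fin.
have intN : ((\sum_(k < M) n k / k.+1%:R)%:E <= \int[mu]_(t in D) Ns t)%E.
  rewrite /Ns ge0_integral_sum//; last 2 first.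
  - by move=> k; apply: measurable_funeM; apply/measurable_EFinP.
  - by move=> k t /D0 t0; rewrite mule_ge0 ?lee_fin// exprn_ge0.
  rewrite -sumEFin; apply: lee_sum => k _.
  rewrite ge0_integralZl_EFin//; last 2 first.
  - by move=> t /D0 t0; rewrite lee_fin exprn_ge0.
  - exact/measurable_EFinP.
  by rewrite (EFinM (n k)) lee_wpmul2l ?lee_fin.
(* At [t = 1] the series of coefficients need not converge; this point is a null set by [mu_1], so
   an almost everywhere inequality results. *)
have point t : D t -> t <> 1 -> (Ns t <= limn (Ps^~ t))%E.
  move=> Dt t1; have t0 := D0 t Dt; pose r := Num.sqrt t.
  have r2 : r ^+ 2 = t by rewrite sqr_sqrtr.
  have cr : c <= r.
    by rewrite -(ler_pXn2r (n := 2)) ?nnegrE ?sqrtr_ge0 ?(ltW c_gt0)// r2; move: Dt; rewrite /D /= in_itv/= => /andP[].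
  have r1 : r < 1.
    rewrite -(ltr_pXn2r (n := 2)) ?nnegrE ?sqrtr_ge0// r2 expr1n lt_neqAle; apply/andP; split; first exact/eqP.
    by move: Dt; rewrite /D /= in_itv/= => /andP[].
  have [P [N [hP hN NP]]] := coef_beta c_gt0 cr r1 hf hg fg.
  have rt k : r ^+ k.*2 = t ^+ k by rewrite -r2 -exprM mul2n.
  have NsE : Ns t = (\sum_(k < M) n k * r ^+ k.*2)%:E.
    by rewrite /Ns -sumEFin; apply: eq_bigr => k _; rewrite rt EFinM.
  have PsE L : Ps L t = (b t * \sum_(k < L) p k * r ^+ k.*2)%:E.
    by rewrite /Ps mulr_sumr -sumEFin; apply: eq_bigr => k _; rewrite rt -EFinM; congr (_%:E); ring.
  have -> : limn (Ps^~ t) = (b t * P)%:E.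
    apply/cvg_lim => //; rewrite (_ : (fun L => _) = (fun L => (b t * \sum_(k < L) p k * r ^+ k.*2)%:E)).
      by apply: cvg_EFin; [exact: nearW|apply: cvgM => //; exact: cvg_cst].
    by apply/funext.
  rewrite NsE lee_fin; apply: le_trans NP.
  have ndn : nondecreasing_seq (fun m => \sum_(k < m) n k * r ^+ k.*2).
    by apply/nondecreasing_seqP => m; rewrite big_ord_recr lerDl mulr_ge0// exprn_ge0 ?sqrtr_ge0.
  rewrite -(cvg_lim _ hN)//; apply: (nondecreasing_cvgn_le ndn).
  by apply/cvg_ex; exists N.
rewrite -lee_fin; apply: (le_trans intN).
apply: (@le_trans _ _ (\int[mu]_(t in D) limn (Ps^~ t))%E).
  apply: ae_ge0_le_integral => //.
  - by move=> t Dt; apply: lime_ge; [apply: ereal_nondecreasing_is_cvgn; exact: PsM|apply: nearW => L; exact: Ps0].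
  - apply: (emeasurable_fun_cvg Ps) => // t Dt.
    by apply: ereal_nondecreasing_is_cvgn; exact: PsM.
  exists [set 1]; split=> // t /=.
  by apply: contra_notP => t1 Dt; exact: point.
rewrite monotone_convergence//; apply: lime_le.
  apply: ereal_nondecreasing_is_cvgn => i j ij; apply: ge0_le_integral => //.
  - by move=> t; exact: Ps0.
  - by move=> t Dt; exact: PsM.
exact: nearW.
Qed.

End MomentComparison.

(** * Comparison of the Bergman norms *)

Section Korenblum.
Variable R : realType.
Implicit Types (f g : R[i] -> R[i]) (z : R[i]) (M L n : nat).
Local Notation mu := (@lebesgue_measure R).
Local Notation Pt := (measurableTypeR R * measurableTypeR R)%type.

Lemma disk_area_gt0 : 0 < disk_area R.
Proof.
pose I : set R := `[0, 2^-1]%classic.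
pose S : set Pt := I `*` I.
have mI : measurable (I : set (measurableTypeR R)) by exact: measurable_itv.
have mS : measurable S by exact: measurableX.
have lS : (mu \x mu)%E S = (4^-1)%:E.
  have lI : mu I = (2^-1)%:E.
    by rewrite /I lebesgue_measure_itv/= lte_fin invr_gt0 ltr0n sube0.
  transitivity (mu I * mu I)%E; first exact: (product_measure1E mu mu mI mI).
  by rewrite lI -EFinM; congr (_%:E); rewrite -invfM; congr (_^-1); ring.
have le4 : ((4^-1)%:E <= disk_moment R 0)%E.
  rewrite -lS -[S]setIT -integral_indic//; apply: ge0_le_integral => //.
  - by apply/measurable_EFinP; exact: measurable_indic.
  - by apply: measurable_on_disk; exact: real_measurable_pow.
  move=> p _; rewrite lee_fin expr0 indicE.
  case: (boolP (p \in S)) => [|_]; last by case: ifP.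
  rewrite inE /S /I /= !in_itv/= => -[/andP[x0 x1] /andP[y0 y1]].
  have h : normc (p.1 +i* p.2)%C < 1.
    rewrite -(ltr_pXn2r (n := 2)) ?nnegrE ?normc_ge0// sqr_normcE/= expr1n.
    have e1 : p.1 ^+ 2 <= 2^-1 ^+ 2 by rewrite lerXn2r ?nnegrE ?invr_ge0.
    have e2 : p.2 ^+ 2 <= 2^-1 ^+ 2 by rewrite lerXn2r ?nnegrE ?invr_ge0.
    have e3 : (2^-1 : R) ^+ 2 = 4^-1 by rewrite exprVn; congr (_^-1); ring.
    by move: e1 e2; rewrite e3; lra.
  by rewrite h.
by move: le4; rewrite disk_areaE lee_fin; apply: lt_le_trans; rewrite invr_gt0.
Qed.

Lemma bergman_sqnormE f : bergman_sqnorm f =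
  ((pi^-1)%:E * area (on_disk 1 (fun z => (normc (f z) ^+ 2)%R)))%E.
Proof.
rewrite /bergman_sqnorm /area_integral integral_mkcond; congr (_ * _)%E.
apply: eq_integral => p _; rewrite patchE /on_disk /unit_disk.
have E : (p \in [set q : R * R | [set z : R[i] | normc z < 1] (q.1 +i* q.2)%C]) = (normc (p.1 +i* p.2)%C < 1).
  by apply/idP/idP; rewrite inE.
by rewrite E; case: ifP.
Qed.

Lemma bergman_mass_nondecreasing f : nondecreasing_seq (bergman_mass f).
Proof.
apply/nondecreasing_seqP => n; rewrite /bergman_mass big_ord_recr /= lerDl.
by rewrite divr_ge0// exprn_ge0 ?normc_ge0.
Qed.

(** The limit of [pos] exists since its terms are dominated by those of [bergman_mass g], and it is
    an admissible [Sp], hence bounds [neg]. At finite length the mass of [f] is that of [g] minus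
    [pos] plus [neg]; in the limit the two corrections cancel favourably. *)
Lemma mass_comparison f g (S : R) :
  (forall M, bergman_mass g M <= S) ->
  (forall Sp : R, (forall L, \sum_(k < L) pos_part (coef_gap f g k) / k.+1%:R <= Sp) ->
     forall M, \sum_(k < M) pos_part (- coef_gap f g k) / k.+1%:R <= Sp) ->
  forall M, bergman_mass f M <= S.
Proof.
move=> gS comp M.
pose pos L := \sum_(k < L) pos_part (coef_gap f g k) / k.+1%:R.
pose neg L := \sum_(k < L) pos_part (- coef_gap f g k) / k.+1%:R.
have pos_nd : nondecreasing_seq pos.
  by apply/nondecreasing_seqP => n; rewrite /pos big_ord_recr /= lerDl divr_ge0// pos_part_ge0.
have posS L : pos L <= S.
  apply: le_trans (gS L); apply: ler_sum => k _; rewrite ler_wpM2r ?invr_ge0//.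
  rewrite /pos_part ge_max exprn_ge0 ?normc_ge0// andbT.
  by rewrite /coef_gap gerBl exprn_ge0 ?normc_ge0.
have cpos : cvgn pos by apply: nondecreasing_is_cvgn => //; exists S => _ [L _ <-].
have Esum L : bergman_mass f L = bergman_mass g L - pos L + neg L.
  rewrite /bergman_mass /pos /neg -sumrB -big_split /=; apply: eq_bigr => k _.
  have -> : normc (coef f k) ^+ 2 = normc (coef g k) ^+ 2 - coef_gap f g k by rewrite /coef_gap; ring.
  by rewrite -{1}(pos_partB (coef_gap f g k)); ring.
have negP L : neg L <= lim (pos @ \oo) by apply: comp => L'; exact: nondecreasing_cvgn_le.
have cv : S - pos L + lim (pos @ \oo) @[L --> \oo] --> S - lim (pos @ \oo) + lim (pos @ \oo).
  apply: cvgD; last exact: cvg_cst.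
  by apply: cvgB => //; exact: cvg_cst.
rewrite -[S](subrK (lim (pos @ \oo))); apply: (cvgr_to_ge cv); exists M => // L /= ML.
apply: (le_trans (bergman_mass_nondecreasing f ML)); rewrite Esum.
by rewrite lerD// lerD2r.
Qed.

End Korenblum.

Theorem lemma3p1 (R : realType) (c : R) (c_gt0 : 0 < c) (c_lt1 : c < 1)
  (mu : probability (measurableTypeR R) R)
  (mu_supp : mu `[c ^+ 2, 1]%classic = 1%:E)
  (mu_1 : mu [set 1] = 0%:E)
  (mu_moment : forall k : nat,
     ((k.+1%:R^-1)%:E <= \int[mu]_(t in `[(c ^+ 2)%R, 1%R]) (t ^+ k)%:E)%E)
  (mu_beta_moment : forall k : nat, (1 <= k)%N ->
     (\int[mu]_(t in `[(c ^+ 2)%R, 1%R]) (beta c (Num.sqrt t) * t ^+ k)%:E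
        <= (k.+1%:R^-1)%:E)%E) :
  korenblum_admissible c.
Proof.
move=> f g [df fin_f] [dg fin_g] fg.
have hf : holo f by move=> z z1; apply: derivable_cdiff; exact: df.
have hg : holo g by move=> z z1; apply: derivable_cdiff; exact: dg.
have a0 := disk_area_gt0 R.
have piV : 0 < (pi : R)^-1 by rewrite invr_gt0 pi_gt0.
pose A v := area (on_disk 1 (fun z : R[i] => normc (v z : R[i]) ^+ 2)).
have A0 v : (0 <= A v)%E.
  by apply: integral_ge0 => p _; apply: on_disk_ge0 => z _; rewrite exprn_ge0 ?normc_ge0.
have Afin v : (bergman_sqnorm v < +oo)%E -> A v = (fine (A v))%:E.
  rewrite bergman_sqnormE -/(A v); move: (A0 v); case: (A v) => [x||]//.
  by rewrite gt0_muley ?lte_fin.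
have Ag := Afin g fin_g; have Af := Afin f fin_f.
(* The common factor [disk_area] is divided out here and restored when [bergman_le] is applied to
   [f]. *)
have gS M : bergman_mass g M <= fine (A g) / disk_area R.
  by rewrite ler_pdivlMr// mulrC -lee_fin -Ag; exact: bergman_ge.
have comp S := moment_comparison c_gt0 c_lt1 mu_supp mu_1 mu_moment mu_beta_moment (S := S) hf hg fg.
have fS := mass_comparison gS comp.
have := bergman_le hf fS; rewrite mulrC divfK ?gt_eqF// -Ag -/(A f) => le_fg.
rewrite /bergman_norm ler_wsqrtr// !bergman_sqnormE -/(A f) -/(A g).
rewrite Af Ag -!EFinM /= ler_wpM2l ?(ltW piV)//.
by rewrite -lee_fin -Af -Ag.
Qed.
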